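(* Consider the $n$-agent model $(Z^n,A^n)$, $n\in\mathbb N$, and the limiting mean-field process $(Z^{(1:k)},A^{(1:k,1:k)})$ described in the context, and suppose Assumptions 1, 2 and 3 of the context hold. Fix $t\in\mathbb N_0$ and $k\in\mathbb N$. For each $n$ (with $n\ge k$ in the case of sampling without replacement) let $M^n_k=\{m^n_1,\dots,m^n_k\}$ be a uniform random sample of size $k$ (with or without replacement) from $[1:n]$, drawn independently of $(Z^n,A^n)$. Then, as $n\to\infty$, $$\left(\big(Z^n_{m^n_i}[t]\big)_{i\in[1:k]},\big(A^n_{m^n_i m^n_j}[t]\big)_{i,j\in[1:k]}\right)\Rightarrow\left(\big(Z^{(i)}[t]\big)_{i\in[1:k]},\big(A^{(ij)}[t]\big)_{i,j\in[1:k]}\right).$$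
   Context: **Notation.** $\mathbb N=\{1,2,\dots\}$, $\mathbb N_0=\mathbb N\cup\{0\}$, $[t]=\{0,\dots,t\}$, $[1:n]=\{1,\dots,n\}$, $\mathcal I_n=\{(i,j):1\le i<j\le n\}$. For a Polish space $\mathcal X$, $\mathcal P(\mathcal X)$ is the space of Borel probability measures on $\mathcal X$ with the weak topology and $\mathcal M_t(\mathcal X)$ is the space of functions $[t]\to\mathcal X$. For a trajectory $x$, $x[t]=(x(0),\dots,x(t))$. $\Rightarrow$ is convergence in distribution. **The $n$-agent model.** Fix $d\in\mathbb N$, $\gamma\in(0,1)$, and an a.e. continuous function $B:\{0,1\}\times\mathbb R^d\times\mathbb R^d\to[0,1]$ with $B(a,x,y)=B(a,y,x)$. For each $n$, $Z^n(t)=(Z^n_i(t))_{i=1}^n\subset\mathbb R^d$ and the symmetric $\{0,1\}$-valued matrix $A^n(t)=(A^n_{ij}(t))_{i,j=1}^n$, $t\in\mathbb N_0$, satisfy $$Z^n_i(t+1)=(1-\gamma)Z^n_i(t)+\gamma L^n_i(t)+\xi_i(t),\qquad L^n_i(t)=\frac{\sum_{j=1}^nZ^n_j(t)A^n_{ij}(t)}{\sum_{j=1}^nA^n_{ij}(t)}.$$ Let $\mathcal F^n_t=\sigma(Z^n[t],A^n[t])$, $\mathcal F^{A,n}_0=\sigma(Z^n(0))$ and $\mathcal F^{A,n}_t=\sigma(Z^n[t],A^n[t-1])$ for $t>0$. For $(i,j)\in\mathcal I_n$, $\mathbb P(A^n_{ij}(t+1)=1\mid\mathcal F^{A,n}_{t+1})=B(A^n_{ij}(t),Z^n_i(t+1),Z^n_j(t+1))$.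 **Assumption 1.** (a) $\{\xi_i(t)\}_{i\in\mathbb N,t\in\mathbb N_0}$ are i.i.d. $\mathbb R^d$-valued with absolutely continuous law, and for each $t\in\mathbb N_0$, $(\xi_i(t))_{i\in\mathbb N}$ is independent of $\bigvee_n\mathcal F^n_t$. (b) For each $n,t$, $A^n(t)$ is symmetric, $A^n_{ii}(t)=1$ for all $i$, and $\{A^n_{ij}(t)\}_{(i,j)\in\mathcal I_n}$ are conditionally independent Bernoulli variables given $\mathcal F^{A,n}_t$. **Assumption 2.** (a) For every $n$, $Z^n_1(0),\dots,Z^n_n(0)$ are exchangeable, and there is an absolutely continuous $\mu_0\in\mathcal P(\mathbb R^d)$ with $\frac1n\sum_{i=1}^n\delta_{Z^n_i(0)}\to\mu_0$ in probability. (b) There is an a.e. continuous $B_0:\mathbb R^d\times\mathbb R^d\to[0,1]$, with $B_0(x,y)=B_0(y,x)$, such that $\mathbb E[A^n_{ij}(0)\mid Z^n(0)]=B_0(Z^n_i(0),Z^n_j(0))$ for $(i,j)\in\mathcal I_n$. **Assumption 3.** (a) $\limsup_{n\to\infty}\mathbb E[\exp(C|Z^n_1(0)|)]<\infty$ for all $C\in\mathbb R$. (b) $\mathbb E[\exp(C|\xi_1(0)|)]<\infty$ for all $C\in\mathbb R$. (c) Exactly one of the following holds: (i) there are constants $\bar C,C_b>0$ with $B_0(z_1,z_2)e^{C_b|z_1-z_2|}\ge\bar C$ and $B(a,z_1,z_2)e^{C_b|z_1-z_2|}\ge\bar C$ for all $a\in\{0,1\}$, $z_1,z_2\in\mathbb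 R^d$; (ii) there is $C_b>0$ with $B_0(z_1,z_2)=B(a,z_1,z_2)=0$ whenever $|z_1-z_2|>C_b$, and for all $(a,z)\in\{0,1\}\times\mathbb R^d$, $\min\{B_0(z,z),B(a,z,z)\}>0$ and $(z,z)$, $(a,z,z)$ are continuity points of $B_0$, $B$ respectively. **Limiting mean-field process.** Let $\widehat B(p,x,y)=pB(1,x,y)+(1-p)B(0,x,y)$ and, for trajectories $z_1,z_2$, recursively $B_s(z_1[s],z_2[s])=\widehat B\big(B_{s-1}(z_1[s-1],z_2[s-1]),z_1(s),z_2(s)\big)$ for $s>0$, starting from $B_0(z_1(0),z_2(0))$. The variables $Z^{(1)}(0),\dots,Z^{(k)}(0)$ are i.i.d. with law $\mu_0$ and $$Z^{(i)}(s+1)=(1-\gamma)Z^{(i)}(s)+\gamma L^{(i)}(s)+\xi_i(s),\qquad L^{(i)}(s)=\frac{\int z(s)\,B_s(Z^{(i)}[s],z)\,\mu_s(dz)}{\int B_s(Z^{(i)}[s],z)\,\mu_s(dz)},$$ where $\mu_s=\mathrm{Law}(Z^{(1)}[s])\in\mathcal P(\mathcal M_s(\mathbb R^d))$, and the noise is i.i.d. (with the same absolutely continuous law on $\mathbb R^d$ as the noise variables $\xi_i(t)$ of the $n$-agent model) with $\xi_{1:k}(s)$ independent of $\sigma(Z^{(1:k)}[s],A^{(1:k,1:k)}[s])$. The matrices $A^{(1:k,1:k)}(s)$ are symmetric with $A^{(ii)}(s)=1$; given $\sigma(Z^{(1:k)}(0))$ if $s=0$, and given $\sigma(Z^{(1:k)}[s],A^{(1:k,1:k)}[s-1])$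 if $s>0$, the variables $\{A^{(ij)}(s)\}_{(i,j)\in\mathcal I_k}$ are conditionally independent Bernoulli with parameters $B_0(Z^{(i)}(0),Z^{(j)}(0))$ if $s=0$, and $B(A^{(ij)}(s-1),Z^{(i)}(s),Z^{(j)}(s))$ if $s>0$. *)

(* Defs.v *)
(* Points of R^d are row vectors ['rV[R]_d]; a trajectory {0, ..., t} -> T is a
   ['rV[T]_t.+1], with the product topology. Agents are numbered from 0, and
   index [n : nat] stands for the model with n.+1 agents. *)
From HB Require Import structures.
From mathcomp Require Import all_boot all_order all_algebra.
From mathcomp Require Import perm lra.
From mathcomp Require Import all_classical all_reals all_analysis.
From mathcomp Require Import measurable_realfun.

Set Implicit Arguments.
Unset Strict Implicit.
Unset Printing Implicit Defensive.

Import Order.TTheory GRing.Theory Num.Theory.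
Import numFieldNormedType.Exports.

Local Open Scope classical_set_scope.
Local Open Scope ring_scope.

Notation borel T := (@g_sigma_algebraType T open).

Section borel_lemmas.
Context (R : realType).

Lemma open_borel (T : ptopologicalType) (U : set T) :
  open U -> measurable (U : set (borel T)).
Proof. by move=> oU; exact: sub_sigma_algebra. Qed.

Lemma continuous_borelP (T : ptopologicalType) (f : T -> R) :
  continuous f -> measurable_fun setT (f : borel T -> measurableTypeR R).
Proof.
move=> cf; apply: (measurability _ (RGenOpens.measurableE R)) => _ [_ [a [b ->] <-]].
rewrite setTI; apply: open_borel; apply: open_comp => //.
Qed.

Lemma continuous_borel (T U : ptopologicalType) (f : T -> U) :
  continuous f -> measurable_fun setT (f : borel T -> borel U).
Proof.
move=> cf; apply: measurability => // _ [V oV <-].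
by rewrite setTI; apply: open_borel; apply: open_comp.
Qed.

End borel_lemmas.


Section lebesgue_rV.
Context (R : realType) (d : nat).

(* R x R^d -> R^(d+1) *)
Definition rV_cons (p : measurableTypeR R * borel 'rV[R]_d) : borel 'rV[R]_d.+1 :=
  \row_j (if unlift ord0 j is Some k then (p.2 : 'rV[R]_d) ord0 k else p.1).

Definition rV_uncons (u : borel 'rV[R]_d.+1) : measurableTypeR R * borel 'rV[R]_d :=
  ((u : 'rV[R]_d.+1) ord0 ord0, \row_k (u : 'rV[R]_d.+1) ord0 (lift ord0 k)).

Lemma rV_consK : cancel rV_cons rV_uncons.
Proof.
move=> [x y]; rewrite /rV_uncons /rV_cons mxE unlift_none; congr pair.
by apply/rowP => k; rewrite !mxE liftK.
Qed.

Lemma measurable_rV_uncons : measurable_fun setT rV_uncons.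
Proof.
apply: measurable_fun_pair.
  exact: (@continuous_borelP R 'rV[R]_d.+1 _ (@coord_continuous R 1 d.+1 ord0 ord0)).
apply: (@continuous_borel 'rV[R]_d.+1 'rV[R]_d
  (fun u : 'rV[R]_d.+1 => \row_k u ord0 (lift ord0 k))).
move=> u /= A [P uP PA]; exists (fun i j =>
  if unlift ord0 j is Some k then P i k else setT).
  move=> i j; rewrite ord1; case: unliftP => [k ->|_]; last exact: filterT.
  by have := uP ord0 k; rewrite !mxE.
move=> v Pv; apply: PA => i k; have := Pv i (lift ord0 k).
by rewrite liftK !ord1 mxE.
Qed.

Lemma measurable_rV_cons : measurable_fun setT rV_cons.
Proof.
apply: measurability => // _ [U oU <-]; rewrite setTI.
pose r (n : nat) : R := n.+1%:R^-1.
pose box (q : (rat * 'rV[rat]_d) * nat) :=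
  (ball (ratr q.1.1 : R) (r q.2) `*`
   ball (map_mx ratr q.1.2 : 'rV[R]_d) (r q.2)) : set (R * 'rV[R]_d).
pose D := [set q | box q `<=` rV_cons @^-1` U].
have r_gt0 n : 0 < r n by rewrite invr_gt0.
have -> : rV_cons @^-1` U = \bigcup_(q in D) box q.
  apply/seteqP; split=> [[x y] /= Uxy|p [q Dq] /Dq//].
  have /nbhs_ballP[e /= e0 eU] : nbhs (rV_cons (x, y) : 'rV[R]_d.+1) U.
    exact: open_nbhs_nbhs.
  have [n ne] : exists n, r n + r n < e.
    have [n _ /(_ _ (leqnn n))] : \forall n \near \oo, r n < e / 2.
      by apply: (@near_infty_natSinv_lt _ (PosNum (divr_gt0 e0 _))).
    by move=> ne; exists n; rewrite [e]splitr ltrD.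
  have rat_near (z : R) : {q : rat | ball (ratr q : R) (r n) z}.
    have : (z - r n < z + r n) by rewrite ltrD2l gtrN.
    move=> /rat_in_itvoo/cid[q]; rewrite in_itv/= => /andP[q1 q2].
    exists q; rewrite /ball/= ltr_norml; apply/andP; split; lra.
  pose q := ((sval (rat_near x), \row_j sval (rat_near (y ord0 j))), n).
  have qxy : box q (x, y).
    split => /=; first exact: (svalP (rat_near x)).
    split => // i j; rewrite (ord1 i) !mxE; exact: (svalP (rat_near (y ord0 j))).
  exists q => // -[x' y'] [/= qx' [_ qy']]; apply: eU.
  split => // i j; rewrite (ord1 i) !mxE; case: qxy => /= qx [_ qy].
  apply: (le_ball (ltW ne)); case: unliftP => [k _|_] /=.
    apply: ball_triangle; last exact: (qy' ord0 k).
    exact/ball_sym/(qy ord0 k).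
  by apply: ball_triangle qx'; exact/ball_sym.
rewrite bigcup_mkcond; apply: countable_bigcupT_measurable => [|q].
  exact: countableP.
case: ifP => // _; apply: measurableX; first exact: measurable_ball.
exact: open_borel (ball_open _ _).
Qed.

Context (mu : {sigma_finite_measure set (borel 'rV[R]_d) -> \bar R}).

Definition lebesgue_rV_cons : set (borel 'rV[R]_d.+1) -> \bar R :=
  pushforward (@lebesgue_measure R \x mu)%E rV_cons.


Let lebesgue_rV_cons_measure :=
  measure_function_pushforward__canonical__measure_function_Measure
    (@lebesgue_measure R \x mu)%E measurable_rV_cons.

HB.instance Definition _ := Measure.copy lebesgue_rV_cons
  lebesgue_rV_cons_measure.

Lemma lebesgue_rV_cons_sigma_finite : sigma_finite setT lebesgue_rV_cons.
Proof.
have /sigma_finiteP[F [FT ndF mF]] := sigma_finiteT (@lebesgue_measure R).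
have /sigma_finiteP[G [GT ndG mG]] := sigma_finiteT mu.
exists (fun n => rV_uncons @^-1` (F n `*` G n)) => [|n].
  apply/esym; rewrite -subTset => u _.
  have [[n _ Fn] [m _ Gm]] : (\bigcup_n F n) (rV_uncons u).1 /\
      (\bigcup_n G n) (rV_uncons u).2 by rewrite -FT -GT.
  exists (maxn n m) => //; split.
    by move: Fn; apply/subsetPset/ndF/leq_maxl.
  by move: Gm; apply/subsetPset/ndG/leq_maxr.
have [mFn Fnoo] := mF n; have [mGn Gnoo] := mG n; split.
  rewrite -[X in measurable X]setTI; apply: measurable_rV_uncons => //.
  exact: measurableX.
rewrite /lebesgue_rV_cons /pushforward.
have -> : rV_cons @^-1` (rV_uncons @^-1` (F n `*` G n)) = F n `*` G n.
  by apply/funext => p; congr ((F n `*` G n) _); exact: rV_consK.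
by rewrite product_measure1E// lte_mul_pinfty// ge0_fin_numE.
Qed.

HB.instance Definition _ := Measure_isSigmaFinite.Build _ _ _ lebesgue_rV_cons
  lebesgue_rV_cons_sigma_finite.

End lebesgue_rV.

(* Lebesgue measure on R^d, as an iterated product measure. *)
Fixpoint lebesgue_rV (R : realType) (d : nat) :
    {sigma_finite_measure set (borel 'rV[R]_d) -> \bar R} :=
  if d is d'.+1 then lebesgue_rV_cons (lebesgue_rV R d')
  else \d_(0 : borel 'rV[R]_0).

Section probability_notions.
Context {disp : measure_display} {Om : measurableType disp} {R : realType}.
Context (P : probability Om R).

(* Sub-sigma-algebras of [Om] are given by their sets of events. *)

Definition independent (G H : set (set Om)) : Prop :=
  forall E F, G E -> H F -> P (E `&` F) = (P E * P F)%E.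

Definition sigma_gen {I : Type} {d'} {T : measurableType d'}
    (X : I -> Om -> T) : set (set Om) :=
  <<s \bigcup_i preimage_set_system setT (X i) measurable >>.

Definition mutually_independent {I : eqType} {d'} {T : measurableType d'}
    (X : I -> Om -> T) : Prop :=
  forall (J : seq I) (V : I -> set T), uniq J ->
    (forall i, measurable (V i)) ->
    P (\bigcap_(i in [set` J]) (X i @^-1` V i)) =
    (\prod_(i <- J) P (X i @^-1` V i))%E.

Definition has_law {d'} {T : measurableType d'} (X : Om -> T)
    (nu : set T -> \bar R) : Prop :=
  measurable_fun setT X /\
  forall V, measurable V -> P (X @^-1` V) = nu V.

Definition iid {I : eqType} {d'} {T : measurableType d'} (X : I -> Om -> T)
    (nu : set T -> \bar R) : Prop :=
  mutually_independent X /\ forall i, has_law (X i) nu.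

(* [Y] is a version of E[X | G]. *)
Definition is_cond_exp (G : set (set Om)) (X Y : Om -> R) : Prop :=
  [/\ forall V : set R, measurable V -> G (Y @^-1` V),
      P.-integrable setT (EFin \o Y) &
      forall E, G E ->
        (\int[P]_(w in E) (Y w)%:E = \int[P]_(w in E) (X w)%:E)%E].

Definition is_cond_prob (G : set (set Om)) (E : set Om) (q : Om -> R) : Prop :=
  is_cond_exp G \1_E q.

Definition cond_independent {I : finType} {d'} {T : measurableType d'}
    (G : set (set Om)) (X : I -> Om -> T) : Prop :=
  forall (V : I -> set T) (q : I -> Om -> R),
    (forall i, measurable (V i)) ->
    (forall i, is_cond_prob G (X i @^-1` V i) (q i)) ->
    is_cond_prob G (\bigcap_i (X i @^-1` V i)) (fun w => \prod_i q i w).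

Definition exchangeable {n : nat} {T : ptopologicalType}
    (X : 'I_n -> Om -> T) : Prop :=
  forall (s : {perm 'I_n}) (V : set (borel 'rV[T]_n)), measurable V ->
    P ((fun w => \row_i X (s i) w) @^-1` V) =
    P ((fun w => \row_i X i w) @^-1` V).

End probability_notions.

Section weak_convergence.
Context {disp : measure_display} {Om : measurableType disp} {R : realType}.

Definition bounded_continuous {T : topologicalType} (f : T -> R) : Prop :=
  continuous f /\ exists M, forall x, `|f x| <= M.

Definition cvg_in_distribution {disp'} {Om' : measurableType disp'}
    (P : probability Om R) (Q : probability Om' R) {S : topologicalType}
    (X : nat -> Om -> S) (Y : Om' -> S) : Prop :=
  forall f : S -> R, bounded_continuous f ->
    (fun n => 'E_P[f \o X n])%E @ \oo --> ('E_Q[f \o Y])%E.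

(* (n+1)^-1 \sum_i \delta_(x i) *)
Definition empirical {T : ptopologicalType} {n : nat} (x : 'I_n.+1 -> borel T) :
    {measure set (borel T) -> \bar R} :=
  mscale (n.+1%:R^-1)%:nng (msum (fun i => \d_(x (inord i))) n.+1).

(* Convergence in probability, in P(T) with the weak topology, to the constant
   [mu]: the probability that [M n] lies outside any given basic neighbourhood
   {nu | |\int f_l dnu - \int f_l dmu| < e for l < p} of [mu] tends to 0. *)
Definition cvg_in_prob_weak (P : probability Om R) {T : ptopologicalType}
    (M : nat -> Om -> {measure set (borel T) -> \bar R})
    (mu : {measure set (borel T) -> \bar R}) : Prop :=
  forall (p : nat) (f : 'I_p -> T -> R) (e : R),
    (forall l, bounded_continuous (f l)) -> 0 < e ->
    (fun n => P [set w | ~ forall l,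
       `|(\int[M n w]_x f l x) - (\int[mu]_x f l x)| < e]) @ \oo --> 0%E.

End weak_convergence.

Section edge_kernels.
Context {R : realType} {d : nat}.
Local Notation rV := 'rV[R]_d.

Definition enorm (x : rV) : R := Num.sqrt (\sum_j x ord0 j ^+ 2).

Definition ae_continuous (f : rV -> rV -> R) : Prop :=
  (lebesgue_rV R d \x lebesgue_rV R d)%E.-negligible
    [set p : rV * rV | ~ {for p, continuous (fun q : rV * rV => f q.1 q.2)}].

(* Almost everywhere continuity only gives Lebesgue measurability; the edge
   probabilities are functions applied to random variables, so they are taken
   Borel measurable. *)
Record edge_kernel (f : rV -> rV -> R) : Prop := EdgeKernel {
  ek_range : forall x y, 0 <= f x y <= 1;
  ek_sym : forall x y, f x y = f y x;
  ek_measurable : measurable_fun setT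
    (fun q : (borel rV * borel rV)%type => f q.1 q.2);
  ek_continuous : ae_continuous f
}.

End edge_kernels.

(* The index set {(i, j) : i < j}. *)
Definition pairs (n : nat) := {p : 'I_n * 'I_n | (p.1 < p.2)%N}.

Section network_process.
Context {disp : measure_display} {Om : measurableType disp} {R : realType}.
Context {d n : nat}.
Local Notation rV := 'rV[R]_d.
Context (Z : 'I_n -> nat -> Om -> rV) (A : 'I_n -> 'I_n -> nat -> Om -> bool).

(* The sigma-algebra generated by Z(s), s \in SZ, and A(s), s \in SA. *)
Definition history (SZ SA : set nat) : set (set Om) :=
  <<s (\bigcup_(s in SZ) \bigcup_i
         preimage_set_system setT (Z i s : Om -> borel rV) measurable) `|`
      (\bigcup_(s in SA) \bigcup_i \bigcup_j
         preimage_set_system setT (A i j s) measurable) >>.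

(* sigma(Z[t], A[t]) *)
Definition filtration (t : nat) : set (set Om) :=
  history [set s | (s <= t)%N] [set s | (s <= t)%N].

(* sigma(Z[t], A[t-1]), which is sigma(Z(0)) for t = 0 *)
Definition filtrationA (t : nat) : set (set Om) :=
  history [set s | (s <= t)%N] [set s | (s < t)%N].

Definition network_measurable : Prop :=
  (forall i t, measurable_fun setT (Z i t : Om -> borel rV)) /\
  (forall i j t, measurable_fun setT (A i j t)).

Definition reflexive_symmetric : Prop :=
  forall t w, (forall i j, A i j t w = A j i t w) /\ (forall i, A i i t w).

Definition cond_independent_edges (P : probability Om R) : Prop :=
  forall t, cond_independent P (filtrationA t)
    (fun p : pairs n => A (val p).1 (val p).2 t).

Definition local_mean (i : 'I_n) (t : nat) (w : Om) : rV :=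
  (\sum_j (A i j t w)%:R)^-1 *: (\sum_j (A i j t w)%:R *: Z j t w).

End network_process.

Section agent_model.
Context {disp : measure_display} {Om : measurableType disp} {R : realType}.
Context (P : probability Om R) {d : nat}.
Local Notation rV := 'rV[R]_d.
Context (gamma : R) (B : bool -> rV -> rV -> R) (B0 : rV -> rV -> R).
Context (xi : nat -> nat -> Om -> rV).

Record agent_model {n : nat} (Z : 'I_n -> nat -> Om -> rV)
    (A : 'I_n -> 'I_n -> nat -> Om -> bool) : Prop := AgentModel {
  am_measurable : network_measurable Z A;
  am_state : forall i t w, Z i t.+1 w =
    (1 - gamma) *: Z i t w + gamma *: local_mean Z A i t w + xi i t w;
  am_edge : forall (i j : 'I_n) t, (i < j)%N ->
    is_cond_prob P (filtrationA Z A t.+1) (A i j t.+1 @^-1` [set true])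
      (fun w => B (A i j t w) (Z i t.+1 w) (Z j t.+1 w))
}.

Context (Z : forall n, 'I_n.+1 -> nat -> Om -> rV).
Context (A : forall n, 'I_n.+1 -> 'I_n.+1 -> nat -> Om -> bool).
Context (nu mu0 : probability (borel rV) R).

Record assumption1 : Prop := Assumption1 {
  a1_noise_iid : iid P (fun it : nat * nat => xi it.1 it.2 : Om -> borel rV) nu;
  a1_noise_ac : nu `<< lebesgue_rV R d;
  a1_noise_indep : forall t, independent P
    (sigma_gen (fun i => xi i t : Om -> borel rV))
    <<s \bigcup_n filtration (@Z n) (@A n) t >>;
  a1_graph : forall n, reflexive_symmetric (@A n);
  a1_edges : forall n, cond_independent_edges (@Z n) (@A n) P
}.

Record assumption2 : Prop := Assumption2 {
  a2_exchangeable : forall n, exchangeable P (fun i => @Z n i 0%N);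
  a2_mu0_ac : mu0 `<< lebesgue_rV R d;
  a2_empirical : cvg_in_prob_weak P
    (fun n w => empirical (fun i => @Z n i 0%N w)) mu0;
  a2_kernel : edge_kernel B0;
  a2_edge : forall n (i j : 'I_n.+1), (i < j)%N ->
    is_cond_exp P (sigma_gen (fun i => @Z n i 0%N : Om -> borel rV))
      (fun w => (@A n i j 0%N w)%:R) (fun w => B0 (Z i 0%N w) (Z j 0%N w))
}.

Definition tail_lower_bound : Prop :=
  exists Cbar Cb : R, [/\ 0 < Cbar, 0 < Cb,
    forall z1 z2, Cbar <= B0 z1 z2 * expR (Cb * enorm (z1 - z2)) &
    forall a z1 z2, Cbar <= B a z1 z2 * expR (Cb * enorm (z1 - z2))].

Definition bounded_confidence : Prop :=
  (exists2 Cb : R, 0 < Cb & forall a z1 z2, Cb < enorm (z1 - z2) ->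
     B0 z1 z2 = 0 /\ B a z1 z2 = 0) /\
  (forall a z, [/\ 0 < Num.min (B0 z z) (B a z z),
     {for (z, z), continuous (fun q : rV * rV => B0 q.1 q.2)} &
     {for (z, z), continuous (fun q : rV * rV => B a q.1 q.2)}]).

Record assumption3 : Prop := Assumption3 {
  a3_init_moments : forall C : R, (limn_esup (fun n =>
    \int[P]_w (expR (C * enorm (@Z n ord0 0%N w)))%:E) < +oo)%E;
  a3_noise_moments : forall C : R,
    (\int[P]_w (expR (C * enorm (xi 0%N 0%N w)))%:E < +oo)%E;
  a3_kernels : (tail_lower_bound /\ ~ bounded_confidence) \/
    (~ tail_lower_bound /\ bounded_confidence)
}.

End agent_model.

Section mean_field_process.
Context {disp : measure_display} {Om : measurableType disp} {R : realType}.
Context (Q : probability Om R) {d : nat}.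
Local Notation rV := 'rV[R]_d.
Context (gamma : R) (B : bool -> rV -> rV -> R) (B0 : rV -> rV -> R).

Definition upto {T : Type} (t : nat) (x : nat -> T) : 'rV[T]_t.+1 :=
  \row_(s < t.+1) x s.

Definition Bhat (p : R) (x y : rV) : R :=
  p * B true x y + (1 - p) * B false x y.

(* B_s(z1[s], z2[s]); it depends on the first s + 1 values only. *)
Fixpoint Bpath (s : nat) (z1 z2 : nat -> rV) : R :=
  if s is s'.+1 then Bhat (Bpath s' z1 z2) (z1 s) (z2 s)
  else B0 (z1 0%N) (z2 0%N).

Definition path_of {s : nat} (z : 'rV[rV]_s.+1) : nat -> rV :=
  fun r => z ord0 (inord r).

(* The vector-valued integral in the numerator is taken coordinatewise. *)
Definition mean_field {s : nat} (mu : set (borel 'rV[rV]_s.+1) -> \bar R)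
    (x : nat -> rV) : rV :=
  (fine (\int[mu]_z (Bpath s x (path_of z))%:E))^-1 *:
  \row_c fine (\int[mu]_z (path_of z s ord0 c * Bpath s x (path_of z))%:E).

Definition path_law (X : nat -> Om -> rV) (s : nat) :
    set (borel 'rV[rV]_s.+1) -> \bar R :=
  pushforward Q (fun w => upto s (X ^~ w) : borel 'rV[rV]_s.+1).

Context (mu0 nu : probability (borel rV) R).

Record limit_process {k : nat} (zeta Z : 'I_k.+1 -> nat -> Om -> rV)
    (A : 'I_k.+1 -> 'I_k.+1 -> nat -> Om -> bool) : Prop := LimitProcess {
  lp_measurable : network_measurable Z A;
  lp_init : iid Q (fun i => Z i 0%N : Om -> borel rV) mu0;
  lp_noise_iid : iid Q
    (fun p : 'I_k.+1 * nat => zeta p.1 p.2 : Om -> borel rV) nu;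
  lp_noise_indep : forall s, independent Q
    (sigma_gen (fun i => zeta i s : Om -> borel rV)) (filtration Z A s);
  lp_state : forall i s w, Z i s.+1 w = (1 - gamma) *: Z i s w +
    gamma *: mean_field (@path_law (Z ord0) s) (Z i ^~ w) + zeta i s w;
  lp_graph : reflexive_symmetric A;
  lp_edge : forall (i j : 'I_k.+1) s, (i < j)%N ->
    is_cond_prob Q (filtrationA Z A s) (A i j s @^-1` [set true])
      (fun w => if s is s'.+1 then B (A i j s' w) (Z i s w) (Z j s w)
                else B0 (Z i 0%N w) (Z j 0%N w));
  lp_edges : cond_independent_edges Z A Q
}.

End mean_field_process.

Section sampling.
Context {disp : measure_display} {Om : measurableType disp} {R : realType}.
Context (P : probability Om R).

(* An ordered sample of size k from 'I_n, uniform over all maps 'I_k -> 'I_n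
   (with replacement) or over the injective ones (without replacement). *)
Definition uniform_sample (replacement : bool) {k n : nat}
    (m : Om -> {ffun 'I_k -> 'I_n}) : Prop :=
  forall f, measurable (m @^-1` [set f]) /\
    P (m @^-1` [set f]) = ((replacement || injectiveb f)%:R /
      #|[pred g : {ffun 'I_k -> 'I_n} | replacement || injectiveb g]|%:R)%:E.

Definition sample_independent {d k n : nat} (m : Om -> {ffun 'I_k -> 'I_n})
    (Z : 'I_n -> nat -> Om -> 'rV[R]_d)
    (A : 'I_n -> 'I_n -> nat -> Om -> bool) : Prop :=
  independent P (preimage_set_system setT m setT) (history Z A setT setT).

End sampling.

(* Main.v *)
(* For a sample of K agents and a pattern a of edges at the times before r, let
   E_n(r, a, f) be the expectation of f(positions) on the event that the edges of
   the sample follow a, averaged over all samples. In the limit it is the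
   expectation of f(X) w_a(X), where the trajectories X are independent copies of
   the mean-field trajectory and w_a(X) is the conditional probability of a given
   X. Convergence for all K is proved by induction on time. The step from
   positions to edges is exact for injective samples by conditional independence
   of the edges. The step from edges to positions integrates the noise exactly,
   after the local means L_i have been replaced by the mean field; since all laws
   of positions are absolutely continuous, almost everywhere continuity of the
   kernels suffices to pass to the limit.

   The replacement of L_i is a law of large numbers: the mean square error of the
   empirical averages in the numerator and denominator of L_i is an average over
   samples of size 3, which vanishes by the convergence for K = 3. The unbounded
   numerator is truncated by means of exponential moments, uniform in n; in the
   long-range case they propagate because E[g / deg] <= 2 E[g / E[deg | past]] for
   every nonnegative g depending on the past. The limiting denominators are
   positive because the kernels are positive near the diagonal.

   The limiting process of the statement satisfies the same recursion exactly,
   hence has the same limit when viewed as a constant sequence. A sample without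
   replacement differs from one with replacement by a vanishing fraction. *)

Require Import Defs.
From HB Require Import structures.
From mathcomp Require Import all_boot all_order all_algebra.
From mathcomp Require Import perm lra ring.
From mathcomp Require Import all_classical all_reals all_analysis.
From mathcomp Require Import measurable_realfun.

Set Implicit Arguments.
Unset Strict Implicit.
Unset Printing Implicit Defensive.

Import Order.TTheory GRing.Theory Num.Theory.
Import numFieldNormedType.Exports.

Local Open Scope classical_set_scope.
Local Open Scope ring_scope.

(** * Bounded random variables and their expectations *)

(** The kernels are only almost everywhere continuous, so convergence is stated for bounded
    functions that are continuous at almost every limiting array. This class is stable under
    multiplication by kernels, and a portmanteau argument recovers it at each time from products of
    Lipschitz functions of the new positions.

    The induction looks circular. Continuity of the drift at time [s] needs first moments of the
    limit, about which nothing is assumed, and replacing local means by the mean field needs a law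
    of large numbers at time [s]. Both are deduced from the convergence at time [s] for three
    agents, once the edges at time [s] are included; the induction for [K = 3] thus closes in
    itself, and all other [K] rely on it.

    The limiting process is given for [k + 1] agents only. Any other number of copies is built on
    product spaces from the trajectory of agent [ord0], and only the features that the induction
    uses, [wls] and [copies], are carried along. Exponential moments are kept as bounds on truncated
    empirical averages, uniform in the truncation. *)

Section bounded_random_variables.
Context {dT : measure_display} {T : measurableType dT} {R : realType}.
Implicit Types (f g : T -> R).

Definition brv f := measurable_fun setT f /\ exists M : R, forall x, `|f x| <= M.

Definition urv f := measurable_fun setT f /\ forall x, 0 <= f x <= 1.

Lemma urv_brv f : urv f -> brv f.
Proof.
move=> [mf f01]; split => //; exists 1 => x; have /andP[f0 f1] := f01 x.
by rewrite ger0_norm.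
Qed.

Lemma brv_cst (c : R) : brv (fun=> c).
Proof. by split; [exact: measurable_cst|exists `|c|]. Qed.

Lemma brvD f g : brv f -> brv g -> brv (fun x => f x + g x).
Proof.
move=> [mf [M fM]] [mg [N gN]]; split; first exact: measurable_funD.
by exists (M + N) => x; rewrite (le_trans (ler_normD _ _))// lerD.
Qed.

Lemma brvM f g : brv f -> brv g -> brv (fun x => f x * g x).
Proof.
move=> [mf [M fM]] [mg [N gN]]; split; first exact: measurable_funM.
by exists (M * N) => x; rewrite normrM ler_pM.
Qed.

Lemma brvZ c f : brv f -> brv (fun x => c * f x).
Proof. by move=> bf; apply: brvM => //; exact: brv_cst. Qed.

Lemma brvN f : brv f -> brv (fun x => - f x).
Proof.
move=> [mf [M fM]]; split; last by exists M => x; rewrite normrN.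
exact: measurableT_comp.
Qed.

Lemma brvB f g : brv f -> brv g -> brv (fun x => f x - g x).
Proof. by move=> bf bg; apply: brvD => //; exact: brvN. Qed.

Lemma brv_sum (I : Type) (s : seq I) (p : pred I) (h : I -> T -> R) :
  (forall i, brv (h i)) -> brv (fun x => \sum_(i <- s | p i) h i x).
Proof.
move=> bh; elim: s => [|i s ih].
  by under eq_fun do rewrite big_nil; exact: brv_cst.
under eq_fun do rewrite big_cons.
by case: (p i) => //; exact: brvD.
Qed.

Lemma brv_prod (I : Type) (s : seq I) (p : pred I) (h : I -> T -> R) :
  (forall i, brv (h i)) -> brv (fun x => \prod_(i <- s | p i) h i x).
Proof.
move=> bh; elim: s => [|i s ih].
  by under eq_fun do rewrite big_nil; exact: brv_cst.
under eq_fun do rewrite big_cons.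
by case: (p i) => //; exact: brvM.
Qed.

Lemma brv_norm f : brv f -> brv (fun x => `|f x|).
Proof.
move=> [mf [M fM]]; split; last by exists M => x; rewrite normr_id.
exact: measurableT_comp.
Qed.

Lemma urv_indic (A : set T) : measurable A -> urv (\1_A : T -> R).
Proof.
move=> mA; split; first exact: measurable_indic.
by move=> x; rewrite indicE; case: (x \in A); rewrite ?lexx ?ler01.
Qed.

Lemma brv_indic (A : set T) : measurable A -> brv (\1_A : T -> R).
Proof. by move=> mA; exact/urv_brv/urv_indic. Qed.

Lemma urv_prod (I : Type) (s : seq I) (p : pred I) (h : I -> T -> R) :
  (forall i, urv (h i)) -> urv (fun x => \prod_(i <- s | p i) h i x).
Proof.
move=> uh; split; first by case: (brv_prod s p (fun i => urv_brv (uh i))).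
move=> x; apply/andP; split.
  by apply: prodr_ge0 => i _; case: (uh i) => _ /(_ x)/andP[].
elim: s => [|i s ih]; rewrite ?big_nil// big_cons; case: ifP => // _.
have /andP[h0 h1] := proj2 (uh i) x; apply: mulr_ile1 => //.
by apply: prodr_ge0 => j _; case: (uh j) => _ /(_ x)/andP[].
Qed.

Lemma urvM f g : urv f -> urv g -> urv (fun x => f x * g x).
Proof.
move=> [mf f1] [mg g1]; split; first exact: measurable_funM.
move=> x; have /andP[? ?] := f1 x; have /andP[? ?] := g1 x.
by rewrite mulr_ge0// mulr_ile1.
Qed.

Lemma measurable_preimage_gt f (c : R) : measurable_fun setT f ->
  measurable [set x | c < f x].
Proof.
move=> mf; have := mf measurableT _ (measurable_itv `]c, +oo[).
by rewrite setTI; congr measurable; apply/seteqP; split=> x /=;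
  rewrite in_itv/= andbT.
Qed.

End bounded_random_variables.

Section expectation.
Context {dT : measure_display} {T : measurableType dT} {R : realType}.
Variable P : probability T R.
Implicit Types (f g : T -> R).

Definition Ex f : R := \int[P]_x f x.

Lemma brv_integrable f : brv f -> P.-integrable setT (EFin \o f).
Proof.
move=> [mf [M fM]]; apply: measurable_bounded_integrable => //.
  by rewrite (le_lt_trans (probability_le1 _ _))// ltry.
exists M; split; first exact: num_real.
by move=> M' MM' x _ /=; rewrite (le_trans (fM x))// ltW.
Qed.

Lemma EFin_Ex f : brv f -> (\int[P]_x (f x)%:E)%E = (Ex f)%:E.
Proof.
by move=> bf; rewrite fineK//; apply: integrable_fin_num => //;
  exact: brv_integrable.
Qed.

Lemma Ex_cst c : Ex (fun=> c) = c.
Proof.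
have PT : fine (P setT) = 1 by rewrite probability_setT.
by rewrite /Ex Rintegral_cst// -[RHS]mulr1 -PT.
Qed.

Lemma ExD f g : brv f -> brv g -> Ex (fun x => f x + g x) = Ex f + Ex g.
Proof. by move=> bf bg; rewrite /Ex RintegralD//; exact: brv_integrable. Qed.

Lemma ExB f g : brv f -> brv g -> Ex (fun x => f x - g x) = Ex f - Ex g.
Proof. by move=> bf bg; rewrite /Ex RintegralB//; exact: brv_integrable. Qed.

Lemma ExZ c f : brv f -> Ex (fun x => c * f x) = c * Ex f.
Proof. by move=> bf; rewrite /Ex RintegralZl//; exact: brv_integrable. Qed.

Lemma Ex_sum (I : Type) (s : seq I) (p : pred I) (h : I -> T -> R) :
  (forall i, brv (h i)) ->
  Ex (fun x => \sum_(i <- s | p i) h i x) = \sum_(i <- s | p i) Ex (h i).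
Proof.
move=> bh; elim: s => [|i s ih].
  by under eq_fun do rewrite big_nil; rewrite Ex_cst big_nil.
under eq_fun do rewrite big_cons; rewrite big_cons.
by case: (p i) => //; rewrite ExD// ?ih//; exact: brv_sum.
Qed.

Lemma Ex_le f g : brv f -> brv g -> (forall x, f x <= g x) -> Ex f <= Ex g.
Proof.
by move=> bf bg fg; apply: le_Rintegral => // *; exact: brv_integrable.
Qed.

Lemma Ex_ge0 f : (forall x, 0 <= f x) -> 0 <= Ex f.
Proof. by move=> f0; exact: Rintegral_ge0. Qed.

Lemma Ex_norm f : brv f -> `|Ex f| <= Ex (fun x => `|f x|).
Proof. by move=> bf; apply: le_normr_Rintegral => //; exact: brv_integrable. Qed.

Lemma Ex_bound f (M : R) : brv f -> (forall x, `|f x| <= M) -> `|Ex f| <= M.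
Proof.
move=> bf fM; rewrite (le_trans (Ex_norm bf))// -[leRHS]Ex_cst.
by apply: Ex_le => //; [exact: brv_norm|exact: brv_cst].
Qed.

Lemma Ex_urv f : urv f -> 0 <= Ex f <= 1.
Proof.
move=> uf; have f01 x : 0 <= f x <= 1 by case: uf => _ /(_ x).
rewrite Ex_ge0/=; last by move=> x; case/andP : (f01 x).
rewrite -[leRHS]Ex_cst; apply: Ex_le => [||x]; first exact: urv_brv.
  exact: brv_cst.
by case/andP : (f01 x).
Qed.

Lemma Ex_indic (A : set T) : measurable A -> Ex \1_A = fine (P A).
Proof. by move=> mA; rewrite /Ex /Rintegral integral_indic// setIT. Qed.

Lemma Ex_indicM f (A : set T) : measurable A ->
  Ex (fun x => f x * \1_A x) = \int[P]_(x in A) f x.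
Proof.
move=> mA; rewrite [RHS]Rintegral_mkcond; apply: eq_Rintegral => x _.
by rewrite patchE indicE; case: (x \in A); rewrite ?mulr1 ?mulr0.
Qed.

Lemma Ex_le_ae f g : brv f -> brv g -> {ae P, forall x, f x <= g x} ->
  Ex f <= Ex g.
Proof.
move=> bf bg fg; rewrite -subr_ge0 -ExB//.
have bfg := brvB bg bf.
suff -> : Ex (fun x => g x - f x) = Ex (fun x => Num.max 0 (g x - f x)).
  by apply: Ex_ge0 => x; rewrite le_max lexx.
congr fine; apply: ae_eq_integral => //.
- by case: bfg => /measurable_EFinP.
- by apply/measurable_EFinP/measurable_maxr => //; case: bfg.
- by apply: filterS fg => x fgx _ /=; congr EFin; rewrite max_r// subr_ge0.
Qed.

Lemma Ex_ae_eq f g : brv f -> brv g -> {ae P, forall x, f x = g x} ->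
  Ex f = Ex g.
Proof.
move=> bf bg fg; apply/eqP; rewrite eq_le; apply/andP; split;
  by apply: Ex_le_ae => //; apply: filterS fg => x ->.
Qed.

Lemma Ex_dct (h : nat -> T -> R) f (M : R) : (forall n, measurable_fun setT (h n)) ->
  measurable_fun setT f -> (forall n x, `|h n x| <= M) ->
  {ae P, forall x, h n x @[n --> \oo] --> f x} ->
  Ex (h n) @[n --> \oo] --> Ex f.
Proof.
move=> mh mf hM hf.
have iM : P.-integrable setT (EFin \o (fun=> M)) by exact/brv_integrable/brv_cst.
have mh' n : measurable_fun setT (EFin \o h n) by exact/measurable_EFinP.
have mf' : measurable_fun setT (EFin \o f) by exact/measurable_EFinP.
have hf' : {ae P, forall x, setT x ->
    (EFin \o h n) x @[n --> \oo] --> (EFin \o f) x}.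
  apply: filterS hf => x hx _; apply: cvg_EFin; last exact: hx.
  exact: nearW.
have hM' : {ae P, forall x, forall n, setT x ->
    (`|(EFin \o h n) x| <= (EFin \o (fun=> M)) x)%E}.
  by apply: aeW => x n _ /=; rewrite lee_fin.
have [intf _ cvgh] := dominated_convergence measurableT mh' mf' hf' iM hM'.
apply: fine_cvg; rewrite fineK; first exact: cvgh.
exact: integrable_fin_num.
Qed.

End expectation.

Lemma cvgr_sum {R : numFieldType} {U J : Type} {F : set_system U}
    {FF : Filter F} (l : seq J) (p : pred J) (h : J -> U -> R) (a : J -> R) :
  (forall j, p j -> h j x @[x --> F] --> a j) ->
  \sum_(j <- l | p j) h j x @[x --> F] --> \sum_(j <- l | p j) a j.
Proof. by apply: cvg_big; exact: add_continuous. Qed.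

Lemma cvgr_prod {R : numFieldType} {U J : Type} {F : set_system U}
    {FF : Filter F} (l : seq J) (p : pred J) (h : J -> U -> R) (a : J -> R) :
  (forall j, p j -> h j x @[x --> F] --> a j) ->
  \prod_(j <- l | p j) h j x @[x --> F] --> \prod_(j <- l | p j) a j.
Proof. by apply: cvg_big; exact: mul_continuous. Qed.

(** * Approximation by indicators of level sets *)

Section layer_cake.
Variable R : realType.

(** The sum counts the integers of [{1, ..., N}] strictly below [u]; it cannot see how far [u]
    exceeds [N + 1], hence the cap. *)
Lemma count_below_ge (N : nat) (u : R) :
  Num.min u N.+1%:R - 1 <= \sum_(j < N) (j.+1%:R < u)%R%:R.
Proof.
elim: N => [|N ih]; first by rewrite big_ord0 subr_le0 ge_min lexx orbT.
rewrite big_ord_recr/=; case: ltP => [Nu|uN].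
  move: ih; rewrite (min_r (ltW Nu)) => ih.
  apply: (@le_trans _ _ (N.+1%:R)); last first.
    by move: ih; rewrite -lerBlDr => /le_trans ->.
  by rewrite lerBlDr natr1 ge_min lexx orbT.
rewrite addr0 (le_trans _ ih)// lerB// (min_l uN) ge_min lexx//.
Qed.

Lemma count_below_le (N : nat) (u : R) : 0 <= u ->
  \sum_(j < N) (j.+1%:R < u)%R%:R <= u.
Proof.
move=> u0; elim: N => [|N ih]; first by rewrite big_ord0.
rewrite big_ord_recr/=; case: ltP => [Nu|uN]; last by rewrite addr0.
apply/ltW; apply: le_lt_trans Nu; rewrite -natr1 lerD2r.
rewrite (@le_trans _ _ (\sum_(j < N) 1))//.
  by apply: ler_sum => j _; case: (_ < u).
by rewrite sumr_const card_ord.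
Qed.

(** Counting the levels below [y] rounds [y] down on a grid of step [(N+1)^-1]. The inequality is
    strict so that, at a continuity point of a function, its superlevel sets are neighbourhoods. *)
Lemma layer_cake (N : nat) (y : R) : 0 <= y <= 1 ->
  0 <= y - N.+1%:R^-1 * \sum_(j < N.+1) (j.+1%:R / N.+1%:R < y)%R%:R
    <= N.+1%:R^-1.
Proof.
move=> /andP[y0 y1]; have N0 : (0 : R) < N.+1%:R by rewrite ltr0n.
have -> : \sum_(j < N.+1) (j.+1%:R / N.+1%:R < y)%R%:R =
    \sum_(j < N.+1) (j.+1%:R < y * N.+1%:R)%R%:R :> R.
  by apply: eq_bigr => j _; rewrite ltr_pdivrMr.
have u0 : 0 <= y * N.+1%:R by rewrite mulr_ge0// ltW.
have := count_below_le N.+1 u0; have := count_below_ge N.+1 (y * N.+1%:R).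
rewrite min_l; last first.
  by rewrite (@le_trans _ _ N.+1%:R) ?ler_nat// ler_piMl// ltW.
set S := \sum_(_ < _) _ => h1 h2.
have -> : y - N.+1%:R^-1 * S = N.+1%:R^-1 * (y * N.+1%:R - S).
  by rewrite mulrBr mulrCA mulVf ?gt_eqF// mulr1.
have I0 : 0 <= N.+1%:R^-1 :> R by rewrite invr_ge0 ltW.
by rewrite mulr_ge0 ?subr_ge0//= ler_piMr//; lra.
Qed.

End layer_cake.

Section functional_extensionality.
Context {dS : measure_display} {S : measurableType dS} {R : realType}.
Variables (F : (S -> R) -> R) (C : R).
Hypothesis FD : forall f g, brv f -> brv g ->
  F (fun x => f x + g x) = F f + F g.
Hypothesis FZ : forall c f, brv f -> F (fun x => c * f x) = c * F f.
Hypothesis FC : forall f (M : R), brv f -> (forall x, `|f x| <= M) ->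
  `|F f| <= C * M.
Hypothesis F1 : forall A, measurable A -> F \1_A = 0.

Let F_sum (I : Type) (s : seq I) (h : I -> S -> R) : (forall i, brv (h i)) ->
  F (fun x => \sum_(i <- s) h i x) = \sum_(i <- s) F (h i).
Proof.
move=> bh; elim: s => [|i s ih].
  rewrite big_nil (_ : (fun _ => _) = fun x => 0 * (fun=> 0) x).
    by rewrite FZ ?mul0r//; exact: brv_cst.
  by apply/funext => x; rewrite big_nil mul0r.
rewrite big_cons -ih -FD//; last exact: brv_sum.
by congr F; apply/funext => x; rewrite big_cons.
Qed.

Let F_urv f : urv f -> F f = 0.
Proof.
move=> uf; have [mf f01] := uf.
pose A N j := [set x | j.+1%:R / N.+1%:R < f x].
have mA N j : measurable (A N j) by exact: measurable_preimage_gt.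
pose a N x := N.+1%:R^-1 * \sum_(j < N.+1) \1_(A N j) x : R.
have ba N : brv (a N).
  by apply/brvZ/brv_sum => j; exact/brv_indic.
have Fa N : F (a N) = 0.
  rewrite FZ; last by apply: brv_sum => j; exact/brv_indic.
  by rewrite F_sum ?big1 ?mulr0// => j *; [exact: F1|exact: brv_indic].
have fa N x : `|f x - a N x| <= N.+1%:R^-1.
  have := layer_cake N (f01 x); rewrite /a.
  rewrite (eq_bigr (fun j : 'I_N.+1 => \1_(A N j) x)) => [/andP[h0 h1]|j _].
    by rewrite ger0_norm.
  by rewrite indicE/= /A; case: ltP => h; [rewrite mem_set|rewrite memNset//=;
    apply/negP; rewrite -leNgt].
have bd N : `|F f| <= C * N.+1%:R^-1.
  have := FC (brvB (urv_brv uf) (ba N)) (fa N).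
  have -> : F (fun x => f x - a N x) = F f; last by [].
  rewrite FD; [|exact: urv_brv|exact: brvN].
  have -> : (fun x => - a N x) = (fun x => -1 * a N x).
    by apply/funext => x; rewrite mulN1r.
  by rewrite FZ// Fa mulr0 addr0.
apply/eqP; rewrite -normr_le0.
suff : (C * n.+1%:R^-1) @[n --> \oo] --> (C * 0 : R).
  rewrite mulr0 => hC; rewrite -(cvg_lim _ hC)//.
  by apply: limr_ge; [exact: cvgP hC|exact: nearW].
by apply: cvgM; [exact: cvg_cst|exact: cvg_harmonic].
Qed.

(** Simple functions are uniformly dense: after an affine change into [[0, 1]], the layer cake gives
    combinations of indicators at distance at most [(N+1)^-1], and [FC] turns uniform distance into
    distance of values. *)
Lemma functional_ext0 f : brv f -> F f = 0.
Proof.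
move=> bf; have [mf [M fM]] := bf.
(* The extra [1] keeps [K + K] invertible when [M = 0]. *)
pose K := M + 1.
have K0 : 0 < K + K.
  have : 0 <= M by exact: le_trans (normr_ge0 _) (fM point).
  by rewrite /K; lra.
pose g x := (K + K)^-1 * (f x + K).
have ug : urv g.
  split; first by case: (brvZ (K + K)^-1 (brvD bf (brv_cst K))).
  move=> x; have := fM x; rewrite ler_norml => /andP[h1 h2].
  rewrite /g mulrC divr_ge0 ?ler_pdivrMr//; rewrite /K; lra.
have u1 : urv (fun _ : S => 1 : R).
  by split; [exact: measurable_cst|move=> x; rewrite ler01 lexx].
have bg := urv_brv ug; have b1 := urv_brv u1.
have -> : f = (fun x => (K + K) * g x + (- K) * 1).
  by apply/funext => x; rewrite /g mulrA mulfV ?gt_eqF// mul1r mulr1 addrK.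
rewrite FD; [|exact: brvZ|exact: brvZ].
by rewrite (FZ _ bg) (FZ _ b1) (F_urv ug) (F_urv u1) !mulr0 addr0.
Qed.

End functional_extensionality.

(** The two functionals may be expectations on different probability spaces; this is how identities
    known on events are extended to bounded functions. *)
Lemma functional_ext {dS : measure_display} {S : measurableType dS}
    {R : realType} (F G : (S -> R) -> R) (C D : R) :
  (forall f g, brv f -> brv g -> F (fun x => f x + g x) = F f + F g) ->
  (forall c f, brv f -> F (fun x => c * f x) = c * F f) ->
  (forall f (M : R), brv f -> (forall x, `|f x| <= M) -> `|F f| <= C * M) ->
  (forall f g, brv f -> brv g -> G (fun x => f x + g x) = G f + G g) ->
  (forall c f, brv f -> G (fun x => c * f x) = c * G f) ->
  (forall f (M : R), brv f -> (forall x, `|f x| <= M) -> `|G f| <= D * M) ->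
  (forall A, measurable A -> F \1_A = G \1_A) ->
  forall f, brv f -> F f = G f.
Proof.
move=> FD FZ FC GD GZ GC FG f bf; apply/eqP; rewrite -subr_eq0; apply/eqP.
apply: (@functional_ext0 _ _ _ (fun f => F f - G f) (C + D)) => //.
- by move=> g h bg bh; rewrite FD// GD//; lra.
- by move=> c g bg; rewrite FZ// GZ//; lra.
- move=> g M bg gM; rewrite (le_trans (ler_normB _ _))// mulrDl lerD//.
    exact: FC.
  exact: GC.
- by move=> A mA; rewrite FG// subrr.
Qed.

(** * Conditioning and products *)

Section conditioning.
Context {dO : measure_display} {Om : measurableType dO} {R : realType}.
Variable P : probability Om R.

(** Measurability for a sub-sigma-algebra is encoded in the type of the source:
    [g_sigma_algebraType gen] has the points of [Om] with other measurable sets, so that one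
    function can be used with both types. *)
Lemma measurable_fun_sub (gen : set (set Om)) {d'} {U : measurableType d'}
    (g : Om -> U) : <<s gen>> `<=` measurable ->
  measurable_fun setT (g : g_sigma_algebraType gen -> U) ->
  measurable_fun setT g.
Proof. by move=> sub mg _ V mV; apply: sub; exact: (mg measurableT V mV). Qed.

Lemma brv_sub (gen : set (set Om)) (g : g_sigma_algebraType gen -> R) :
  <<s gen>> `<=` measurable -> brv g -> brv (g : Om -> R).
Proof. by move=> sub [mg bg]; split=> //; exact: measurable_fun_sub mg. Qed.

(** The defining identity of a conditional expectation, known on events of the past, extended by
    [functional_ext] to bounded factors that are functions of the past. *)
Lemma Ex_cond (gen : set (set Om)) (X Y : Om -> R) :
  <<s gen>> `<=` measurable -> brv X -> brv Y ->
  (forall E, <<s gen>> E ->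
    Ex P (fun w => X w * \1_E w) = Ex P (fun w => Y w * \1_E w)) ->
  forall g : g_sigma_algebraType gen -> R, brv g ->
    Ex P (fun w => X w * g w) = Ex P (fun w => Y w * g w).
Proof.
move=> sub bX bY XY.
have [_ [M XM]] := bX; have [_ [N YN]] := bY.
have bg g : brv (g : g_sigma_algebraType gen -> R) -> brv (g : Om -> R).
  exact: brv_sub.
apply: (@functional_ext _ (g_sigma_algebraType gen) _
  (fun g => Ex P (fun w => X w * g w)) (fun g => Ex P (fun w => Y w * g w)) M N).
- move=> f g bf bg'; rewrite -ExD; [|exact/brvM/bg|exact/brvM/bg].
  by congr (Ex P _); apply/funext => w; rewrite mulrDr.
- move=> c f bf; rewrite -ExZ; last exact/brvM/bg.
  by congr (Ex P _); apply/funext => w; rewrite mulrCA.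
- move=> f K bf fK; apply: Ex_bound; first exact/brvM/bg.
  by move=> w; rewrite normrM ler_pM.
- move=> f g bf bg'; rewrite -ExD; [|exact/brvM/bg|exact/brvM/bg].
  by congr (Ex P _); apply/funext => w; rewrite mulrDr.
- move=> c f bf; rewrite -ExZ; last exact/brvM/bg.
  by congr (Ex P _); apply/funext => w; rewrite mulrCA.
- move=> f K bf fK; apply: Ex_bound; first exact/brvM/bg.
  by move=> w; rewrite normrM ler_pM.
- exact: XY.
Qed.

End conditioning.

Section weighted_measure.
Context {dO : measure_display} {Om : measurableType dO} {R : realType}.
Variables (P : probability Om R) (H : Om -> R).
Hypotheses (bH : brv H) (H0 : forall w, 0 <= H w).
Local Open Scope ereal_scope.

Definition weighted (A : set Om) : \bar R := \int[P]_(w in A) (H w)%:E.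

Let weighted0 : weighted set0 = 0. Proof. exact: integral_set0. Qed.

Let weighted_ge0 A : 0 <= weighted A.
Proof. by apply: integral_ge0 => w _; rewrite lee_fin. Qed.

Let weighted_sigma_additive : semi_sigma_additive weighted.
Proof.
apply: (@semi_sigma_additive_nng_induced _ Om R P (EFin \o H)).
  by apply/measurable_EFinP; case: bH.
by move=> w; rewrite lee_fin.
Qed.

HB.instance Definition _ := isMeasure.Build _ _ _ weighted
  weighted0 weighted_ge0 weighted_sigma_additive.

Definition weighted_mu : {measure set Om -> \bar R} := weighted.

Lemma weighted_muE A : measurable A ->
  weighted_mu A = (Ex P (fun w => H w * \1_A w)%R)%:E.
Proof.
move=> mA; rewrite Ex_indicM// fineK//; apply: integrable_fin_num => //.
apply: integrableS (brv_integrable P bH) => //.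
Qed.

End weighted_measure.

Section law_uniqueness.
Context {R : realType} {dS : measure_display} {S : measurableType dS}.
Context {d1 : measure_display} {O1 : measurableType d1} (P1 : probability O1 R).
Context {d2 : measure_display} {O2 : measurableType d2} (P2 : probability O2 R).

Lemma brv_comp {d} {O : measurableType d} (h : S -> R) (X : O -> S) :
  brv h -> measurable_fun setT X -> brv (h \o X).
Proof.
move=> [mh [M hM]] mX; split; first exact: measurableT_comp.
by exists M => x; exact: hM.
Qed.

(** The laws of [X1] and [X2] with densities [H1] and [H2] are finite measures that agree on a
    pi-system, hence on all measurable sets. The weights make it possible to compare laws in the
    presence of other factors. *)
Lemma Ex_unique (G : set (set S)) (H1 : O1 -> R) (X1 : O1 -> S)
    (H2 : O2 -> R) (X2 : O2 -> S) :
  @measurable _ S = <<s G>> -> setI_closed G -> G setT ->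
  brv H1 -> (forall w, 0 <= H1 w) -> measurable_fun setT X1 ->
  brv H2 -> (forall w, 0 <= H2 w) -> measurable_fun setT X2 ->
  (forall A, G A -> Ex P1 (fun w => H1 w * \1_A (X1 w)) =
                    Ex P2 (fun w => H2 w * \1_A (X2 w))) ->
  forall h, brv h -> Ex P1 (fun w => H1 w * h (X1 w)) =
                     Ex P2 (fun w => H2 w * h (X2 w)).
Proof.
move=> mG GI GT bH1 H10 mX1 bH2 H20 mX2 eqG.
have [_ [M HM]] := bH1; have [_ [N HN]] := bH2.
have bX1 (h : S -> R) : brv h -> brv (fun w => h (X1 w)) by move=> bh; apply: brv_comp.
have bX2 (h : S -> R) : brv h -> brv (fun w => h (X2 w)) by move=> bh; apply: brv_comp.
apply: (@functional_ext _ _ _ (fun h => Ex P1 (fun w => H1 w * h (X1 w)))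
  (fun h => Ex P2 (fun w => H2 w * h (X2 w))) M N).
- move=> f g bf bg'; rewrite -ExD; [|exact/brvM/bX1|exact/brvM/bX1].
  by congr (Ex P1 _); apply/funext => w; rewrite mulrDr.
- move=> c f bf; rewrite -ExZ; last exact/brvM/bX1.
  by congr (Ex P1 _); apply/funext => w; rewrite mulrCA.
- move=> f K bf fK; apply: Ex_bound; first exact/brvM/bX1.
  by move=> w; rewrite normrM ler_pM.
- move=> f g bf bg'; rewrite -ExD; [|exact/brvM/bX2|exact/brvM/bX2].
  by congr (Ex P2 _); apply/funext => w; rewrite mulrDr.
- move=> c f bf; rewrite -ExZ; last exact/brvM/bX2.
  by congr (Ex P2 _); apply/funext => w; rewrite mulrCA.
- move=> f K bf fK; apply: Ex_bound; first exact/brvM/bX2.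
  by move=> w; rewrite normrM ler_pM.
pose m1 := pushforward (weighted_mu P1 bH1 H10) X1.
pose m2 := pushforward (weighted_mu P2 bH2 H20) X2.
have mE1 A : measurable A -> measurable (X1 @^-1` A).
  by move=> mA; rewrite -[X in measurable X]setTI; exact: mX1.
have mE2 A : measurable A -> measurable (X2 @^-1` A).
  by move=> mA; rewrite -[X in measurable X]setTI; exact: mX2.
have m1E A : measurable A -> m1 A = (Ex P1 (fun w => H1 w * \1_A (X1 w)))%:E.
  by move=> mA; rewrite /m1/= /pushforward weighted_muE//; exact: mE1.
have m2E A : measurable A -> m2 A = (Ex P2 (fun w => H2 w * \1_A (X2 w)))%:E.
  by move=> mA; rewrite /m2/= /pushforward weighted_muE//; exact: mE2.
have subG A : G A -> measurable A by rewrite mG; exact: sub_sigma_algebra.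
move=> A mA; apply: EFin_inj; rewrite -m1E// -m2E//.
pose M1 := measure_function_pushforward__canonical__measure_function_Measure
  (weighted_mu P1 bH1 H10) mX1.
pose M2 := measure_function_pushforward__canonical__measure_function_Measure
  (weighted_mu P2 bH2 H20) mX2.
apply: (@measure_unique _ R S G (fun=> setT) mG GI _ _ M1 M2) => //.
- by apply/seteqP; split=> // x _; exists 0%N.
- move=> B GB; have mB := subG _ GB.
  by have := m1E _ mB; have := m2E _ mB; rewrite /m1 /m2 /= => -> ->; rewrite eqG.
- by move=> _; have := m1E _ measurableT; rewrite /m1/= => ->; rewrite ltry.
Qed.

End law_uniqueness.

Section product_probability.
Context {R : realType} {d1 d2 : measure_display}.
Context {O1 : measurableType d1} {O2 : measurableType d2}.
Variables (P1 : probability O1 R) (P2 : probability O2 R).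

Definition prod_mu (P : probability O1 R * probability O2 R) :=
  (P.1 \x P.2)%E.

HB.instance Definition _ P := Measure.on (prod_mu P).

Let prod_muT P : prod_mu P setT = 1%E.
Proof.
transitivity (P.1 setT * P.2 setT)%E.
  by rewrite /prod_mu -setXTT product_measure1E.
by rewrite !probability_setT mule1.
Qed.

HB.instance Definition _ P := Measure_isProbability.Build _ _ _ (prod_mu P)
  (prod_muT P).

Definition pprod : probability (O1 * O2)%type R := prod_mu (P1, P2).

Lemma brv_Exr (f : O1 * O2 -> R) : brv f ->
  brv (fun x => Ex P2 (fun y => f (x, y))).
Proof.
move=> bf; have [mf [M fM]] := bf; split; last first.
  exists M => x; apply: Ex_bound => //; split; last by exists M.
  by apply: measurableT_comp => //; exact: measurable_pair1.
have intf := brv_integrable pprod bf.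
have := @measurable_fubini_F _ _ _ _ _ P1 P2 _ intf.
by move=> h; apply: measurableT_comp h => //; exact: fine_measurable.
Qed.

Lemma Ex_pprod (f : O1 * O2 -> R) : brv f ->
  Ex pprod f = Ex P1 (fun x => Ex P2 (fun y => f (x, y))).
Proof.
move=> bf; have [mf [M fM]] := bf.
have intf := brv_integrable pprod bf.
have := @integral12_prod_meas1 _ _ _ _ _ P1 P2 _ intf.
rewrite /Ex /Rintegral => /esym h; congr fine; rewrite [LHS]h.
apply: eq_integral => x _; apply: (EFin_Ex P2 (f := fun y => f (x, y))).
split; last by exists M.
by apply: measurableT_comp => //; exact: measurable_pair1.
Qed.

End product_probability.

(** * Functionals of arrays of trajectories *)

Section arrays.
Context {R : realType} {d : nat} {I : finType}.
Local Notation T := 'rV[R]_d.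
Local Notation arr := (I -> nat -> T).
Implicit Types (s : nat) (z y : arr) (f g : arr -> R).

(** Trajectories stay infinite in time and closeness is tested up to time [s] only. A function that
    is continuous at [z] for this filter takes the same value at all arrays that agree with [z] up
    to time [s]. *)
Definition arr_near s z : set_system arr := [set A |
  exists2 e : R, 0 < e &
    forall y, (forall i r, (r <= s)%N -> `|y i r - z i r| < e) -> A y].

Global Instance arr_near_filter s z : ProperFilter (arr_near s z).
Proof.
apply: Build_ProperFilter_ex => [A [e e0 eA]|].
  by exists z; apply: eA => i r _; rewrite subrr normr0.
split; first by exists 1.
- move=> A B [e e0 eA] [e' e'0 eB]; exists (Num.min e e').
    by rewrite lt_min e0.
  move=> y h; split; [apply: eA|apply: eB] => i r /(h i r);
    by rewrite lt_min => /andP[].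
- by move=> A B AB [e e0 eA]; exists e => // y /eA /AB.
Qed.

Definition arr_cont s f z := f y @[y --> arr_near s z] --> f z.

(** No sigma-algebra is put on arrays: measurability is tested along all random arrays, whose
    entries after time [s] may be arbitrary. *)
Definition arr_mfun s f : Prop :=
  forall (dO : measure_display) (O : measurableType dO) (X : I -> nat -> O -> T),
    (forall i r, (r <= s)%N -> measurable_fun setT (X i r : O -> borel T)) ->
    measurable_fun setT (fun w => f (fun i r => X i r w)).

Definition bmf s f := arr_mfun s f /\ exists M : R, forall z, `|f z| <= M.

Definition umf s f := arr_mfun s f /\ forall z, 0 <= f z <= 1.

Lemma umf_bmf s f : umf s f -> bmf s f.
Proof.
move=> [mf f01]; split => //; exists 1 => z; have /andP[? _] := f01 z.
by rewrite ger0_norm//; case/andP : (f01 z).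
Qed.

Lemma arr_mfun_le s s' f : (s <= s')%N -> arr_mfun s f -> arr_mfun s' f.
Proof.
by move=> ss' mf dO O X mX; apply: mf => i r /leq_trans rs; apply/mX/rs.
Qed.

Lemma bmf_brv s f {dO} {O : measurableType dO} (X : I -> nat -> O -> T) :
  (forall i r, (r <= s)%N -> measurable_fun setT (X i r : O -> borel T)) ->
  bmf s f -> brv (fun w => f (fun i r => X i r w)).
Proof. by move=> mX [mf [M fM]]; split; [exact: mf|exists M]. Qed.

Lemma umf_urv s f {dO} {O : measurableType dO} (X : I -> nat -> O -> T) :
  (forall i r, (r <= s)%N -> measurable_fun setT (X i r : O -> borel T)) ->
  umf s f -> urv (fun w => f (fun i r => X i r w)).
Proof. by move=> mX [mf fM]; split; [exact: mf|move=> w; exact: fM]. Qed.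

Lemma bmf_cst s c : bmf s (fun=> c).
Proof. by split; [move=> *; exact: measurable_cst|exists `|c|]. Qed.

Lemma bmfD s f g : bmf s f -> bmf s g -> bmf s (fun z => f z + g z).
Proof.
move=> [mf [M fM]] [mg [N gN]]; split.
  by move=> dO O X mX; apply: measurable_funD; [exact: mf|exact: mg].
by exists (M + N) => z; rewrite (le_trans (ler_normD _ _))// lerD.
Qed.

Lemma bmfM s f g : bmf s f -> bmf s g -> bmf s (fun z => f z * g z).
Proof.
move=> [mf [M fM]] [mg [N gN]]; split.
  by move=> dO O X mX; apply: measurable_funM; [exact: mf|exact: mg].
by exists (M * N) => z; rewrite normrM ler_pM.
Qed.

Lemma bmfZ s c f : bmf s f -> bmf s (fun z => c * f z).
Proof. by move=> bf; apply: bmfM => //; exact: bmf_cst. Qed.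

Lemma bmfB s f g : bmf s f -> bmf s g -> bmf s (fun z => f z - g z).
Proof.
move=> bf bg; apply: bmfD => //.
have -> : (fun z => - g z) = (fun z => -1 * g z).
  by apply/funext => z; rewrite mulN1r.
exact: bmfZ.
Qed.

Lemma bmf_prod s (J : Type) (l : seq J) (p : pred J) (h : J -> arr -> R) :
  (forall j, bmf s (h j)) -> bmf s (fun z => \prod_(j <- l | p j) h j z).
Proof.
move=> bh; elim: l => [|j l ih].
  by under eq_fun do rewrite big_nil; exact: bmf_cst.
under eq_fun do rewrite big_cons.
by case: (p j) => //; exact: bmfM.
Qed.

Lemma arr_contM s f g z : arr_cont s f z -> arr_cont s g z ->
  arr_cont s (fun y => f y * g y) z.
Proof. exact: cvgM. Qed.

Lemma arr_contD s f g z : arr_cont s f z -> arr_cont s g z ->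
  arr_cont s (fun y => f y + g y) z.
Proof. exact: cvgD. Qed.

Lemma arr_contB s f g z : arr_cont s f z -> arr_cont s g z ->
  arr_cont s (fun y => f y - g y) z.
Proof. exact: cvgB. Qed.

Lemma arr_cont_cst s c z : arr_cont s (fun=> c) z.
Proof. exact: cvg_cst. Qed.

Lemma arr_cont_prod s (J : Type) (l : seq J) (p : pred J) (h : J -> arr -> R) z :
  (forall j, arr_cont s (h j) z) ->
  arr_cont s (fun y => \prod_(j <- l | p j) h j y) z.
Proof.
by move=> ch; apply: cvgr_prod => j _; exact: ch.
Qed.

Lemma arr_near_coord s z i r : (r <= s)%N ->
  y i r @[y --> arr_near s z] --> z i r.
Proof.
move=> rs; apply/cvgrPdist_lt => e e0; exists e => // y h.
by rewrite distrC; exact: h.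
Qed.

End arrays.

(** * A countable base for arrays *)

Section rational_boxes.
Context {R : realType} {d : nat} {I : finType} (s : nat).
Local Notation T := 'rV[R]_d.
Local Notation arr := (I -> nat -> T).
Implicit Types (z y : arr) (A : set arr).

Definition box_index : countType := ({ffun I * 'I_s.+1 -> 'rV[rat]_d} * nat)%type.

Definition ratv (q : 'rV[rat]_d) : T := map_mx ratr q.

Definition boxrad (n : nat) : R := n.+1%:R^-1.

Lemma boxrad_gt0 n : 0 < boxrad n. Proof. by rewrite invr_gt0 ltr0n. Qed.

Lemma boxrad_small (e : R) : 0 < e -> exists n, boxrad n < e.
Proof.
move=> e0; have [n _ /(_ _ (leqnn n))] : \forall n \near \oo, boxrad n < e.
  exact: (@near_infty_natSinv_lt _ (PosNum e0)).
by exists n.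
Qed.

Lemma ratv_dense (x : T) (e : R) : 0 < e -> exists q, `|x - ratv q| < e.
Proof.
move=> e0.
have near_ (c : R) : exists q : rat, `|c - ratr q| < e.
  have : (c - e < c + e) by rewrite ltrD2l gtrN.
  move=> /rat_in_itvoo[q]; rewrite in_itv/= => /andP[q1 q2].
  by exists q; rewrite ltr_norml; apply/andP; split; lra.
have [q Hq] := choice near_.
exists (\row_j q (x ord0 j)).
suff : ball (ratv (\row_j q (x ord0 j))) e x.
  by rewrite mx_norm_ball /ball_ /= distrC.
split => // i j; rewrite (ord1 i) !mxE; apply: ball_sym; exact: Hq.
Qed.

Definition box (q : box_index) : set arr :=
  [set z | forall i (r : 'I_s.+1), `|z i r - ratv (q.1 (i, r))| < boxrad q.2].

Lemma box_dense z A : arr_near s z A -> exists q, box q z /\ box q `<=` A.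
Proof.
move=> [e e0 eA].
have [n ne] : exists n, boxrad n < e / 2 by apply: boxrad_small; rewrite divr_gt0.
have [q Hq] := choice (fun ir : I * 'I_s.+1 =>
  ratv_dense (z ir.1 ir.2) (boxrad_gt0 n)).
exists (finfun q, n); split=> [i r|y yq]; first by rewrite /= ffunE; exact: Hq (i, r).
apply: eA => i r rs; have := yq i (Ordinal (rs : (r < s.+1)%N)).
have := Hq (i, Ordinal (rs : (r < s.+1)%N)); rewrite /= ffunE => h1 h2.
rewrite (le_lt_trans (ler_distD (ratv (q (i, Ordinal (rs : (r < s.+1)%N)))) _ _))//.
rewrite [e]splitr ltrD//; first exact: lt_trans ne.
by rewrite distrC; exact: lt_trans ne.
Qed.

Lemma box_open q z : box q z -> arr_near s z (box q).
Proof.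
move=> qz.
(* The least slack over the finitely many entries; the initial value of the minimum matters only
   when there are no agents. *)
pose m := \big[Num.min/boxrad q.2]_(ir : I * 'I_s.+1)
  (boxrad q.2 - `|z ir.1 ir.2 - ratv (q.1 ir)|).
exists m.
  rewrite /m; apply: lt_bigmin => [|[i r] _]; first exact: boxrad_gt0.
  by rewrite subr_gt0; exact: qz.
move=> y h i r; have /(h i) := ltn_ord r; rewrite /m => hm.
have {}hm : `|y i r - z i r| < boxrad q.2 - `|z i r - ratv (q.1 (i, r))|.
  by apply: (lt_le_trans hm); exact: (bigmin_le_cond _ (j := (i, r))).
rewrite (le_lt_trans (ler_distD (z i r) _ _))//; lra.
Qed.

Definition interior_of A : set arr := [set z | arr_near s z A].

Lemma interior_of_open A z : interior_of A z -> arr_near s z (interior_of A).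
Proof.
move=> /box_dense[q [/box_open qz qA]]; apply: filterS qz => y qy.
exact: filterS (box_open qy).
Qed.

Lemma interior_ofS A : interior_of A `<=` A.
Proof. by move=> z [e e0]; apply => i r _; rewrite subrr normr0. Qed.

(** An open set is the union of the rational boxes that it contains, which are countably many, and
    each box is a finite intersection of preimages of balls. *)
Lemma measurable_open {dO} {O : measurableType dO} (X : I -> nat -> O -> T) A :
  (forall i r, (r <= s)%N -> measurable_fun setT (X i r : O -> borel T)) ->
  (forall z, A z -> arr_near s z A) ->
  measurable [set w | A (fun i r => X i r w)].
Proof.
move=> mX oA.
have -> : [set w | A (fun i r => X i r w)] =
    \bigcup_(q in [set q | box q `<=` A]) [set w | box q (fun i r => X i r w)].
  apply/seteqP; split=> [w /= /oA/box_dense[q [qw qA]]|w [q /= qA /qA//]].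
  by exists q.
rewrite bigcup_mkcond; apply: countable_bigcupT_measurable => [|q].
  exact: countableP.
case: ifP => // _.
have -> : [set w | box q (fun i r => X i r w)] =
   \bigcap_(ir in [set: I * 'I_s.+1])
     (X ir.1 ir.2 @^-1` ball (ratv (q.1 ir)) (boxrad q.2)).
  apply/seteqP; split=> [w h [i r] _ /=|w h i r].
    by rewrite mx_norm_ball/ball_/= distrC; exact: h.
  by have := h (i, r) Logic.I; rewrite /= mx_norm_ball/ball_/= distrC.
apply: fin_bigcap_measurable; first exact: finite_finset.
move=> [i r] _; rewrite /= -[X in measurable X]setTI.
have rs : (r <= s)%N by rewrite -ltnS ltn_ord.
by apply: (mX i r rs measurableT); apply: open_borel; exact: ball_open.
Qed.

Lemma arr_cont_mfun (f : arr -> R) : (forall z, arr_cont s f z) -> arr_mfun s f.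
Proof.
move=> cf dO O X mX.
apply: (measurability _ (RGenOpens.measurableE R)) => _ [_ [a [b ->] <-]].
rewrite setTI; apply: (@measurable_open _ _ X [set z | f z \in `]a, b[]) => //.
by move=> z /= fz; exact: (cf z _ (near_in_itvoo fz)).
Qed.

(** A product of tents, one for each entry, positive exactly on the box. The product form puts it
    into the classes of product test functions on which convergence is known first. *)
Definition boxbump (q : box_index) z : R :=
  \prod_i \prod_(r < s.+1) Num.max 0 (boxrad q.2 - `|z i r - ratv (q.1 (i, r))|).

Lemma boxbump_factor01 (x : T) q n : 0 <= Num.max 0 (boxrad n - `|x - ratv q|) <= 1.
Proof.
rewrite le_max lexx/= ge_max ler01/= (@le_trans _ _ (boxrad n))//.
  by rewrite gerBl.
by rewrite invf_le1 ?ler1n// ltr0n.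
Qed.

Lemma boxbump01 q z : 0 <= boxbump q z <= 1.
Proof.
apply/andP; split.
  apply: prodr_ge0 => i _; apply: prodr_ge0 => r _.
  by case/andP : (boxbump_factor01 (z i r) (q.1 (i, r)) q.2).
apply: Num.Theory.prodr_ile1 => i _; apply/andP; split.
  by apply: prodr_ge0 => r _; case/andP : (boxbump_factor01 (z i r) (q.1 (i, r)) q.2).
by apply: Num.Theory.prodr_ile1 => r _; exact: boxbump_factor01.
Qed.

Lemma boxbump_gt0 q z : 0 < boxbump q z <-> box q z.
Proof.
split=> [h i r|h].
  rewrite ltNge; apply/negP => hle; move: h.
  rewrite /boxbump (bigD1 i)//= (bigD1 r)//= (max_l _) ?mul0r ?ltxx//.
  by rewrite subr_le0.
apply: prodr_gt0 => i _; apply: prodr_gt0 => r _.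
by rewrite lt_max subr_gt0; apply/orP; right; exact: h.
Qed.

End rational_boxes.

Section inner_approximation.
Context {R : realType} {d : nat} {I : finType} (s : nat).
Local Notation T := 'rV[R]_d.
Local Notation arr := (I -> nat -> T).
Implicit Types (z y : arr) (A : set arr).

(** Boxes are enumerated through [pickle], and those not contained in [A] contribute zero, so that
    some term is positive exactly at the interior points of [A]. *)
Definition inner_bump A (l : nat) z : R :=
  if (unpickle l : option (@box_index d I s)) is Some q then
    if `[< box q `<=` A >] then boxbump q z else 0
  else 0.

Lemma inner_bump01 A l z : 0 <= inner_bump A l z <= 1.
Proof.
rewrite /inner_bump; case: unpickle => [q|]; rewrite ?lexx ?ler01//.
by case: ifP => _; rewrite ?lexx ?ler01//; exact: boxbump01.
Qed.

Lemma inner_bump_gt0 A z :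
  (exists l, 0 < inner_bump A l z) <-> interior_of s A z.
Proof.
split=> [[l]|/box_dense[q [qz qA]]].
  rewrite /inner_bump; case: unpickle => [q|]; rewrite ?ltxx//.
  case: ifPn => [/asboolP qA /boxbump_gt0 qz|_]; last by rewrite ltxx.
  by apply: (@filterS _ (arr_near s z) _ _ _ qA); exact: box_open.
exists (pickle q); rewrite /inner_bump pickleK ifT; last exact/asboolP.
exact/boxbump_gt0.
Qed.

Definition inner_seq (L : nat) := flatten [seq nseq L l | l <- iota 0 L].

(* The exponent [L] makes the approximation tend to [1] as soon as a single
   boxbump is positive. *)
Definition inner_apx A (L : nat) z : R :=
  1 - \prod_(l <- inner_seq L) (1 - inner_bump A l z).

Lemma inner_apxE A L z :
  inner_apx A L z = 1 - \prod_(l <- iota 0 L) (1 - inner_bump A l z) ^+ L.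
Proof.
rewrite /inner_apx /inner_seq big_flatten big_map.
by congr (1 - _); apply: eq_bigr => l _; rewrite big_nseq iter_mulr_1.
Qed.

Let c01 A l z : 0 <= 1 - inner_bump A l z <= 1.
Proof.
by have /andP[h1 h2] := inner_bump01 A l z; rewrite subr_ge0 h2/= gerBl.
Qed.

Lemma inner_apx01 A L z : 0 <= inner_apx A L z <= 1.
Proof.
rewrite subr_ge0 gerBl; apply/andP; split.
  by apply: Num.Theory.prodr_ile1 => l _; exact: c01.
by apply: prodr_ge0 => l _; case/andP : (c01 A l z).
Qed.

Lemma inner_apx_out A L z : ~ interior_of s A z -> inner_apx A L z = 0.
Proof.
move=> nA; rewrite /inner_apx big1 ?subrr// => l _.
suff -> : inner_bump A l z = 0 by rewrite subr0.
apply/eqP; rewrite eq_le; have /andP[-> _] := inner_bump01 A l z.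
by rewrite andbT leNgt; apply/negP => h; apply/nA/inner_bump_gt0; exists l.
Qed.

Lemma inner_apx_le A L z : inner_apx A L z <= \1_A z.
Proof.
have [Az|nAz] := pselect (interior_of s A z); last first.
  by rewrite inner_apx_out// indicE.
rewrite indicE mem_set; last exact: interior_ofS Az.
by case/andP : (inner_apx01 A L z).
Qed.

Lemma inner_apx_cvg A z :
  inner_apx A L z @[L --> \oo] --> (\1_(interior_of s A) z : R).
Proof.
have [Az|nAz] := pselect (interior_of s A z); last first.
  rewrite indicE memNset//; under eq_fun do rewrite inner_apx_out//.
  exact: cvg_cst.
rewrite indicE mem_set//.
have [l0 hl0] := (inner_bump_gt0 A z).2 Az.
rewrite -[X in _ --> X]subr0; under eq_fun do rewrite inner_apxE.
apply: cvgB; first exact: cvg_cst.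
have := c01 A l0 z; set a := 1 - inner_bump A l0 z => /andP[a0 _].
have a1 : a < 1 by rewrite gtrBl.
(* Once [L] exceeds the index [l0] of a bump that is positive at [z], the factor of [l0] alone
   bounds the whole product by [a ^+ L] with [a < 1]. *)
apply: (@squeeze_cvgr _ _ _ _ (fun=> 0) (fun L => a ^+ L)).
- near=> L; apply/andP; split.
    by apply: prodr_ge0 => l _; apply: exprn_ge0; case/andP : (c01 A l z).
  have l0L : l0 \in iota 0 L.
    by rewrite mem_iota/= add0n; near: L; exact: nbhs_infty_gt.
  rewrite (big_rem _ l0L)/= ler_piMr ?exprn_ge0//.
  apply: Num.Theory.prodr_ile1 => l _; have /andP[h0 h1] := c01 A l z.
  by rewrite exprn_ge0// exprn_ile1.
- exact: cvg_cst.
- by apply: cvg_expr; rewrite ger0_norm.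
Unshelve. all: by end_near. Qed.

End inner_approximation.

(** * A portmanteau theorem for positive linear functionals *)

Section portmanteau.
Context {R : realType} {d : nat} {I : finType} (s : nat).
Local Notation T := 'rV[R]_d.
Local Notation arr := (I -> nat -> T).
Implicit Types (z y : arr) (A : set arr) (f g h : arr -> R).
Context {dO : measure_display} {O : measurableType dO} (Q : probability O R).
Variables (X : I -> nat -> O -> T) (rho : O -> R).
Hypothesis mX : forall i r, (r <= s)%N ->
  measurable_fun setT (X i r : O -> borel T).
Hypothesis urho : urv rho.

(** The weight [rho] will be the conditional probability of a pattern of edges, so the limit is in
    general a sub-probability. *)
Definition Einf f := Ex Q (fun w => f (fun i r => X i r w) * rho w).

Variable En : nat -> (arr -> R) -> R.
Hypothesis EnD : forall n f g, bmf s f -> bmf s g ->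
  En n (fun z => f z + g z) = En n f + En n g.
Hypothesis EnZ : forall n c f, bmf s f -> En n (fun z => c * f z) = c * En n f.
Hypothesis En_le : forall n f g, bmf s f -> bmf s g -> (forall z, f z <= g z) ->
  En n f <= En n g.

Variable H : set (arr -> R).
Hypothesis Hbmf : forall h, H h -> bmf s h.
Hypothesis HM : forall g h, H g -> H h -> H (fun z => g z * h z).
Hypothesis H1 : H (fun=> 1).
Hypothesis H0 : H (fun=> 0).
Hypothesis Hbump : forall q, H (@boxbump R d I s q).
Hypothesis EnH : forall h, H h -> En n h @[n --> \oo] --> Einf h.

Let G := [set g | bmf s g /\ En n g @[n --> \oo] --> Einf g].

Let brvX f : bmf s f -> brv (fun w => f (fun i r => X i r w)).
Proof. exact: bmf_brv. Qed.

Let brvXr f : bmf s f -> brv (fun w => f (fun i r => X i r w) * rho w).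
Proof. by move=> bf; apply: brvM; [exact: brvX|exact: urv_brv]. Qed.

Let EinfD f g : bmf s f -> bmf s g ->
  Einf (fun z => f z + g z) = Einf f + Einf g.
Proof.
move=> bf bg; rewrite /Einf -ExD; [|exact: brvXr|exact: brvXr].
by congr (Ex Q _); apply/funext => w; rewrite mulrDl.
Qed.

Let EinfZ c f : bmf s f -> Einf (fun z => c * f z) = c * Einf f.
Proof.
move=> bf; rewrite /Einf -ExZ; last exact: brvXr.
by congr (Ex Q _); apply/funext => w; rewrite mulrA.
Qed.

Let GD f g : G f -> G g -> G (fun z => f z + g z).
Proof.
move=> [bf cf] [bg cg]; split; first exact: bmfD.
by rewrite EinfD//; under eq_fun do rewrite EnD//; exact: cvgD.
Qed.

Let GZ c f : G f -> G (fun z => c * f z).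
Proof.
move=> [bf cf]; split; first exact: bmfZ.
by rewrite EinfZ//; under eq_fun do rewrite EnZ//; exact: cvgMr.
Qed.

Let GB f g : G f -> G g -> G (fun z => f z - g z).
Proof.
move=> Gf Gg; have -> : (fun z => f z - g z) = (fun z => f z + -1 * g z).
  by apply/funext => z; rewrite mulN1r.
by apply: GD => //; exact: GZ.
Qed.

Let G_sum (J : Type) (l : seq J) (h : J -> arr -> R) :
  (forall j, G (h j)) -> G (fun z => \sum_(j <- l) h j z).
Proof.
move=> Gh; elim: l => [|j l ih].
  under eq_fun do rewrite big_nil; split; first exact: bmf_cst.
  exact: EnH.
by under eq_fun do rewrite big_cons; exact: GD.
Qed.

(** The product expands into signed products of elements of [H]; peeling off one factor at a time,
    [g] collects the chosen [phi j], and [HM] keeps it in [H]. *)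
Let G_prod (J : Type) (l : seq J) (phi : J -> arr -> R) g :
  (forall j, H (phi j)) -> H g ->
  G (fun z => g z * \prod_(j <- l) (1 - phi j z)).
Proof.
move=> Hphi; elim: l g => [|j l ih] g Hg.
  under eq_fun do rewrite big_nil mulr1.
  by split; [exact: Hbmf|exact: EnH].
under eq_fun do rewrite big_cons mulrA mulrBr mulr1 mulrBl.
by apply: GB; [exact: ih|apply: ih; exact: HM].
Qed.

Let G_apx A L : G (inner_apx s A L).
Proof.
have G1 : G (fun=> 1) by split; [exact: bmf_cst|exact: EnH].
apply: GB => //.
have -> : (fun z => \prod_(l <- inner_seq L) (1 - inner_bump s A l z)) =
    (fun z => 1 * \prod_(l <- inner_seq L) (1 - inner_bump s A l z)).
  by apply/funext => z; rewrite mul1r.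
apply: G_prod => // l; rewrite /inner_bump.
by case: (unpickle l : option (@box_index d I s)) => [q|//]; case: (`[< box q `<=` A >]).
Qed.

(** The interiors of the superlevel sets of [f] are approximated from below by functions of [G].
    Passing to the interior costs nothing where [f] is continuous, since [f > c] then holds nearby.
    The approximants lie below [f] everywhere, so [En_le] applies to them before the limit. *)
Let lower f : umf s f ->
  {ae Q, forall w, arr_cont s f (fun i r => X i r w)} ->
  forall e, 0 < e -> exists g, [/\ G g, (forall z, g z <= f z) &
    Einf f - e <= Einf g].
Proof.
move=> uf cf e e0; have [mf f01] := uf.
(* Half of [e] pays for the layer cake, the other half for stopping the inner approximation at a
   finite [L]. *)
have [N Ne] := boxrad_small (divr_gt0 e0 (ltr0Sn R 1)).
pose A (j : nat) := [set z | j.+1%:R / N.+1%:R < f z].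
pose g L z := N.+1%:R^-1 * \sum_(j < N.+1) inner_apx s (A j) L z.
pose g' z : R := N.+1%:R^-1 * \sum_(j < N.+1) \1_(interior_of s (A j)) z.
have Gg L : G (g L) by apply/GZ/G_sum => j; exact: G_apx.
have N0 : 0 <= N.+1%:R^-1 :> R by rewrite invr_ge0 ler0n.
have AE z : \sum_(j < N.+1) (j.+1%:R / N.+1%:R < f z)%R%:R =
    \sum_(j < N.+1) \1_(A j) z :> R.
  apply: eq_bigr => j _; rewrite indicE.
  by case: ltP => h; [rewrite mem_set|rewrite memNset//=;
    apply/negP; rewrite -leNgt].
have gf L z : g L z <= f z.
  have /andP[+ _] := layer_cake N (f01 z); rewrite AE subr_ge0.
  apply: le_trans; rewrite ler_wpM2l//; apply: ler_sum => j _.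
  exact: inner_apx_le.
have bg' : brv (fun w => g' (fun i r => X i r w)).
  apply/brvZ/brv_sum => j.
  rewrite (_ : (fun w => _) =
      \1_[set w | interior_of s (A j) (fun i r => X i r w)]).
    apply/brv_indic/(measurable_open (s := s) (X := X) (A := interior_of s (A j))) => //.
    exact: interior_of_open.
  by apply/funext => w; rewrite !indicE; congr (_%:R); apply/idP/idP;
    rewrite !inE.
have g'1 L w : `|g L (fun i r => X i r w) * rho w| <= 1.
  have /andP[r0 r1] := proj2 urho w.
  have gz : 0 <= g L (fun i r => X i r w).
    apply: mulr_ge0 => //; apply: sumr_ge0 => j _.
    by case/andP : (inner_apx01 s (A j) L (fun i r => X i r w)).
  rewrite ger0_norm; last by rewrite mulr_ge0.
  rewrite mulr_ile1// (le_trans (gf L _))//.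
  by case/andP : (f01 (fun i r => X i r w)).
have cg : Einf (g L) @[L --> \oo] --> Einf g'.
  apply: (@Ex_dct _ _ _ _ _ _ 1) => [L||//|].
  - by case: (brvXr (proj1 (Gg L))).
  - by case: (brvM bg' (urv_brv urho)).
  apply: aeW => w; apply: cvgMl; apply: cvgMr.
  by apply: cvgr_sum => j _; exact: inner_apx_cvg.
have g'f : Einf f - e / 2 <= Einf g'.
  have -> : Einf f - e / 2 = Ex Q (fun w => f (fun i r => X i r w) * rho w - e / 2).
    by rewrite ExB ?Ex_cst//; [exact/brvXr/umf_bmf|exact: brv_cst].
  apply: Ex_le_ae.
  - by apply: brvB; [exact/brvXr/umf_bmf|exact: brv_cst].
  - exact: (brvM bg' (urv_brv urho)).
  apply: filterS cf => w cfw; have /andP[r0 r1] := proj2 urho w.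
  set z := fun i r => X i r w.
  have /andP[_ h] := layer_cake N (f01 z).
  have {}h : f z - g' z <= e / 2.
    rewrite (le_trans _ (ltW Ne))//; apply: le_trans h; rewrite lerB//.
    rewrite ler_wpM2l//; apply: ler_sum => j _; rewrite indicE.
    case: ltP => //= fz; rewrite mem_set//.
    have := @cvgr_gt _ _ (arr_near s z) _ f (f z) cfw _ fz; exact.
  rewrite lerBlDr -lerBlDl -mulrBl.
  rewrite (@le_trans _ _ (e / 2 * rho w))// ?ler_wpM2r//.
  by rewrite ler_piMr// divr_ge0// ltW.
have : \forall L \near \oo, Einf g' - e / 2 < Einf (g L).
  by apply: (cvgr_gt _ cg); rewrite gtrBl divr_gt0.
move=> [L _ /(_ L (leqnn L)) /= hL]; exists (g L); split => //.
by move: hL g'f; lra.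
Qed.

Theorem portmanteau f : bmf s f ->
  {ae Q, forall w, arr_cont s f (fun i r => X i r w)} ->
  En n f @[n --> \oo] --> Einf f.
Proof.
have main g : umf s g -> {ae Q, forall w, arr_cont s g (fun i r => X i r w)} ->
    forall e, 0 < e -> \forall n \near \oo, Einf g - e <= En n g.
  move=> ug cg e e0; have [h [[bh ch] hg hE]] := lower ug cg (divr_gt0 e0 (ltr0Sn R 1)).
  have : \forall n \near \oo, Einf h - e / 2 < En n h.
    by apply: (cvgr_gt _ ch); rewrite gtrBl divr_gt0.
  apply: filterS => n hn; have := En_le n bh (umf_bmf ug) hg; lra.
have umain g : umf s g -> {ae Q, forall w, arr_cont s g (fun i r => X i r w)} ->
    En n g @[n --> \oo] --> Einf g.
  move=> ug cg; apply/cvgrPdist_le => e e0.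
  have e20 : 0 < e / 2 by rewrite divr_gt0.
  (* The lower bound for [1 - g] is the upper bound for [g], because the total masses converge. *)
  have ug' : umf s (fun z => 1 - g z).
    split; first by case: (bmfB (bmf_cst s 1) (umf_bmf ug)).
    by move=> z; have /andP[h0 h1] := proj2 ug z; rewrite subr_ge0 h1 gerBl.
  have cg' : {ae Q, forall w, arr_cont s (fun z => 1 - g z) (fun i r => X i r w)}.
    by apply: filterS cg => w cgw; apply: cvgB => //; exact: cvg_cst.
  have c1 := EnH H1.
  have hn1 : \forall n \near \oo, En n (fun=> 1) < Einf (fun=> 1) + e / 2.
    by apply: (cvgr_lt _ c1); rewrite ltrDl.
  apply: filterS2 (filterI (main _ ug cg _ e20) (main _ ug' cg' _ e20)) hn1.
  move=> n [h1 h2] h3.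
  have e1 : En n (fun z => 1 - g z) = En n (fun=> 1) - En n g.
    rewrite (_ : (fun z => 1 - g z) = (fun z => 1 + -1 * g z)); last first.
      by apply/funext => z; rewrite mulN1r.
    rewrite EnD ?EnZ ?mulN1r//; try exact: umf_bmf.
      exact: bmf_cst.
    exact/bmfZ/umf_bmf.
  have e2 : Einf (fun z => 1 - g z) = Einf (fun=> 1) - Einf g.
    rewrite (_ : (fun z => 1 - g z) = (fun z => 1 + -1 * g z)); last first.
      by apply/funext => z; rewrite mulN1r.
    rewrite EinfD ?EinfZ ?mulN1r//; try exact: umf_bmf.
      exact: bmf_cst.
    exact/bmfZ/umf_bmf.
  by rewrite ler_norml; move: h1 h2 h3; rewrite e1 e2 => *; apply/andP; split; lra.
move=> bf cf; have [mf [M fM]] := bf.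
pose K := M + 1.
have K0 : 0 < K + K.
  have : 0 <= M by exact: le_trans (normr_ge0 _) (fM (fun _ _ => 0)).
  by rewrite /K; lra.
pose g z := (K + K)^-1 * (f z + K).
have ug : umf s g.
  split; first by case: (bmfZ (K + K)^-1 (bmfD bf (bmf_cst s K))).
  move=> x; have := fM x; rewrite ler_norml => /andP[h1 h2].
  rewrite /g mulrC divr_ge0 ?ler_pdivrMr//; rewrite /K; lra.
have cg : {ae Q, forall w, arr_cont s g (fun i r => X i r w)}.
  apply: filterS cf => w cfw; apply: cvgMr; apply: cvgD => //; exact: cvg_cst.
have Gg : G g by split; [exact: umf_bmf|exact: umain].
have G1 : G (fun=> 1) by split; [exact: bmf_cst|exact: EnH].
have -> : f = (fun z => (K + K) * g z + (- K) * 1).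
  by apply/funext => x; rewrite /g mulrA mulfV ?gt_eqF// mul1r mulr1 addrK.
by have [] := GD (GZ (K + K) Gg) (GZ (- K) G1).
Qed.

End portmanteau.

(** * Absolutely continuous random vectors *)

Section translation.
Variable R : realType.

Lemma lebesgue_translation (a : R) (A : set (measurableTypeR R)) :
  measurable A ->
  (@lebesgue_measure R) ((fun x => x + a) @^-1` A) = (@lebesgue_measure R) A.
Proof.
move=> mA.
have mf : measurable_fun setT ((fun x => x + a) : measurableTypeR R -> measurableTypeR R).
  by apply: measurable_funD => //; exact: measurable_cst.
pose M := measure_function_pushforward__canonical__measure_function_Measure
  (@lebesgue_measure R) mf.
apply/esym; apply: (@lebesgue_measure_unique R M) => // _ [[x y] _ <-].
rewrite /M/= /pushforward.
have -> : (fun u => u + a) @^-1` `]x, y]%classic = `](x - a), (y - a)]%classic.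
  by apply/seteqP; split=> u /=; rewrite !in_itv/= ltrBlDr lerBrDr.
rewrite !lebesgue_measure_itv/= !lte_fin ltrD2r -!EFinB.
by case: ifP => // _; congr EFin; lra.
Qed.

Lemma measurable_addr_rV n (z : 'rV[R]_n) :
  measurable_fun setT (fun x : borel 'rV[R]_n => x + z : borel 'rV[R]_n).
Proof.
have cz : continuous (fun x : 'rV[R]_n => x + z).
  by move=> x; apply: (@cvgD _ _ _ (nbhs x)); [exact: cvg_id|exact: cvg_cst].
exact: (@continuous_borel 'rV[R]_n 'rV[R]_n).
Qed.

(** In [R x R^d] a translation acts on each factor. By induction the translated measure agrees with
    the product measure on rectangles, which determine it. *)
Lemma lebesgue_rV_translation (d : nat) (y : 'rV[R]_d) (A : set (borel 'rV[R]_d)) :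
  measurable A ->
  lebesgue_rV R d ((fun x : borel 'rV[R]_d => x + y : borel 'rV[R]_d) @^-1` A) =
  lebesgue_rV R d A.
Proof.
elim: d y A => [|d ih] y A mA.
  by congr (lebesgue_rV R 0 _); apply/seteqP; split=> x /=; rewrite !thinmx0.
have mshift := measurable_addr_rV.
pose a : R := y ord0 ord0.
pose b : 'rV[R]_d := \row_k y ord0 (lift ord0 k).
pose sh (p : measurableTypeR R * borel 'rV[R]_d) :
  measurableTypeR R * borel 'rV[R]_d := (p.1 + a, (p.2 : 'rV[R]_d) + b).
have msh : measurable_fun setT sh.
  apply: measurable_fun_pair.
    apply: measurable_funD; [exact: measurable_fst|exact: measurable_cst].
  by apply: measurableT_comp (mshift _ _) _; exact: measurable_snd.
have mcA : measurable (@rV_cons R d @^-1` A).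
  by rewrite -[X in measurable X]setTI; apply: measurable_rV_cons.
change ((@lebesgue_measure R \x lebesgue_rV R d)%E
  (@rV_cons R d @^-1` ((fun x : borel 'rV[R]_d.+1 => x + y) @^-1` A)) =
  (@lebesgue_measure R \x lebesgue_rV R d)%E (@rV_cons R d @^-1` A)).
have -> : @rV_cons R d @^-1` ((fun x : borel 'rV[R]_d.+1 => x + y) @^-1` A) =
    sh @^-1` (@rV_cons R d @^-1` A).
  apply/funext => p; congr A; apply/rowP => j; rewrite !mxE.
  by case: unliftP => [k ->|->] /=; rewrite ?mxE.
pose M := measure_function_pushforward__canonical__measure_function_Measure
  (@lebesgue_measure R \x lebesgue_rV R d)%E msh.
apply/esym; apply: (@product_measure_unique _ _ _ _ R _ _ M) => // U V mU mV.
rewrite /M/= /pushforward.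
have -> : sh @^-1` (U `*` V) = ((fun x => x + a) @^-1` U) `*`
   ((fun x : borel 'rV[R]_d => x + b) @^-1` V) by [].
rewrite product_measure1E.
- by congr (_ * _)%E; [exact: lebesgue_translation|exact: ih].
- have mf : measurable_fun setT (fun x : measurableTypeR R => x + a).
    by apply: measurable_funD => //; exact: measurable_cst.
  by rewrite -[X in measurable X]setTI; exact: mf.
- by rewrite -[X in measurable X]setTI; apply: mshift.
Qed.

End translation.

Section null_sections.
Context {R : realType} {d : nat}.
Local Notation T := 'rV[R]_d.
Local Notation leb := (lebesgue_rV R d).

Definition ac_rv {dO} {O : measurableType dO} (P : probability O R)
    (X : O -> T) : Prop :=
  measurable_fun setT (X : O -> borel T) /\
  forall V : set (borel T), measurable V -> leb V = 0%E -> P (X @^-1` V) = 0%E.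

Lemma null_section_ae (N : set (borel T * borel T)) : measurable N ->
  (leb \x leb)%E N = 0%E ->
  exists M : set (borel T), [/\ measurable M, leb M = 0%E &
    forall x, ~ M x -> leb (xsection N x) = 0%E].
Proof.
move=> mN N0.
have mf : measurable_fun setT (leb \o xsection N).
  exact: measurable_fun_xsection.
exists [set x | (leb (xsection N x) != 0)%E]; split.
- rewrite -[X in measurable X]setTI; exact: emeasurable_neq.
- have [+ _] := ae_eq_integral_abs leb measurableT mf.
  have -> : (\int[leb]_x `|(leb \o xsection N) x| = 0)%E.
    rewrite -N0; apply: eq_integral => x _; rewrite gee0_abs//.
  move=> /(_ erefl) h; apply: measure_negligible.
    rewrite -[X in measurable X]setTI; exact: emeasurable_neq.
  by apply: negligibleS h => x /= /eqP h /(_ Logic.I).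
- by move=> x /= /negP; rewrite negbK => /eqP.
Qed.

(** By Tonelli, almost every section of a null set is null. The two variables live on separate
    spaces, which is how independence enters. *)
Lemma ac_rv_pair_ae (N : set (borel T * borel T)) {d1 d2}
    {O1 : measurableType d1} {O2 : measurableType d2} (P1 : probability O1 R)
    (P2 : probability O2 R) (X1 : O1 -> T) (X2 : O2 -> T) :
  measurable N -> (leb \x leb)%E N = 0%E -> ac_rv P1 X1 -> ac_rv P2 X2 ->
  {ae P1, forall w1, {ae P2, forall w2, ~ N (X1 w1, X2 w2)}}.
Proof.
move=> mN N0 [mX1 ac1] [mX2 ac2]; have [M [mM M0 hM]] := null_section_ae mN N0.
exists (X1 @^-1` M); split; first by rewrite -[X in measurable X]setTI; exact: mX1.
  exact: ac1.
move=> w1 /= h; apply: contrapT => nM; apply: h.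
exists (X2 @^-1` xsection N (X1 w1)).
have mS := measurable_xsection (X1 w1 : borel T) mN; split.
- by rewrite -[X in measurable X]setTI; exact: mX2.
- by apply: ac2 => //; exact: hM.
- by move=> w2 /= /contrapT h; rewrite /xsection/= inE.
Qed.

Lemma ac_rvD {dO} {O : measurableType dO} (P : probability O R) (X : O -> T)
    (y : T) : ac_rv P X -> ac_rv P (fun w => X w + y).
Proof.
move=> [mX ac]; split.
  exact: measurableT_comp (measurable_addr_rV _) mX.
move=> V mV V0; apply: (ac ((fun x : borel T => x + y : borel T) @^-1` V)).
  by rewrite -[X in measurable X]setTI; exact: measurable_addr_rV.
by rewrite lebesgue_rV_translation.
Qed.

End null_sections.

(** * Edge kernels and patterns of edges *)

(** The mass that the Bernoulli law of parameter [p] gives to [b]. *)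
Definition bern {R : realType} (b : bool) (p : R) : R := if b then p else 1 - p.

Lemma bern01 {R : realType} b (p : R) : 0 <= p <= 1 -> 0 <= bern b p <= 1.
Proof. by case: b => //= /andP[p0 p1]; rewrite subr_ge0 p1 gerBl. Qed.

Section edge_kernel_theory.
Context {R : realType} {d : nat}.
Local Notation T := 'rV[R]_d.
Local Notation leb := (lebesgue_rV R d).
Variables (B : bool -> T -> T -> R) (B0 : T -> T -> R).
Hypotheses (hB : forall a, edge_kernel (B a)) (hB0 : edge_kernel B0).

(* The conditional probability of an edge at time [s], given that its state at
   time [s - 1] is [a] (which is irrelevant for [s = 0]). *)
Definition eker (s : nat) (a : bool) (x y : T) : R :=
  if s is _.+1 then B a x y else B0 x y.

Lemma eker_kernel s a : edge_kernel (eker s a).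
Proof. by case: s. Qed.

Lemma eker01 s a x y : 0 <= eker s a x y <= 1.
Proof. by have [] := eker_kernel s a. Qed.

Lemma eker_sym s a x y : eker s a x y = eker s a y x.
Proof. by have [] := eker_kernel s a. Qed.

Lemma measurable_eker s a {dO} {O : measurableType dO} (X Y : O -> T) :
  measurable_fun setT (X : O -> borel T) ->
  measurable_fun setT (Y : O -> borel T) ->
  measurable_fun setT (fun w => eker s a (X w) (Y w)).
Proof.
move=> mX mY; have [_ _ mk _] := eker_kernel s a.
exact: (measurableT_comp mk (measurable_fun_pair mX mY)).
Qed.

Definition econt (x y : T) := forall s a,
  {for (x, y), continuous (fun q : T * T => eker s a q.1 q.2)}.

Lemma econt_null : exists N : set (borel T * borel T), [/\ measurable N,
  (leb \x leb)%E N = 0%E & forall x y, ~ N (x, y) -> econt x y].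
Proof.
have [N0 [mN0 N00 sN0]] := ek_continuous hB0.
have [N1 [mN1 N10 sN1]] := ek_continuous (hB true).
have [N2 [mN2 N20 sN2]] := ek_continuous (hB false).
exists (N0 `|` (N1 `|` N2)); split.
- by do 2 apply: measurableU => //.
- apply: measure_negligible; first by do 2 apply: measurableU => //.
  apply: negligibleU; first by exists N0; split.
  by apply: negligibleU; [exists N1; split|exists N2; split].
move=> x y nN s a; apply: contrapT => nc; apply: nN; case: s nc => [|s] nc.
  by left; exact: sN0.
by right; case: a nc => nc; [left; exact: sN1|right; exact: sN2].
Qed.

Section arrays_of_kernels.
Context {I : finType}.
Implicit Types (z : I -> nat -> T) (i j : I).

Lemma umf_eker s s' a i j : (s <= s')%N ->
  umf s' (fun z => eker s a (z i s) (z j s)).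
Proof.
move=> ss'; split=> [dO O X mX|z]; last exact: eker01.
by apply: measurable_eker; exact: mX.
Qed.

Lemma arr_cont_eker s s' a i j z : (s <= s')%N -> econt (z i s) (z j s) ->
  arr_cont s' (fun z => eker s a (z i s) (z j s)) z.
Proof.
move=> ss' /(_ s a) cz.
have cp : (y i s, y j s) @[y --> arr_near s' z] --> (z i s, z j s).
  have ci := @arr_near_coord R d I s' z i s ss'.
  have cj := @arr_near_coord R d I s' z j s ss'.
  exact: (cvg_pair ci cj).
exact: (cvg_comp _ _ cp cz).
Qed.

Lemma bmf_bern s b f : @bmf R d I s f -> bmf s (fun z => bern b (f z)).
Proof. by case: b => //= bf; apply: bmfB => //; exact: bmf_cst. Qed.

Lemma arr_cont_bern s b f z : arr_cont s f z ->
  arr_cont s (fun z => bern b (f z)) z.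
Proof. by case: b => //= cf; apply: arr_contB => //; exact: arr_cont_cst. Qed.

Lemma Bpath01 s (x y : nat -> T) : 0 <= Bpath B B0 s x y <= 1.
Proof.
elim: s => [|s /andP[h0 h1]] /=; first exact: (eker01 0 true).
have /andP[t0 t1] := eker01 1 true (x s.+1) (y s.+1).
have /andP[f0 f1] := eker01 1 false (x s.+1) (y s.+1).
rewrite /Bhat; apply/andP; split; first by rewrite addr_ge0// mulr_ge0// subr_ge0.
set p := Bpath B B0 s x y in h0 h1 *.
rewrite -[leRHS](subrK p) addrC lerD//.
  by rewrite ler_piMr// subr_ge0.
by rewrite ler_piMr.
Qed.

Lemma BpathS s (x y : nat -> T) : Bpath B B0 s.+1 x y =
  Bpath B B0 s x y * eker s.+1 true (x s.+1) (y s.+1) +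
  (1 - Bpath B B0 s x y) * eker s.+1 false (x s.+1) (y s.+1).
Proof. by []. Qed.

Lemma umf_Bpath s s' i j : (s <= s')%N ->
  umf s' (fun z => Bpath B B0 s (z i) (z j)).
Proof.
move=> ss'; split; last by move=> z; exact: Bpath01.
suff : bmf s' (fun z => Bpath B B0 s (z i) (z j)) by case.
elim: s ss' => [|s ih] ss'; first exact: umf_bmf (umf_eker true i j ss').
have {}ih := ih (ltnW ss').
under eq_fun do rewrite BpathS.
apply: bmfD; apply: bmfM => //; try exact/umf_bmf/umf_eker.
by apply: bmfB => //; exact: bmf_cst.
Qed.

End arrays_of_kernels.

Section pattern_weight.
Context {k : nat}.
Implicit Types (z : 'I_k -> nat -> T) (a : nat -> pairs k -> bool).

(** The conditional probability of the edges [a s] given the positions and the edges [a s.-1]. For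
    [s = 0] the index [s.-1] is [0] again, and [eker] ignores the value read there. *)
Definition stepwt s a z : R := \prod_(p : pairs k)
  bern (a s p) (eker s (a s.-1 p) (z (val p).1 s) (z (val p).2 s)).

(* The conditional probability, given the positions, that the edges at times
   [s < r] are as prescribed by [a]. *)
Definition wt r a z : R := \prod_(s < r) stepwt s a z.

Lemma stepwt_umf s s' a : (s <= s')%N -> umf s' (stepwt s a).
Proof.
move=> ss'; split.
  suff : bmf s' (stepwt s a) by case.
  by apply: bmf_prod => p; apply/bmf_bern/umf_bmf/umf_eker.
move=> z; apply/andP; split.
  by apply: prodr_ge0 => p _; case/andP : (bern01 (a s p)
    (eker01 s (a s.-1 p) (z (val p).1 s) (z (val p).2 s))).
by apply: Num.Theory.prodr_ile1 => p _; exact/bern01/eker01.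
Qed.

Lemma wt_umf r s a : (r <= s.+1)%N -> umf s (wt r a).
Proof.
move=> rs; have us (q : 'I_r) : umf s (stepwt q a).
  by apply: stepwt_umf; rewrite -ltnS (leq_trans (ltn_ord q)).
split.
  suff : bmf s (wt r a) by case.
  by apply: bmf_prod => q; apply: umf_bmf.
move=> z; apply/andP; split.
  by apply: prodr_ge0 => q _; case/andP : (proj2 (us q) z).
by apply: Num.Theory.prodr_ile1 => q _; case: (us q).
Qed.

Lemma arr_cont_stepwt s a z : (forall p : pairs k,
    econt (z (val p).1 s) (z (val p).2 s)) -> arr_cont s (stepwt s a) z.
Proof.
move=> ez; apply: arr_cont_prod => p.
by apply: arr_cont_bern; apply: arr_cont_eker.
Qed.

Lemma wtS r a z : wt r.+1 a z = wt r a z * stepwt r a z.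
Proof. by rewrite /wt big_ord_recr. Qed.

End pattern_weight.

End edge_kernel_theory.

(** * Measurability and integration of the noise *)

Section measurability_of_vectors.
Context {R : realType} {dO : measure_display} {O : measurableType dO}.

Lemma measurable_arr_fun {d s} {I : finType} {S : ptopologicalType}
    (F : (I -> nat -> 'rV[R]_d) -> S) (X : I -> nat -> O -> 'rV[R]_d) :
  (forall z, F y @[y --> arr_near s z] --> F z) ->
  (forall i r, (r <= s)%N -> measurable_fun setT (X i r : O -> borel 'rV[R]_d)) ->
  measurable_fun setT ((fun w => F (fun i r => X i r w)) : O -> borel S).
Proof.
move=> cF mX; apply: measurability => // _ [V oV <-]; rewrite setTI.
apply: (measurable_open (s := s) (X := X) (A := F @^-1` V)) => // z Vz.
by apply: cF; exact: open_nbhs_nbhs.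
Qed.

Lemma measurable_coord {d} (f : O -> 'rV[R]_d) j :
  measurable_fun setT (f : O -> borel 'rV[R]_d) ->
  measurable_fun setT (fun w => f w ord0 j).
Proof.
move=> mf; exact: (measurableT_comp
  (@continuous_borelP R 'rV[R]_d _ (@coord_continuous R 1 d ord0 j)) mf).
Qed.

(** The coordinates are read as [d] agents in dimension one at time zero, so that the countable base
    of boxes shows that coordinates generate the Borel sets. *)
Lemma measurable_rV {d} (f : O -> 'rV[R]_d) :
  (forall j, measurable_fun setT (fun w => f w ord0 j)) ->
  measurable_fun setT (f : O -> borel 'rV[R]_d).
Proof.
move=> mf.
pose X (j : 'I_d) (_ : nat) (w : O) : 'rV[R]_1 := const_mx (f w ord0 j).
have mX j r : measurable_fun setT (X j r : O -> borel 'rV[R]_1).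
  apply: measurability => // _ [V oV <-]; rewrite setTI.
  have -> : X j r @^-1` V = (fun w => f w ord0 j) @^-1` (const_mx @^-1` V) by [].
  rewrite -[X in measurable X]setTI; apply: mf => //.
  apply: open_measurable; apply: open_comp => // x _ A [Q Qx QA].
  have := Qx ord0 ord0; rewrite mxE; apply: filterS => y Qy.
  by apply: QA => a b; rewrite (ord1 a) (ord1 b) mxE.
pose F (z : 'I_d -> nat -> 'rV[R]_1) : 'rV[R]_d := \row_j z j 0%N ord0 ord0.
have -> : f = (fun w => F (fun j r => X j r w)).
  by apply/funext => w; apply/rowP => j; rewrite !mxE.
apply: (@measurable_arr_fun 1 0) => // z A [Q Qz QA].
have cz j : (fun y : 'I_d -> nat -> 'rV[R]_1 => y j 0%N ord0 ord0) @ arr_near 0 z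
    --> z j 0%N ord0 ord0.
  exact: (cvg_comp _ _ (@arr_near_coord R 1 _ 0 z j 0 isT)
    (@coord_continuous R 1 1 ord0 ord0 (z j 0%N))).
have : arr_near 0 z [set y : 'I_d -> nat -> 'rV[R]_1 |
    forall j, Q ord0 j (y j 0%N ord0 ord0)].
  apply: (@filter_forall _ 'I_d (fun j => [set y : 'I_d -> nat -> 'rV[R]_1 |
    Q ord0 j (y j 0%N ord0 ord0)]) (arr_near 0 z) _) => j.
  by apply: cz; have := Qz ord0 j; rewrite mxE.
move=> h; rewrite /= /nbhs/=; apply: filterS h => y Qy.
by apply: QA => a j; rewrite (ord1 a) mxE.
Qed.

Lemma measurable_addV {d} (f g : O -> 'rV[R]_d) :
  measurable_fun setT (f : O -> borel 'rV[R]_d) ->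
  measurable_fun setT (g : O -> borel 'rV[R]_d) ->
  measurable_fun setT ((fun w => f w + g w) : O -> borel 'rV[R]_d).
Proof.
move=> mf mg; apply: measurable_rV => j.
by under eq_fun do rewrite mxE; apply: measurable_funD; exact: measurable_coord.
Qed.

Lemma measurable_scaleV {d} c (f : O -> 'rV[R]_d) :
  measurable_fun setT (f : O -> borel 'rV[R]_d) ->
  measurable_fun setT ((fun w => c *: f w) : O -> borel 'rV[R]_d).
Proof.
move=> mf; apply: measurable_rV => j.
under eq_fun do rewrite mxE; apply: measurable_funM; first exact: measurable_cst.
exact: measurable_coord.
Qed.

End measurability_of_vectors.

Section rectangles.
Context {R : realType} {d1 d2 : measure_display}.
Context {S1 : measurableType d1} {S2 : measurableType d2}.
Context {dA : measure_display} {OA : measurableType dA} (PA : probability OA R).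
Context {dB : measure_display} {OB : measurableType dB} (PB : probability OB R).

Lemma Ex_unique_rect (HA : OA -> R) (XA : OA -> S1) (YA : OA -> S2)
    (HB : OB -> R) (XB : OB -> S1) (YB : OB -> S2) :
  urv HA -> measurable_fun setT XA -> measurable_fun setT YA ->
  urv HB -> measurable_fun setT XB -> measurable_fun setT YB ->
  (forall U V, measurable U -> measurable V ->
    Ex PA (fun w => HA w * (\1_U (XA w) * \1_V (YA w))) =
    Ex PB (fun w => HB w * (\1_U (XB w) * \1_V (YB w)))) ->
  forall h : S1 * S2 -> R, brv h ->
    Ex PA (fun w => HA w * h (XA w, YA w)) =
    Ex PB (fun w => HB w * h (XB w, YB w)).
Proof.
move=> uA mXA mYA uB mXB mYB eqr h bh.
have := @Ex_unique R _ _ _ _ PA _ _ PB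
  [set U `*` V | U in measurable & V in measurable]
  HA (fun w => (XA w, YA w)) HB (fun w => (XB w, YB w)).
apply => //.
- by rewrite measurable_prod_measurableType.
- move=> _ _ [U mU [V mV <-]] [U' mU' [V' mV' <-]]; rewrite -setXI.
  exists (U `&` U'); first exact: measurableI.
  by exists (V `&` V') => //; exact: measurableI.
- by exists setT => //; exists setT => //; rewrite setXTT.
- exact: urv_brv.
- by move=> w; case: uA => _ /(_ w)/andP[].
- exact: measurable_fun_pair.
- exact: urv_brv.
- by move=> w; case: uB => _ /(_ w)/andP[].
- exact: measurable_fun_pair.
move=> _ [U mU [V mV <-]].
have e (x : S1) (y : S2) : \1_(U `*` V) (x, y) = \1_U x * \1_V y :> R.
  by rewrite !indicE in_setX/= -natrM mulnb.
by under eq_fun do rewrite e; under [in RHS]eq_fun do rewrite e; exact: eqr.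
Qed.

End rectangles.

Section noise.
Context {R : realType} {d : nat} {I : finType}.
Local Notation T := 'rV[R]_d.
Variable nu : probability (borel T) R.

(** The transition operator of one step of noise. *)
Definition smooth (psi : T -> R) (y : T) : R := Ex nu (fun x => psi (y + x)).

Lemma urv_shift (psi : borel T -> R) (y : T) : urv psi ->
  urv ((fun x => psi (y + x)) : borel T -> R).
Proof.
move=> [mp p1]; split => // .
have -> : (fun x => psi (y + x)) = psi \o (fun x : borel T => x + y : borel T).
  by apply/funext => x /=; rewrite addrC.
exact: measurableT_comp mp (measurable_addr_rV _).
Qed.

Lemma urv_smooth (psi : borel T -> R) : urv psi -> urv (smooth psi : borel T -> R).
Proof.
move=> up; split; last by move=> y; apply: Ex_urv; exact: urv_shift.
have bf : brv (fun p : borel T * borel T => psi (p.1 + p.2 : 'rV[R]_d)).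
  have [mp [M pM]] := urv_brv up; split; last by exists M => p.
  apply: (measurableT_comp mp); apply: measurable_addV.
    exact: measurable_fst.
  exact: measurable_snd.
by case: (brv_Exr nu nu bf).
Qed.

Context {dO : measure_display} {O : measurableType dO} (P : probability O R).
Variables (Y xi : I -> O -> T).
Hypothesis mY : forall i, measurable_fun setT (Y i : O -> borel T).
Hypothesis mxi : forall i, measurable_fun setT (xi i : O -> borel T).
Variable G : set (O -> R).
Hypothesis Gu : forall g, G g -> urv g.
Hypothesis GY : forall g i (phi : borel T -> R), G g -> urv phi ->
  G (fun w => g w * phi (Y i w)).
Hypothesis Gxi : forall g (V : I -> set (borel T)), G g ->
  (forall i, measurable (V i)) ->
  Ex P (fun w => g w * \prod_i \1_(V i) (xi i w)) =
  Ex P g * \prod_i Ex nu (\1_(V i)).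

Let urvY (phi : borel T -> R) i : urv phi -> urv (fun w => phi (Y i w)).
Proof. by move=> [mp p1]; split=> //; exact: measurableT_comp mp (mY i). Qed.

Let urvxi (phi : borel T -> R) i : urv phi -> urv (fun w => phi (xi i w)).
Proof. by move=> [mp p1]; split=> //; exact: measurableT_comp mp (mxi i). Qed.

(** The coordinates are treated one at a time. [Gxi] expresses independence through rectangles only,
    so the coordinates outside the list [l] of treated ones carry indicators of arbitrary sets [V i]
    in place of [psi i]. *)
Lemma noise_integration g (psi : I -> borel T -> R) :
  G g -> (forall i, urv (psi i)) ->
  Ex P (fun w => g w * \prod_i psi i (Y i w + xi i w)) =
  Ex P (fun w => g w * \prod_i smooth (psi i) (Y i w)).
Proof.
move=> Gg upsi.
pose F (l : seq I) (V : I -> set (borel T)) i w : R :=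
  if i \in l then psi i (Y i w + xi i w) else \1_(V i) (xi i w).
pose F' (l : seq I) i w : R :=
  if i \in l then smooth (psi i) (Y i w) else 1.
pose c (l : seq I) (V : I -> set (borel T)) i : R :=
  if i \in l then 1 else Ex nu (\1_(V i)).
have upsiY i : urv (fun w => psi i (Y i w + xi i w)).
  have [mp p1] := upsi i; split => //.
  apply: (measurableT_comp mp); exact: measurable_addV.
have uF l V i : (forall j, measurable (V j)) -> urv (F l V i).
  by rewrite /F => mV; case: (i \in l) => //; exact: (urvxi i (urv_indic (mV i))).
suff S l : uniq l -> forall g V, G g -> (forall i, measurable (V i)) ->
    Ex P (fun w => g w * \prod_i F l V i w) =
    Ex P (fun w => g w * \prod_i F' l i w) * \prod_i c l V i.
  have e1 : (fun w => g w * \prod_i psi i (Y i w + xi i w)) =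
      (fun w => g w * \prod_i F (enum I) (fun=> setT) i w).
    by apply/funext => w; congr (_ * _); apply: eq_bigr => i _; rewrite /F mem_enum.
  have e2 : (fun w => g w * \prod_i smooth (psi i) (Y i w)) =
      (fun w => g w * \prod_i F' (enum I) i w).
    by apply/funext => w; congr (_ * _); apply: eq_bigr => i _; rewrite /F' mem_enum.
  rewrite e1 e2 (S _ (enum_uniq _) _ _ Gg)// [X in _ * X]big1 ?mulr1// => i _.
  by rewrite /c mem_enum.
elim: l => [|i0 l ih] /=.
  move=> _ {}g V {}Gg mV; rewrite [LHS](Gxi Gg mV); congr (Ex P _ * _).
  by apply/funext => w; rewrite big1// mulr1.
move=> /andP[i0l ul] {}g V {}Gg mV.
pose V' (U : set (borel T)) i := if i == i0 then U else V i.
have mV' U : measurable U -> forall i, measurable (V' U i).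
  by move=> mU i; rewrite /V'; case: ifP.
pose H w := g w * \prod_(i | i != i0) F l V i w.
have uH : urv H by apply: urvM; [exact: Gu|apply: urv_prod => i; exact: uF].
have eF U (x : R) w : x * \prod_i F l (V' U) i w =
    x * \prod_(i | i != i0) F l V i w * \1_U (xi i0 w).
  rewrite (bigD1 i0)//= {1}/F (negbTE i0l) {1}/V' eqxx mulrCA [LHS]mulrC.
  congr (_ * _ * _); apply: eq_bigr => i ii0.
  by rewrite /F /V' (negbTE ii0).
have ec U : \prod_i c l (V' U) i = Ex nu (\1_U) * \prod_(i | i != i0) c l V i.
  rewrite (bigD1 i0)//= {1}/c (negbTE i0l) {1}/V' eqxx; congr (_ * _).
  by apply: eq_bigr => i ii0; rewrite /c /V' (negbTE ii0).
(* Under the weight [H], the noise [xi i0] has law [nu] and is independent of [Y i0]. On rectangles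
   this is the induction hypothesis with [\1_U (Y i0)] absorbed into [g] and [W] in place of
   [V i0]. *)
have one_step : Ex P (fun w => H w * psi i0 (Y i0 w + xi i0 w)) =
    Ex P (fun w => H w * smooth (psi i0) (Y i0 w)).
  have mH2 : urv (fun p : O * borel T => H p.1).
    by case: uH => mH H1; split=> //; exact: measurableT_comp mH measurable_fst.
  have mh : brv (fun p : borel T * borel T => psi i0 (p.1 + p.2 : 'rV[R]_d)).
    have [mp [M pM]] := urv_brv (upsi i0); split; last by exists M => p.
    apply: (measurableT_comp mp); apply: measurable_addV.
      exact: measurable_fst.
    exact: measurable_snd.
  rewrite (@Ex_unique_rect R _ _ (borel T) (borel T) _ _ P _ _ (pprod P nu)
      H (Y i0) (xi i0) (fun p => H p.1) (fun p => Y i0 p.1) (fun p => p.2)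
      uH (mY i0) (mxi i0) mH2 (measurableT_comp (mY i0) measurable_fst)
      measurable_snd _ _ mh).
    rewrite Ex_pprod; last first.
      apply: brvM; first exact: urv_brv.
      apply: (brv_comp mh); apply: measurable_fun_pair; last exact: measurable_snd.
      exact: measurableT_comp (mY i0) measurable_fst.
    congr (Ex P _); apply/funext => w /=; rewrite ExZ//.
    exact/urv_brv/urv_shift.
  move=> U W mU mW; rewrite Ex_pprod; last first.
    apply: brvM; [exact: urv_brv|apply: brvM].
      apply: (brv_comp (brv_indic mU)).
      exact: measurableT_comp (mY i0) measurable_fst.
    by apply: (brv_comp (brv_indic mW)); exact: measurable_snd.
  have E1 : (fun w => H w * (\1_U (Y i0 w) * \1_W (xi i0 w))) =
      (fun w => (g w * \1_U (Y i0 w)) * \prod_i F l (V' W) i w).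
    by apply/funext => w; rewrite eF /H; ring.
  have E2 : (fun w => H w * \1_U (Y i0 w)) =
      (fun w => (g w * \1_U (Y i0 w)) * \prod_i F l (V' setT) i w).
    apply/funext => w; rewrite eF /H; rewrite (_ : \1_setT _ = 1); first by ring.
    by rewrite indicE mem_set.
  have GU : G (fun w => g w * \1_U (Y i0 w)) by apply: GY => //; exact: urv_indic.
  rewrite E1 (ih ul _ _ GU (mV' _ mW)) ec.
  transitivity (Ex P (fun w => H w * \1_U (Y i0 w)) * Ex nu (\1_W)).
    rewrite E2 (ih ul _ _ GU (mV' _ measurableT)) ec.
    rewrite (_ : Ex nu \1_setT = 1); first by ring.
    rewrite -[RHS](Ex_cst nu); congr (Ex nu _); apply/funext => x.
    by rewrite indicE mem_set.
  rewrite mulrC -ExZ; last first.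
    apply: brvM; [exact: urv_brv|apply/urv_brv/urvY/urv_indic => //].
  congr (Ex P _); apply/funext => w /=.
  rewrite mulrC -ExZ; last exact: brv_indic.
  by congr (Ex nu _); apply/funext => x; rewrite mulrA.
have e1 : (fun w => g w * \prod_i F (i0 :: l) V i w) =
    (fun w => H w * psi i0 (Y i0 w + xi i0 w)).
  apply/funext => w; rewrite (bigD1 i0)//= {1}/F mem_head mulrCA mulrC /H.
  congr (_ * _ * _); apply: eq_bigr => i ii0.
  by rewrite /F in_cons (negbTE ii0).
have e2 : (fun w => H w * smooth (psi i0) (Y i0 w)) =
    (fun w => (g w * smooth (psi i0) (Y i0 w)) * \prod_i F l (V' setT) i w).
  apply/funext => w; rewrite eF /H; rewrite (_ : \1_setT _ = 1); first by ring.
  by rewrite indicE mem_set.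
rewrite e1 one_step e2 ih//; last 2 first.
- by apply: GY => //; exact: urv_smooth.
- exact: mV'.
congr (Ex P _ * _); first apply/funext => w.
  rewrite [in RHS](bigD1 i0)//= {2}/F' mem_head -mulrA; congr (_ * (_ * _)).
  rewrite (bigD1 i0)//= {1}/F' (negbTE i0l) mul1r; apply: eq_bigr => i ii0.
  by rewrite /F' in_cons (negbTE ii0).
rewrite ec (_ : Ex nu \1_setT = 1) ?mul1r; last first.
  rewrite -[RHS](Ex_cst nu); congr (Ex nu _); apply/funext => x.
  by rewrite indicE mem_set.
rewrite [in RHS](bigD1 i0)//= {2}/c mem_head mul1r; apply: eq_bigr => i ii0.
by rewrite /c in_cons (negbTE ii0).
Qed.

End noise.

(** * The limiting dynamics of positions *)

Lemma Ex_indic_eq0 {dT} {T : measurableType dT} {R : realType}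
    (P : probability T R) (A : set T) : measurable A ->
  Ex P \1_A = 0 <-> P A = 0%E.
Proof.
move=> mA; rewrite Ex_indic//; split=> [/eqP|->//].
by rewrite fine_eq0 ?fin_num_measure// => /eqP.
Qed.

Lemma Ex_ae0 {dT} {T : measurableType dT} {R : realType}
    (P : probability T R) (f : T -> R) : brv f -> {ae P, forall x, f x = 0} ->
  Ex P f = 0.
Proof. by move=> bf f0; rewrite -(Ex_cst P 0); apply: Ex_ae_eq => //; exact: brv_cst. Qed.

Lemma urv_one {dT} {T : measurableType dT} {R : realType} :
  urv (fun _ : T => 1 : R).
Proof. by split; [exact: measurable_cst|move=> x; rewrite ler01 lexx]. Qed.

Lemma Ex_mul2 {R : realType} {d1 d2} {T1 : measurableType d1}
    {T2 : measurableType d2} (P1 : probability T1 R) (P2 : probability T2 R)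
    (f : T1 -> R) (g : T2 -> R) : brv f -> brv g ->
  Ex P1 (fun x => Ex P2 (fun y => f x * g y)) = Ex P1 f * Ex P2 g.
Proof.
move=> bf bg; rewrite mulrC -ExZ//; congr (Ex P1 _); apply/funext => x.
by rewrite ExZ// mulrC.
Qed.

Section weak_limit_structure.
Context {R : realType} {d : nat}.
Local Notation T := 'rV[R]_d.
Local Notation leb := (lebesgue_rV R d).
Variables (mu0 nu : probability (borel T) R) (drift : nat -> (nat -> T) -> T).

(* The part of the limiting dynamics of [k] agents that concerns positions
   only: [wls_step] encodes that [X i s.+1 - drift s (X i)], [i < k], are i.i.d.
   with law [nu] and independent of the past. *)
Record wls {k : nat} {dO} {O : measurableType dO} (Q : probability O R)
    (X : 'I_k -> nat -> O -> T) : Prop := Wls {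
  wls_measurable : forall i s, measurable_fun setT (X i s : O -> borel T);
  wls_init : forall psi : 'I_k -> borel T -> R, (forall i, urv (psi i)) ->
    Ex Q (fun w => \prod_i psi i (X i 0%N w)) = \prod_i Ex mu0 (psi i);
  wls_step : forall s (g : ('I_k -> nat -> T) -> R) (psi : 'I_k -> borel T -> R),
    umf s g -> (forall i, urv (psi i)) ->
    Ex Q (fun w => g (fun i r => X i r w) * \prod_i psi i (X i s.+1 w)) =
    Ex Q (fun w => g (fun i r => X i r w) *
      \prod_i smooth nu (psi i) (drift s (X i ^~ w)))
}.

Hypothesis mdrift : forall s dO (O : measurableType dO) (X : nat -> O -> T),
  (forall r, (r <= s)%N -> measurable_fun setT (X r : O -> borel T)) ->
  measurable_fun setT ((fun w => drift s (X ^~ w)) : O -> borel T).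
Hypotheses (acmu0 : mu0 `<< leb) (acnu : nu `<< leb).

Let ac_id (mu : probability (borel T) R) : mu `<< leb ->
  ac_rv mu (fun x : borel T => x : T).
Proof.
move=> /null_content_dominatesP h; split; first exact: measurable_id.
by move=> V mV V0; exact: h.
Qed.

Context {k : nat} {dO : measure_display} {O : measurableType dO}.
Variables (Q : probability O R) (X : 'I_k -> nat -> O -> T).
Hypothesis wX : wls Q X.

Let mX := wls_measurable wX.

Let mpre (V : set (borel T)) i s : measurable V -> measurable (X i s @^-1` V).
Proof. by move=> mV; rewrite -[Y in measurable Y]setTI; exact: mX. Qed.

Let mdX i s : measurable_fun setT ((fun w => drift s (X i ^~ w)) : O -> borel T).
Proof. by apply: mdrift. Qed.

Let smooth_null (V : set (borel T)) y : measurable V -> leb V = 0%E ->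
  smooth nu \1_V y = 0.
Proof.
move=> mV V0; have [mZ acZ] := ac_rvD y (ac_id acnu).
transitivity (Ex nu \1_((fun x : borel T => x + y : borel T) @^-1` V)).
  by congr (Ex nu _); apply/funext => x; rewrite addrC.
apply/Ex_indic_eq0; last exact: acZ.
by rewrite -[Y in measurable Y]setTI; exact: mZ.
Qed.

Let one_coord (phi : borel T -> R) i (h : 'I_k -> T) :
  \prod_j (if j == i then phi else fun=> 1) (h j) = phi (h i).
Proof. by rewrite (bigD1 i)//= eqxx big1 ?mulr1// => j /negbTE ->. Qed.

Lemma wls_ac i s : ac_rv Q (X i s).
Proof.
split; first exact: mX.
move=> V mV V0; apply/Ex_indic_eq0; first exact: mpre.
pose psi j : borel T -> R := if j == i then \1_V else fun=> 1.
have upsi j : urv (psi j).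
  by rewrite /psi; case: ifP => _; [exact: urv_indic|exact: urv_one].
case: s => [|s].
  rewrite (_ : \1__ = fun w => \prod_j psi j (X j 0%N w)); last first.
    by apply/funext => w; rewrite (one_coord _ i (fun j => X j 0%N w)).
  rewrite wls_init// (bigD1 i)//= /psi eqxx (_ : Ex mu0 _ = 0) ?mul0r//.
  have [_ h] := ac_id acmu0.
  by apply/(Ex_indic_eq0 mu0 mV); exact: (h V mV V0).
have u1 : @umf R d 'I_k s (fun=> 1).
  by split=> [? ? ? _|z]; [exact: measurable_cst|rewrite ler01 lexx].
rewrite (_ : \1__ = fun w => 1 * \prod_j psi j (X j s.+1 w)); last first.
  by apply/funext => w; rewrite mul1r (one_coord _ i (fun j => X j s.+1 w)).
rewrite (wls_step wX u1 upsi) -[RHS](Ex_cst Q); congr (Ex Q _); apply/funext => w.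
by rewrite (bigD1 i)//= {1}/psi eqxx smooth_null// mul0r mulr0.
Qed.

Let two_coord (F : 'I_k -> (borel T -> R) -> R) (phi psi : borel T -> R) i j :
  i != j -> (forall l, F l (fun=> 1) = 1) ->
  \prod_l F l (if l == i then phi else if l == j then psi else fun=> 1) =
  F i phi * F j psi.
Proof.
move=> ij F1; rewrite (bigD1 i)//= eqxx (bigD1 j)/=; last by rewrite eq_sym.
rewrite eq_sym (negbTE ij) eqxx big1 ?mulr1// => l /andP[/negbTE -> /negbTE ->].
exact: F1.
Qed.

(** At time zero the pair has law [mu0 x mu0]. Later, given the past, it consists of two independent
    noises translated by their drifts, and translations preserve Lebesgue null sets. *)
Lemma wls_pair_null (N : set (borel T * borel T)) i j s : i != j ->
  measurable N -> (leb \x leb)%E N = 0%E ->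
  {ae Q, forall w, ~ N (X i s w, X j s w)}.
Proof.
move=> ij mN N0.
have mXX : measurable_fun setT (fun w => (X i s w, X j s w) : borel T * borel T).
  by apply: measurable_fun_pair; exact: mX.
have mNX : measurable ((fun w => (X i s w, X j s w)) @^-1` N).
  by rewrite -[Y in measurable Y]setTI; exact: mXX.
exists ((fun w => (X i s w, X j s w)) @^-1` N); split => //; last first.
  by move=> w /contrapT.
apply/Ex_indic_eq0 => //.
pose pair_psi (U V : set (borel T)) l : borel T -> R :=
  if l == i then \1_U else if l == j then \1_V else fun=> 1.
have upsi U V l : measurable U -> measurable V -> urv (pair_psi U V l).
  move=> mU mV; rewrite /pair_psi; case: ifP => _; first exact: urv_indic.
  by case: ifP => _; [exact: urv_indic|exact: urv_one].
have eqN : \1_((fun w => (X i s w, X j s w)) @^-1` N) =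
    (fun w => 1 * \1_N (X i s w, X j s w)) :> (O -> R).
  by apply/funext => w; rewrite mul1r.
have bN : brv (\1_N : borel T * borel T -> R) by exact: brv_indic.
case: s mXX mNX eqN => [|s] mXX mNX eqN; rewrite eqN.
  rewrite (@Ex_unique_rect R _ _ (borel T) (borel T) _ _ Q _ _ (pprod mu0 mu0)
    (fun=> 1) (X i 0%N) (X j 0%N) (fun=> 1) fst snd
    urv_one (mX i 0%N) (mX j 0%N) urv_one measurable_fst measurable_snd _ _ bN).
    have -> : (fun w : borel T * borel T => 1 * \1_N (w.1, w.2)) = \1_N :> (_ -> R).
      by apply/funext => -[x y]; rewrite mul1r.
    rewrite Ex_pprod//; apply: Ex_ae0; first exact: brv_Exr.
    have := ac_rv_pair_ae mN N0 (ac_id acmu0) (ac_id acmu0).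
    apply: filterS => x hx; apply: Ex_ae0.
      by apply: (brv_comp bN); exact: measurable_pair1.
    by apply: filterS hx => y ny; rewrite indicE memNset.
  move=> U V mU mV.
  rewrite (_ : (fun w => _) = fun w => \prod_l pair_psi U V l (X l 0%N w)).
    rewrite (wls_init wX) => [|l]; last exact: upsi.
    rewrite (_ : (fun w => _) = fun p : borel T * borel T => \1_U p.1 * \1_V p.2).
      rewrite Ex_pprod; last first.
        apply: brvM; first by apply: (brv_comp (brv_indic mU)); exact: measurable_fst.
        by apply: (brv_comp (brv_indic mV)); exact: measurable_snd.
      rewrite Ex_mul2; [|exact: brv_indic|exact: brv_indic].
      by apply: (two_coord (F := fun=> Ex mu0)) => // l; exact: Ex_cst.
    by apply/funext => p; rewrite mul1r.
  apply/funext => w; rewrite mul1r; apply/esym.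
  exact: (two_coord (F := fun l phi => phi (X l 0%N w))).
have mA : measurable_fun setT ((fun p => drift s (X i ^~ p.1) + (p.2.1 : 'rV[R]_d))
    : O * (borel T * borel T) -> borel T).
  apply: measurable_addV; last exact: (measurableT_comp measurable_fst measurable_snd).
  exact: (measurableT_comp (mdX i s) measurable_fst).
have mB : measurable_fun setT ((fun p => drift s (X j ^~ p.1) + (p.2.2 : 'rV[R]_d))
    : O * (borel T * borel T) -> borel T).
  apply: measurable_addV; last exact: (measurableT_comp measurable_snd measurable_snd).
  exact: (measurableT_comp (mdX j s) measurable_fst).
rewrite (@Ex_unique_rect R _ _ (borel T) (borel T) _ _ Q _ _ (pprod Q (pprod nu nu))
    (fun=> 1) (X i s.+1) (X j s.+1) (fun=> 1) _ _
    urv_one (mX i s.+1) (mX j s.+1) urv_one mA mB _ _ bN).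
  rewrite Ex_pprod; last first.
    by apply: brvZ; apply: (brv_comp bN); exact: measurable_fun_pair.
  rewrite -[RHS](Ex_cst Q); congr (Ex Q _); apply/funext => w.
  have bw : brv (fun y : borel T * borel T => 1 * (\1_N (drift s (X i ^~ w) +
      (y.1 : 'rV[R]_d) : borel T, drift s (X j ^~ w) + (y.2 : 'rV[R]_d) : borel T)
      : R)).
    apply: brvZ; apply: (brv_comp bN); apply: measurable_fun_pair.
      by apply: measurable_addV; [exact: measurable_cst|exact: measurable_fst].
    by apply: measurable_addV; [exact: measurable_cst|exact: measurable_snd].
  rewrite Ex_pprod//; apply: Ex_ae0; first exact: (brv_Exr nu nu bw).
  have := ac_rv_pair_ae mN N0 (ac_rvD (drift s (X i ^~ w)) (ac_id acnu))
    (ac_rvD (drift s (X j ^~ w)) (ac_id acnu)).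
  apply: filterS => x hx; apply: Ex_ae0.
    by apply: (brv_comp bw); exact: measurable_pair1.
  apply: filterS hx => y ny; rewrite mul1r indicE memNset//= => h; apply: ny.
  by rewrite addrC [X in (_, X)]addrC.
move=> U V mU mV.
have u1 : @umf R d 'I_k s (fun=> 1).
  by split=> [? ? ? _|z]; [exact: measurable_cst|rewrite ler01 lexx].
rewrite (_ : (fun w => _) = fun w => 1 * \prod_l pair_psi U V l (X l s.+1 w)).
  rewrite (wls_step wX u1) => [|l]; last exact: upsi.
  rewrite Ex_pprod; last first.
    apply: brvZ; apply: brvM; first exact: (brv_comp (brv_indic mU) mA).
    exact: (brv_comp (brv_indic mV) mB).
  congr (Ex Q _); apply/funext => w; rewrite mul1r.
  rewrite (_ : (fun y => _) = (fun y : borel T * borel T =>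
     \1_U (drift s (X i ^~ w) + (y.1 : 'rV[R]_d)) *
     \1_V (drift s (X j ^~ w) + (y.2 : 'rV[R]_d)))); last first.
    by apply/funext => y; rewrite mul1r.
  rewrite Ex_pprod; last first.
    apply: brvM.
      apply: (brv_comp (brv_indic mU)).
      by apply: measurable_addV; [exact: measurable_cst|exact: measurable_fst].
    apply: (brv_comp (brv_indic mV)).
    by apply: measurable_addV; [exact: measurable_cst|exact: measurable_snd].
  have uV := urv_shift (drift s (X j ^~ w)) (urv_indic mV).
  have uU := urv_shift (drift s (X i ^~ w)) (urv_indic mU).
  rewrite (Ex_mul2 nu nu (urv_brv uU) (urv_brv uV)).
  apply: (two_coord (F := fun l phi => smooth nu phi (drift s (X l ^~ w)))) => // l.
  exact: Ex_cst.
apply/funext => w; rewrite !mul1r; apply/esym.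
exact: (two_coord (F := fun l phi => phi (X l s.+1 w))).
Qed.

End weak_limit_structure.

(** * Induction on time *)

Section lipschitz.
Context {R : realType} {d : nat}.
Local Notation T := 'rV[R]_d.

(** Lipschitz rather than continuous: the error made by moving the argument of [smooth nu psi] from
    the local mean to the mean field is then linear in their distance. *)
Definition ulip (psi : T -> R) : Prop :=
  (forall x, 0 <= psi x <= 1) /\
  exists2 K : R, 0 <= K & forall x y, `|psi x - psi y| <= K * `|x - y|.

Lemma ulip_cvg {U : Type} {F : set_system U} {FF : Filter F} (psi : T -> R)
  (h : U -> T) (x : T) : ulip psi -> h u @[u --> F] --> x ->
  psi (h u) @[u --> F] --> psi x.
Proof.
move=> [_ [K K0 hK]] hx; apply/cvgrPdist_le => e e0.
have K10 : 0 < K + 1 by rewrite ltr_wpDl.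
have : \forall u \near F, `|x - h u| < e / (K + 1).
  by move/cvgrPdist_lt : hx; apply; rewrite divr_gt0.
apply: filterS => u hu; rewrite (le_trans (hK _ _))//.
rewrite (@le_trans _ _ ((K + 1) * `|x - h u|))// ?ler_wpM2r ?lerDl//.
by rewrite mulrC -ler_pdivlMr// ltW.
Qed.

Lemma ulip_continuous (psi : T -> R) : ulip psi -> continuous psi.
Proof. by move=> lp x; apply: (@ulip_cvg _ (nbhs x) _ psi id x lp). Qed.

Lemma ulip_urv (psi : T -> R) : ulip psi -> urv (psi : borel T -> R).
Proof.
move=> lp; split; last by case: lp.
exact: (@continuous_borelP R T psi (ulip_continuous lp)).
Qed.

Lemma ulip1 : ulip (fun=> 1).
Proof.
split=> [x|]; first by rewrite ler01 lexx.
by exists 0 => // x y; rewrite subrr normr0 mul0r.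
Qed.

Lemma prod_unit_dist (a b a' b' : R) : 0 <= a <= 1 -> 0 <= b' <= 1 ->
  `|a * b - a' * b'| <= `|a - a'| + `|b - b'|.
Proof.
move=> /andP[a0 a1] /andP[b0 b1].
have -> : a * b - a' * b' = (a - a') * b' + a * (b - b') by ring.
rewrite (le_trans (ler_normD _ _))// !normrM (ger0_norm a0) (ger0_norm b0) lerD//.
  by rewrite ler_piMr.
by rewrite ler_piMl.
Qed.

Lemma prod_unit_dist_big (J : Type) (l : seq J) (f g : J -> R) :
  (forall j, 0 <= f j <= 1) -> (forall j, 0 <= g j <= 1) ->
  `|\prod_(j <- l) f j - \prod_(j <- l) g j| <= \sum_(j <- l) `|f j - g j|.
Proof.
move=> hf hg; elim: l => [|j l ih]; first by rewrite !big_nil subrr normr0.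
rewrite !big_cons (le_trans (prod_unit_dist _ _ (hf j) _))// ?lerD2l//.
apply/andP; split; first by apply: prodr_ge0 => i _; case/andP : (hg i).
by apply: Num.Theory.prodr_ile1 => i _.
Qed.

Lemma ulipM (psi phi : T -> R) : ulip psi -> ulip phi ->
  ulip (fun x => psi x * phi x).
Proof.
move=> [p1 [K K0 hK]] [q1 [L L0 hL]]; split.
  move=> x; have /andP[a0 a1] := p1 x; have /andP[b0 b1] := q1 x.
  by rewrite mulr_ge0// mulr_ile1.
exists (K + L); first exact: addr_ge0.
by move=> x y; rewrite (le_trans (prod_unit_dist _ _ (p1 x) (q1 y)))// mulrDl lerD.
Qed.

Lemma ulip_box n (q : 'rV[rat]_d) :
  ulip (fun x : T => Num.max 0 (boxrad n - `|x - ratv q|)).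
Proof.
split=> [x|]; first exact: boxbump_factor01.
exists 1 => // x y; rewrite mul1r.
set a := boxrad n - _; set b := boxrad n - _.
have ab : `|a - b| <= `|x - y|.
  rewrite /a /b (_ : _ - _ = `|y - ratv q| - `|x - ratv q|); last by ring.
  rewrite (le_trans (ler_dist_dist _ _))// opprB addrA subrK.
  by rewrite distrC.
apply: le_trans ab; rewrite /Num.max.
case: ltP => ha; case: ltP => hb //; rewrite ?subr0 ?sub0r ?subrr ?normr0 ?normrN.
- by rewrite gtr0_norm// (le_trans _ (ler_norm _))// lerDl oppr_ge0.
- rewrite gtr0_norm// distrC (le_trans _ (ler_norm _))// lerDl oppr_ge0//.
- by [].
Qed.

Lemma ulip_smooth (nu : probability (borel T) R) (psi : T -> R) :
  ulip psi -> ulip (smooth nu psi).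
Proof.
move=> lp; have up := ulip_urv lp; have [p1 [K K0 hK]] := lp.
split; first by move=> x; apply: Ex_urv; exact: urv_shift.
exists K => // x y; rewrite /smooth -ExB; [|exact/urv_brv/urv_shift..].
apply: Ex_bound.
  by apply: brvB; exact/urv_brv/urv_shift.
by move=> u; rewrite (le_trans (hK _ _))// opprD addrACA subrr addr0.
Qed.

End lipschitz.

Section induction_scheme.
Context {R : realType} {d k : nat}.
Local Notation T := 'rV[R]_d.
Local Notation arr := ('I_k -> nat -> T).
Local Notation leb := (lebesgue_rV R d).
Variables (B : bool -> T -> T -> R) (B0 : T -> T -> R).
Hypotheses (hB : forall a, edge_kernel (B a)) (hB0 : edge_kernel B0).
Variables (mu0 nu : probability (borel T) R) (drift : nat -> (nat -> T) -> T).
Hypothesis mdrift : forall s dO (O : measurableType dO) (X : nat -> O -> T),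
  (forall r, (r <= s)%N -> measurable_fun setT (X r : O -> borel T)) ->
  measurable_fun setT ((fun w => drift s (X ^~ w)) : O -> borel T).
Hypotheses (acmu0 : mu0 `<< leb) (acnu : nu `<< leb).
Context {dO : measure_display} {O : measurableType dO}.
Variables (Q : probability O R) (X : 'I_k -> nat -> O -> T).
Hypothesis wX : wls mu0 nu drift Q X.

Local Notation pattern := (nat -> pairs k -> bool).
Local Notation XX := (fun w i r => X i r w).

Definition ae_cont s (f : arr -> R) := {ae Q, forall w, arr_cont s f (XX w)}.

(* [E n a f] stands for the expectation of [f] of the positions on the event that
   the edges at the times before [r] follow the pattern [a]. *)
Definition edge_cvg (E : nat -> pattern -> (arr -> R) -> R) r s :=
  forall a f, bmf s f -> ae_cont s f ->
    E ^~ a ^~ f @ \oo --> Ex Q (fun w => f (XX w) * wt B B0 r a (XX w)).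

Variable En : nat -> nat -> pattern -> (arr -> R) -> R.
Hypothesis EnD : forall r n a s f g, bmf s f -> bmf s g ->
  En r n a (fun z => f z + g z) = En r n a f + En r n a g.
Hypothesis EnZ : forall r n a s c f, bmf s f ->
  En r n a (fun z => c * f z) = c * En r n a f.
Hypothesis En_le : forall r n a s f g, bmf s f -> bmf s g ->
  (forall z, f z <= g z) -> En r n a f <= En r n a g.
Hypothesis En_init : forall a (psi : 'I_k -> T -> R), (forall i, ulip (psi i)) ->
  En 0 n a (fun z => \prod_i psi i (z i 0%N)) @[n --> \oo] -->
    \prod_i Ex mu0 (psi i).
Hypothesis En_edge : forall s a f, bmf s f ->
  En s.+1 n a f - En s n a (fun z => f z * stepwt B B0 s a z) @[n --> \oo] --> 0.
(** This hypothesis and [En_step] may use the convergence that includes the edges at time [s]: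
    integrability of the limit and the law of large numbers for the local means will be consequences
    of it. *)
Hypothesis drift_cont : forall s, edge_cvg (En s.+1) s.+1 s ->
  {ae Q, forall w, forall i, (fun y : arr => drift s (y i)) @ arr_near s (XX w)
    --> drift s (X i ^~ w)}.
Hypothesis En_step : forall s, edge_cvg (En s.+1) s.+1 s ->
  forall a (phi : arr -> R) (psi : 'I_k -> T -> R),
    umf s phi -> (forall z, arr_cont s phi z) -> (forall i, ulip (psi i)) ->
  En s.+1 n a (fun z => phi z * \prod_i psi i (z i s.+1)) -
  En s.+1 n a (fun z => phi z * \prod_i smooth nu (psi i) (drift s (z i)))
    @[n --> \oo] --> 0.

Let mX i r s : (r <= s)%N -> measurable_fun setT (X i r : O -> borel T).
Proof. by move=> _; exact: wls_measurable wX i r. Qed.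

Let uwt r a : urv (fun w => wt B B0 r a (XX w)).
Proof.
have := @wt_umf _ _ B B0 hB hB0 k r r a (leqnSn r); apply: umf_urv.
by move=> i q _; exact: wls_measurable wX i q.
Qed.

Lemma ae_econt_pairs s :
  {ae Q, forall w, forall p : pairs k, econt B B0 (X (val p).1 s w) (X (val p).2 s w)}.
Proof.
have [N [mN N0 hN]] := econt_null hB hB0.
apply: filter_forall => p.
have pp : (val p).1 != (val p).2 by have := valP p; apply: contraL => /eqP ->; rewrite ltnn.
apply: filterS (wls_pair_null mdrift acmu0 acnu wX s pp mN N0) => w.
exact: hN.
Qed.

(** Integrating out the edges at time [s] multiplies [f] by [stepwt]. Its discontinuities form a
    Lebesgue null set of pairs of positions, which two distinct limiting agents almost surely avoid,
    so the product is again an admissible test function. *)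
Let edge_next s : edge_cvg (En s) s s -> edge_cvg (En s.+1) s.+1 s.
Proof.
move=> Ps a f bf cf.
have us := @stepwt_umf _ _ B B0 hB hB0 k s s a (leqnn s).
have bfs : bmf s (fun z => f z * stepwt B B0 s a z).
  by apply: bmfM => //; exact: umf_bmf us.
have cfs : ae_cont s (fun z => f z * stepwt B B0 s a z).
  apply: filterS2 cf (ae_econt_pairs s) => w cfw ew.
  by apply: arr_contM => //; exact: arr_cont_stepwt.
have h := Ps a _ bfs cfs.
have -> : (En s.+1 ^~ a ^~ f) = (fun n =>
    (En s.+1 n a f - En s n a (fun z => f z * stepwt B B0 s a z)) +
    En s n a (fun z => f z * stepwt B B0 s a z)).
  by apply/funext => n; rewrite subrK.
rewrite -[X in _ --> X]add0r; apply: cvgD; first exact: En_edge.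
rewrite (_ : (fun w => _) = (fun w => f (XX w) * stepwt B B0 s a (XX w) *
  wt B B0 s a (XX w)))//.
by apply/funext => w; rewrite wtS mulrAC mulrA.
Qed.

Let edge0 : edge_cvg (En 0) 0 0.
Proof.
move=> a f bf cf.
apply: (@portmanteau R d 'I_k 0 _ _ Q X (fun w => wt B B0 0 a (XX w))
  (fun i r => @mX i r 0) (uwt 0 a) (fun n => En 0 n a) _ _ _
  [set h | exists c (psi : 'I_k -> T -> R), (forall i, ulip (psi i)) /\
     h = (fun z => c * \prod_i psi i (z i 0%N))]) => //.
- by move=> n g h; exact: EnD.
- by move=> n c g; exact: EnZ.
- by move=> n g h; exact: En_le.
- move=> _ [c [psi [hpsi ->]]]; apply: bmfZ; apply: bmf_prod => i.
  apply: umf_bmf; split=> [dO' O' X' mX'|z]; last by case: (hpsi i).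
  by have [mp _] := ulip_urv (hpsi i); exact: measurableT_comp mp (mX' i 0%N (leqnn _)).
- move=> _ _ [c [psi [hpsi ->]]] [c' [psi' [hpsi' ->]]].
  exists (c * c'), (fun i x => psi i x * psi' i x); split.
    by move=> i; exact: ulipM.
  by apply/funext => z; rewrite big_split/= mulrACA.
- exists 1, (fun _ _ => 1); split; first by move=> i; exact: ulip1.
  by apply/funext => z; rewrite big1// mulr1.
- exists 0, (fun _ _ => 1); split; first by move=> i; exact: ulip1.
  by apply/funext => z; rewrite mul0r.
- move=> q; exists 1, (fun i x => Num.max 0 (boxrad q.2 - `|x - ratv (q.1 (i, ord0))|)).
  split; first by move=> i; exact: ulip_box.
  by apply/funext => z; rewrite mul1r; apply: eq_bigr => i _; rewrite big_ord1.
move=> _ [c [psi [hpsi ->]]].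
have bpsi : @bmf R d 'I_k 0 (fun z => \prod_i psi i (z i 0%N)).
  apply: bmf_prod => i.
  apply: umf_bmf; split=> [dO' O' X' mX'|z]; last by case: (hpsi i).
  by have [mp _] := ulip_urv (hpsi i); exact: measurableT_comp mp (mX' i 0%N (leqnn _)).
under eq_fun do rewrite (EnZ _ _ _ _ bpsi).
rewrite /Einf (_ : Ex Q _ = c * \prod_i Ex mu0 (psi i)).
  by apply: cvgMr; exact: En_init.
rewrite -(wls_init wX) => [|i]; last exact: ulip_urv.
rewrite -ExZ; last exact: (bmf_brv (fun i r => @mX i r 0) bpsi).
by congr (Ex Q _); apply/funext => w; rewrite /wt big_ord0 mulr1.
Qed.

(** By the portmanteau theorem it is enough to test a continuous function of the past times
    Lipschitz functions of the new positions. [En_step] turns the latter into functions of the past,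
    to which the hypothesis applies, and [wls_step] undoes this in the limit. *)
Let edge_step s : edge_cvg (En s.+1) s.+1 s -> edge_cvg (En s.+1) s.+1 s.+1.
Proof.
move=> Cs a f bf cf.
have bphi (phi : arr -> R) (psi : 'I_k -> T -> R) : umf s phi ->
    (forall i, ulip (psi i)) ->
    bmf s.+1 (fun z => phi z * \prod_i psi i (z i s.+1)).
  move=> [mphi phi1] hpsi; apply: bmfM.
    by apply: umf_bmf; split=> //; exact: arr_mfun_le mphi.
  apply: bmf_prod => i.
  apply: umf_bmf; split=> [dO' O' X' mX'|z]; last by case: (hpsi i).
  by have [mp _] := ulip_urv (hpsi i); exact: measurableT_comp mp (mX' i s.+1 (leqnn _)).
apply: (@portmanteau R d 'I_k s.+1 _ _ Q X (fun w => wt B B0 s.+1 a (XX w))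
  (fun i r => @mX i r s.+1) (uwt s.+1 a) (fun n => En s.+1 n a) _ _ _
  [set h | exists c (phi : arr -> R) (psi : 'I_k -> T -> R),
     [/\ umf s phi, (forall z, arr_cont s phi z), (forall i, ulip (psi i)) &
     h = (fun z => c * (phi z * \prod_i psi i (z i s.+1)))]]) => //.
- by move=> n g h; exact: EnD.
- by move=> n c g; exact: EnZ.
- by move=> n g h; exact: En_le.
- by move=> _ [c [phi [psi [uphi _ hpsi ->]]]]; exact/bmfZ/bphi.
- move=> _ _ [c [phi [psi [uphi cphi hpsi ->]]]] [c' [phi' [psi' [uphi' cphi' hpsi' ->]]]].
  exists (c * c'), (fun z => phi z * phi' z), (fun i x => psi i x * psi' i x); split.
  + split; first by case: (bmfM (umf_bmf uphi) (umf_bmf uphi')).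
    move=> z; have /andP[? ?] := proj2 uphi z; have /andP[? ?] := proj2 uphi' z.
    by rewrite mulr_ge0// mulr_ile1.
  + by move=> z; exact: arr_contM.
  + by move=> i; exact: ulipM.
  + by apply/funext => z; rewrite big_split/=; ring.
- exists 1, (fun=> 1), (fun _ _ => 1); split.
  + by split=> [? ? ? _|z]; [exact: measurable_cst|rewrite ler01 lexx].
  + by move=> z; exact: arr_cont_cst.
  + by move=> i; exact: ulip1.
  + by apply/funext => z; rewrite big1// !mulr1.
- exists 0, (fun=> 1), (fun _ _ => 1); split.
  + by split=> [? ? ? _|z]; [exact: measurable_cst|rewrite ler01 lexx].
  + by move=> z; exact: arr_cont_cst.
  + by move=> i; exact: ulip1.
  + by apply/funext => z; rewrite mul0r.
(* A bump up to time [s + 1] splits into its part up to time [s], which is continuous in the past,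
   and one tent for each new position. *)
- move=> q; exists 1, (fun z => \prod_i \prod_(r < s.+1)
    Num.max 0 (boxrad q.2 - `|z i r - ratv (q.1 (i, widen_ord (leqnSn _) r))|)),
    (fun i x => Num.max 0 (boxrad q.2 - `|x - ratv (q.1 (i, ord_max))|)).
  have cphi (z : arr) : arr_cont s (fun z => \prod_i \prod_(r < s.+1)
      Num.max 0 (boxrad q.2 - `|z i r - ratv (q.1 (i, widen_ord (leqnSn _) r))|)) z.
    apply: arr_cont_prod => i; apply: arr_cont_prod => r.
    apply: (ulip_cvg (ulip_box _ _)).
    by apply: arr_near_coord; rewrite -ltnS ltn_ord.
  split => //.
  + split; first exact: arr_cont_mfun.
    move=> z; apply/andP; split.
      apply: prodr_ge0 => i _; apply: prodr_ge0 => r _.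
      by rewrite le_max lexx.
    apply: Num.Theory.prodr_ile1 => i _; apply/andP; split.
      by apply: prodr_ge0 => r _; rewrite le_max lexx.
    by apply: Num.Theory.prodr_ile1 => r _; exact: boxbump_factor01.
  + by move=> i; exact: ulip_box.
  + apply/funext => z; rewrite mul1r -big_split/=; apply: eq_bigr => i _.
    by rewrite big_ord_recr.
move=> _ [c [phi [psi [uphi cphi hpsi ->]]]].
under eq_fun do rewrite (EnZ _ _ _ _ (bphi _ _ uphi hpsi)).
pose g z := phi z * \prod_i smooth nu (psi i) (drift s (z i)).
have bg : bmf s g.
  apply: bmfM; first exact: umf_bmf.
  apply: bmf_prod => i; apply: umf_bmf; split=> [dO' O' X' mX'|z].
    have [mp _] := ulip_urv (ulip_smooth nu (hpsi i)).
    by apply: (measurableT_comp mp); apply: mdrift => r; exact: mX'.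
  by case: (ulip_smooth nu (hpsi i)).
have cg : ae_cont s g.
  apply: filterS (drift_cont Cs) => w hw; apply: arr_contM => //.
  apply: arr_cont_prod => i; apply: (ulip_cvg (ulip_smooth nu (hpsi i))); exact: hw.
have h := Cs a g bg cg.
have uphiwt : umf s (fun z => phi z * wt B B0 s.+1 a z).
  have uw := @wt_umf _ _ B B0 hB hB0 k s.+1 s a (leqnn _).
  split; first by case: (bmfM (umf_bmf uphi) (umf_bmf uw)).
  move=> z; have /andP[? ?] := proj2 uphi z; have /andP[? ?] := proj2 uw z.
  by rewrite mulr_ge0// mulr_ile1.
rewrite /Einf (_ : Ex Q _ = c * Ex Q (fun w => g (XX w) * wt B B0 s.+1 a (XX w))).
  apply: cvgMr.
  rewrite (_ : (fun n => _) = (fun n =>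
    (En s.+1 n a (fun z => phi z * \prod_i psi i (z i s.+1)) - En s.+1 n a g) +
    En s.+1 n a g)); last by apply/funext => n; rewrite subrK.
  by rewrite -[X in _ --> X]add0r; apply: cvgD => //; exact: En_step.
have e1 : (fun w => g (XX w) * wt B B0 s.+1 a (XX w)) =
    (fun w => (phi (XX w) * wt B B0 s.+1 a (XX w)) *
      \prod_i smooth nu (psi i) (drift s (X i ^~ w))).
  by apply/funext => w; rewrite /g mulrAC.
rewrite e1 -(wls_step wX uphiwt) => [|i]; last exact: ulip_urv.
rewrite -ExZ; last first.
  apply: brvM; first exact: (bmf_brv (fun i r => @mX i r s) (umf_bmf uphiwt)).
  apply: brv_prod => i; apply: (brv_comp (urv_brv (ulip_urv (hpsi i)))).
  exact: wls_measurable wX i s.+1.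
by congr (Ex Q _); apply/funext => w; ring.
Qed.

Theorem edge_cvg_all s : edge_cvg (En s.+1) s.+1 s.
Proof. by apply: edge_next; elim: s => // s ih; apply/edge_step/edge_next. Qed.

End induction_scheme.

Lemma Ex_pprodr {R : realType} {d1 d2} {O1 : measurableType d1}
    {O2 : measurableType d2} (P1 : probability O1 R) (P2 : probability O2 R)
    (f : O1 * O2 -> R) : brv f ->
  Ex (pprod P1 P2) f = Ex P2 (fun y => Ex P1 (fun x => f (x, y))).
Proof.
move=> bf; have [mf [M fM]] := bf.
have intf := brv_integrable (pprod P1 P2) bf.
have := @integral21_prod_meas1 _ _ _ _ _ P1 P2 _ intf.
rewrite /Ex /Rintegral => /esym h; congr fine; rewrite [LHS]h.
apply: eq_integral => y _; apply: (EFin_Ex P1 (f := fun x => f (x, y))).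
split; last by exists M.
by apply: measurableT_comp => //; exact: measurable_pair2.
Qed.

Section products_of_weak_limits.
Context {R : realType} {d : nat}.
Local Notation T := 'rV[R]_d.
Variables (mu0 nu : probability (borel T) R) (drift : nat -> (nat -> T) -> T).
Hypothesis mdrift : forall s dO (O : measurableType dO) (X : nat -> O -> T),
  (forall r, (r <= s)%N -> measurable_fun setT (X r : O -> borel T)) ->
  measurable_fun setT ((fun w => drift s (X ^~ w)) : O -> borel T).

Context {k1 k2 : nat} {d1 d2 : measure_display}.
Context {O1 : measurableType d1} {O2 : measurableType d2}.
Variables (Q1 : probability O1 R) (Q2 : probability O2 R).
Variables (X1 : 'I_k1 -> nat -> O1 -> T) (X2 : 'I_k2 -> nat -> O2 -> T).
Hypotheses (w1 : wls mu0 nu drift Q1 X1) (w2 : wls mu0 nu drift Q2 X2).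

Definition joinX (i : 'I_(k1 + k2)) (s : nat) (w : O1 * O2) : T :=
  match fintype.split i with inl j => X1 j s w.1 | inr j => X2 j s w.2 end.

Lemma joinXl j s w : joinX (lshift k2 j) s w = X1 j s w.1.
Proof.
rewrite /joinX; case: split_ordP => [i /lshift_inj ->//|i /eqP].
by rewrite eq_lrshift.
Qed.

Lemma joinXr j s w : joinX (rshift k1 j) s w = X2 j s w.2.
Proof.
rewrite /joinX; case: split_ordP => [i /eqP|i /rshift_inj ->//].
by rewrite eq_rlshift.
Qed.

Let mJ i s : measurable_fun setT (joinX i s : O1 * O2 -> borel T).
Proof.
rewrite /joinX; case: (fintype.split i) => j.
  exact: measurableT_comp (wls_measurable w1 j s) measurable_fst.
exact: measurableT_comp (wls_measurable w2 j s) measurable_snd.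
Qed.

Let fixl (x : O1) (z : 'I_k2 -> nat -> T) (i : 'I_(k1 + k2)) (s : nat) : T :=
  match fintype.split i with inl j => X1 j s x | inr j => z j s end.

Let fixr (y : O2) (z : 'I_k1 -> nat -> T) (i : 'I_(k1 + k2)) (s : nat) : T :=
  match fintype.split i with inl j => z j s | inr j => X2 j s y end.

(** By Fubini one family is frozen while the step of the other is integrated; [f2], where only the
    second family has been smoothed, is the intermediate stage. *)
Lemma wls_prod : wls mu0 nu drift (pprod Q1 Q2) joinX.
Proof.
split; first exact: mJ.
  move=> psi upsi.
  have b1 : brv (fun x => \prod_j psi (lshift k2 j) (X1 j 0%N x)).
    apply: brv_prod => j; apply: (brv_comp (urv_brv (upsi _))).
    exact: wls_measurable w1 j 0%N.
  have b2 : brv (fun y => \prod_j psi (rshift k1 j) (X2 j 0%N y)).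
    apply: brv_prod => j; apply: (brv_comp (urv_brv (upsi _))).
    exact: wls_measurable w2 j 0%N.
  have e w : \prod_i psi i (joinX i 0%N w) =
      (\prod_j psi (lshift k2 j) (X1 j 0%N w.1)) *
      (\prod_j psi (rshift k1 j) (X2 j 0%N w.2)).
    rewrite big_split_ord; congr (_ * _); apply: eq_bigr => j _.
      by rewrite joinXl.
    by rewrite joinXr.
  under eq_fun do rewrite e.
  rewrite Ex_pprod; last first.
    apply: brvM; first exact: (brv_comp b1 measurable_fst).
    exact: (brv_comp b2 measurable_snd).
  rewrite [LHS](Ex_mul2 Q1 Q2 b1 b2) (wls_init w1 (fun j => upsi (lshift k2 j)))
    (wls_init w2 (fun j => upsi (rshift k1 j))).
  by rewrite big_split_ord.
move=> s g psi ug upsi.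
have mg := proj1 ug.
have bpsi1 i : brv (fun w => psi i (joinX i s.+1 w)).
  exact: (brv_comp (urv_brv (upsi i)) (mJ i s.+1)).
have mdJ i : measurable_fun setT ((fun w => drift s (joinX i ^~ w)) : O1 * O2 -> borel T).
  by apply: mdrift => r _; exact: mJ.
have bsm i : brv (fun w => smooth nu (psi i) (drift s (joinX i ^~ w))).
  exact: (brv_comp (urv_brv (urv_smooth nu (upsi i))) (mdJ i)).
have bg : brv (fun w => g (fun i r => joinX i r w)).
  by apply: (bmf_brv _ (umf_bmf ug)) => i r _; exact: mJ.
have um1 j : urv (fun w : O1 * O2 => psi (lshift k2 j) (X1 j s.+1 w.1)).
  have [mp p1] := upsi (lshift k2 j); split=> //.
  exact: measurableT_comp mp (measurableT_comp (wls_measurable w1 j s.+1) measurable_fst).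
pose f1 w := g (fun i r => joinX i r w) *
  ((\prod_j psi (lshift k2 j) (X1 j s.+1 w.1)) *
   (\prod_j psi (rshift k1 j) (X2 j s.+1 w.2))).
pose f2 w := g (fun i r => joinX i r w) *
  ((\prod_j psi (lshift k2 j) (X1 j s.+1 w.1)) *
   (\prod_j smooth nu (psi (rshift k1 j)) (drift s (X2 j ^~ w.2)))).
pose f3 w := g (fun i r => joinX i r w) *
  ((\prod_j smooth nu (psi (lshift k2 j)) (drift s (X1 j ^~ w.1))) *
   (\prod_j smooth nu (psi (rshift k1 j)) (drift s (X2 j ^~ w.2)))).
have b1 : brv (fun w : O1 * O2 => \prod_j psi (lshift k2 j) (X1 j s.+1 w.1)).
  apply: brv_prod => j; have := bpsi1 (lshift k2 j).
  by under eq_fun do rewrite joinXl.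
have b2 : brv (fun w : O1 * O2 => \prod_j psi (rshift k1 j) (X2 j s.+1 w.2)).
  apply: brv_prod => j; have := bpsi1 (rshift k1 j).
  by under eq_fun do rewrite joinXr.
have ejl j (w : O1 * O2) : joinX (lshift k2 j) ^~ w = X1 j ^~ w.1.
  by apply/funext => r; rewrite joinXl.
have ejr j (w : O1 * O2) : joinX (rshift k1 j) ^~ w = X2 j ^~ w.2.
  by apply/funext => r; rewrite joinXr.
have b3 : brv (fun w : O1 * O2 =>
    \prod_j smooth nu (psi (lshift k2 j)) (drift s (X1 j ^~ w.1))).
  apply: brv_prod => j; have := bsm (lshift k2 j).
  by under eq_fun do rewrite ejl.
have b4 : brv (fun w : O1 * O2 =>
    \prod_j smooth nu (psi (rshift k1 j)) (drift s (X2 j ^~ w.2))).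
  apply: brv_prod => j; have := bsm (rshift k1 j).
  by under eq_fun do rewrite ejr.
have e1 : (fun w => g (fun i r => joinX i r w) * \prod_i psi i (joinX i s.+1 w)) = f1.
  apply/funext => w; rewrite /f1 big_split_ord; congr (_ * (_ * _));
    apply: eq_bigr => j _; by rewrite ?joinXl ?joinXr.
have e3 : (fun w => g (fun i r => joinX i r w) *
    \prod_i smooth nu (psi i) (drift s (joinX i ^~ w))) = f3.
  apply/funext => w; rewrite /f3 big_split_ord; congr (_ * (_ * _));
    apply: eq_bigr => j _; by rewrite ?ejl ?ejr.
rewrite e1 e3; transitivity (Ex (pprod Q1 Q2) f2).
  rewrite Ex_pprod; last by apply: brvM => //; exact: brvM.
  rewrite [RHS]Ex_pprod; last by apply: brvM => //; exact: brvM.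
  congr (Ex Q1 _); apply/funext => x; rewrite /f1 /f2/=.
  set c := \prod_j psi (lshift k2 j) _.
  have c01 : 0 <= c <= 1.
    apply/andP; split.
      by apply: prodr_ge0 => j _; case: (upsi (lshift k2 j)) => _ /(_ (X1 j s.+1 x))/andP[].
    apply: Num.Theory.prodr_ile1 => j _.
    by case: (upsi (lshift k2 j)) => _ /(_ (X1 j s.+1 x)).
  (* With the first space frozen at [x], its factors form a constant in [[0, 1]], and [g] becomes a
     test function of the second family alone. *)
  pose g' z := g (fixl x z) * c.
  have ug' : umf s g'.
    split.
      move=> dO' O' X' mX'; apply: measurable_funM; last exact: measurable_cst.
      apply: (mg _ _ (fun i r w => fixl x (fun i r => X' i r w) i r)) => i r rs.
      rewrite /fixl; case: (fintype.split i) => j; first exact: measurable_cst.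
      exact: mX'.
    move=> z; have /andP[? ?] := proj2 ug (fixl x z); case/andP : c01 => ? ?.
    by rewrite /g' mulr_ge0// mulr_ile1.
  have := wls_step w2 ug' (fun j => upsi (rshift k1 j)).
  rewrite /g'; under eq_fun do rewrite -mulrA; under [in RHS]eq_fun do rewrite -mulrA.
  by [].
rewrite Ex_pprodr; last by apply: brvM => //; exact: brvM.
rewrite [RHS]Ex_pprodr; last by apply: brvM => //; exact: brvM.
congr (Ex Q2 _); apply/funext => y; rewrite /f2 /f3/=.
set c := \prod_j smooth nu (psi (rshift k1 j)) _.
have c01 : 0 <= c <= 1.
  have us j := urv_smooth nu (upsi (rshift k1 j)).
  apply/andP; split.
    by apply: prodr_ge0 => j _; case: (us j) => _ /(_ (drift s (X2 j ^~ y)))/andP[].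
  apply: Num.Theory.prodr_ile1 => j _.
  by case: (us j) => _ /(_ (drift s (X2 j ^~ y))).
pose g' z := g (fixr y z) * c.
have ug' : umf s g'.
  split.
    move=> dO' O' X' mX'; apply: measurable_funM; last exact: measurable_cst.
    apply: (mg _ _ (fun i r w => fixr y (fun i r => X' i r w) i r)) => i r rs.
    rewrite /fixr; case: (fintype.split i) => j; last exact: measurable_cst.
    exact: mX'.
  move=> z; have /andP[? ?] := proj2 ug (fixr y z); case/andP : c01 => ? ?.
  by rewrite /g' mulr_ge0// mulr_ile1.
have := wls_step w1 ug' (fun j => upsi (lshift k2 j)).
rewrite /g'; under eq_fun do rewrite -mulrA [c * _]mulrC.
by under [in RHS]eq_fun do rewrite -mulrA [c * _]mulrC.
Qed.

End products_of_weak_limits.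

(** * The mean field *)

(** Tonelli is applied to the positive and negative parts separately, which also covers the points
    [x] at which the integrand is not integrable. *)
Lemma measurable_Rintegral_prod {R : realType} {d1 d2} {O1 : measurableType d1}
    {O2 : measurableType d2} (P2 : probability O2 R) (f : O1 * O2 -> R) :
  measurable_fun setT f ->
  measurable_fun setT (fun x => \int[P2]_y f (x, y)).
Proof.
move=> mf; have mF : measurable_fun setT (EFin \o f) by exact/measurable_EFinP.
apply: measurableT_comp; first exact: fine_measurable.
have h1 := measurable_fun_fubini_tonelli_F (m2 := P2) _ (measurable_funepos mF)
  (funepos_ge0 _).
have h2 := measurable_fun_fubini_tonelli_F (m2 := P2) _ (measurable_funeneg mF)
  (funeneg_ge0 _).
rewrite (_ : (fun x => _) = (fubini_F P2 (EFin \o f)^\+ \- fubini_F P2 (EFin \o f)^\-)%E).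
  exact: (emeasurable_funB h1 h2).
apply/funext => x; rewrite [LHS]integralE.
have e : (fun y => (f (x, y))%:E) = (EFin \o f) \o (fun y => (x, y)) by [].
rewrite e funepos_comp funeneg_comp; exact: erefl.
Qed.

(** The radii [boxrad n] give a countable base of [arr_near], so sequences suffice; this makes
    dominated convergence available. *)
Lemma arr_cont_seq {R : realType} {d : nat} {I : finType} s
    (f : (I -> nat -> 'rV[R]_d) -> R) z :
  (forall y : nat -> I -> nat -> 'rV[R]_d,
    (forall n i r, (r <= s)%N -> `|y n i r - z i r| < boxrad n) ->
    f (y n) @[n --> \oo] --> f z) ->
  arr_cont s f z.
Proof.
move=> h; apply/cvgrPdist_lt => e e0; apply: contrapT => nc.
have {}nc n : exists y : I -> nat -> 'rV[R]_d,
    (forall i r, (r <= s)%N -> `|y i r - z i r| < boxrad n) /\ e <= `|f z - f y|.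
  apply: contrapT => ny; apply: nc; exists (boxrad n); first exact: boxrad_gt0.
  by move=> y hy; rewrite ltNge; apply/negP => hf; apply: ny; exists y.
have [y hy] := choice nc.
have /cvgrPdist_lt/(_ _ e0)[n _ /(_ n (leqnn n))/=] := h y (fun n => proj1 (hy n)).
by rewrite ltNge (proj2 (hy n)).
Qed.

Lemma Ex_gt0 {dT} {T : measurableType dT} {R : realType} (P : probability T R)
    (f : T -> R) (A : set T) : brv f -> (forall x, 0 <= f x) ->
  measurable A -> (forall x, A x -> 0 < f x) -> P A <> 0%E -> 0 < Ex P f.
Proof.
move=> bf f0 mA fA PA; rewrite lt_neqAle Ex_ge0// andbT; apply/eqP => /esym Ef0.
apply: PA; apply: measure_negligible => //.
have [+ _] := ae_eq_integral_abs P measurableT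
  ((measurable_EFinP setT f).2 (proj1 bf)).
have -> : (\int[P]_x `|(EFin \o f) x| = 0)%E.
  transitivity (\int[P]_x (f x)%:E)%E.
    by apply: eq_integral => x _ /=; rewrite ger0_norm.
  by rewrite EFin_Ex// Ef0.
move=> /(_ erefl); apply: negligibleS => x /fA fx /= /(_ Logic.I)[fx0].
by rewrite fx0 ltxx in fx.
Qed.

Section mean_field_functions.
Context {R : realType} {d : nat}.
Local Notation T := 'rV[R]_d.
Local Notation leb := (lebesgue_rV R d).
Variables (B : bool -> T -> T -> R) (B0 : T -> T -> R).
Hypotheses (hB : forall a, edge_kernel (B a)) (hB0 : edge_kernel B0).
Local Notation Bpath := (Bpath B B0).
Local Notation econt := (econt B B0).
Local Notation eker := (eker B B0).

Lemma measurable_Bpath s {dO} {O : measurableType dO} (X Y : nat -> O -> T) :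
  (forall r, (r <= s)%N -> measurable_fun setT (X r : O -> borel T)) ->
  (forall r, (r <= s)%N -> measurable_fun setT (Y r : O -> borel T)) ->
  measurable_fun setT (fun w => Bpath s (X ^~ w) (Y ^~ w)).
Proof.
move=> mX mY.
have [mB _] := @umf_Bpath _ _ B B0 hB hB0 bool s s true false (leqnn s).
apply: (mB _ _ (fun (b : bool) r => if b then X r else Y r)) => -[] r rs.
  exact: mX.
exact: mY.
Qed.

Lemma eq_Bpath s (x y x' y' : nat -> T) :
  (forall r, (r <= s)%N -> x r = x' r) -> (forall r, (r <= s)%N -> y r = y' r) ->
  Bpath s x y = Bpath s x' y'.
Proof.
elim: s => [|s ih] hx hy /=; first by rewrite hx// hy.
rewrite ih ?hx ?hy// => r rs; [apply: hx|apply: hy]; exact: leqW.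
Qed.

Context {dO : measure_display} {O : measurableType dO} (Q : probability O R).
Variable Z0 : nat -> O -> T.
Hypothesis mZ0 : forall s, measurable_fun setT (Z0 s : O -> borel T).

(** The mean field at [x] before normalisation, as an integral over the space that carries [Z0]: the
    numerator when [u] is a coordinate, the denominator when [u = 1]. *)
Definition mfU s (u : T -> R) (x : nat -> T) : R :=
  \int[Q]_w (u (Z0 s w) * Bpath s x (Z0 ^~ w)).

Lemma measurable_mfU s (u : borel T -> R) {d'} {O' : measurableType d'}
    (X : nat -> O' -> T) : measurable_fun setT u ->
  (forall r, (r <= s)%N -> measurable_fun setT (X r : O' -> borel T)) ->
  measurable_fun setT (fun o => mfU s u (X ^~ o)).
Proof.
move=> mu mX.
have := @measurable_Rintegral_prod R _ _ O' O Q
  (fun p => u (Z0 s p.2) * Bpath s (X ^~ p.1) (Z0 ^~ p.2)); apply.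
apply: measurable_funM.
  exact: (measurableT_comp mu (measurableT_comp (mZ0 s) measurable_snd)).
apply: (@measurable_Bpath s _ _ (fun r p => X r p.1) (fun r p => Z0 r p.2)) => r rs.
  exact: (measurableT_comp (mX r rs) measurable_fst).
exact: (measurableT_comp (mZ0 r) measurable_snd).
Qed.

Let mupto s : measurable_fun setT
  ((fun w => upto s (Z0 ^~ w)) : O -> borel 'rV[T]_s.+1).
Proof.
pose F (z : 'I_1 -> nat -> T) : 'rV[T]_s.+1 := upto s (z ord0).
apply: (@measurable_arr_fun R _ _ d s 'I_1 'rV[T]_s.+1 F (fun _ => Z0)) => [z|i r _].
  move=> A [P Pz PA].
  have h : arr_near s z [set y : 'I_1 -> nat -> T |
      forall r : 'I_s.+1, P ord0 r (y ord0 r)].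
    apply: (@filter_forall _ 'I_s.+1 (fun r => [set y : 'I_1 -> nat -> T |
      P ord0 r (y ord0 r)]) (arr_near s z) _) => r.
    have rs : (r <= s)%N by rewrite -ltnS.
    apply: (@arr_near_coord R d 'I_1 s z ord0 r rs).
    by have := Pz ord0 r; rewrite mxE.
  rewrite /= /nbhs/=; apply: filterS h => y Py.
  by apply: PA => a r; rewrite (ord1 a) mxE.
exact: mZ0.
Qed.

Lemma measurable_entry s (r : 'I_s.+1) : measurable_fun setT
  ((fun z : 'rV[T]_s.+1 => z ord0 r) : borel 'rV[T]_s.+1 -> borel T).
Proof.
apply: (@continuous_borel 'rV[T]_s.+1 T (fun z : 'rV[T]_s.+1 => z ord0 r)) => z A hA.
exists (fun i j => if j == r then A else setT).
  move=> i j; case: eqP => [->|_]; last exact: filterT.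
  by rewrite (ord1 i).
by move=> y /(_ ord0 r); rewrite eqxx.
Qed.

Let path_of_upto s (z : nat -> T) r : (r <= s)%N -> path_of (upto s z) r = z r.
Proof. by move=> rs; rewrite /path_of mxE inordK. Qed.

Let integral_path_law s (f : borel 'rV[T]_s.+1 -> R) :
  measurable_fun setT f ->
  (\int[@path_law _ _ _ Q d Z0 s]_z (f z)%:E = \int[Q]_w (f (upto s (Z0 ^~ w)))%:E)%E.
Proof.
move=> mf; have mF : measurable_fun setT (EFin \o f) by exact/measurable_EFinP.
have e1 : (fun w => (f (upto s (Z0 ^~ w)))%:E) =
    (EFin \o f) \o (fun w => upto s (Z0 ^~ w)) by [].
rewrite [LHS]integralE [RHS]integralE e1
  (funepos_comp (EFin \o f) (fun w => upto s (Z0 ^~ w)))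
  (funeneg_comp (EFin \o f) (fun w => upto s (Z0 ^~ w))).
rewrite /path_law; congr (_ - _)%E.
  have h := ge0_integral_pushforward (@mupto s) Q measurableT
    (measurable_funepos mF) (fun y _ => funepos_ge0 _ y).
  by rewrite [LHS]h preimage_setT.
have h := ge0_integral_pushforward (@mupto s) Q measurableT
  (measurable_funeneg mF) (fun y _ => funeneg_ge0 _ y).
by rewrite [LHS]h preimage_setT.
Qed.

(** The integral moves from path space to the space of [Z0]; truncating the trajectory is harmless
    since [B_s] reads only the times up to [s]. *)
Lemma mean_fieldE s (x : nat -> T) :
  mean_field B B0 (@path_law _ _ _ Q d Z0 s) x =
  (mfU s (fun=> 1) x)^-1 *: \row_c mfU s (fun y => y ord0 c) x.
Proof.
have mB : measurable_fun setT
    ((fun z => Bpath s x (path_of z)) : borel 'rV[T]_s.+1 -> R).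
  apply: (@measurable_Bpath s _ (borel 'rV[T]_s.+1) (fun r _ => x r)
    (fun r z => path_of z r)) => r rs; first exact: measurable_cst.
  exact: measurable_entry.
have eB w : Bpath s x (path_of (upto s (Z0 ^~ w))) = Bpath s x (Z0 ^~ w).
  by apply: eq_Bpath => // r rs; exact: path_of_upto.
rewrite /mean_field; congr (_^-1 *: _).
  rewrite integral_path_law//; congr fine; apply: eq_integral => w _.
  by rewrite eB mul1r.
apply/rowP => c; rewrite !mxE integral_path_law; last first.
  apply: measurable_funM => //; apply: measurable_coord; exact: measurable_entry.
by congr fine; apply: eq_integral => w _; rewrite eB path_of_upto.
Qed.

(** Dominated convergence: [B_s] is continuous along pairs of trajectories that meet the kernels at
    continuity points, and [B_s <= 1] makes [|u (Z0 s)|] a dominating function. *)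
Lemma arr_cont_mfU {I : finType} s (u : borel T -> R) (z : I -> nat -> T) i :
  measurable_fun setT u -> Q.-integrable setT (EFin \o (fun w => u (Z0 s w))) ->
  {ae Q, forall w, forall r, (r <= s)%N -> econt (z i r) (Z0 r w)} ->
  arr_cont s (fun y => mfU s u (y i)) z.
Proof.
move=> mu iu hz; apply: arr_cont_seq => y hy.
have muZ : measurable_fun setT (fun w => u (Z0 s w)).
  exact: (measurableT_comp mu (mZ0 s)).
have mf (x : nat -> T) : measurable_fun setT
    (fun w => (u (Z0 s w) * Bpath s x (Z0 ^~ w))%:E).
  apply/measurable_EFinP/measurable_funM => //.
  apply: (@measurable_Bpath s _ _ (fun r _ => x r)) => r _.
    exact: measurable_cst.
  exact: mZ0.
have yz r : (r <= s)%N -> y n i r @[n --> \oo] --> z i r.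
  move=> rs; apply/cvgrPdist_lt => e e0; have [n ne] := boxrad_small e0.
  exists n => // m /= nm; rewrite distrC (lt_trans (hy m i r rs))//.
  apply: le_lt_trans ne; rewrite lef_pV2 ?posrE ?ltr0n// ler_nat ltnS//.
have hB' : {ae Q, forall w, setT w -> (u (Z0 s w) * Bpath s (y n i) (Z0 ^~ w))%:E
    @[n --> \oo] --> (u (Z0 s w) * Bpath s (z i) (Z0 ^~ w))%:E}.
  apply: filterS hz => w hw _; apply: cvg_EFin; first exact: nearW.
  apply: cvgMr => /=; elim: s hy yz hw {iu muZ mf} => [|s ih] hy yz hw /=.
    have cp : (y n i 0%N, Z0 0%N w) @[n --> \oo] --> (z i 0%N, Z0 0%N w).
      have cc : (fun _ : nat => Z0 0%N w) @ \oo --> Z0 0%N w by exact: cvg_cst.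
      exact: (cvg_pair (yz 0%N (leqnn _)) cc).
    exact: (cvg_comp _ _ cp (hw 0%N isT 0%N true)).
  have cp : (y n i s.+1, Z0 s.+1 w) @[n --> \oo] --> (z i s.+1, Z0 s.+1 w).
    have cc : (fun _ : nat => Z0 s.+1 w) @ \oo --> Z0 s.+1 w by exact: cvg_cst.
    exact: (cvg_pair (yz s.+1 (leqnn _)) cc).
  have {}ih : Bpath s (y n i) (Z0 ^~ w) @[n --> \oo] --> Bpath s (z i) (Z0 ^~ w).
    apply: ih => [n j r rs|r rs|r rs]; [apply: hy|apply: yz|apply: hw]; exact: leqW.
  apply: cvgD; apply: cvgM => //.
  - exact: (cvg_comp _ _ cp (hw s.+1 (leqnn _) 1%N true)).
  - by apply: cvgB => //; exact: cvg_cst.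
  - exact: (cvg_comp _ _ cp (hw s.+1 (leqnn _) 1%N false)).
have iu' : Q.-integrable setT (fun w => `|(u (Z0 s w))%:E|%E).
  exact: (integrable_abse iu).
have bd : {ae Q, forall w, forall n, setT w ->
    (`|(u (Z0 s w) * Bpath s (y n i) (Z0 ^~ w))%:E| <= `|(u (Z0 s w))%:E|)%E}.
  apply: aeW => w n _; rewrite !abse_EFin lee_fin normrM ler_piMr//.
  by have /andP[h0 h1] := @Bpath01 _ _ B B0 hB hB0 s (y n i) (Z0 ^~ w); rewrite ger0_norm.
have [intf _ cv] := dominated_convergence measurableT (fun n => mf (y n i)) (mf (z i)) hB' iu' bd.
apply: fine_cvg; rewrite fineK; first exact: cv.
exact: integrable_fin_num.
Qed.

(* What the positivity of the denominators of the limit requires of the kernels. *)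
Definition near_pos : Prop := forall s (x : nat -> T),
  arr_near s (fun _ : 'I_1 => x) [set z | 0 < Bpath s x (z ord0)].

(** Almost surely the trajectory lies in no rational box of probability zero, as there are countably
    many of these. By [near_pos] it lies in a box on which the integrand is positive, and this box
    then has positive probability. *)
Lemma mfU1_gt0 s : near_pos ->
  {ae Q, forall w, 0 < mfU s (fun=> 1) (Z0 ^~ w)}.
Proof.
move=> np.
pose S (q : @box_index d 'I_1 s) := [set w | @box R d 'I_1 s q (fun _ r => Z0 r w)].
have mS q : measurable (S q).
  by apply: (@measurable_open R d 'I_1 s _ _ (fun _ => Z0)) => [i r _|z];
    [exact: mZ0|exact: box_open].
(* The union of these sets is the event that the trajectory visits some box of probability zero. *)
pose F n : set O := if (unpickle n : option (@box_index d 'I_1 s)) is Some q then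
  if `[< Q (S q) = 0%E >] then S q else set0 else set0.
apply: (@negligibleS _ _ _ Q (\bigcup_n F n)); last first.
  apply: negligible_bigcup => n; rewrite /F; case: unpickle => [q|]; last exact: negligible_set0.
  by case: asboolP => [h|_]; [exact/negligibleP|exact: negligible_set0].
move=> w /= /negP; rewrite -leNgt => D0.
have [q [wq qB]] := box_dense (np s (Z0 ^~ w)).
exists (pickle q) => //; rewrite /F pickleK ifT//; apply/asboolP; apply: contrapT => Sq.
have : 0 < mfU s (fun=> 1) (Z0 ^~ w).
  apply: (@Ex_gt0 _ _ _ Q _ (S q)) => //.
  - apply: brvZ; split.
      by apply: (@measurable_Bpath s _ _ (fun r _ => Z0 r w)) => r _;
        [exact: measurable_cst|exact: mZ0].
    exists 1 => v; have /andP[h0 h1] := @Bpath01 _ _ B B0 hB hB0 s (Z0 ^~ w) (Z0 ^~ v).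
    by rewrite ger0_norm.
  - by move=> v; rewrite mul1r; case/andP : (@Bpath01 _ _ B B0 hB hB0 s (Z0 ^~ w) (Z0 ^~ v)).
  - by move=> v hv; rewrite mul1r; exact: (qB (fun _ r => Z0 r v) hv).
by rewrite ltNge D0.
Qed.

(** [B_s] is a convex combination of kernel values, so positive kernels at each time suffice. Under
    the tail bound they are positive everywhere; under bounded confidence they are positive on the
    diagonal and, by continuity there, close to it. *)
Lemma near_pos_kernels : tail_lower_bound B B0 \/ bounded_confidence B B0 ->
  near_pos.
Proof.
move=> h s x.
have conv (p a b : R) : 0 <= p <= 1 -> 0 < a -> 0 < b -> 0 < p * a + (1 - p) * b.
  move=> /andP[p0 p1] a0 b0; have [->|pn] := eqVneq p 0.
    by rewrite mul0r subr0 mul1r add0r.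
  rewrite ltr_pwDl//; first by rewrite mulr_gt0// lt_neqAle eq_sym pn.
  by rewrite mulr_ge0 ?subr_ge0// ltW.
have pos (z : nat -> T) : (forall r a, (r <= s)%N -> 0 < eker r a (x r) (z r)) ->
    0 < Bpath s x z.
  elim: s => [|s ih] hz; first exact: (hz 0%N true).
  rewrite BpathS; apply: conv; first exact: Bpath01.
    exact: hz.
  exact: hz.
suff : arr_near s (fun _ : 'I_1 => x) [set z | forall ra : 'I_s.+1 * bool,
    0 < eker ra.1 ra.2 (x ra.1) (z ord0 ra.1)].
  apply: filterS => z hz; apply: pos => r a rs.
  exact: (hz (Ordinal (rs : (r < s.+1)%N), a)).
apply: (@filter_forall _ ('I_s.+1 * bool)%type (fun ra => [set z : 'I_1 -> nat -> T |
  0 < eker ra.1 ra.2 (x ra.1) (z ord0 ra.1)]) (arr_near s (fun _ => x)) _) => -[r a] /=.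
have rs : (r <= s)%N by rewrite -ltnS.
case: h => [[C [Cb [C0 Cb0 h0 h1]]]|[_ h]].
  have ek (y y' : T) : 0 < eker r a y y'.
    have : C <= eker r a y y' * expR (Cb * enorm (y - y')) by rewrite /eker; case: (nat_of_ord r).
    by move=> /(lt_le_trans C0); rewrite pmulr_lgt0// expR_gt0.
  by apply: filterE => z /=.
have [+ c0 c1] := h a (x r); rewrite lt_min => /andP[p0 p1].
have e : eker r a = B0 \/ eker r a = B a.
  by rewrite /eker; case: (nat_of_ord r); [left|right].
have pe : 0 < eker r a (x r) (x r) by case: e => ->.
have ce : {for (x r, x r), continuous (fun q : T * T => eker r a q.1 q.2)}.
  by case: e => ->.
have cp : (x r, (y : 'I_1 -> nat -> T) ord0 r) @[y --> arr_near s (fun _ => x)] --> (x r, x r).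
  have cc : (fun _ : 'I_1 -> nat -> T => x r) @ arr_near s (fun _ => x) --> x r.
    exact: cvg_cst.
  exact: (cvg_pair cc (@arr_near_coord R d 'I_1 s (fun _ => x) ord0 r rs)).
have c := cvg_comp _ _ cp ce.
exact: (@cvgr_gt _ _ (arr_near s (fun _ => x)) _ _ _ c _ pe).
Qed.

Lemma ae_econt_ac {d'} {O' : measurableType d'} (P' : probability O' R)
    (X : nat -> O' -> T) s :
  (forall r, ac_rv P' (X r)) -> (forall r, ac_rv Q (Z0 r)) ->
  {ae P', forall w', {ae Q, forall w, forall r, (r <= s)%N -> econt (X r w') (Z0 r w)}}.
Proof.
move=> acX acZ; have [N [mN N0 hN]] := econt_null hB hB0.
have : {ae P', forall w', forall r : 'I_s.+1, {ae Q, forall w, ~ N (X r w', Z0 r w)}}.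
  by apply: filter_forall => r; exact: ac_rv_pair_ae.
apply: filterS => w' hw'.
have : {ae Q, forall w, forall r : 'I_s.+1, ~ N (X r w', Z0 r w)}.
  by apply: filter_forall => r; exact: hw'.
apply: filterS => w hw r rs.
by apply: hN; exact: (hw (Ordinal (rs : (r < s.+1)%N))).
Qed.

End mean_field_functions.

(** * Networks of agents *)

Section conditional_expectation.
Context {dO} {Om : measurableType dO} {R : realType} (P : probability Om R).

Lemma brv_integralE (f : Om -> R) (E : set Om) : brv f -> measurable E ->
  (\int[P]_(w in E) (f w)%:E)%E = (Ex P (fun w => f w * \1_E w))%:E.
Proof.
move=> bf mE; rewrite Ex_indicM// fineK//; apply: integrable_fin_num => //.
exact: integrableS (brv_integrable P bf).
Qed.

Lemma is_cond_expP (G : set (set Om)) (X Y : Om -> R) : G `<=` measurable ->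
  brv X -> brv Y ->
  is_cond_exp P G X Y <->
  (forall V : set R, measurable V -> G (Y @^-1` V)) /\
  (forall E, G E -> Ex P (fun w => X w * \1_E w) = Ex P (fun w => Y w * \1_E w)).
Proof.
move=> GS bX bY; split=> [[GY _ h]|[GY h]]; split=> //.
- move=> E GE; apply: EFin_inj; rewrite -!brv_integralE//; try exact: GS.
  by rewrite h.
- exact: brv_integrable.
- by move=> E GE; rewrite !brv_integralE ?h//; exact: GS.
Qed.

End conditional_expectation.

Section independent_noise.
Context {dO} {Om : measurableType dO} {R : realType} (P : probability Om R).
Context {d : nat}.
Local Notation T := 'rV[R]_d.
Variable nu : probability (borel T) R.

Lemma iid_bigcap {J : eqType} {k : nat} (xi : J -> Om -> T) (idx : 'I_k -> J)
    (V : 'I_k -> set (borel T)) :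
  iid P (xi : J -> Om -> borel T) nu -> injective idx ->
  (forall i, measurable (V i)) ->
  P (\bigcap_i (xi (idx i) @^-1` V i)) = (\prod_i nu (V i))%E.
Proof.
move=> [mi hl] ii mV.
pose V' (j : J) := if [pick i | idx i == j] is Some i then V i else setT.
have V'E i : V' (idx i) = V i.
  rewrite /V'; case: pickP => [l /eqP/ii ->//|/(_ i)].
  by rewrite eqxx.
have mV' j : measurable (V' j) by rewrite /V'; case: pickP => //.
have := mi [seq idx i | i <- enum 'I_k] V'.
rewrite map_inj_uniq ?enum_uniq// => /(_ isT mV').
rewrite big_map big_enum/= => h.
have -> : \bigcap_i (xi (idx i) @^-1` V i) =
    \bigcap_(j in [set` [seq idx i | i <- enum 'I_k]]) (xi j @^-1` V' j).
  apply/seteqP; split=> [w hw j /= /mapP[i _ ->]|w hw i _].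
    by rewrite V'E; exact: hw.
  by have := hw (idx i); rewrite V'E; apply; apply/map_f; rewrite mem_enum.
rewrite h; apply: eq_bigr => i _; rewrite V'E.
by have [_ ->] := hl (idx i).
Qed.

Lemma fine_prod_fin {k : nat} (f : 'I_k -> \bar R) :
  (forall i, f i \is a fin_num) -> fine (\prod_i f i)%E = \prod_i fine (f i).
Proof.
move=> ff; suff [h ->] : (\prod_i f i)%E \is a fin_num /\
   fine (\prod_i f i)%E = \prod_i fine (f i) by [].
elim/big_rec2 : _ => [//|i x y _ [fy <-]].
by rewrite fin_numM// fineM.
Qed.

(** [idx] selects the noises of the agents of a sample, [sub] parametrises the noises of one time
    step, which are jointly independent of the past, and [pre] locates the former among the
    latter. *)
Lemma indep_noise_Ex {J K : eqType} {k : nat} (gen : set (set Om))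
    (xi : J -> Om -> T) (idx : 'I_k -> J) (sub : K -> J) (pre : 'I_k -> K) :
  <<s gen>> `<=` measurable ->
  iid P (xi : J -> Om -> borel T) nu -> injective idx ->
  (forall i, idx i = sub (pre i)) ->
  independent P (sigma_gen (fun j => xi (sub j) : Om -> borel T)) <<s gen>> ->
  forall (g : g_sigma_algebraType gen -> R) (V : 'I_k -> set (borel T)),
    brv g -> (forall i, measurable (V i)) ->
    Ex P (fun w => (g : Om -> R) w * \prod_i \1_(V i) (xi (idx i) w)) =
    Ex P g * \prod_i Ex nu (\1_(V i)).
Proof.
move=> sub_gen ixi ii idxE ind g V bg mV.
have mxi j : measurable_fun setT (xi j : Om -> borel T) by have [_ /(_ j)[]] := ixi.
have bX : brv (fun w => \prod_i \1_(V i) (xi (idx i) w) : R).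
  by apply: brv_prod => i; exact: (brv_comp (brv_indic (mV i)) (mxi (idx i))).
have := @Ex_cond _ _ _ P gen (fun w => \prod_i \1_(V i) (xi (idx i) w))
  (fun=> \prod_i Ex nu (\1_(V i))) sub_gen bX (brv_cst _).
move=> /(_ _ g bg) h.
rewrite mulrC -ExZ; last exact: brv_sub.
rewrite -h; first by congr (Ex P _); apply/funext => w; rewrite mulrC.
move=> E GE; have mE := sub_gen _ GE.
rewrite ExZ; last exact: brv_indic.
rewrite Ex_indic//.
pose D := \bigcap_i (xi (idx i) @^-1` V i).
have mD : measurable D.
  apply: fin_bigcap_measurable; first exact: finite_finset.
  by move=> i _; rewrite -[X in measurable X]setTI; exact: mxi.
have GD : sigma_gen (fun j => xi (sub j) : Om -> borel T) D.
  rewrite /sigma_gen.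
  apply: (@fin_bigcap_measurable _ (g_sigma_algebraType (\bigcup_i
    preimage_set_system setT (xi (sub i) : Om -> borel T) measurable))).
    exact: finite_finset.
  move=> i _; apply: sub_sigma_algebra; exists (pre i) => //.
  by exists (V i) => //; rewrite setTI idxE.
have -> : (fun w => \prod_i \1_(V i) (xi (idx i) w) * \1_E w) = \1_(D `&` E) :> (Om -> R).
  apply/funext => w; rewrite !indicE in_setI -mulnb natrM.
  congr (_ * _); have [wD|wD] := pselect (D w).
    rewrite (mem_set wD) big1// => i _; rewrite indicE mem_set//; exact: wD.
  rewrite (memNset wD)/=; have [i hi] : exists i, ~ V i (xi (idx i) w).
    by apply: contrapT => nh; apply: wD => i _; apply: contrapT => hi; apply: nh; exists i.
  by rewrite (bigD1 i)//= indicE memNset// mul0r.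
rewrite Ex_indic; last exact: measurableI.
rewrite (ind D E GD GE) fineM ?fin_num_measure//; congr (_ * _).
rewrite iid_bigcap// fine_prod_fin => [|i]; last exact: fin_num_measure.
by apply: eq_bigr => i _; rewrite Ex_indic.
Qed.

End independent_noise.

Section network.
Context {dO} {Om : measurableType dO} {R : realType} (P : probability Om R).
Context {d n : nat}.
Local Notation T := 'rV[R]_d.
Variables (B : bool -> T -> T -> R) (B0 : T -> T -> R).
Hypotheses (hB : forall a, edge_kernel (B a)) (hB0 : edge_kernel B0).
Local Notation eker := (eker B B0).
Variables (Z : 'I_n -> nat -> Om -> T) (A : 'I_n -> 'I_n -> nat -> Om -> bool).
Hypothesis nm : network_measurable Z A.

(** The generators of [history], isolated so that measurability for a history can be expressed by
    the type of the source. *)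
Definition hgen (SZ SA : set nat) : set (set Om) :=
  (\bigcup_(s in SZ) \bigcup_i
     preimage_set_system setT (Z i s : Om -> borel T) measurable) `|`
  (\bigcup_(s in SA) \bigcup_i \bigcup_j
     preimage_set_system setT (A i j s) measurable).

Local Notation hist SZ SA := (g_sigma_algebraType (hgen SZ SA)).

Lemma hgen_sub SZ SA : <<s hgen SZ SA >> `<=` measurable.
Proof.
apply: smallest_sub; first exact: sigma_algebra_measurable.
move=> E [[s _ [i _ [V mV <-]]]|[s _ [i _ [j _ [V mV <-]]]]].
  by have [/(_ i s) h _] := nm; exact: h.
by have [_ /(_ i j s) h] := nm; exact: h.
Qed.

Lemma hist_Z (SZ SA : set nat) i s : SZ s ->
  measurable_fun setT (Z i s : hist SZ SA -> borel T).
Proof.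
move=> Ss _ V mV; apply: sub_sigma_algebra; left; exists s => //; exists i => //.
by exists V.
Qed.

Lemma hist_A (SZ SA : set nat) i j s : SA s ->
  measurable_fun setT (A i j s : hist SZ SA -> bool).
Proof.
move=> Ss _ V mV; apply: sub_sigma_algebra; right; exists s => //; exists i => //.
by exists j => //; exists V.
Qed.

Lemma brv_bool {d'} {O' : measurableType d'} (a : O' -> bool) (h : bool -> R) :
  measurable_fun setT a -> brv (fun w => h (a w)).
Proof.
move=> ma; split.
  exact: (measurableT_comp (_ : measurable_fun setT h) ma).
exists (`|h true| + `|h false|) => w.
by case: (a w); rewrite ?lerDl ?lerDr.
Qed.

Hypothesis symA : reflexive_symmetric A.
Hypothesis condA : cond_independent_edges Z A P.
Hypothesis edgeA : forall (i j : 'I_n) s, (i < j)%N ->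
  is_cond_prob P (filtrationA Z A s) (A i j s @^-1` [set true])
    (fun w => eker s (A i j s.-1 w) (Z i s w) (Z j s w)).

Definition aker s (i j : 'I_n) w := eker s (A i j s.-1 w) (Z i s w) (Z j s w).

Local Notation upto_s s := [set r | (r <= s)%N].
Local Notation before_s s := [set r | (r < s)%N].
Local Notation histA s := (hist (upto_s s) (before_s s)).

Lemma brv_aker s i j : brv (aker s i j : histA s -> R).
Proof.
split; last first.
  exists 1 => w; have /andP[h0 h1] := @eker01 _ _ B B0 hB hB0 s (A i j s.-1 w) (Z i s w) (Z j s w).
  by rewrite ger0_norm.
have mk a : measurable_fun setT
    ((fun w => eker s a (Z i s w) (Z j s w)) : histA s -> R).
  by apply: measurable_eker => //; apply: hist_Z => /=.
(* At time zero the sigma-algebra contains no edges, and [eker 0] does not look at any. *)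
case: s mk => [|s] mk; first exact: (mk true).
have -> : aker s.+1 i j = (fun w => (A i j s w)%:R * eker s.+1 true (Z i s.+1 w) (Z j s.+1 w)
    + (1 - (A i j s w)%:R) * eker s.+1 false (Z i s.+1 w) (Z j s.+1 w)).
  apply/funext => w; rewrite /aker/=; case: (A i j s w).
    by rewrite mul1r subrr mul0r addr0.
  by rewrite mul0r subr0 mul1r add0r.
have mA : measurable_fun setT ((fun w => (A i j s w)%:R) : histA s.+1 -> R).
  have ha : measurable_fun setT (A i j s : histA s.+1 -> bool).
    by apply: hist_A => /=.
  by case: (brv_bool (fun b => b%:R) ha).
apply: measurable_funD; apply: measurable_funM => //.
by apply: measurable_funB => //; exact: measurable_cst.
Qed.

Lemma aker01 s i j w : 0 <= aker s i j w <= 1.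
Proof. exact: eker01. Qed.

Lemma brv_bern {d'} {O' : measurableType d'} b (f : O' -> R) :
  brv f -> brv (fun w => bern b (f w)).
Proof. by case: b => // bf; apply: brvB => //; exact: brv_cst. Qed.

(** Conditional independence is applied with [setT], of conditional probability one, for the pairs
    outside [S]; the probability of an absent edge is obtained from the complement. *)
Lemma Ex_edges s (S : {set pairs n}) (c : pairs n -> bool) (g : histA s -> R) :
  brv g ->
  Ex P (fun w => (g : Om -> R) w *
    \prod_(p in S) (A (val p).1 (val p).2 s w == c p)%:R) =
  Ex P (fun w => (g : Om -> R) w *
    \prod_(p in S) bern (c p) (aker s (val p).1 (val p).2 w)).
Proof.
move=> bg.
have sub := @hgen_sub (upto_s s) (before_s s).
pose V (p : pairs n) : set bool := if p \in S then [set c p] else setT.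
pose q (p : pairs n) w : R :=
  if p \in S then bern (c p) (aker s (val p).1 (val p).2 w) else 1.
have mAp (p : pairs n) : measurable_fun setT (A (val p).1 (val p).2 s).
  by case: nm => _; exact.
have mAV (p : pairs n) (W : set bool) : measurable (A (val p).1 (val p).2 s @^-1` W).
  by rewrite -[X in measurable X]setTI; apply: (mAp p).
have bak (p : pairs n) : brv (aker s (val p).1 (val p).2 : histA s -> R) by exact: brv_aker.
have bq (p : pairs n) : brv (q p : histA s -> R).
  by rewrite /q; case: (p \in S); [exact: brv_bern|exact: brv_cst].
have GS : filtrationA Z A s `<=` measurable by exact: sub.
have Gpre (f : histA s -> R) (W : set R) : brv f -> measurable W ->
    filtrationA Z A s (f @^-1` W).
  move=> [mf _] mW; have := mf measurableT W mW.
  by rewrite setTI.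
have hq (p : pairs n) :
    is_cond_prob P (filtrationA Z A s) (A (val p).1 (val p).2 s @^-1` V p) (q p).
  have bi W : brv (\1_(A (val p).1 (val p).2 s @^-1` W) : Om -> R) by exact: brv_indic.
  have bqO : brv (q p : Om -> R) by exact: brv_sub (bq p).
  apply/(is_cond_expP P GS (bi _) bqO); split=> [W mW|E GE]; first exact: Gpre.
  have bao : brv (aker s (val p).1 (val p).2 : Om -> R) by exact: brv_sub (bak p).
  have /(is_cond_expP P GS (bi _) bao)[_ /(_ E GE) h] := edgeA s (valP p).
  have mE := GS E GE.
  rewrite /V /q; case: (p \in S); last first.
    by congr (Ex P _); apply/funext => w; rewrite [X in X * _]indicE mem_set// mul1r.
  case: (c p) => //=.
  have e1 : (fun w => \1_(A (val p).1 (val p).2 s @^-1` [set false]) w * \1_E w) =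
     (fun w => \1_E w - \1_(A (val p).1 (val p).2 s @^-1` [set true]) w * \1_E w) :> (Om -> R).
    have ib b w : \1_(A (val p).1 (val p).2 s @^-1` [set b]) w =
        (A (val p).1 (val p).2 s w == b)%:R :> R.
      by rewrite indicE; case: eqP => hb; [rewrite mem_set|rewrite memNset].
    apply/funext => w; rewrite !ib.
    by case: (A _ _ s w); rewrite /= ?mul0r ?mul1r ?subrr ?subr0.
  have e2 : (fun w => (1 - aker s (val p).1 (val p).2 w) * \1_E w) =
     (fun w => \1_E w - aker s (val p).1 (val p).2 w * \1_E w) :> (Om -> R).
    by apply/funext => w; rewrite mulrBl mul1r.
  rewrite e1 e2 ExB ?h ?ExB//; try exact: brv_indic.
    by apply: brvM => //; exact: brv_indic.
  by apply: brvM; [exact: bi|exact: brv_indic].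
have := condA (V := V) (q := q) (fun p => _) hq.
have bI : brv (\1_(\bigcap_p (A (val p).1 (val p).2 s @^-1` V p)) : Om -> R).
  apply: brv_indic; apply: fin_bigcap_measurable; first exact: finite_finset.
  by move=> p _; exact: mAV.
have bqp : brv ((fun w => \prod_p q p w) : histA s -> R) by exact: brv_prod.
have bqpO : brv ((fun w => \prod_p q p w) : Om -> R) by exact: brv_sub bqp.
move=> /(_ (fun=> Logic.I)) /(is_cond_expP P GS bI bqpO)[_ h].
have := Ex_cond sub bI bqpO h bg.
have e1 w : \1_(\bigcap_p (A (val p).1 (val p).2 s @^-1` V p)) w =
    \prod_(p in S) (A (val p).1 (val p).2 s w == c p)%:R :> R.
  rewrite indicE; have [hw|hw] := pselect
      ((\bigcap_p (A (val p).1 (val p).2 s @^-1` V p)) w).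
    rewrite mem_set// big1// => p pS; have := hw p Logic.I.
    by rewrite /V pS /= => ->; rewrite eqxx.
  rewrite memNset//; have [p hp] : exists p, ~ V p (A (val p).1 (val p).2 s w).
    by apply: contrapT => nh; apply: hw => p _; apply: contrapT => hp; apply: nh; exists p.
  move: hp; rewrite /V; case: ifP => pS hp; last by case: hp.
  rewrite (bigD1 p)//=.
  by case: eqP => // _; rewrite mul0r.
have e2 w : \prod_p q p w = \prod_(p in S) bern (c p) (aker s (val p).1 (val p).2 w).
  by rewrite [RHS]big_mkcond/=.
have -> : (fun w => \1_(\bigcap_p (A (val p).1 (val p).2 s @^-1` V p)) w * (g : Om -> R) w) =
  (fun w => (g : Om -> R) w * \prod_(p in S) (A (val p).1 (val p).2 s w == c p)%:R).
  by apply/funext => w; rewrite e1 mulrC.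
move=> ->; congr (Ex P _); apply/funext => w.
by rewrite e2 mulrC.
Qed.

Lemma aker_sym s i j w : aker s i j w = aker s j i w.
Proof.
by rewrite /aker eker_sym//; have [/(_ j i) -> _] := symA s.-1 w.
Qed.

Section sampled_agents.
Context {k : nat} (m : 'I_k -> 'I_n).

Definition ind r (a : nat -> pairs k -> bool) w : R :=
  \prod_(s < r) \prod_(p : pairs k)
    (A (m (val p).1) (m (val p).2) s w == a s p)%:R.

Lemma ind01 r a w : 0 <= ind r a w <= 1.
Proof.
apply/andP; split; first by apply: prodr_ge0 => s _; apply: prodr_ge0.
apply: Num.Theory.prodr_ile1 => s _; apply/andP; split; first exact: prodr_ge0.
by apply: Num.Theory.prodr_ile1 => p _; rewrite ler0n lern1 leq_b1.
Qed.

Lemma indS r a w : ind r.+1 a w = ind r a w *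
  \prod_(p : pairs k) (A (m (val p).1) (m (val p).2) r w == a r p)%:R.
Proof. by rewrite /ind big_ord_recr. Qed.

Lemma urv_ind (SZ SA : set nat) r a : (forall s, (s < r)%N -> SA s) ->
  urv (ind r a : hist SZ SA -> R).
Proof.
move=> hSA; split; last by move=> w; exact: ind01.
suff : brv (ind r a : hist SZ SA -> R) by case.
apply: brv_prod => s; apply: brv_prod => p.
apply: (brv_bool (fun b => (b == a s p)%:R)).
by apply: hist_A; apply: hSA.
Qed.

Lemma brv_Zm (SZ SA : set nat) s (f : ('I_k -> nat -> T) -> R) :
  (forall r, (r <= s)%N -> SZ r) -> bmf s f ->
  brv ((fun w => f (fun i r => Z (m i) r w)) : hist SZ SA -> R).
Proof.
move=> hSZ; apply: (@bmf_brv _ _ _ _ _ _ (hist SZ SA) (fun i => Z (m i))).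
by move=> i r rs; apply: hist_Z; exact: hSZ.
Qed.

Hypothesis inj_m : injective m.

Let sort_ex (q : pairs k) : exists p : pairs n,
  val p = (m (val q).1, m (val q).2) \/ val p = (m (val q).2, m (val q).1).
Proof.
have : m (val q).1 != m (val q).2.
  by apply/eqP => /inj_m h; have := valP q; rewrite h ltnn.
rewrite -val_eqE /= neq_ltn => /orP[h|h].
  by exists (exist _ (m (val q).1, m (val q).2) h); left.
by exists (exist _ (m (val q).2, m (val q).1) h); right.
Qed.

(** An injective sample need not be increasing, so its pairs must be sorted to become pairs of the
    network, which symmetric quantities do not notice. The same [S] and [c'] serve for the edges and
    for their conditional probabilities. *)
Let prod_sorted (F : 'I_n -> 'I_n -> bool -> R) (c : pairs k -> bool) :
  (forall i j b, F i j b = F j i b) ->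
  exists (S : {set pairs n}) (c' : pairs n -> bool), forall F : 'I_n -> 'I_n -> bool -> R,
  (forall i j b, F i j b = F j i b) ->
  \prod_(q : pairs k) F (m (val q).1) (m (val q).2) (c q) =
  \prod_(p in S) F (val p).1 (val p).2 (c' p).
Proof.
move=> _; have [mu hmu] := choice sort_ex.
have imu : injective mu.
  move=> q q' e; apply: val_inj.
  have lq := valP q; have lq' := valP q'.
  case: (val q) (val q') lq lq' (hmu q) (hmu q') => [a b] [a' b'] /= lq lq'.
  rewrite e; move: (val (mu q')) => [x y] /=.
  move=> [[-> ->]|[-> ->]] [[]|[]] /inj_m h1 /inj_m h2; rewrite ?h1 ?h2//.
    by move: lq lq'; rewrite h1 h2 => h /(ltn_trans h); rewrite ltnn.
  by move: lq lq'; rewrite h1 h2 => h /(ltn_trans h); rewrite ltnn.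
exists [set mu q | q : pairs k], (fun p => if [pick q | mu q == p] is Some q then c q else true).
move=> G symG; rewrite big_imset/=; last by move=> q q' _ _; exact: imu.
rewrite [in RHS](eq_bigl xpredT); last by move=> q; rewrite inE.
apply: eq_bigr => q _; case: pickP => [q' /eqP/imu ->|/(_ q)]; last by rewrite eqxx.
by case: (hmu q) => -> //=; exact: symG.
Qed.

Lemma Ex_edge_step s a (f : ('I_k -> nat -> T) -> R) : bmf s f ->
  Ex P (fun w => f (fun i r => Z (m i) r w) * ind s.+1 a w) =
  Ex P (fun w => (f (fun i r => Z (m i) r w) *
    stepwt B B0 s a (fun i r => Z (m i) r w)) * ind s a w).
Proof.
move=> bf.
have [S [c' hS]] := @prod_sorted (fun _ _ _ => 0) (a s) (fun _ _ _ => erefl).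
pose g w := f (fun i r => Z (m i) r w) * ind s a w.
have bg : brv (g : histA s -> R).
  apply: brvM; first by apply: (@brv_Zm (upto_s s) (before_s s) s).
  by apply/urv_brv; apply: urv_ind.
transitivity (Ex P (fun w => g w *
    \prod_(p in S) (A (val p).1 (val p).2 s w == c' p)%:R)).
  congr (Ex P _); apply/funext => w; rewrite indS mulrA; congr (_ * _).
  apply: (hS (fun i j b => (A i j s w == b)%:R)) => i j b.
  by have [-> _] := symA s w.
rewrite (Ex_edges S c' bg); congr (Ex P _); apply/funext => w.
rewrite -(hS (fun i j b => bern b (aker s i j w))); last first.
  by move=> i j b; rewrite aker_sym.
rewrite /g mulrAC -!mulrA; congr (_ * _).
(* If the earlier edges follow [a], the actual conditional probabilities are those prescribed by the
   pattern; otherwise [ind s a] vanishes and both sides are zero. *)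
have [h|h] := pselect (forall r (p : pairs k), (r < s)%N ->
    A (m (val p).1) (m (val p).2) r w = a r p).
  congr (_ * _); apply: eq_bigr => p _; rewrite /aker; congr (bern _ _).
  case: s h {bf hS g bg} => // s h.
  by rewrite /= (h s p).
suff -> : ind s a w = 0 by rewrite !mulr0.
have [r [p [rs hrp]]] : exists r (p : pairs k), (r < s)%N /\
    A (m (val p).1) (m (val p).2) r w <> a r p.
  apply: contrapT => nh; apply: h => r p rs; apply: contrapT => hrp.
  by apply: nh; exists r, p.
rewrite /ind (bigD1 (Ordinal rs))//= (bigD1 p)//=.
by case: eqP => // _; rewrite !mul0r.
Qed.

Context {J K : eqType}.
Variables (nu : probability (borel T) R) (xi : J -> Om -> T).
Variables (idx : 'I_k -> J) (sub : K -> J) (pre : 'I_k -> K) (Y : 'I_k -> Om -> T).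
Variable s : nat.
Hypothesis ixi : iid P (xi : J -> Om -> borel T) nu.
Hypotheses (inj_idx : injective idx) (idxE : forall i, idx i = sub (pre i)).
Hypothesis indep : independent P
  (sigma_gen (fun j => xi (sub j) : Om -> borel T)) (filtration Z A s).
Hypothesis mY : forall i,
  measurable_fun setT (Y i : hist (upto_s s) (upto_s s) -> borel T).

(** The history contains the edges at time [s] as well, because [Y] will be built from local means
    at that time. *)
Lemma Ex_noise_step (g : hist (upto_s s) (upto_s s) -> R) (psi : 'I_k -> borel T -> R) :
  urv g -> (forall i, urv (psi i)) ->
  Ex P (fun w => (g : Om -> R) w * \prod_i psi i (Y i w + xi (idx i) w)) =
  Ex P (fun w => (g : Om -> R) w * \prod_i smooth nu (psi i) (Y i w)).
Proof.
move=> ug upsi; have subs := @hgen_sub (upto_s s) (upto_s s).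
pose G := [set g : Om -> R | urv (g : hist (upto_s s) (upto_s s) -> R)].
apply: (@noise_integration R d 'I_k nu _ _ P Y (fun i => xi (idx i)) _ _ G) => //.
- by move=> i; exact: measurable_fun_sub (mY i).
- by move=> i; have [_ /(_ (idx i))[]] := ixi.
- move=> h [mh h1]; split; last exact: h1.
  exact: measurable_fun_sub mh.
- move=> h i phi uh [mp p1]; apply: (urvM uh); split; last by move=> w; exact: p1.
  exact: measurableT_comp mp (mY i).
- move=> h V uh mV.
  by apply: (indep_noise_Ex subs ixi inj_idx idxE indep (g := h)) => //; exact: urv_brv.
Qed.

End sampled_agents.

End network.

(** * Degrees *)

Lemma measurable_inv {R : realType} : measurable_fun setT (fun x : R => x^-1).
Proof.
rewrite -(setUv [set 0 : R]); apply/measurable_funU => //.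
  by apply: measurableC; exact: measurable_set1.
split; first exact: measurable_fun_set1.
apply: open_continuous_measurable_fun.
  by apply: closed_openC; exact: closed_eq.
move=> x; rewrite inE /= => /eqP x0; exact: inv_continuous.
Qed.

Lemma brv_inv_ge1 {R : realType} {dO} {O : measurableType dO} (f : O -> R) :
  measurable_fun setT f -> (forall w, 1 <= f w) -> brv (fun w => (f w)^-1).
Proof.
move=> mf f1; split; first exact: measurableT_comp measurable_inv mf.
exists 1 => w; have f0 : 0 < f w by apply: lt_le_trans (f1 w).
by rewrite ger0_norm ?invr_ge0 ?(ltW f0)// invf_le1//.
Qed.

(* Taylor expansion of [x^-1] at [l], with the remainder bounded for [x >= 1]. *)
Lemma inv_taylor {R : realType} (x l y : R) : 1 <= x -> 0 < l -> 0 <= y ->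
  y / x <= y / l - y / l / l * (x - l) + y / l / l * (x - l) ^+ 2.
Proof.
move=> x1 l0 y0; have x0 : 0 < x by apply: lt_le_trans x1.
have -> : y / l - y / l / l * (x - l) + y / l / l * (x - l) ^+ 2 =
    y / x + y * ((x - l) ^+ 2 / l ^+ 2 * (1 - x^-1)).
  by field; rewrite !gt_eqF.
have vx : x^-1 <= 1 by rewrite invf_le1.
by rewrite lerDl mulr_ge0// mulr_ge0 ?subr_ge0// divr_ge0 ?sqr_ge0.
Qed.

Section degrees.
Context {dO} {Om : measurableType dO} {R : realType} (P : probability Om R).
Context {d n : nat}.
Local Notation T := 'rV[R]_d.
Variables (B : bool -> T -> T -> R) (B0 : T -> T -> R).
Hypotheses (hB : forall a, edge_kernel (B a)) (hB0 : edge_kernel B0).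
Variables (Z : 'I_n -> nat -> Om -> T) (A : 'I_n -> 'I_n -> nat -> Om -> bool).
Hypothesis nm : network_measurable Z A.
Hypothesis symA : reflexive_symmetric A.
Hypothesis condA : cond_independent_edges Z A P.
Hypothesis edgeA : forall (i j : 'I_n) s, (i < j)%N ->
  is_cond_prob P (filtrationA Z A s) (A i j s @^-1` [set true])
    (fun w => eker B B0 s (A i j s.-1 w) (Z i s w) (Z j s w)).

Local Notation aker := (aker B B0 Z A).
Local Notation histA s := (g_sigma_algebraType
  (hgen Z A [set r | (r <= s)%N] [set r | (r < s)%N])).

Variables (s : nat) (i : 'I_n).

Let sub := hgen_sub nm (SZ := [set r | (r <= s)%N]) (SA := [set r | (r < s)%N]).

Let toO (h : histA s -> R) : brv h -> brv (h : Om -> R).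
Proof. exact: brv_sub. Qed.

Let a j w : R := (A i j s w)%:R.

(** Loops are always present, while [aker] describes the edges between distinct agents. *)
Definition eprob j w : R := if j == i then 1 else aker s i j w.

Let ba j : brv (a j : Om -> R).
Proof. by apply: (brv_bool (fun b => b%:R)); case: nm. Qed.

Let bp j : brv (eprob j : histA s -> R).
Proof.
rewrite /eprob; case: (j == i); first exact: brv_cst.
exact: brv_aker.
Qed.

Lemma eprob01 j w : 0 <= eprob j w <= 1.
Proof. by rewrite /eprob; case: eqP => _; [rewrite ler01 lexx|exact: aker01]. Qed.

Let sort_ex (j : 'I_n) : j != i -> exists p : pairs n,
  val p = (i, j) \/ val p = (j, i).
Proof.
rewrite eq_sym -val_eqE /= neq_ltn => /orP[h|h].
  by exists (exist _ (i, j) h); left.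
by exists (exist _ (j, i) h); right.
Qed.

Let A_sorted (p : pairs n) j w : val p = (i, j) \/ val p = (j, i) ->
  ((A (val p).1 (val p).2 s w == true)%:R : R) = a j w.
Proof.
rewrite /a; case=> ->/=; first by case: (A _ _ _ _).
by rewrite (proj1 (symA s w) j i); case: (A _ _ _ _).
Qed.

Let aker_sorted (p : pairs n) j w : val p = (i, j) \/ val p = (j, i) ->
  aker s (val p).1 (val p).2 w = aker s i j w.
Proof. by case=> ->//=; rewrite aker_sym. Qed.

Let Ex1 j (h : histA s -> R) : brv h -> j != i ->
  Ex P (fun w => (h : Om -> R) w * a j w) = Ex P (fun w => (h : Om -> R) w * eprob j w).
Proof.
move=> bh ji; have [p hp] := sort_ex ji.
have := Ex_edges hB hB0 nm condA edgeA [set p] (fun=> true) bh.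
under eq_fun do rewrite big_set1 (A_sorted _ hp).
under [in X in _ = X -> _]eq_fun do rewrite big_set1 /= (aker_sorted _ hp).
by rewrite /eprob (negbTE ji).
Qed.

Let Ex2 j l (h : histA s -> R) : brv h -> j != i -> l != i -> j != l ->
  Ex P (fun w => (h : Om -> R) w * (a j w * a l w)) =
  Ex P (fun w => (h : Om -> R) w * (eprob j w * eprob l w)).
Proof.
move=> bh ji li jl; have [p hp] := sort_ex ji; have [q hq] := sort_ex li.
have pq : p != q.
  apply: contra_neq jl => pq; move: hp hq; rewrite pq.
  move=> [->|->] [[]|[]] => // h1 h2; move: h1 h2 ji li => // -> ->; rewrite ?eqxx//.
have := Ex_edges hB hB0 nm condA edgeA [set p; q] (fun=> true) bh.
under eq_fun do rewrite big_setU1 ?inE//= big_set1 (A_sorted _ hp) (A_sorted _ hq).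
under [in X in _ = X -> _]eq_fun do
  rewrite big_setU1 ?inE//= big_set1 /= (aker_sorted _ hp) (aker_sorted _ hq).
by rewrite /eprob (negbTE ji) (negbTE li).
Qed.

(** Centred edges: given the history they are orthogonal, with second moment at most [eprob j], and
    the loop contributes zero. *)
Let M j w := a j w - eprob j w.

Let M_i w : M i w = 0.
Proof. by rewrite /M /a /eprob eqxx (proj2 (symA s w) i) subrr. Qed.

Let bM j : brv (M j : Om -> R).
Proof. by apply: brvB => //; exact/toO/bp. Qed.

Let ExM j (h : histA s -> R) : brv h -> Ex P (fun w => (h : Om -> R) w * M j w) = 0.
Proof.
move=> bh; have [->|ji] := eqVneq j i.
  by under eq_fun do rewrite M_i mulr0; exact: Ex_cst.
under eq_fun do rewrite /M mulrBr.
rewrite ExB ?Ex1 ?subrr//; first by apply: brvM => //; exact: toO.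
by apply: brvM; [exact: toO|exact/toO/bp].
Qed.

Let ExMM j l (h : histA s -> R) : brv h -> j != l ->
  Ex P (fun w => (h : Om -> R) w * (M j w * M l w)) = 0.
Proof.
move=> bh jl; have [->|ji] := eqVneq j i.
  by under eq_fun do rewrite M_i mul0r mulr0; exact: Ex_cst.
have [->|li] := eqVneq l i.
  by under eq_fun do rewrite M_i mulr0 mulr0; exact: Ex_cst.
have e w : h w * (M j w * M l w) = h w * (a j w * a l w) -
    h w * (eprob j w * eprob l w) - ((h w * eprob l w) * M j w + (h w * eprob j w) * M l w).
  by rewrite /M; ring.
under eq_fun do rewrite e.
have bhp x : brv ((fun w => h w * eprob x w) : histA s -> R) by apply: brvM.
have bO := toO bh.
have bpO x : brv (eprob x : Om -> R) by exact/toO/bp.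
rewrite ExB; [|by apply: brvB; apply: brvM => //; exact: brvM|
  by apply: brvD; apply: brvM => //; exact: brvM].
rewrite ExB; [|by apply: brvM => //; exact: brvM|by apply: brvM => //; exact: brvM].
rewrite ExD; [|by apply: brvM => //; exact: brvM|by apply: brvM => //; exact: brvM].
by rewrite Ex2// !ExM// subrr addr0 subr0.
Qed.

(** Since [a ^ 2 = a], the conditional second moment is [p - p ^ 2], where [p] is the conditional
    probability of the edge. *)
Let ExM2 j (h : histA s -> R) : brv h -> (forall w, 0 <= h w) ->
  Ex P (fun w => (h : Om -> R) w * (M j w * M j w)) <=
  Ex P (fun w => (h : Om -> R) w * eprob j w).
Proof.
move=> bh h0; have [->|ji] := eqVneq j i.
  under eq_fun do rewrite M_i mulr0 mulr0; rewrite Ex_cst; apply: Ex_ge0 => w.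
  by rewrite mulr_ge0//; case/andP : (eprob01 i w).
have bO := toO bh.
have bpO x : brv (eprob x : Om -> R) by exact/toO/bp.
have bhp x : brv ((fun w => h w * eprob x w) : histA s -> R) by apply: brvM.
have e w : h w * (M j w * M j w) = h w * a j w - 2 * ((h w * eprob j w) * a j w) +
    h w * eprob j w * eprob j w.
  by rewrite /M /a; case: (A i j s w) => /=; ring.
under eq_fun do rewrite e.
rewrite ExD; [|by apply: brvB; [exact: brvM|apply: brvZ; apply: brvM => //; exact: brvM]|
  by apply: brvM => //; exact: brvM].
rewrite ExB; [|exact: brvM|by apply: brvZ; apply: brvM => //; exact: brvM].
rewrite ExZ; last by apply: brvM => //; exact: brvM.
rewrite !Ex1//.
have : 0 <= Ex P (fun w => h w * eprob j w * eprob j w).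
  apply: Ex_ge0 => w; have /andP[p0 _] := eprob01 j w.
  by rewrite !mulr_ge0.
by set x := Ex P _; lra.
Qed.

Definition deg w : R := \sum_j (A i j s w)%:R.
Definition edeg w : R := \sum_j eprob j w.

Lemma deg_ge1 w : 1 <= deg w.
Proof.
rewrite /deg (bigD1 i)//= (proj2 (symA s w) i) lerDl.
by apply: sumr_ge0 => j _.
Qed.

Lemma edeg_ge1 w : 1 <= edeg w.
Proof.
rewrite /edeg (bigD1 i)//= {1}/eprob eqxx lerDl.
by apply: sumr_ge0 => j _; case/andP : (eprob01 j w).
Qed.

Lemma brv_inv_edeg : brv ((fun w => (edeg w)^-1) : histA s -> R).
Proof.
apply: brv_inv_ge1; last exact: edeg_ge1.
suff : brv (edeg : histA s -> R) by case.
exact: brv_sum.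
Qed.

Lemma brv_inv_deg : brv ((fun w => (deg w)^-1) : Om -> R).
Proof.
apply: brv_inv_ge1; last exact: deg_ge1.
suff : brv (deg : Om -> R) by case.
exact: brv_sum.
Qed.

(* The conditional variance of the degree is at most its conditional mean. *)
Lemma Ex_inv_deg (g : histA s -> R) : brv g -> (forall w, 0 <= g w) ->
  Ex P (fun w => (g : Om -> R) w / deg w) <=
  2 * Ex P (fun w => (g : Om -> R) w / edeg w).
Proof.
move=> bg g0.
pose h w := g w / edeg w / edeg w.
have bie := brv_inv_edeg.
have bh : brv (h : histA s -> R) by apply: brvM => //; exact: brvM.
have e0 w : 0 < edeg w by apply: lt_le_trans (edeg_ge1 w).
have h0 w : 0 <= h w by rewrite /h !divr_ge0// ltW.
have sM w : deg w - edeg w = \sum_j M j w by rewrite /M sumrB.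
pose S w := \sum_j h w * M j w.
pose V w := \sum_j \sum_l h w * (M j w * M l w).
have bO := toO bh.
have bS : brv (S : Om -> R) by apply: brv_sum => j; exact: brvM.
have bV : brv (V : Om -> R).
  by apply: brv_sum => j; apply: brv_sum => l; apply: brvM => //; exact: brvM.
have bge : brv ((fun w => g w / edeg w) : Om -> R) by apply: toO; exact: brvM.
have pt w : g w / deg w <= g w / edeg w - S w + V w.
  have d1 := deg_ge1 w.
  have -> : S w = h w * (deg w - edeg w) by rewrite sM mulr_sumr.
  have -> : V w = h w * (deg w - edeg w) ^+ 2.
    rewrite sM expr2 mulr_suml mulr_sumr; apply: eq_bigr => j _.
    by rewrite mulr_sumr mulr_sumr.
  exact: inv_taylor.
apply: (@le_trans _ _ (Ex P (fun w => g w / edeg w - S w + V w))).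
  apply: Ex_le => //; last by apply: brvD => //; exact: brvB.
  by apply: brvM; [exact: toO|exact: brv_inv_deg].
rewrite ExD//; last exact: brvB.
rewrite ExB//.
have -> : Ex P S = 0 by rewrite Ex_sum ?big1// => j *; [exact: ExM|exact: brvM].
(* The off-diagonal terms vanish by orthogonality; the diagonal ones add up to at most [h * edeg],
   which is [g / edeg]. *)
have Vle : Ex P V <= Ex P (fun w => g w / edeg w).
  have bhMM j l : brv ((fun w => h w * (M j w * M l w)) : Om -> R).
    by apply: brvM => //; exact: brvM.
  have bhp j : brv ((fun w => h w * eprob j w) : Om -> R).
    by apply: toO; exact: brvM.
  rewrite Ex_sum; last by move=> j; exact: brv_sum.
  apply: (@le_trans _ _ (\sum_j Ex P (fun w => h w * eprob j w))).
    apply: ler_sum => j _; rewrite Ex_sum// (bigD1 j)//= big1 ?addr0; last first.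
      by move=> l lj; rewrite ExMM// eq_sym.
    exact: ExM2.
  rewrite -Ex_sum// le_eqVlt; apply/orP; left; apply/eqP; congr (Ex P _).
  by apply/funext => w; rewrite -mulr_sumr /h -/(edeg w) mulfVK// gt_eqF.
by lra.
Qed.

End degrees.

(** * Samples and patterns *)

Section sample_averages.
Context {R : realType} {K n : nat}.
Local Notation sample := {ffun 'I_K -> 'I_n.+1}.

(** The average over samples with replacement: unlike the average over injective samples it
    factorises on products. *)
Definition savg (x : sample -> R) : R := n.+1%:R ^- K * \sum_m x m.

Lemma savg_prod (F : 'I_K -> 'I_n.+1 -> R) :
  savg (fun m => \prod_i F i (m i)) = \prod_i (n.+1%:R^-1 * \sum_j F i j).
Proof.
by rewrite /savg -bigA_distr_bigA /= big_split/= prodr_const card_ord exprVn.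
Qed.

Lemma savgD x y : savg (fun m => x m + y m) = savg x + savg y.
Proof. by rewrite /savg big_split mulrDr. Qed.

Lemma savgZ c x : savg (fun m => c * x m) = c * savg x.
Proof. by rewrite /savg -mulr_sumr mulrCA. Qed.

Lemma savg_sum (J : Type) (l : seq J) (x : J -> sample -> R) :
  savg (fun m => \sum_(j <- l) x j m) = \sum_(j <- l) savg (x j).
Proof. by rewrite /savg exchange_big/= mulr_sumr. Qed.

Lemma savg_le x y : (forall m, x m <= y m) -> savg x <= savg y.
Proof.
move=> xy; rewrite /savg ler_wpM2l ?invr_ge0 ?exprn_ge0//.
by apply: ler_sum => m _.
Qed.

Lemma savg_norm x : `|savg x| <= savg (fun m => `|x m|).
Proof.
rewrite /savg normrM ger0_norm ?invr_ge0 ?exprn_ge0//.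
by rewrite ler_wpM2l ?invr_ge0 ?exprn_ge0// ler_norm_sum.
Qed.

Lemma savg_marginal i (x : 'I_n.+1 -> R) :
  savg (fun m => x (m i)) = n.+1%:R^-1 * \sum_j x j.
Proof.
have e (m : sample) : x (m i) = \prod_l (if l == i then x (m l) else 1).
  by rewrite -big_mkcond big_pred1_eq.
under eq_fun do rewrite e.
rewrite (savg_prod (fun l j => if l == i then x j else 1)) (bigD1 i)//= eqxx.
rewrite [X in _ * X = _]big1 ?mulr1// => l /negbTE ->.
by rewrite sumr_const card_ord mulVf// pnatr_eq0.
Qed.

(** A union bound: two given entries of the sample coincide with probability [(n+1)^-1]. *)
Lemma savg_noninjective :
  savg (fun m => (~~ injectiveb m)%:R) <= #|{: pairs K}|%:R / n.+1%:R.
Proof.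
apply: (@le_trans _ _ (savg (fun m =>
    \sum_(p : pairs K) ((m (val p).1 == m (val p).2)%:R : R)))).
  apply: savg_le => m; case: injectivePn => [[i [j ij mij]]|_]; last first.
    exact: sumr_ge0.
  have [p pE] : exists p : pairs K, m (val p).1 = m (val p).2.
    move: ij; rewrite -val_eqE/= neq_ltn => /orP[h|h].
      by exists (exist _ (i, j) h).
    by exists (exist _ (j, i) h).
  by rewrite (bigD1 p)//= pE eqxx lerDl sumr_ge0.
rewrite savg_sum mulr_natl -sumr_const ler_sum// => p _.
have p12 : (val p).1 != (val p).2.
  by have := valP p; apply: contraL => /eqP ->; rewrite ltnn.
(* Summing over the common value [v] turns the coincidence into products over the sample, to which
   [savg_prod] applies. *)
have e (m : sample) : ((m (val p).1 == m (val p).2)%:R : R) =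
    \sum_v \prod_l (if l == (val p).1 then (m l == v)%:R else
                    if l == (val p).2 then (m l == v)%:R else 1).
  rewrite (bigD1 (m (val p).1))//= [X in _ + X]big1 ?addr0.
    rewrite (bigD1 (val p).1)//= (bigD1 (val p).2) 1?eq_sym//= !eqxx.
    rewrite (negbTE (_ : (val p).2 != _)) 1?eq_sym// mul1r.
    rewrite big1 ?mulr1 1?eq_sym// => l /andP[/negbTE -> /negbTE ->] //.
  by move=> v vm; rewrite (bigD1 (val p).1)//= eqxx eq_sym (negbTE vm) mul0r.
under eq_fun do rewrite e.
rewrite savg_sum.
under eq_bigr do rewrite (savg_prod (fun l j => if l == (val p).1 then (j == _)%:R else
                    if l == (val p).2 then (j == _)%:R else 1)).
have s1 (v : 'I_n.+1) : \sum_j ((j == v)%:R : R) = 1.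
  by rewrite (bigD1 v)//= eqxx big1 ?addr0// => j /negbTE ->.
have s2 : n.+1%:R^-1 * \sum_(j < n.+1) (1 : R) = 1.
  by rewrite sumr_const card_ord mulVf// pnatr_eq0.
rewrite (eq_bigr (fun=> n.+1%:R^-1 * n.+1%:R^-1)) => [|v _]; last first.
  rewrite (bigD1 (val p).1)//= (bigD1 (val p).2) 1?eq_sym//= !eqxx.
  rewrite (negbTE (_ : (val p).2 != _)) 1?eq_sym// !s1 !mulr1 big1 ?mulr1//.
  by move=> l /andP[/negbTE -> /negbTE ->].
by rewrite sumr_const card_ord -[X in X <= _]mulr_natl mulrA divff ?pnatr_eq0// mul1r.
Qed.

End sample_averages.

Section patterns.
Context {k : nat}.
Local Notation pattern := (nat -> pairs k -> bool).

Definition upd (a : pattern) r (e : pairs k -> bool) : pattern :=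
  fun s => if s == r then e else a s.

(* One representative of each pattern of edges at the times [0, ..., r - 1]. *)
Fixpoint pats r : seq pattern := if r is q.+1 then
    [seq upd a q (e : {ffun pairs k -> bool}) | a <- pats q,
      e <- index_enum {ffun pairs k -> bool}]
  else [:: fun _ _ => false].

Context {R : realType}.

Lemma upd_lt a r e s : (s < r)%N -> upd a r e s = a s.
Proof. by rewrite /upd; case: eqP => // ->; rewrite ltnn. Qed.

Lemma updE a r e : upd a r e r = e.
Proof. by rewrite /upd eqxx. Qed.

(** Exactly one representative agrees with [c] at the times before [r], and [G] does not see later
    times. *)
Lemma sum_pats_ind r (c : pattern) (G : pattern -> R) :
  (forall a a', (forall s, (s < r)%N -> a s =1 a' s) -> G a = G a') ->
  \sum_(a <- pats r) G a * \prod_(s < r) \prod_p (c s p == a s p)%:R = G c.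
Proof.
elim: r G => [|r ih] G hG.
  by rewrite /= big_seq1 big_ord0 mulr1; exact: hG.
rewrite /= big_allpairs_dep/=.
transitivity (\sum_(a <- pats r) G (upd a r (c r)) *
    \prod_(s < r) \prod_p ((c s p == a s p)%:R : R)).
  apply: eq_bigr => a _.
  have e1 (e : {ffun pairs k -> bool}) : G (upd a r e) *
      \prod_(s < r.+1) \prod_p (c s p == upd a r e s p)%:R =
      (G (upd a r e) * \prod_(s < r) \prod_p (c s p == a s p)%:R) *
      (e == [ffun p => c r p])%:R.
    rewrite big_ord_recr/= mulrA updE; congr (_ * _ * _).
      by apply: eq_bigr => s _; rewrite upd_lt.
    have [->|ne] := eqVneq; first by rewrite big1// => p _; rewrite ffunE eqxx.
    have [p ep] : exists p, c r p != e p.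
      apply/existsP; apply: contraR ne; rewrite negb_exists => /forallP h.
      by apply/eqP/ffunP => p; rewrite ffunE; have := h p; rewrite negbK => /eqP.
    by rewrite (bigD1 p)//= (negbTE ep) mul0r.
  under eq_bigr do rewrite e1.
  rewrite (bigD1 [ffun p => c r p])//= eqxx mulr1 [X in _ + X]big1 ?addr0.
    congr (_ * _); apply: hG => s _ p; rewrite /upd; case: ifP => // _.
    by rewrite ffunE.
  by move=> e /negbTE ->; rewrite mulr0.
rewrite (ih (fun a => G (upd a r (c r)))) => [|a a' h].
  by apply: hG => s _ p; rewrite /upd; case: eqP => [->|].
apply: hG => s; rewrite ltnS leq_eqVlt => /orP[/eqP ->|sr] p; rewrite ?updE//.
by rewrite !upd_lt// h.
Qed.

Context {d : nat}.
Local Notation T := 'rV[R]_d.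
Variables (B : bool -> T -> T -> R) (B0 : T -> T -> R).

Lemma sum_pats_step (z : 'I_k -> nat -> T) r (c e : pairs k -> R) :
  \sum_(a <- pats r.+1) \prod_p (c p + e p * (a r p)%:R) * wt B B0 r.+1 a z =
  \sum_(a <- pats r) \prod_p (c p + e p *
    eker B B0 r (a r.-1 p) (z (val p).1 r) (z (val p).2 r)) * wt B B0 r a z.
Proof.
rewrite [pats r.+1]/= big_allpairs_dep/=; apply: eq_bigr => a _.
pose ker p := eker B B0 r (a r.-1 p) (z (val p).1 r) (z (val p).2 r).
have e1 (f : {ffun pairs k -> bool}) :
    \prod_p (c p + e p * (upd a r f r p)%:R) * wt B B0 r.+1 (upd a r f) z =
    wt B B0 r a z * \prod_p ((c p + e p * (f p)%:R) * bern (f p) (ker p)).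
  rewrite wtS updE mulrCA big_split/=; congr (_ * (_ * _)).
    apply: eq_bigr => s _; apply: eq_bigr => p _; rewrite !upd_lt//.
    by rewrite (leq_ltn_trans (leq_pred _)).
  rewrite /stepwt; apply: eq_bigr => p _; rewrite updE /ker; congr bern.
  by case: r {ker} => // r; rewrite /= upd_lt.
under eq_bigr do rewrite e1.
rewrite -mulr_sumr mulrC
  -(bigA_distr_bigA (fun (p : pairs k) (b : bool) => (c p + e p * b%:R) * bern b (ker p))).
congr (_ * _); apply: eq_bigr => p _.
by rewrite (bigD1 true)//= (bigD1 false)//= big1 => [|[]]//; rewrite -/(ker p); ring.
Qed.

(** Given the positions, the edges of different pairs are independent Markov chains. Summing out the
    last edges replaces each by its kernel, which is affine in the previous edge; going back to time
    zero reproduces the recursion that defines [B_r]. *)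
Lemma sum_pats_affine (z : 'I_k -> nat -> T) r (c e : pairs k -> R) :
  \sum_(a <- pats r.+1) \prod_p (c p + e p * (a r p)%:R) * wt B B0 r.+1 a z =
  \prod_p (c p + e p * Bpath B B0 r (z (val p).1) (z (val p).2)).
Proof.
elim: r c e => [|r ih] c e; rewrite sum_pats_step.
  by rewrite /= big_seq1 /wt big_ord0 mulr1.
pose x b (p : pairs k) := eker B B0 r.+1 b (z (val p).1 r.+1) (z (val p).2 r.+1).
transitivity (\sum_(a <- pats r.+1) \prod_p ((c p + e p * x false p) +
    (e p * (x true p - x false p)) * (a r p)%:R) * wt B B0 r.+1 a z).
  apply: eq_bigr => a _; congr (_ * _); apply: eq_bigr => p _.
  by rewrite /x; case: (a r p) => /=; ring.
by rewrite ih; apply: eq_bigr => p _; rewrite BpathS /x; ring.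
Qed.

End patterns.

(** * Exponential moments *)

Section real_inequalities.
Context {R : realType}.

(** The tangent of the exponential at the mean [b] lies below the graph, and its linear part
    averages to zero. *)
Lemma expR_jensen (J : finType) (u y : J -> R) :
  (forall j, 0 <= u j) -> \sum_j u j = 1 ->
  expR (\sum_j u j * y j) <= \sum_j u j * expR (y j).
Proof.
move=> u0 u1; set b := \sum_j u j * y j.
have -> : expR b = \sum_j u j * (expR b * (1 + (y j - b))).
  under eq_bigr do rewrite mulrCA.
  rewrite -mulr_sumr; under eq_bigr do rewrite mulrDr mulrBr mulr1.
  by rewrite big_split/= sumrB -mulr_suml u1 mul1r subrr addr0 mulr1.
apply: ler_sum => j _; rewrite ler_wpM2l//.
rewrite -[in leRHS](subrK b (y j)) expRD mulrC ler_wpM2r ?expR_ge0//.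
exact: expR_ge1Dx.
Qed.

Lemma cube_jensen (J : finType) (u y : J -> R) :
  (forall j, 0 <= u j) -> \sum_j u j = 1 -> (forall j, 0 <= y j) ->
  (\sum_j u j * y j) ^+ 3 <= \sum_j u j * y j ^+ 3.
Proof.
move=> u0 u1 y0; set b := \sum_j u j * y j.
have b0 : 0 <= b by apply: sumr_ge0 => j _; rewrite mulr_ge0.
have -> : b ^+ 3 = \sum_j u j * (b ^+ 3 + 3 * b ^+ 2 * (y j - b)).
  under eq_bigr do rewrite mulrDr (mulrCA _ (3 * _)) mulrBr.
  rewrite big_split/= -mulr_sumr -mulr_suml sumrB -mulr_suml u1 !mul1r.
  by rewrite -/b subrr mulr0 addr0.
apply: ler_sum => j _; rewrite ler_wpM2l// -subr_ge0.
have -> : y j ^+ 3 - (b ^+ 3 + 3 * b ^+ 2 * (y j - b)) =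
    (y j - b) ^+ 2 * (y j + 2 * b) by ring.
by rewrite mulr_ge0 ?sqr_ge0// addr_ge0 ?mulr_ge0.
Qed.

Lemma sum_avg1 n : \sum_(j < n.+1) (n.+1%:R^-1 : R) = 1.
Proof. by rewrite sumr_const card_ord -[LHS]mulr_natl divff ?pnatr_eq0. Qed.

Lemma avg_cst n (x : R) : n.+1%:R^-1 * \sum_(i < n.+1) x = x.
Proof.
by rewrite sumr_const card_ord -[X in _ * X]mulr_natl mulrA mulVf ?mul1r// pnatr_eq0.
Qed.

(** Jensen twice, through the geometric mean: the inverse of the mean of [e^-y] is at most [e] to
    the mean of [y], which is at most the mean of [e^y]. *)
Lemma avg_inv_expR n (y : 'I_n.+1 -> R) :
  (\sum_j expR (- y j))^-1 <= n.+1%:R^-1 * (n.+1%:R^-1 * \sum_j expR (y j)).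
Proof.
have n0 : 0 < n.+1%:R^-1 :> R by rewrite invr_gt0.
pose h := \sum_j n.+1%:R^-1 * expR (- y j).
have h1 : expR (- \sum_j n.+1%:R^-1 * y j) <= h.
  rewrite -sumrN; under eq_bigr do rewrite -mulrN.
  by apply: expR_jensen => [j|]; [exact: ltW|exact: sum_avg1].
have h2 : expR (\sum_j n.+1%:R^-1 * y j) <= n.+1%:R^-1 * \sum_j expR (y j).
  by rewrite mulr_sumr; apply: expR_jensen => [j|]; [exact: ltW|exact: sum_avg1].
have -> : (\sum_j expR (- y j))^-1 = n.+1%:R^-1 * h^-1.
  by rewrite /h -mulr_sumr invfM invrK mulrA mulVf ?mul1r// pnatr_eq0.
rewrite ler_wpM2l ?(ltW n0)//; apply: le_trans h2.
by rewrite -[leRHS]invrK -expRN lef_pV2 ?posrE ?expR_gt0// (lt_le_trans _ h1)// expR_gt0.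
Qed.

Lemma min_scale (K c x : R) : 0 <= K -> 0 <= x -> 1 <= c ->
  Num.min K (c * x) <= c * Num.min K x.
Proof.
move=> K0 x0 c1; have c0 : 0 <= c by apply: le_trans c1.
by rewrite minr_pMr// le_min !ge_min lexx orbT andbT ler_peMl.
Qed.

Lemma min_add (K x y : R) : 0 <= K -> 0 <= x -> 0 <= y ->
  Num.min K (x + y) <= Num.min K x + Num.min K y.
Proof. by move=> K0 x0 y0; rewrite /Num.min; do 3 case: ltP => ?; lra. Qed.

(** A single term above [(n+1) K] already lifts the average above [K], so the terms are capped at
    that level. *)
Lemma min_avg n (K : R) (x : 'I_n.+1 -> R) : 0 <= K -> (forall j, 0 <= x j) ->
  Num.min K (n.+1%:R^-1 * \sum_j x j) <=
  n.+1%:R^-1 * \sum_j Num.min (n.+1%:R * K) (x j).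
Proof.
move=> K0 x0; have n0 : 0 < n.+1%:R :> R by [].
have [/existsP[j hj]|] := boolP [exists j, n.+1%:R * K < x j].
  rewrite ge_min; apply/orP; left; rewrite mulrC ler_pdivlMr// mulrC.
  rewrite (bigD1 j)//= min_l ?lerDl ?(ltW hj)//; apply: sumr_ge0 => l _.
  by rewrite le_min x0 mulr_ge0// ltW.
rewrite negb_exists => /forallP h; rewrite ge_min; apply/orP; right.
rewrite ler_wpM2l ?invr_ge0 ?(ltW n0)//; apply: ler_sum => j _.
by rewrite min_r// leNgt.
Qed.

Lemma avg_min n (K : R) (x : 'I_n.+1 -> R) :
  n.+1%:R^-1 * \sum_j Num.min K (x j) <= Num.min K (n.+1%:R^-1 * \sum_j x j).
Proof.
have n0 : 0 < n.+1%:R :> R by [].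
rewrite le_min; apply/andP; split; last first.
  rewrite ler_wpM2l ?invr_ge0 ?(ltW n0)//; apply: ler_sum => j _.
  by rewrite ge_min lexx orbT.
rewrite mulrC ler_pdivrMr// mulrC.
have -> : n.+1%:R * K = \sum_(j < n.+1) K by rewrite sumr_const card_ord mulr_natl.
by apply: ler_sum => j _; rewrite ge_min lexx.
Qed.

End real_inequalities.

Section l1_norm.
Context {R : realType} {d : nat}.
Local Notation T := 'rV[R]_d.

Definition l1 (x : T) : R := \sum_j `|x ord0 j|.

Lemma l1_ge0 x : 0 <= l1 x. Proof. exact: sumr_ge0. Qed.

Lemma l1D x y : l1 (x + y) <= l1 x + l1 y.
Proof. by rewrite /l1 -big_split; apply: ler_sum => j _; rewrite mxE ler_normD. Qed.

Lemma l1Z c x : l1 (c *: x) = `|c| * l1 x.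
Proof. by rewrite /l1 mulr_sumr; apply: eq_bigr => j _; rewrite mxE normrM. Qed.

Lemma l1N x : l1 (- x) = l1 x.
Proof. by rewrite -scaleN1r l1Z normrN1 mul1r. Qed.

Lemma l1_sum (J : finType) (x : J -> T) : l1 (\sum_j x j) <= \sum_j l1 (x j).
Proof.
elim/big_rec2 : _ => [|j a b _ h]; first by rewrite /l1 big1// => j _; rewrite mxE normr0.
by rewrite (le_trans (l1D _ _))// lerD2l.
Qed.

Lemma coord_le_l1 (x : T) j : `|x ord0 j| <= l1 x.
Proof. by rewrite /l1 (bigD1 j)//= lerDl sumr_ge0. Qed.

Lemma norm_le_l1 x : `|x| <= l1 x.
Proof.
rewrite [leLHS]/Num.norm/= mx_normrE; apply: bigmax_le => [|[i j] _/=].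
  exact: l1_ge0.
by rewrite ord1 coord_le_l1.
Qed.

Lemma enorm_ge0 (x : T) : 0 <= enorm x. Proof. exact: sqrtr_ge0. Qed.

Lemma enorm_le_l1 x : enorm x <= l1 x.
Proof.
rewrite -(ger0_norm (l1_ge0 x)) -sqrtr_sqr ler_wsqrtr// expr2 /l1 mulr_suml.
apply: ler_sum => j _; rewrite -real_normK ?num_real// expr2 ler_wpM2l//; exact: coord_le_l1.
Qed.

Lemma l1_le_enorm x : l1 x <= d%:R * enorm x.
Proof.
have -> : d%:R * enorm x = \sum_(j < d) enorm x.
  by rewrite sumr_const card_ord mulr_natl.
apply: ler_sum => j _; rewrite -sqrtr_sqr ler_wsqrtr//.
by rewrite (bigD1 j)//= lerDl sumr_ge0// => i _; exact: sqr_ge0.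
Qed.

Lemma measurable_l1 {dO} {O : measurableType dO} (f : O -> T) :
  measurable_fun setT (f : O -> borel T) -> measurable_fun setT (fun w => l1 (f w)).
Proof.
move=> mf; apply: measurable_sum => j.
exact: (measurableT_comp (@normr_measurable R setT) (measurable_coord j mf)).
Qed.

Lemma measurable_exp_l1 {dO} {O : measurableType dO} C (f : O -> T) :
  measurable_fun setT (f : O -> borel T) ->
  measurable_fun setT (fun w => expR (C * l1 (f w))).
Proof.
move=> mf; apply: (measurableT_comp (@measurable_expR R)).
by apply: measurable_funM; [exact: measurable_cst|exact: measurable_l1].
Qed.

Lemma brv_min {dO} {O : measurableType dO} K (f : O -> R) : measurable_fun setT f ->
  (forall w, 0 <= f w) -> brv (fun w => Num.min K (f w)).
Proof.
move=> mf f0; split; first exact: measurable_minr (measurable_cst _) mf.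
exists `|K| => w; rewrite /Num.min; case: ltP => // fK.
by rewrite ger0_norm// (le_trans fK)// ler_norm.
Qed.

Lemma Ex_min_le {dO} {O : measurableType dO} (P : probability O R) K (f : O -> R) M :
  0 <= K -> measurable_fun setT f -> (forall w, 0 <= f w) ->
  (\int[P]_w (f w)%:E <= M%:E)%E -> Ex P (fun w => Num.min K (f w)) <= M.
Proof.
move=> K0 mf f0 fM; rewrite -lee_fin -EFin_Ex; last exact: brv_min.
apply: le_trans fM; apply: ge0_le_integral => //.
- by move=> w _; rewrite lee_fin le_min K0 f0.
- by apply/measurable_EFinP; case: (brv_min K mf f0).
- by apply/measurable_EFinP.
- by move=> w _; rewrite lee_fin ge_min lexx orbT.
Qed.

End l1_norm.

Lemma measurable_local_mean_at {R : realType} {d n} {dO} {O : measurableType dO}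
    (Z : 'I_n -> nat -> O -> 'rV[R]_d) (A : 'I_n -> 'I_n -> nat -> O -> bool) i s :
  (forall j, measurable_fun setT (Z j s : O -> borel 'rV[R]_d)) ->
  (forall j l, measurable_fun setT (A j l s)) ->
  measurable_fun setT (local_mean Z A i s : O -> borel 'rV[R]_d).
Proof.
move=> mZ mA; apply: measurable_rV => c.
have mAR j : measurable_fun setT (fun w => (A i j s w)%:R : R).
  by case: (brv_bool (fun b => b%:R : R) (mA i j)).
have -> : (fun w => local_mean Z A i s w ord0 c) =
  (fun w => (\sum_j (A i j s w)%:R)^-1 * \sum_j (A i j s w)%:R * Z j s w ord0 c).
  apply/funext => w; rewrite /local_mean mxE summxE; congr (_ * _).
  by apply: eq_bigr => j _; rewrite mxE.
apply: measurable_funM.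
  by apply: (measurableT_comp measurable_inv); exact: measurable_sum.
apply: measurable_sum => j; apply: measurable_funM; first exact: mAR.
exact: measurable_coord.
Qed.

Section exponential_moments.
Context {dO} {Om : measurableType dO} {R : realType} (P : probability Om R).
Context {d n : nat}.
Local Notation T := 'rV[R]_d.
Variables (B : bool -> T -> T -> R) (B0 : T -> T -> R).
Hypotheses (hB : forall a, edge_kernel (B a)) (hB0 : edge_kernel B0).
Variables (Z : 'I_n.+1 -> nat -> Om -> T) (A : 'I_n.+1 -> 'I_n.+1 -> nat -> Om -> bool).
Hypothesis nm : network_measurable Z A.
Hypothesis symA : reflexive_symmetric A.
Hypothesis condA : cond_independent_edges Z A P.
Hypothesis edgeA : forall (i j : 'I_n.+1) s, (i < j)%N ->
  is_cond_prob P (filtrationA Z A s) (A i j s @^-1` [set true])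
    (fun w => eker B B0 s (A i j s.-1 w) (Z i s w) (Z j s w)).

Local Notation N := (n.+1%:R : R).
Local Notation dg := (deg (R := R) A).
Local Notation histA s := (g_sigma_algebraType
  (hgen Z A [set r | (r <= s)%N] [set r | (r < s)%N])).

(** Moments are tracked as averages over the agents, because local means are controlled on average
    rather than one by one. They are used under a cap [Num.min K], with bounds uniform in [K]. *)
Definition emom s C w : R := N^-1 * \sum_i expR (C * l1 (Z i s w)).

Definition lmom s C w : R := N^-1 * \sum_i expR (C * l1 (local_mean Z A i s w)).

Let N0 : 0 < N. Proof. by []. Qed.

Lemma avg_ge0 (x : 'I_n.+1 -> R) : (forall i, 0 <= x i) -> 0 <= N^-1 * \sum_i x i.
Proof. by move=> x0; rewrite mulr_ge0 ?invr_ge0 ?(ltW N0)// sumr_ge0. Qed.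

Lemma emom_ge0 s C w : 0 <= emom s C w.
Proof. by apply: avg_ge0 => i; exact: expR_ge0. Qed.

Lemma emom_le s C C' w : C <= C' -> emom s C w <= emom s C' w.
Proof.
move=> CC; rewrite ler_wpM2l ?invr_ge0 ?(ltW N0)//; apply: ler_sum => i _.
by rewrite ler_expR ler_wpM2r// l1_ge0.
Qed.

Lemma emom_cube s C w : emom s C w ^+ 3 <= emom s (3 * C) w.
Proof.
rewrite /emom !mulr_sumr.
have := @cube_jensen R 'I_n.+1 (fun=> N^-1) (fun i => expR (C * l1 (Z i s w))).
rewrite sum_avg1 => h; apply: le_trans (h _ _ _) _ => //.
apply: ler_sum => i _; rewrite ler_wpM2l ?invr_ge0 ?(ltW N0)//.
by rewrite -expRM_natl mulrA.
Qed.

Lemma measurable_emom (SZ SA : set nat) s C : SZ s ->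
  measurable_fun setT (emom s C : g_sigma_algebraType (hgen Z A SZ SA) -> R).
Proof.
move=> h; apply: measurable_funM; first exact: measurable_cst.
by apply: measurable_sum => i; apply: measurable_exp_l1; exact: hist_Z.
Qed.

Let mZ i s : measurable_fun setT (Z i s : Om -> borel T).
Proof. by case: nm. Qed.

Lemma measurable_local_mean i s :
  measurable_fun setT (local_mean Z A i s : Om -> borel T).
Proof. by apply: measurable_local_mean_at => [j|j l]; case: nm. Qed.

(** Jensen with the weights [A i j / deg i]. *)
Lemma exp_local_mean C i s w : 0 <= C ->
  expR (C * l1 (local_mean Z A i s w)) <=
  (dg s i w)^-1 * \sum_j (A i j s w)%:R * expR (C * l1 (Z j s w)).
Proof.
move=> C0; have d0 : 0 < dg s i w by apply: lt_le_trans (deg_ge1 symA s i w).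
rewrite [leRHS]mulr_sumr; under [leRHS]eq_bigr do rewrite mulrA.
apply: le_trans (expR_jensen _ _ _); last 2 first.
- by move=> j; rewrite mulr_ge0 ?invr_ge0 ?(ltW d0).
- by rewrite -mulr_sumr -/(dg s i w) mulVf// gt_eqF.
rewrite ler_expR; under [leRHS]eq_bigr do rewrite mulrCA -mulrA.
rewrite -!mulr_sumr ler_wpM2l// /local_mean l1Z ger0_norm ?invr_ge0 ?(ltW d0)//.
rewrite ler_wpM2l ?invr_ge0 ?(ltW d0)//; apply: (le_trans (l1_sum _)).
by apply: ler_sum => j _; rewrite l1Z ger0_norm.
Qed.

Let toO s (h : histA s -> R) : brv h -> brv (h : Om -> R).
Proof. exact/brv_sub/(hgen_sub nm). Qed.

Lemma lmom_ge0 s C w : 0 <= lmom s C w.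
Proof. by apply: avg_ge0 => i; exact: expR_ge0. Qed.

Lemma measurable_lmom s C : measurable_fun setT (lmom s C).
Proof.
apply: measurable_funM; first exact: measurable_cst.
apply: measurable_sum => i; apply: measurable_exp_l1; exact: measurable_local_mean.
Qed.

Lemma measurable_emomO s C : measurable_fun setT (emom s C).
Proof.
apply: measurable_funM; first exact: measurable_cst.
by apply: measurable_sum => i; apply: measurable_exp_l1.
Qed.

Lemma brv_min_emom s C K : brv (fun w => Num.min K (emom s C w)).
Proof. by apply: brv_min; [exact: measurable_emomO|exact: emom_ge0]. Qed.

Section long_range.
Variables (Cbar Cb : R) (s : nat).
Hypotheses (Cbar0 : 0 < Cbar) (Cb0 : 0 < Cb).
Hypothesis lowB : forall a x y, Cbar <= eker B B0 s a x y * expR (Cb * enorm (x - y)).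

Let Cbar1 : Cbar <= 1.
Proof.
have := lowB true 0 0; rewrite subrr.
have -> : enorm (0 : T) = 0.
  apply/eqP; rewrite eq_le enorm_ge0 andbT (le_trans (enorm_le_l1 _))//.
  by rewrite /l1 big1// => j _; rewrite mxE normr0.
rewrite mulr0 expR0 mulr1 => h; apply: (le_trans h).
by case/andP: (eker01 hB hB0 s true 0 0).
Qed.

(** By the triangle inequality [e^(-Cb |x - y|)] is at least [e^(-Cb |x|) e^(-Cb |y|)], which
    separates [i] from [j]. *)
Let edeg_low i w :
  Cbar * expR (- (Cb * l1 (Z i s w))) * \sum_j expR (- (Cb * l1 (Z j s w))) <=
  edeg B B0 Z A s i w.
Proof.
rewrite /edeg mulr_sumr; apply: ler_sum => j _; rewrite -mulrA -expRD -opprD -mulrDr.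
have l0 : 0 <= Cb * (l1 (Z i s w) + l1 (Z j s w)).
  by rewrite mulr_ge0 ?(ltW Cb0)// addr_ge0 ?l1_ge0.
rewrite /eprob; case: eqP => _.
  by rewrite mulr_ile1 ?expR_ge0 ?(ltW Cbar0)// -expR0 ler_expR oppr_le0.
rewrite /aker expRN ler_pdivrMr ?expR_gt0//.
apply: (le_trans (lowB (A i j s.-1 w) (Z i s w) (Z j s w))).
rewrite ler_wpM2l//; first by case/andP: (eker01 hB hB0 s (A i j s.-1 w) (Z i s w) (Z j s w)).
rewrite ler_expR ler_wpM2l ?(ltW Cb0)// (le_trans (enorm_le_l1 _))//.
by rewrite (le_trans (l1D _ _))// l1N.
Qed.

(** The separated bound on [edeg] inverts to a product; [avg_inv_expR] turns its factor common to
    all [i] into [emom] divided by the number of agents, and the sum over [i] gives the second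
    [emom]. *)
Let sum_inv_edeg w :
  \sum_i (edeg B B0 Z A s i w)^-1 <= Cbar^-1 * emom s Cb w ^+ 2.
Proof.
have h i : (edeg B B0 Z A s i w)^-1 <=
    Cbar^-1 * (expR (Cb * l1 (Z i s w)) * (N^-1 * emom s Cb w)).
  pose E := \sum_j expR (- (Cb * l1 (Z j s w))).
  have E0 : 0 < E.
    by rewrite /E (bigD1 i)//= ltr_wpDr ?expR_gt0// sumr_ge0// => j _; exact: expR_ge0.
  have p0 : 0 < Cbar * expR (- (Cb * l1 (Z i s w))) * E by rewrite !mulr_gt0 ?expR_gt0.
  have e0 : 0 < edeg B B0 Z A s i w by apply: lt_le_trans p0 (edeg_low i w).
  apply: (@le_trans _ _ (Cbar * expR (- (Cb * l1 (Z i s w))) * E)^-1).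
    by rewrite lef_pV2 ?posrE//; exact: edeg_low.
  rewrite !invfM -expRN opprK -mulrA ler_wpM2l ?invr_ge0 ?(ltW Cbar0)//.
  by rewrite ler_wpM2l ?expR_ge0//; exact: avg_inv_expR.
apply: (le_trans (ler_sum _ (fun i _ => h i))).
rewrite -mulr_sumr -mulr_suml ler_wpM2l ?invr_ge0 ?(ltW Cbar0)//.
by rewrite mulrA [X in X * _]mulrC -/(emom s Cb w) expr2.
Qed.

(** Extending the sum over neighbours to all agents bounds [lmom] by [emom] times the sum of inverse
    degrees. [Ex_inv_deg] replaces these by inverse expected degrees, whose sum is quadratic in
    [emom]; Jensen for cubes absorbs the three factors into one moment of exponent [3 D]. *)
Lemma lmom_long_range C K : 0 <= C -> 0 < K ->
  Ex P (fun w => Num.min K (lmom s C w)) <=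
  2 / Cbar * Ex P (fun w => Num.min (N * K) (emom s (3 * Num.max C Cb) w)).
Proof.
move=> C0 K0; set D := Num.max C Cb.
pose g w := Num.min K (emom s C w).
have bg : brv (g : histA s -> R).
  by apply: brv_min; [apply: measurable_emom => /=|exact: emom_ge0].
have g0 w : 0 <= g w by rewrite /g le_min (ltW K0) emom_ge0.
have bi i := brv_inv_edeg hB hB0 Z A s i.
have bd i := brv_inv_deg nm symA s i.
have e1 i w : 0 < edeg B B0 Z A s i w.
  by apply: lt_le_trans (edeg_ge1 hB hB0 Z A s i w).
have d1 i w : 0 < dg s i w by apply: lt_le_trans (deg_ge1 symA s i w).
have degN i w : dg s i w <= N.
  rewrite /deg -[N]mulr1 mulr_natl -[n.+1 in leRHS]card_ord -sumr_const.
  by apply: ler_sum => j _; case: (A _ _ _ _).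
pose iD w := \sum_i (dg s i w)^-1.
(* Degrees are at most the number of agents. This allows the cap to be moved from [emom * iD] onto
   the factor [emom], which depends on positions only. *)
have D1 w : 1 <= iD w.
  rewrite -(sum_avg1 (R := R) n); apply: ler_sum => i _.
  by rewrite lef_pV2 ?posrE.
have lD w : lmom s C w <= emom s C w * iD w.
  rewrite /lmom /iD mulr_sumr mulr_sumr; apply: ler_sum => i _.
  apply: (@le_trans _ _ (N^-1 * ((dg s i w)^-1 * \sum_j expR (C * l1 (Z j s w))))).
    rewrite ler_wpM2l ?invr_ge0 ?(ltW N0)//; apply: (le_trans (exp_local_mean _ _ _ C0)).
    rewrite ler_wpM2l ?invr_ge0 ?(ltW (d1 _ _))//; apply: ler_sum => j _.
    by rewrite ler_piMl ?expR_ge0//; case: (A _ _ _ _).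
  by rewrite mulrCA mulrC.
have bl : brv (fun w => Num.min K (lmom s C w)).
  by apply: brv_min; [exact: measurable_lmom|exact: lmom_ge0].
apply: (@le_trans _ _ (Ex P (fun w => \sum_i g w / dg s i w))).
  apply: Ex_le => //; first by apply: brv_sum => i; apply: brvM => //; exact/toO/bg.
  move=> w; rewrite -mulr_sumr -/(iD w) /g.
  case: (ltP K (emom s C w)) => hK.
    by rewrite ge_min ler_peMr// (ltW K0).
  by rewrite ge_min lD orbT.
rewrite Ex_sum => [|i]; last by apply: brvM => //; exact/toO/bg.
apply: (@le_trans _ _ (\sum_i 2 * Ex P (fun w => (g : Om -> R) w / edeg B B0 Z A s i w))).
  by apply: ler_sum => i _; exact: Ex_inv_deg.
have bge i : brv ((fun w => g w / edeg B B0 Z A s i w) : Om -> R).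
  exact: (@toO s _ (brvM bg (bi i))).
rewrite -mulr_sumr -mulrA ler_wpM2l// -Ex_sum// -ExZ; last exact: brv_min_emom.
apply: Ex_le; [exact: brv_sum|by apply: brvZ; exact: brv_min_emom|].
move=> w; have Ci1 : 1 <= Cbar^-1 by rewrite invf_ge1.
have NK : \sum_i g w / edeg B B0 Z A s i w <= N * K.
  rewrite mulr_natl -[n.+1 in leRHS]card_ord -sumr_const; apply: ler_sum => i _.
  rewrite ler_pdivrMr//; apply: (@le_trans _ _ K); first by rewrite /g ge_min lexx.
  by rewrite ler_peMr ?(ltW K0)// edeg_ge1.
have S3 : \sum_i g w / edeg B B0 Z A s i w <= Cbar^-1 * emom s (3 * D) w.
  rewrite -mulr_sumr; apply: (@le_trans _ _ (emom s C w * (Cbar^-1 * emom s Cb w ^+ 2))).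
    apply: ler_pM => //; last by rewrite /g ge_min lexx orbT.
    by apply: sumr_ge0 => i _; rewrite invr_ge0 ltW.
  rewrite mulrCA ler_wpM2l ?invr_ge0 ?(ltW Cbar0)//; apply: le_trans (emom_cube _ _ _).
  have le1 : emom s C w <= emom s D w by apply: emom_le; rewrite le_max lexx.
  have le2 : emom s Cb w <= emom s D w by apply: emom_le; rewrite le_max lexx orbT.
  rewrite [leRHS]exprS; apply: ler_pM => //; rewrite ?exprn_ge0 ?emom_ge0//.
  by apply: lerXn2r; rewrite ?nnegrE ?emom_ge0.
case: (ltP (N * K) (emom s (3 * D) w)) => h //.
by apply: (le_trans NK); rewrite ler_peMl// mulr_ge0// ltW.
Qed.

End long_range.

Section short_range.
Variables (Cb : R) (s : nat).
Hypothesis Cb0 : 0 < Cb.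
Hypothesis zeroB : forall a x y, Cb < enorm (x - y) -> eker B B0 s a x y = 0.

(** Testing the edge against the indicator of a distance above [Cb] gives expectation zero, since
    the kernel vanishes there. *)
Let near_ae i j : {ae P, forall w, A i j s w -> enorm (Z i s w - Z j s w) <= Cb}.
Proof.
have key (p : pairs n.+1) : {ae P, forall w, A (val p).1 (val p).2 s w ->
    enorm (Z (val p).1 s w - Z (val p).2 s w) <= Cb}.
  pose f (x y : T) : R := (Cb < enorm (x - y))%R%:R.
  have bf : brv ((fun w => f (Z (val p).1 s w) (Z (val p).2 s w)) : histA s -> R).
    rewrite /f; apply: (brv_bool (fun b => b%:R)).
    have mD : measurable_fun setT
      ((fun w => Z (val p).1 s w - Z (val p).2 s w) : histA s -> borel T).
      rewrite (_ : (fun w => _) = (fun w => Z (val p).1 s w + (-1) *: Z (val p).2 s w)).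
        by apply: measurable_addV; [|apply: measurable_scaleV]; apply: hist_Z => /=.
      by apply/funext => w; rewrite scaleN1r.
    apply: (measurable_fun_ltr (measurable_cst _)).
    apply: (measurableT_comp (continuous_measurable_fun (@sqrt_continuous R))).
    apply: measurable_sum => c; apply: measurable_funX.
    exact: (measurable_coord c mD).
  have := Ex_edges hB hB0 nm condA edgeA [set p] (fun=> true) bf.
  under eq_fun do rewrite big_set1.
  under [in X in _ = X -> _]eq_fun do rewrite big_set1 /=.
  have -> : (fun w => f (Z (val p).1 s w) (Z (val p).2 s w) *
      aker B B0 Z A s (val p).1 (val p).2 w) = fun=> 0.
    apply/funext => w; rewrite /f /aker; case: ltP => [h|_]; last by rewrite mul0r.
    by rewrite zeroB// mulr0.
  rewrite Ex_cst => e0.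
  set S := [set w | A (val p).1 (val p).2 s w /\ Cb < enorm (Z (val p).1 s w - Z (val p).2 s w)].
  have eS : (fun w => f (Z (val p).1 s w) (Z (val p).2 s w) *
     (A (val p).1 (val p).2 s w == true)%:R) = \1_S.
    apply/funext => w; rewrite indicE /f; case: ltP => h; last first.
      by rewrite memNset ?mul0r// => -[_]; rewrite ltNge h.
    rewrite mul1r; case E : (A _ _ _ _) => /=; first by rewrite mem_set.
    by rewrite memNset// => -[]; rewrite E.
  have mS : measurable S.
    have : measurable_fun setT (\1_S : Om -> R).
      rewrite -eS; apply: measurable_funM; first by case: (toO bf).
      have [+ _] := brv_bool (fun b => (b == true)%:R : R) (nm.2 (val p).1 (val p).2 s).
      exact.
    move/(@measurable_preimage_gt _ _ _ (\1_S : Om -> R) 0); congr (measurable _).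
    apply/seteqP; split => w /=; rewrite indicE.
      by have [/set_mem|] := boolP (w \in S); rewrite ?ltxx.
    by move=> h; rewrite mem_set.
  rewrite eS in e0; move/(Ex_indic_eq0 P mS) : e0 => PS0.
  exists S; split => // w /= nh; apply: contrapT => nS; apply: nh => Aw.
  by rewrite leNgt; apply/negP => h; apply: nS.
have [->|] := eqVneq i j.
  apply: aeW => w _; rewrite subrr /enorm big1 ?sqrtr0 ?ltW// => c _.
  by rewrite mxE expr0n.
rewrite -val_eqE/= neq_ltn => /orP[h|h]; first exact: (key (exist _ (i, j) h)).
apply: filterS (key (exist _ (j, i) h)) => w /= hw Aij.
have -> : enorm (Z i s w - Z j s w) = enorm (Z j s w - Z i s w).
  by rewrite /enorm; congr Num.sqrt; apply: eq_bigr => c _; rewrite !mxE -sqrrN opprB.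
by apply: hw; rewrite (symA s w).1.
Qed.

(** The neighbours of [i] are at Euclidean distance at most [Cb], hence within [d * Cb] of it in the
    norm [l1]. *)
Lemma lmom_short_range C K : 0 <= C -> 0 < K ->
  Ex P (fun w => Num.min K (lmom s C w)) <=
  expR (C * (d%:R * Cb)) * Ex P (fun w => Num.min K (emom s C w)).
Proof.
move=> C0 K0; rewrite -ExZ; last exact: brv_min_emom.
apply: Ex_le_ae.
- by apply: brv_min; [exact: measurable_lmom|exact: lmom_ge0].
- by apply: brvZ; exact: brv_min_emom.
have : {ae P, forall w, forall i j, A i j s w -> enorm (Z i s w - Z j s w) <= Cb}.
  by apply: filter_forall => i; apply: filter_forall => j; exact: near_ae.
apply: filterS => w hw.
apply: le_trans (min_scale (ltW K0) (emom_ge0 _ _ _) _); last first.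
  by rewrite -[leLHS]expR0 ler_expR !mulr_ge0// ltW.
rewrite le_min ge_min lexx/= ge_min; apply/orP; right.
rewrite /lmom /emom mulrCA ler_wpM2l ?invr_ge0 ?(ltW N0)// mulr_sumr; apply: ler_sum => i _.
apply: (le_trans (exp_local_mean _ _ _ C0)).
have d0 : 0 < dg s i w by apply: lt_le_trans (deg_ge1 symA s i w).
rewrite mulrC ler_pdivrMr// /deg mulr_sumr; apply: ler_sum => j _.
have [Aij|] := boolP (A i j s w); last by rewrite mul0r mulr0.
rewrite mul1r mulr1 -expRD ler_expR -mulrDr ler_wpM2l// addrC.
have -> : Z j s w = Z i s w + - (Z i s w - Z j s w) by rewrite opprB addrC subrK.
rewrite (le_trans (l1D _ _))// lerD2l l1N (le_trans (l1_le_enorm _))//.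
by rewrite ler_wpM2l//; exact: hw.
Qed.

End short_range.
End exponential_moments.

Lemma same_law_integral {dT} {S : measurableType dT} {R : realType}
    {d1} {O1 : measurableType d1} (P1 : probability O1 R) (X1 : O1 -> S)
    {d2} {O2 : measurableType d2} (P2 : probability O2 R) (X2 : O2 -> S)
    (f : S -> R) :
  measurable_fun setT X1 -> measurable_fun setT X2 ->
  (forall V, measurable V -> P1 (X1 @^-1` V) = P2 (X2 @^-1` V)) ->
  measurable_fun setT f -> (forall x, 0 <= f x) ->
  (\int[P1]_w (f (X1 w))%:E = \int[P2]_w (f (X2 w))%:E)%E.
Proof.
move=> m1 m2 h mf f0.
have mF : measurable_fun setT (EFin \o f) by exact/measurable_EFinP.
have F0 : {in setT, forall y, (0 <= (EFin \o f) y)%E} by move=> y _; rewrite lee_fin.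
have := ge0_integral_pushforward m1 P1 measurableT mF F0.
have := ge0_integral_pushforward m2 P2 measurableT mF F0.
rewrite !preimage_setT => <- <-.
have hh V : measurable V -> V `<=` setT -> pushforward P1 X1 V = pushforward P2 X2 V.
  by move=> mV _; exact: h.
pose nu2 : {measure set S -> \bar R} :=
  measure_function_pushforward__canonical__measure_function_Measure P2 m2.
pose nu1 : {measure set S -> \bar R} :=
  measure_function_pushforward__canonical__measure_function_Measure P1 m1.
exact: (@eq_measure_integral _ _ _ setT nu2 nu1 _ hh).
Qed.

Lemma finite_bound {R : realType} (x : \bar R) : (x < +oo)%E ->
  exists M : R, (x <= M%:E)%E.
Proof. by case: x => [r| |] // _; [exists r|exists 0; rewrite leNye]. Qed.

Section moments_of_the_model.
Context {R : realType} {d : nat} {gamma : R}.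
Local Notation T := 'rV[R]_d.
Variables (B : bool -> T -> T -> R) (B0 : T -> T -> R).
Hypotheses (hgamma : 0 < gamma < 1) (hB : forall a, edge_kernel (B a)).
Variables (nu mu0 : probability (borel T) R).
Context {dO : measure_display} {Om : measurableType dO} (P : probability Om R).
Variables (xi : nat -> nat -> Om -> T) (Z : forall n, 'I_n.+1 -> nat -> Om -> T).
Variable A : forall n, 'I_n.+1 -> 'I_n.+1 -> nat -> Om -> bool.
Hypothesis hmodel : forall n, agent_model P gamma B xi (@Z n) (@A n).
Hypothesis h1 : assumption1 P xi Z A nu.
Hypothesis h2 : assumption2 P B0 Z A mu0.
Hypothesis h3 : assumption3 P B B0 xi Z.

Lemma model_network n : network_measurable (@Z n) (@A n).
Proof. exact: am_measurable (hmodel n). Qed.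

Lemma model_sym n : reflexive_symmetric (@A n).
Proof. exact: a1_graph h1 n. Qed.

Lemma model_edges n : cond_independent_edges (@Z n) (@A n) P.
Proof. exact: a1_edges h1 n. Qed.

(** Unites the initial condition with the transition: [filtrationA] at time zero is generated by the
    initial positions. *)
Lemma model_edge n (i j : 'I_n.+1) s : (i < j)%N ->
  is_cond_prob P (filtrationA (@Z n) (@A n) s) (@A n i j s @^-1` [set true])
    (fun w => eker B B0 s (@A n i j s.-1 w) (@Z n i s w) (@Z n j s w)).
Proof.
case: s => [|s] ij; last exact: am_edge (hmodel n) _ _ _ ij.
have := a2_edge h2 ij; rewrite /is_cond_prob /=.
have -> : sigma_gen (fun i => @Z n i 0%N : Om -> borel T) =
    filtrationA (@Z n) (@A n) 0%N.
  rewrite /sigma_gen /filtrationA /history; congr smallest.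
  apply/seteqP; split => [V [l _ h]|V [[s /= + [l _ h]]|[s //]]].
    by left; exists 0%N => //; exists l.
  by rewrite leqn0 => /eqP s0; exists l => //; rewrite s0 in h.
congr (is_cond_exp _ _ _ _); apply/funext => w; rewrite indicE.
case E : (A i j 0%N w); first by rewrite mem_set.
by rewrite memNset//= E.
Qed.

Let mZ n i s : measurable_fun setT (@Z n i s : Om -> borel T).
Proof. by case: (@model_network n). Qed.

Lemma law_init n (i : 'I_n.+1) (V : set (borel T)) : measurable V ->
  P (@Z n i 0%N @^-1` V) = P (@Z n ord0 0%N @^-1` V).
Proof.
move=> mV; have mc := @measurable_entry R d n ord0.
have mW : measurable ((fun z : 'rV[T]_n.+1 => z ord0 ord0) @^-1` V :
    set (borel 'rV[T]_n.+1)).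
  by rewrite -[X in measurable X]setTI; exact: mc.
have := a2_exchangeable h2 (tperm ord0 i) mW.
rewrite (_ : _ @^-1` _ = @Z n i 0%N @^-1` V); last first.
  by apply/funext => w; rewrite /preimage /= mxE tpermL.
by move=> ->; congr (P _); apply/funext => w; rewrite /preimage /= mxE.
Qed.

Lemma moments_init C : 0 <= C -> exists M : R, \forall n \near \oo,
  forall K, 0 < K -> Ex P (fun w => Num.min K (emom (@Z n) 0 C w)) <= M.
Proof.
(* The factor [d] compares [l1] with the Euclidean norm of the assumption. *)
move=> C0; have := a3_init_moments h3 (C * d%:R).
rewrite /limn_esup limf_esupE => /ereal_inf_lt[_ [V hV <-]] /finite_bound[M VM].
exists M; move: hV; apply: filterS => n Vn K K0.
have hn : (\int[P]_w (expR (C * l1 (@Z n ord0 0%N w)))%:E <= M%:E)%E.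
  apply: le_trans VM; apply: (@le_trans _ _
    (\int[P]_w (expR (C * d%:R * enorm (@Z n ord0 0%N w)))%:E)%E); last first.
    by apply: ereal_sup_ubound; exists n.
  apply: ge0_le_integral => //.
  - by apply/measurable_EFinP; exact: measurable_exp_l1.
  - apply/measurable_EFinP.
    apply: (measurableT_comp (@measurable_expR R)).
    apply: measurable_funM; first exact: measurable_cst.
    apply: (measurableT_comp (continuous_measurable_fun (@sqrt_continuous R))).
    apply: measurable_sum => c; apply: measurable_funX.
    exact: (measurable_coord c (mZ _ _)).
  - by move=> w _; rewrite lee_fin ler_expR -mulrA ler_wpM2l// l1_le_enorm.
have N0 : 0 < (n.+1%:R : R) by [].
have bi i : brv (fun w => Num.min (n.+1%:R * K) (expR (C * l1 (@Z n i 0%N w)))).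
  by apply: brv_min => [|w]; [exact: measurable_exp_l1|exact: expR_ge0].
apply: (@le_trans _ _ (Ex P (fun w => n.+1%:R^-1 * \sum_i
    Num.min (n.+1%:R * K) (expR (C * l1 (@Z n i 0%N w)))))).
  apply: Ex_le; first exact: (brv_min_emom (@model_network n)).
    by apply: brvZ; exact: brv_sum.
  by move=> w; apply: min_avg => [|i]; rewrite ?expR_ge0 ?ltW.
rewrite ExZ; last exact: brv_sum.
rewrite Ex_sum// mulrC ler_pdivrMr//.
rewrite mulr_natr -[n.+1 in leRHS]card_ord -sumr_const; apply: ler_sum => i _.
apply: Ex_min_le; [by rewrite mulr_ge0// ltW|exact: measurable_exp_l1|
  by move=> w; exact: expR_ge0|].
rewrite (same_law_integral (f := fun x : borel T => expR (C * l1 x)) (P2 := P)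
  (X2 := (@Z n ord0 0%N : Om -> borel T))) //.
- exact: law_init.
- by apply: measurable_exp_l1 => //; exact: measurable_id.
Qed.

Let kernels_case : tail_lower_bound B B0 \/ bounded_confidence B B0.
Proof. by case: (a3_kernels h3) => -[]; [left|right]. Qed.

Lemma moments_local_mean s : (forall C, 0 <= C -> exists M : R, \forall n \near \oo,
    forall K, 0 < K -> Ex P (fun w => Num.min K (emom (@Z n) s C w)) <= M) ->
  forall C, 0 <= C -> exists M : R, \forall n \near \oo,
    forall K, 0 < K -> Ex P (fun w => Num.min K (lmom (@Z n) (@A n) s C w)) <= M.
Proof.
move=> ih C C0; case: kernels_case => [[Cbar [Cb [Cbar0 Cb0 l0 l]]]|[[Cb Cb0 z0] _]].
  have lowB a x y : Cbar <= eker B B0 s a x y * expR (Cb * enorm (x - y)).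
    by case: s {ih}.
  have D0 : 0 <= 3 * Num.max C Cb by rewrite mulr_ge0// le_max C0.
  have [M hM] := ih _ D0; exists (2 / Cbar * M); move: hM; apply: filterS => n hM K K0.
  apply: (le_trans (lmom_long_range hB (a2_kernel h2) (@model_network n) (@model_sym n)
     (@model_edges n) (@model_edge n) Cbar0 Cb0 lowB C0 K0)).
  by rewrite ler_wpM2l ?divr_ge0 ?(ltW Cbar0)// hM// mulr_gt0.
have zeroB a x y : Cb < enorm (x - y) -> eker B B0 s a x y = 0.
  by move=> /(z0 a)[]; case: s {ih}.
have [M hM] := ih _ C0; exists (expR (C * (d%:R * Cb)) * M); move: hM.
apply: filterS => n hM K K0.
apply: (le_trans (lmom_short_range hB (a2_kernel h2) (@model_network n) (@model_sym n)
     (@model_edges n) (@model_edge n) Cb0 zeroB C0 K0)).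
by rewrite ler_wpM2l ?expR_ge0// hM.
Qed.

Let mxi i s : measurable_fun setT (xi i s : Om -> borel T).
Proof. by have [_ /(_ (i, s))[]] := a1_noise_iid h1. Qed.

Lemma noise_moments C s n K : 0 <= C -> 0 < K ->
  Ex P (fun w => Num.min K (n.+1%:R^-1 * \sum_(i < n.+1) expR (C * l1 (xi i s w)))) <=
  fine (\int[P]_w (expR (C * d%:R * enorm (xi 0%N 0%N w)))%:E)%E.
Proof.
move=> C0 K0; set M := fine _.
have hn : (\int[P]_w (expR (C * l1 (xi 0%N 0%N w)))%:E <= M%:E)%E.
  rewrite fineK; last first.
    rewrite ge0_fin_numE ?(a3_noise_moments h3)//.
    by apply: integral_ge0 => w _; rewrite lee_fin expR_ge0.
  apply: ge0_le_integral => //.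
  - by apply/measurable_EFinP; exact: measurable_exp_l1.
  - apply/measurable_EFinP.
    apply: (measurableT_comp (@measurable_expR R)).
    apply: measurable_funM; first exact: measurable_cst.
    apply: (measurableT_comp (continuous_measurable_fun (@sqrt_continuous R))).
    apply: measurable_sum => c; apply: measurable_funX.
    exact: (measurable_coord c (mxi _ _)).
  - by move=> w _; rewrite lee_fin ler_expR -mulrA ler_wpM2l// l1_le_enorm.
have N0 : 0 < (n.+1%:R : R) by [].
have bi (i : 'I_n.+1) : brv (fun w => Num.min (n.+1%:R * K) (expR (C * l1 (xi i s w)))).
  by apply: brv_min => [|w]; [exact: measurable_exp_l1|exact: expR_ge0].
apply: (@le_trans _ _ (Ex P (fun w => n.+1%:R^-1 * \sum_(i < n.+1)
    Num.min (n.+1%:R * K) (expR (C * l1 (xi i s w)))))).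
  apply: Ex_le; [apply: brv_min|by apply: brvZ; exact: brv_sum|].
  - apply: measurable_funM; first exact: measurable_cst.
    by apply: measurable_sum => i; exact: measurable_exp_l1.
  - by move=> w; apply: avg_ge0 => i; exact: expR_ge0.
  - by move=> w; apply: min_avg => [|i]; rewrite ?expR_ge0 ?ltW.
rewrite ExZ; last exact: brv_sum.
rewrite Ex_sum// mulrC ler_pdivrMr//.
rewrite mulr_natr -[n.+1 in leRHS]card_ord -sumr_const; apply: ler_sum => i _.
apply: Ex_min_le; [by rewrite mulr_ge0// ltW|exact: measurable_exp_l1|
  by move=> w; exact: expR_ge0|].
rewrite (same_law_integral (f := fun x : borel T => expR (C * l1 x)) (P2 := P)
  (X2 := (xi 0%N 0%N : Om -> borel T))) //.
- move=> V mV; have [_ hl] := a1_noise_iid h1.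
  have [_ /(_ V mV)/= ->] := hl (nat_of_ord i, s).
  by have [_ /(_ V mV)/= ->] := hl (0%N, 0%N).
- by apply: measurable_exp_l1 => //; exact: measurable_id.
Qed.

(** The new position is bounded in [l1] by the sum of those of the old position, the local mean and
    the noise, hence by three times their maximum; the exponential of a maximum is at most the sum
    of the exponentials. The exponent [C] at the next time thus costs [3 C] now. *)
Lemma moments s C : 0 <= C -> exists M : R, \forall n \near \oo,
  forall K, 0 < K -> Ex P (fun w => Num.min K (emom (@Z n) s C w)) <= M.
Proof.
elim: s C => [|s ih] C C0; first exact: moments_init.
have C30 : 0 <= 3 * C by rewrite mulr_ge0.
have [M1 h1M] := ih _ C30; have [M2 h2M] := moments_local_mean ih C30.
exists (M1 + M2 + fine (\int[P]_w (expR (3 * C * d%:R * enorm (xi 0%N 0%N w)))%:E)%E).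
move: h1M h2M; apply: filterS2 => n hM1 hM2 K K0.
apply: le_trans (lerD (lerD (hM1 K K0) (hM2 K K0)) (noise_moments s n C30 K0)).
set F := fun w => n.+1%:R^-1 * \sum_(i < n.+1) expR (3 * C * l1 (xi i s w)).
have F0 w : 0 <= F w by apply: avg_ge0 => i; exact: expR_ge0.
have b1 := brv_min_emom (@model_network n) s (3 * C) K.
have b2 : brv (fun w => Num.min K (lmom (@Z n) (@A n) s (3 * C) w)).
  apply: brv_min; last exact: lmom_ge0.
  exact: measurable_lmom (@model_network n) s (3 * C).
have b3 : brv (fun w => Num.min K (F w)).
  apply: brv_min => //; apply: measurable_funM; first exact: measurable_cst.
  by apply: measurable_sum => i; exact: measurable_exp_l1.
rewrite -!ExD//; last exact: brvD.
apply: Ex_le; [exact: brv_min_emom (@model_network n) _ _ _|by apply: brvD => //; exact: brvD|].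
move=> w; have e0 := emom_ge0 (@Z n) s (3 * C) w.
have l0 := lmom_ge0 (@Z n) (@A n) s (3 * C) w.
apply: le_trans (lerD (min_add (ltW K0) e0 l0) (lexx _)).
apply: le_trans (min_add (ltW K0) (addr_ge0 e0 l0) (F0 w)).
rewrite le_min ge_min lexx/= ge_min; apply/orP; right.
rewrite /emom /lmom /F -!mulrDr ler_wpM2l ?invr_ge0// -!big_split/=.
apply: ler_sum => i _; rewrite (am_state (hmodel n)).
set a := l1 (Z i s w); set b := l1 (local_mean _ _ _ _ _); set c := l1 (xi i s w).
have abc : l1 ((1 - gamma) *: Z i s w + gamma *: local_mean (@Z n) (@A n) i s w + xi i s w) <=
    3 * Num.max a (Num.max b c).
  move/andP : hgamma => [g0 g1].
  apply: (le_trans (l1D _ _)); apply: (@le_trans _ _ (a + b + c)).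
    rewrite lerD2r (le_trans (l1D _ _))// (l1Z (1 - gamma)) (l1Z gamma).
    rewrite (ger0_norm (ltW g0)) ger0_norm ?subr_ge0 ?(ltW g1)//.
    by apply: lerD; apply: ler_piMl; rewrite ?l1_ge0// ?(ltW g1)// lerBlDr lerDl ltW.
  have : a <= Num.max a (Num.max b c) by rewrite le_max lexx.
  have : b <= Num.max a (Num.max b c) by rewrite !le_max lexx !orbT.
  have : c <= Num.max a (Num.max b c) by rewrite !le_max lexx !orbT.
  by set m := Num.max _ _; lra.
apply: (@le_trans _ _ (expR (3 * C * Num.max a (Num.max b c)))).
  by rewrite ler_expR -[3 * C]mulrC -mulrA ler_wpM2l.
have em x y : expR (3 * C * Num.max x y) <= expR (3 * C * x) + expR (3 * C * y).
  have := expR_ge0 (3 * C * x); have := expR_ge0 (3 * C * y).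
  by case: (leP x y) => _; lra.
by rewrite (le_trans (em _ _))// -addrA lerD2l; exact: em.
Qed.

End moments_of_the_model.

(** * The limiting process *)

Lemma cvg_row {R : realType} {d : nat} {U : Type} {F : set_system U} {FF : Filter F}
    (f : 'I_d -> U -> R) (a : 'I_d -> R) :
  (forall c, f c u @[u --> F] --> a c) ->
  ((\row_c f c u) : 'rV[R]_d) @[u --> F] --> ((\row_c a c) : 'rV[R]_d).
Proof.
move=> h; apply/cvgrPdist_lt => e e0.
have : \forall u \near F, forall c, `|a c - f c u| < e.
  by apply: filter_forall => c; move/cvgrPdist_lt : (h c); apply.
apply: filterS => u hu; rewrite [ltLHS]/Num.norm/= mx_normrE.
by apply: bigmax_lt => // -[i j] _; rewrite !mxE.
Qed.

Lemma ae_fst {R : realType} {d1 d2} {O1 : measurableType d1} {O2 : measurableType d2}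
    (P1 : probability O1 R) (P2 : probability O2 R) (G : O1 -> Prop) :
  {ae P1, forall x, G x} -> {ae pprod P1 P2, forall w, G w.1}.
Proof.
move=> [N [mN N0 hN]]; exists (N `*` setT); split => [||w /= nG].
- exact: measurableX.
- apply/(Ex_indic_eq0 (pprod P1 P2) (measurableX mN measurableT)).
  rewrite Ex_pprod; last by apply: brv_indic; apply: measurableX.
  have e : Ex P1 \1_N = 0 by apply/(Ex_indic_eq0 P1 mN).
  rewrite -[RHS]e.
  congr (Ex P1 _); apply/funext => x; rewrite -[RHS](Ex_cst P2).
  by congr (Ex P2 _); apply/funext => y; rewrite !indicE in_setX in_setT andbT.
- by split => //; exact: hN.
Qed.

Lemma ae_snd {R : realType} {d1 d2} {O1 : measurableType d1} {O2 : measurableType d2}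
    (P1 : probability O1 R) (P2 : probability O2 R) (G : O2 -> Prop) :
  {ae P2, forall x, G x} -> {ae pprod P1 P2, forall w, G w.2}.
Proof.
move=> [N [mN N0 hN]]; exists (setT `*` N); split => [||w /= nG].
- exact: measurableX.
- apply/(Ex_indic_eq0 (pprod P1 P2) (measurableX measurableT mN)).
  rewrite Ex_pprod; last by apply: brv_indic; apply: measurableX.
  rewrite -[RHS](Ex_cst P1); congr (Ex P1 _); apply/funext => x.
  have e : Ex P2 \1_N = 0 by apply/(Ex_indic_eq0 P2 mN).
  rewrite -[RHS]e.
  by congr (Ex P2 _); apply/funext => y; rewrite !indicE in_setX in_setT.
- by split => //; exact: hN.
Qed.

Section limit_target.
Context {R : realType} {d : nat} {gamma : R}.
Local Notation T := 'rV[R]_d.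
Local Notation leb := (lebesgue_rV R d).
Variables (B : bool -> T -> T -> R) (B0 : T -> T -> R).
Hypotheses (hB : forall a, edge_kernel (B a)) (hB0 : edge_kernel B0).
Hypothesis npos : near_pos B B0.
Variables (nu mu0 : probability (borel T) R).
Hypotheses (acmu0 : mu0 `<< leb) (acnu : nu `<< leb).
Context {dO : measure_display} {O : measurableType dO} (Q : probability O R).
Variable Z0 : nat -> O -> T.
Hypothesis mZ0 : forall s, measurable_fun setT (Z0 s : O -> borel T).

Definition mf s (x : nat -> T) : T := mean_field B B0 (@path_law _ _ _ Q d Z0 s) x.

Definition drift s (x : nat -> T) : T := (1 - gamma) *: x s + gamma *: mf s x.

Lemma measurable_mf s {d'} {O' : measurableType d'} (X : nat -> O' -> T) :
  (forall r, (r <= s)%N -> measurable_fun setT (X r : O' -> borel T)) ->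
  measurable_fun setT ((fun w => mf s (X ^~ w)) : O' -> borel T).
Proof.
move=> mX; apply: measurable_rV => c.
rewrite (_ : (fun w => _) = fun w => (mfU B B0 Q Z0 s (fun=> 1) (X ^~ w))^-1 *
   mfU B B0 Q Z0 s (fun y => y ord0 c) (X ^~ w)); last first.
  by apply/funext => w; rewrite /mf (mean_fieldE hB hB0 Q mZ0) !mxE.
apply: measurable_funM; last first.
  by apply: measurable_mfU => //; apply: measurable_coord; exact: measurable_id.
apply: (measurableT_comp measurable_inv).
by apply: (@measurable_mfU _ _ _ _ hB hB0 _ _ _ _ mZ0 s (fun=> 1)).
Qed.

Lemma measurable_drift s {d'} (O' : measurableType d') (X : nat -> O' -> T) :
  (forall r, (r <= s)%N -> measurable_fun setT (X r : O' -> borel T)) ->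
  measurable_fun setT ((fun w => drift s (X ^~ w)) : O' -> borel T).
Proof.
move=> mX; apply: measurable_addV; apply: measurable_scaleV; first exact: mX.
exact: measurable_mf.
Qed.

Let mdrift s d' (O' : measurableType d') X := @measurable_drift s d' O' X.

Hypothesis w1 : wls mu0 nu drift Q (fun _ : 'I_1 => Z0).

(* The [X i] are only required to have the almost sure properties of [Z0]. *)
Definition copies {K : nat} {d'} {O' : measurableType d'} (Q' : probability O' R)
    (X : 'I_K -> nat -> O' -> T) := forall i (G : (nat -> T) -> Prop),
  {ae Q, forall w, G (Z0 ^~ w)} -> {ae Q', forall w, G (X i ^~ w)}.

Lemma copies_prod {K1 K2 : nat} {d1 d2} {O1 : measurableType d1} {O2 : measurableType d2}
    (Q1 : probability O1 R) (Q2 : probability O2 R)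
    (X1 : 'I_K1 -> nat -> O1 -> T) (X2 : 'I_K2 -> nat -> O2 -> T) :
  copies Q1 X1 -> copies Q2 X2 -> copies (pprod Q1 Q2) (joinX X1 X2).
Proof.
move=> h1 h2 i G hG; rewrite -(splitK i); case: (fintype.split i) => j /=.
  apply: filterS (ae_fst Q2 (h1 j G hG)) => w hw.
  by rewrite (_ : _ ^~ w = X1 j ^~ w.1)//; apply/funext => s; exact: joinXl.
apply: filterS (ae_snd Q1 (h2 j G hG)) => w hw.
by rewrite (_ : _ ^~ w = X2 j ^~ w.2)//; apply/funext => s; exact: joinXr.
Qed.

Lemma copies1 : copies Q (fun _ : 'I_1 => Z0).
Proof. by move=> i G. Qed.

(** One independent copy of [Z0] is added at a time on a product space. *)
Lemma wls_power K : exists d' (O' : measurableType d') (Q' : probability O' R)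
  (X : 'I_K.+1 -> nat -> O' -> T), wls mu0 nu drift Q' X /\ copies Q' X.
Proof.
elim: K => [|K [d' [ O' [Q' [X [wX cX]]]]]].
  by exists dO, O, Q, (fun _ : 'I_1 => Z0); split; [exact: w1|exact: copies1].
exists _, (O * O')%type, (pprod Q Q'), (@joinX R d 1 K.+1 _ _ O O' (fun _ : 'I_1 => Z0) X).
split; first exact: (wls_prod mdrift w1 wX).
exact: (copies_prod copies1 cX).
Qed.

Definition integrable_coords s := forall c,
  Q.-integrable setT (EFin \o (fun w => Z0 s w ord0 c)).

Section continuity_of_the_drift.
Context {K : nat} {d'} {O' : measurableType d'} (Q' : probability O' R).
Variable X : 'I_K -> nat -> O' -> T.
Hypotheses (wX : wls mu0 nu drift Q' X) (cX : copies Q' X).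

Lemma ae_arr_cont_mfU s u : measurable_fun setT (u : borel T -> R) ->
  Q.-integrable setT (EFin \o (fun w => u (Z0 s w))) ->
  {ae Q', forall w, forall i,
    arr_cont s (fun y => mfU B B0 Q Z0 s u (y i)) (fun i r => X i r w)}.
Proof.
move=> mu iu; apply: filter_forall => i.
have ac1 r : ac_rv Q (Z0 r) by exact: (wls_ac acmu0 acnu w1 ord0 r).
have ac2 r : ac_rv Q' (X i r) by exact: (wls_ac acmu0 acnu wX i r).
apply: filterS (ae_econt_ac hB hB0 s ac2 ac1) => w hw.
exact: (arr_cont_mfU hB hB0 mZ0 mu iu).
Qed.

Lemma ae_mf_gt0 s : {ae Q', forall w, forall i, 0 < mfU B B0 Q Z0 s (fun=> 1) (X i ^~ w)}.
Proof.
apply: filter_forall => i.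
exact: (@cX i (fun x => 0 < mfU B B0 Q Z0 s (fun=> 1) x)
  (mfU1_gt0 hB hB0 Q mZ0 s npos)).
Qed.

(** The drift contains a quotient of integrals. These are continuous because almost every trajectory
    of [X] meets almost every trajectory of [Z0] at continuity points of the kernels; the
    denominator is positive along [Z0], and [copies] transports this to [X]. *)
Lemma ae_drift_cont s : integrable_coords s ->
  {ae Q', forall w, forall i, (fun y : 'I_K -> nat -> T => drift s (y i)) @
     arr_near s (fun i r => X i r w) --> drift s (X i ^~ w)}.
Proof.
move=> ic.
have i1 : Q.-integrable setT (EFin \o (fun w => (fun=> 1 : R) (Z0 s w))).
  exact: (brv_integrable Q (brv_cst 1)).
have h1 := ae_arr_cont_mfU (s := s) (u := fun=> 1) (measurable_cst _) i1.
have h2 : {ae Q', forall w, forall c i, arr_cont s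
    (fun y => mfU B B0 Q Z0 s (fun x => x ord0 c) (y i)) (fun i r => X i r w)}.
  apply: filter_forall => c; apply: ae_arr_cont_mfU; last exact: ic.
  by apply: measurable_coord; exact: measurable_id.
apply: filterS3 h1 h2 (ae_mf_gt0 s) => w h1w h2w posw i; rewrite /drift.
apply: cvgD; apply: cvgZr; first exact: arr_near_coord.
rewrite /mf; under eq_cvg do rewrite (mean_fieldE hB hB0 Q mZ0).
rewrite (mean_fieldE hB hB0 Q mZ0); apply: cvgZ.
  by apply: cvgV; [rewrite gt_eqF|exact: h1w].
by apply: cvg_row => c; exact: h2w.
Qed.

End continuity_of_the_drift.

End limit_target.

Section limit_process_theory.
Context {R : realType} {d k : nat} {gamma : R}.
Local Notation T := 'rV[R]_d.
Local Notation leb := (lebesgue_rV R d).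
Variables (B : bool -> T -> T -> R) (B0 : T -> T -> R).
Hypotheses (hB : forall a, edge_kernel (B a)) (hB0 : edge_kernel B0).
Hypothesis npos : near_pos B B0.
Variables (nu mu0 : probability (borel T) R).
Hypotheses (acmu0 : mu0 `<< leb) (acnu : nu `<< leb).
Context {dO : measure_display} {O : measurableType dO} (Q : probability O R).
Variables (zeta Z : 'I_k.+1 -> nat -> O -> T) (A : 'I_k.+1 -> 'I_k.+1 -> nat -> O -> bool).
Hypothesis lp : limit_process Q gamma B B0 mu0 nu zeta Z A.

Local Notation drift := (@drift R d gamma B B0 dO O Q (Z ord0)).

Let mZ i s : measurable_fun setT (Z i s : O -> borel T).
Proof. by case: (lp_measurable lp) => + _; exact. Qed.

Let mdrift s d' (O' : measurableType d') X :
  (forall r, (r <= s)%N -> measurable_fun setT (X r : O' -> borel T)) ->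
  measurable_fun setT ((fun w => drift s (X ^~ w)) : O' -> borel T).
Proof. exact: measurable_drift. Qed.

Let edgeA (i j : 'I_k.+1) s : (i < j)%N ->
  is_cond_prob Q (filtrationA Z A s) (A i j s @^-1` [set true])
    (fun w => eker B B0 s (A i j s.-1 w) (Z i s w) (Z j s w)).
Proof. by move=> /(lp_edge lp) h; have := h s; case: s. Qed.

(** [e] selects agents: a single one for the law of the trajectory, all of them for the
    identification of the limit. *)
Let limit_step {k'} (e : 'I_k' -> 'I_k.+1) s (psi : 'I_k' -> borel T -> R)
    (g : g_sigma_algebraType (hgen Z A [set r | (r <= s)%N] [set r | (r <= s)%N]) -> R) :
  injective e -> urv g -> (forall i, urv (psi i)) ->
  Ex Q (fun w => (g : O -> R) w * \prod_i psi i (Z (e i) s.+1 w)) =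
  Ex Q (fun w => (g : O -> R) w * \prod_i smooth nu (psi i) (drift s (Z (e i) ^~ w))).
Proof.
move=> ie ug upsi.
have stateE w i : Z (e i) s.+1 w = drift s (Z (e i) ^~ w) + zeta (e i) s w.
  exact: lp_state lp _ _ _.
under eq_fun do under eq_bigr do rewrite stateE.
have mY i : measurable_fun setT ((fun w => drift s (Z (e i) ^~ w)) :
    g_sigma_algebraType (hgen Z A [set r | (r <= s)%N] [set r | (r <= s)%N]) -> borel T).
  by apply: mdrift => r rs; apply: hist_Z.
have ii : injective (fun i : 'I_k' => (e i, s)) by move=> i j [/ie].
have indep : independent Q (sigma_gen (fun i => zeta i s : O -> borel T)) (filtration Z A s).
  exact: lp_noise_indep lp _.
exact: (Ex_noise_step (lp_measurable lp) (xi := fun p : 'I_k.+1 * nat => zeta p.1 p.2)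
  (sub := fun j => (j, s)) (pre := e) (lp_noise_iid lp) ii (fun=> erefl)
  indep mY ug upsi).
Qed.

(** The initial positions are treated as noises of law [mu0] added to [Y = 0], with a trivial past
    consisting of constants. *)
Let limit_init {k'} (e : 'I_k' -> 'I_k.+1) (psi : 'I_k' -> borel T -> R) :
  injective e -> (forall i, urv (psi i)) ->
  Ex Q (fun w => \prod_i psi i (Z (e i) 0%N w)) = \prod_i Ex mu0 (psi i).
Proof.
move=> ie upsi.
pose G := [set g : O -> R | exists2 c : R, 0 <= c <= 1 & g = fun=> c].
have Gu g : G g -> urv g.
  by move=> [c c01 ->]; split; [exact: measurable_cst|].
have GY g (i : 'I_k') (phi : borel T -> R) : G g -> urv phi -> G (fun w => g w * phi 0).
  move=> [c /andP[c0 c1] ->] [_ /(_ 0)/andP[p0 p1]].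
  by exists (c * phi 0) => //; rewrite mulr_ge0// mulr_ile1.
have Gxi g (V : 'I_k' -> set (borel T)) : G g -> (forall i, measurable (V i)) ->
    Ex Q (fun w => g w * \prod_i \1_(V i) (Z (e i) 0%N w)) =
    Ex Q g * \prod_i Ex mu0 (\1_(V i)).
  move=> [c _ ->] mV; rewrite Ex_cst ExZ; last first.
    apply: brv_prod => i; apply/urv_brv; have [m1 h1] := urv_indic (R := R) (mV i).
    by split => //; exact: measurableT_comp m1 (mZ _ _).
  congr (_ * _).
  have -> : (fun w => \prod_i (\1_(V i) (Z (e i) 0%N w) : R)) =
      \1_(\bigcap_i (Z (e i) 0%N @^-1` V i)).
    apply/funext => w; rewrite indicE.
    have [h'|h'] := pselect (forall i, V i (Z (e i) 0%N w)).
      rewrite [in RHS]mem_set; last by move=> i _; exact: h'.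
      by rewrite big1// => i _; rewrite indicE mem_set//; exact: h'.
    rewrite memNset => [|h'']; last by apply: h' => i; exact: h''.
    by move/existsNP : h' => [i Vi]; rewrite (bigD1 i)//= indicE memNset ?mul0r.
  rewrite Ex_indic; last first.
    apply: fin_bigcap_measurable => // i _.
    by rewrite -[X in measurable X]setTI; exact: mZ.
  rewrite (iid_bigcap (lp_init lp) ie mV) fine_prod_fin => [|i]; last exact: fin_num_measure.
  by apply: eq_bigr => i _; rewrite Ex_indic.
have G1 : G (fun=> 1) by exists 1 => //; rewrite ler01 lexx.
have := noise_integration (Y := fun (_ : 'I_k') _ => 0) (fun _ => measurable_cst _)
  (fun i => mZ (e i) 0%N) Gu GY Gxi G1 upsi.
under eq_fun do (rewrite mul1r; under eq_bigr do rewrite add0r).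
move=> ->; rewrite (_ : (fun w => _) = fun=> \prod_i smooth mu0 (psi i) 0); last first.
  by apply/funext => w; rewrite mul1r.
rewrite Ex_cst; apply: eq_bigr => i _; rewrite /smooth.
by congr (Ex mu0 _); apply/funext => x; rewrite add0r.
Qed.

Lemma limit_wls : wls mu0 nu drift Q (fun _ : 'I_1 => Z ord0).
Proof.
have ie : injective (fun _ : 'I_1 => ord0 : 'I_k.+1).
  by move=> i j _; rewrite (ord1 i) (ord1 j).
split=> [i s|psi upsi|s g psi ug upsi]; first exact: mZ.
  exact: (limit_init ie upsi).
apply: (limit_step (g := fun w => g (fun _ r => Z ord0 r w)) ie) => //.
by apply: (umf_urv (s := s) _ ug) => i r rs; apply: hist_Z.
Qed.

Section identification.
Context {d'} {O' : measurableType d'} (Q' : probability O' R).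
Variable X : 'I_k.+1 -> nat -> O' -> T.
Hypotheses (wX : wls mu0 nu drift Q' X) (cX : copies Q (Z ord0) Q' X).
Hypothesis ic : forall s, integrable_coords Q (Z ord0) s.

(* The limiting process is a constant sequence to which the induction scheme of
   the finite networks applies. *)
Lemma limit_identification s a (f : ('I_k.+1 -> nat -> T) -> R) :
  bmf s f -> ae_cont Q' X s f ->
  Ex Q (fun w => f (fun i r => Z i r w) * ind A id s.+1 a w) =
  Ex Q' (fun w => f (fun i r => X i r w) * wt B B0 s.+1 a (fun i r => X i r w)).
Proof.
move=> bf cf.
pose En r (n : nat) a (f : ('I_k.+1 -> nat -> T) -> R) :=
  Ex Q (fun w => f (fun i r => Z i r w) * ind A id r a w).
have bZ q g : bmf q g -> brv (fun w => g (fun i r => Z i r w)).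
  by apply: bmf_brv => i r _; exact: mZ.
have bind r b : brv (ind A id r b : O -> R).
  have := @urv_ind _ _ R d k.+1 Z A k.+1 id setT setT r b (fun _ _ => Logic.I).
  by move=> /urv_brv; exact/brv_sub/(hgen_sub (lp_measurable lp)).
have bb q g r b : bmf q g -> brv (fun w => g (fun i r => Z i r w) * ind A id r b w).
  by move=> bg; apply: brvM; [exact: bZ bg|].
have key : edge_cvg B B0 Q' X (En s.+1) s.+1 s.
  apply: (edge_cvg_all hB hB0 mdrift acmu0 acnu wX).
  - move=> r n b q g h bg bh; rewrite /En -ExD; [|exact: bb bg|exact: bb bh].
    by congr (Ex Q _); apply/funext => w; rewrite mulrDl.
  - move=> r n b q c g bg; rewrite /En -ExZ; last exact: bb bg.
    by congr (Ex Q _); apply/funext => w; rewrite mulrA.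
  - move=> r n b q g h bg bh gh; apply: Ex_le; [exact: bb bg|exact: bb bh|].
    by move=> w; rewrite ler_wpM2r//; case/andP: (ind01 (R := R) A id r b w).
  - move=> b psi upsi; rewrite /En.
    rewrite (_ : (fun n : nat => _) = fun=> \prod_i Ex mu0 (psi i)); first exact: cvg_cst.
    apply/funext => n; rewrite -(limit_init (e := id) _ (fun i => ulip_urv (upsi i)))//.
    by congr (Ex Q _); apply/funext => w; rewrite /ind big_ord0 mulr1.
  - move=> q b g bg; rewrite (_ : (fun n : nat => _) = fun=> 0); first exact: cvg_cst.
    apply/funext => n; rewrite /En (Ex_edge_step hB hB0 (lp_measurable lp) (lp_graph lp)
      (lp_edges lp) edgeA (@inj_id _) b bg).
    by rewrite subrr.
  - by move=> q _; exact: (ae_drift_cont hB hB0 npos acmu0 acnu (mZ ord0) limit_wls wX cX).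
  - move=> q _ b phi psi uphi cphi upsi.
    rewrite (_ : (fun n : nat => _) = fun=> 0); first exact: cvg_cst.
    apply/funext => n; rewrite /En.
    pose g w := phi (fun i r => Z i r w) * ind A id q.+1 b w.
    have ug : urv (g : g_sigma_algebraType
        (hgen Z A [set r | (r <= q)%N] [set r | (r <= q)%N]) -> R).
      apply: urvM; last by apply: urv_ind.
      by apply: (umf_urv (s := q) _ uphi) => i r rq; apply: hist_Z.
    have e1 (F : O -> R) : (fun w => phi (fun i r => Z i r w) * F w * ind A id q.+1 b w) =
       (fun w => g w * F w) by apply/funext => w; rewrite /g mulrAC.
    rewrite !e1 (limit_step (e := id) (@inj_id _) ug) ?subrr// => i.
    exact: ulip_urv.
have := key a f bf cf; rewrite /En => h.
exact: (cvg_unique _ (cvg_cst _) h).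
Qed.

End identification.
End limit_process_theory.

(** * Finite networks *)

Lemma cvg0_le {R : realType} (x y : nat -> R) : (forall n, `|x n| <= y n) ->
  y n @[n --> \oo] --> 0 -> x n @[n --> \oo] --> 0.
Proof.
move=> xy y0; apply: norm_cvg0; apply: (@squeeze_cvgr _ _ _ _ (fun=> 0) y _ _ 0) => //.
  by near=> n; rewrite normr_ge0 xy.
exact: cvg_cst.
Unshelve. all: by end_near. Qed.

Lemma savg_Ex {R : realType} {K n : nat} {dO} {O : measurableType dO}
    (P : probability O R) (F : {ffun 'I_K -> 'I_n.+1} -> O -> R) :
  (forall m, brv (F m)) ->
  savg (fun m => Ex P (F m)) = Ex P (fun w => savg (fun m => F m w)).
Proof. by move=> bF; rewrite /savg ExZ ?Ex_sum//; exact: brv_sum. Qed.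

Lemma noninjective_cvg {R : realType} {K : nat} :
  savg (fun m : {ffun 'I_K -> 'I_n.+1} => (~~ injectiveb m)%:R : R) @[n --> \oo] --> 0.
Proof.
apply: (@cvg0_le _ _ (fun n => #|{: pairs K}|%:R * harmonic n)) => [n|].
  rewrite ger0_norm; first exact: savg_noninjective.
  by rewrite /savg mulr_ge0 ?invr_ge0 ?exprn_ge0// sumr_ge0.
by rewrite -[X in _ --> X](mulr0 #|{: pairs K}|%:R); apply: cvgMr; exact: cvg_harmonic.
Qed.

Lemma savg_injective_cvg {R : realType} {K : nat}
    (x y : forall n, {ffun 'I_K -> 'I_n.+1} -> R) (M : R) :
  (forall n m, `|x n m - y n m| <= M) ->
  (forall n (m : {ffun 'I_K -> 'I_n.+1}), injective m -> x n m = y n m) ->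
  savg (x n) - savg (y n) @[n --> \oo] --> 0.
Proof.
move=> xyM xy; apply: (@cvg0_le _ _ (fun n =>
   M * savg (fun m : {ffun 'I_K -> 'I_n.+1} => (~~ injectiveb m)%:R : R))) => [n|].
  have -> : savg (x n) - savg (y n) = savg (fun m => x n m - y n m).
    by rewrite /savg sumrB mulrBr.
  rewrite (le_trans (savg_norm _))// -savgZ; apply: savg_le => m.
  case: (injectiveP m) => [/xy ->|_]; first by rewrite subrr normr0 mulr0.
  by rewrite mulr1.
by rewrite -[X in _ --> X](mulr0 M); apply: cvgMr; exact: noninjective_cvg.
Qed.

Section finite_model.
Context {R : realType} {d : nat} {gamma : R}.
Local Notation T := 'rV[R]_d.
Variables (B : bool -> T -> T -> R) (B0 : T -> T -> R).
Hypotheses (hgamma : 0 < gamma < 1) (hB : forall a, edge_kernel (B a)).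
Variables (nu mu0 : probability (borel T) R).
Context {dO : measure_display} {Om : measurableType dO} (P : probability Om R).
Variables (xi : nat -> nat -> Om -> T) (Z : forall n, 'I_n.+1 -> nat -> Om -> T).
Variable A : forall n, 'I_n.+1 -> 'I_n.+1 -> nat -> Om -> bool.
Hypothesis hmodel : forall n, agent_model P gamma B xi (@Z n) (@A n).
Hypothesis h1 : assumption1 P xi Z A nu.
Hypothesis h2 : assumption2 P B0 Z A mu0.
Hypothesis h3 : assumption3 P B B0 xi Z.
Context {K : nat}.
Local Notation arr := ('I_K -> nat -> T).
Local Notation arrZ n m w := (fun i r => @Z n (m i) r w).
Local Notation sample n := {ffun 'I_K -> 'I_n.+1}.
Let hB0 : edge_kernel B0 := a2_kernel h2.
Let nm n := @model_network R d gamma B _ _ P xi Z A hmodel n.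

Let mZ n i s : measurable_fun setT (@Z n i s : Om -> borel T).
Proof. by case: (nm n). Qed.

Let edgeA n (i j : 'I_n.+1) s : (i < j)%N ->
  is_cond_prob P (filtrationA (@Z n) (@A n) s) (@A n i j s @^-1` [set true])
    (fun w => eker B B0 s (@A n i j s.-1 w) (@Z n i s w) (@Z n j s w)).
Proof. exact: model_edge hmodel h2 _ _ _ _. Qed.

Definition En r n (a : nat -> pairs K -> bool) (f : arr -> R) : R :=
  savg (fun m : sample n => Ex P (fun w => f (arrZ n m w) * ind (@A n) m r a w)).

Let bZ q g n (m : sample n) : bmf q g -> brv (fun w => g (arrZ n m w)).
Proof. by apply: bmf_brv => i r _; exact: mZ. Qed.

Let bind n (m : sample n) r a : brv (ind (@A n) m r a : Om -> R).
Proof.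
have := @urv_ind _ _ R d n.+1 (@Z n) (@A n) K m setT setT r a (fun _ _ => Logic.I).
by move=> /urv_brv; exact/brv_sub/(hgen_sub (@nm n)).
Qed.

Let bb q g n (m : sample n) r a :
  bmf q g -> brv (fun w => g (arrZ n m w) * ind (@A n) m r a w).
Proof. by move=> bg; apply: brvM => //; exact: bZ bg. Qed.

Lemma EnD r n a s f g : bmf s f -> bmf s g ->
  En r n a (fun z => f z + g z) = En r n a f + En r n a g.
Proof.
move=> bf bg; rewrite /En -savgD; congr savg; apply/funext => m.
rewrite -ExD; [|exact: bb bf|exact: bb bg].
by congr (Ex P _); apply/funext => w; rewrite mulrDl.
Qed.

Lemma EnZ r n a s c f : bmf s f -> En r n a (fun z => c * f z) = c * En r n a f.
Proof.
move=> bf; rewrite /En -savgZ; congr savg; apply/funext => m.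
rewrite -ExZ; last exact: bb bf.
by congr (Ex P _); apply/funext => w; rewrite mulrA.
Qed.

Lemma En_le r n a s f g : bmf s f -> bmf s g -> (forall z, f z <= g z) ->
  En r n a f <= En r n a g.
Proof.
move=> bf bg fg; apply: savg_le => m; apply: Ex_le; [exact: bb bf|exact: bb bg|].
by move=> w; rewrite ler_wpM2r//; case/andP: (ind01 (R := R) (@A n) m r a w).
Qed.

Lemma empirical_integral n (psi : T -> R) w : ulip psi ->
  \int[empirical (fun i : 'I_n.+1 => @Z n i 0%N w : borel T)]_x psi x =
  n.+1%:R^-1 * \sum_j psi (@Z n j 0%N w).
Proof.
move=> lp; have [mp _] := ulip_urv lp; have [p01 _] := lp.
have mP : measurable_fun setT (EFin \o (psi : borel T -> R)) by exact/measurable_EFinP.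
have P0 x : setT x -> (0 <= (EFin \o (psi : borel T -> R)) x)%E.
  by move=> _; rewrite lee_fin; case/andP: (p01 x).
rewrite /Rintegral /empirical (ge0_integral_mscale _ measurableT)//.
rewrite (ge0_integral_measure_sum _ measurableT)//.
under eq_bigr do rewrite (integral_dirac _ measurableT)// diracT mul1e inord_val.
by rewrite sumEFin -EFinM.
Qed.

(** Averaged over samples with replacement, a product becomes the product of the empirical means.
    Each is close to its limit outside the event [bad n], whose probability vanishes by convergence
    of the empirical measure. *)
Lemma En_init a (psi : 'I_K -> T -> R) : (forall i, ulip (psi i)) ->
  En 0 n a (fun z => \prod_i psi i (z i 0%N)) @[n --> \oo] --> \prod_i Ex mu0 (psi i).
Proof.
move=> upsi.
have bpsi n i j : brv (fun w => psi i (@Z n j 0%N w)).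
  by apply: (brv_comp (urv_brv (ulip_urv (upsi i)))); exact: mZ.
pose av n i w := n.+1%:R^-1 * \sum_j psi i (@Z n j 0%N w).
have bav n i : brv (av n i) by apply: brvZ; exact: brv_sum.
have EnE n : En 0 n a (fun z => \prod_i psi i (z i 0%N)) =
    Ex P (fun w => \prod_i av n i w).
  rewrite /En savg_Ex; last first.
    by move=> m; apply: brvM => //; exact: brv_prod.
  congr (Ex P _); apply/funext => w; rewrite -savg_prod; congr savg.
  by apply/funext => m; rewrite /ind big_ord0 mulr1.
under eq_fun do rewrite EnE.
apply/cvgrPdist_le => e e0.
have K0 : 0 < (K.+1)%:R :> R by [].
(* The [K] factors contribute at most [e / 2] together; [K.+1] keeps the quotient positive for
   [K = 0]. *)
pose e' := e / 2 / K.+1%:R; have e'0 : 0 < e' by rewrite !divr_gt0.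
pose bad n := [set w | ~ forall l,
   `|(\int[empirical (fun i : 'I_n.+1 => @Z n i 0%N w : borel T)]_x psi l x) -
     (\int[mu0]_x psi l x)| < e'].
have badE n : bad n = ~` \bigcap_(l : 'I_K)
    ((fun w => `|av n l w - Ex mu0 (psi l)|) @^-1` `]-oo, e'[%classic).
  apply/seteqP; split => w; rewrite /bad /setC /=.
    by apply: contra_not => h l; rewrite (empirical_integral _ _ (upsi l));
      have := h l Logic.I; rewrite /= in_itv.
  apply: contra_not => h l _ /=; rewrite in_itv /=.
  by have := h l; rewrite (empirical_integral _ _ (upsi l)).
have mbad n : measurable (bad n).
  rewrite badE; apply: measurableC; apply: fin_bigcap_measurable => // l _.
  rewrite -[X in measurable X]setTI.
  have [+ _] := brv_norm (brvB (bav n l) (brv_cst (Ex mu0 (psi l)))).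
  by apply => //; exact: measurable_itv.
have Pbad : fine (P (bad n)) @[n --> \oo] --> 0.
  apply: fine_cvg; apply: (a2_empirical h2) => // l; split.
    exact: ulip_continuous.
  by exists 1 => x; have [/(_ x)/andP[p0 p1] _] := upsi l; rewrite ger0_norm.
have e20 : 0 < e / 2 by rewrite divr_gt0.
move/cvgrPdist_le : Pbad => /(_ _ e20); apply: filterS => n.
rewrite sub0r normrN => hn; rewrite distrC.
have av01 i w : 0 <= av n i w <= 1.
  have h01 j : 0 <= psi i (@Z n j 0%N w) <= 1 by have [h _] := upsi i.
  rewrite avg_ge0/=; last by move=> j; case/andP: (h01 j).
  rewrite /av [leLHS]mulrC ler_pdivrMr// mul1r -[leRHS]mulr1 mulr_natl -[n.+1 in leRHS]card_ord.
  by rewrite -sumr_const; apply: ler_sum => j _; case/andP: (h01 j).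
have Ex01 i : 0 <= Ex mu0 (psi i) <= 1 by apply: Ex_urv; exact: ulip_urv.
rewrite -[\prod_i Ex mu0 (psi i)](Ex_cst P) -ExB; [|exact: brv_prod|exact: brv_cst].
have bd : brv (fun w => \prod_i av n i w - \prod_i Ex mu0 (psi i)).
  by apply: brvB; [exact: brv_prod|exact: brv_cst].
apply: (le_trans (Ex_norm P bd)).
apply: (@le_trans _ _ (Ex P (fun w => e / 2 + \1_(bad n) w))).
  apply: Ex_le; [exact: brv_norm|by apply: brvD; [exact: brv_cst|exact: brv_indic]|].
  move=> w; rewrite indicE; have [wb|wb] := boolP (w \in bad n).
    rewrite ler_wpDl ?(ltW e20)//.
    have p1 : 0 <= \prod_i av n i w <= 1.
      rewrite prodr_ge0 => [|i _]; last by case/andP: (av01 i w).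
      by apply: Num.Theory.prodr_ile1 => i _.
    have p2 : 0 <= \prod_i Ex mu0 (psi i) <= 1.
      rewrite prodr_ge0 => [|i _]; last by case/andP: (Ex01 i).
      by apply: Num.Theory.prodr_ile1 => i _.
    move: p1 p2 => /andP[? ?] /andP[? ?]; rewrite ler_norml -[true%:R]/(1 : R).
    by apply/andP; split; lra.
  rewrite addr0 (le_trans (prod_unit_dist_big _ (av01 ^~ w) Ex01))//.
  apply: (@le_trans _ _ (\sum_(l < K) e')).
    apply: ler_sum => l _; apply: ltW.
    have /contrapT/(_ l) : ~ ~ forall l, `|(\int[empirical (fun i : 'I_n.+1 =>
      @Z n i 0%N w : borel T)]_x psi l x) - (\int[mu0]_x psi l x)| < e'.
      by move=> h; move: wb; rewrite notin_setE; apply.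
    by rewrite (empirical_integral _ _ (upsi l)).
  rewrite sumr_const card_ord -[leLHS]mulr_natl /e' mulrCA -[leRHS]mulr1 ler_wpM2l ?(ltW e20)//.
  by rewrite ler_pdivrMr// mul1r ler_nat.
rewrite ExD; [|exact: brv_cst|exact: brv_indic]; rewrite Ex_cst Ex_indic//.
by have := ler_norm (fine (P (bad n))); lra.
Qed.

Lemma En_edge s a f : bmf s f ->
  En s.+1 n a f - En s n a (fun z => f z * stepwt B B0 s a z) @[n --> \oo] --> 0.
Proof.
move=> bf; have [_ [M hM]] := bf.
have us := @stepwt_umf _ _ B B0 hB hB0 K s s a (leqnn s).
have bfs := bmfM bf (umf_bmf us).
have M0 : 0 <= M by apply: le_trans (hM (fun _ _ => 0)).
apply: (savg_injective_cvg (M := M + M)) => [n m|n m im]; last first.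
  exact: (Ex_edge_step hB hB0 (@nm n) (a1_graph h1 n) (@a1_edges _ _ _ _ _ _ _ _ _ h1 n)
    (@edgeA n) im a bf).
rewrite (le_trans (ler_normB _ _))// lerD//; apply: Ex_bound.
- exact: bb bf.
- move=> w; have /andP[i0 i1] := ind01 (R := R) (@A n) m s.+1 a w.
  by rewrite normrM (ger0_norm i0) (le_trans (ler_piMr _ i1)).
- exact: bb bfs.
- move=> w; have /andP[i0 i1] := ind01 (R := R) (@A n) m s a w.
  have /andP[u0 u1] := us.2 (arrZ n m w).
  rewrite !normrM (ger0_norm i0) (ger0_norm u0) -mulrA.
  by rewrite (le_trans _ (hM (arrZ n m w)))// ler_piMr// mulr_ile1.
Qed.

End finite_model.

Lemma unit_dist_le1 {R : realDomainType} (x y : R) : 0 <= x <= 1 -> 0 <= y <= 1 ->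
  `|x - y| <= 1.
Proof. by move=> /andP[? ?] /andP[? ?]; rewrite ler_norml; apply/andP; split; lra. Qed.

Section finite_noise_step.
Context {R : realType} {d : nat} {gamma : R}.
Local Notation T := 'rV[R]_d.
Variables (B : bool -> T -> T -> R) (B0 : T -> T -> R).
Hypotheses (hgamma : 0 < gamma < 1) (hB : forall a, edge_kernel (B a)).
Variables (nu mu0 : probability (borel T) R).
Context {dO : measure_display} {Om : measurableType dO} (P : probability Om R).
Variables (xi : nat -> nat -> Om -> T) (Z : forall n, 'I_n.+1 -> nat -> Om -> T).
Variable A : forall n, 'I_n.+1 -> 'I_n.+1 -> nat -> Om -> bool.
Hypothesis hmodel : forall n, agent_model P gamma B xi (@Z n) (@A n).
Hypothesis h1 : assumption1 P xi Z A nu.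
Hypothesis h2 : assumption2 P B0 Z A mu0.
Hypothesis h3 : assumption3 P B B0 xi Z.
Context {dQ : measure_display} {OQ : measurableType dQ} (Q : probability OQ R).
Variable Z0 : nat -> OQ -> T.
Hypothesis mZ0 : forall s, measurable_fun setT (Z0 s : OQ -> borel T).
Local Notation mfs := (mf B B0 Q Z0).
Local Notation dft := (drift (gamma := gamma) B B0 Q Z0).
Let hB0 : edge_kernel B0 := a2_kernel h2.
Let nm n := @model_network R d gamma B _ _ P xi Z A hmodel n.

Let mZ n i s : measurable_fun setT (@Z n i s : Om -> borel T).
Proof. by case: (nm n). Qed.

Definition mean_gap s n (i : 'I_n.+1) w : R :=
  l1 (local_mean (@Z n) (@A n) i s w - mfs s (@Z n i ^~ w)).

Lemma measurable_mean_gap s n i : measurable_fun setT (@mean_gap s n i).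
Proof.
apply: measurable_l1; rewrite (_ : (fun w => _) = fun w =>
  local_mean (@Z n) (@A n) i s w + (-1) *: mfs s (@Z n i ^~ w)); last first.
  by apply/funext => w; rewrite scaleN1r.
apply: measurable_addV; first exact: (measurable_local_mean (@nm n) i s).
by apply: measurable_scaleV; apply: measurable_mf.
Qed.

Lemma brv_mean_gap s n i : brv (fun w => Num.min 1 (@mean_gap s n i w)).
Proof. by apply: brv_min; [exact: measurable_mean_gap|move=> w; exact: l1_ge0]. Qed.

(** Its convergence to zero expresses convergence in probability, on average over the agents, of the
    local means to the mean field along their own trajectories. *)
Definition local_mean_gap s n : R :=
  n.+1%:R^-1 * \sum_i Ex P (fun w => Num.min 1 (@mean_gap s n i w)).

Context {K : nat}.
Local Notation arr := ('I_K -> nat -> T).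
Local Notation arrZ n m w := (fun i r => @Z n (m i) r w).
Local Notation sample n := {ffun 'I_K -> 'I_n.+1}.
Local Notation EN := (@En R d _ Om P Z A K).

(** The difference is at most one and at most [c i] times the gap; [c i + 1] exceeds one, as
    [min_scale] requires to pull the constant out of the minimum. *)
Let smooth_gap s n (m : sample n) (psi : 'I_K -> T -> R) (c : 'I_K -> R) i w :
  (forall i, ulip (psi i)) -> (forall i, 0 <= c i) ->
  (forall i x y, `|smooth nu (psi i) x - smooth nu (psi i) y| <= c i * `|x - y|) ->
  `|smooth nu (psi i) ((1 - gamma) *: @Z n (m i) s w +
      gamma *: local_mean (@Z n) (@A n) (m i) s w) -
    smooth nu (psi i) (dft s (@Z n (m i) ^~ w))| <=
  (c i + 1) * Num.min 1 (@mean_gap s n (m i) w).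
Proof.
move=> upsi c0 hc; set x := (X in smooth nu (psi i) X - _); set y := (X in _ - smooth nu (psi i) X).
have [s01 _] := ulip_smooth nu (upsi i).
apply: le_trans (min_scale ler01 (l1_ge0 _) _); last by rewrite lerDr.
rewrite le_min; apply/andP; split.
  exact: unit_dist_le1.
apply: (le_trans (hc i x y)); rewrite mulrDl mul1r.
apply: (@le_trans _ _ (c i * mean_gap s (m i) w)); last by rewrite lerDl l1_ge0.
rewrite ler_wpM2l//.
have -> : x - y = gamma *: (local_mean (@Z n) (@A n) (m i) s w - mfs s (@Z n (m i) ^~ w)).
  by rewrite /x /y /drift opprD addrACA subrr add0r scalerBr.
move/andP : hgamma => [g0 g1].
rewrite (le_trans (norm_le_l1 _))// l1Z (ger0_norm (ltW g0)) ler_piMl ?l1_ge0//.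
exact: ltW.
Qed.

(** [x] carries the true next positions, [x'] the noise integrated around the local means, [y]
    around the mean field. The first two agree on injective samples, whose agents have distinct
    noises; the last two differ by the gap averaged over samples. *)
Lemma En_step s a (phi : arr -> R) (psi : 'I_K -> T -> R) :
  local_mean_gap s n @[n --> \oo] --> 0 ->
  umf s phi -> (forall i, ulip (psi i)) ->
  EN s.+1 n a (fun z => phi z * \prod_i psi i (z i s.+1)) -
  EN s.+1 n a (fun z => phi z * \prod_i smooth nu (psi i) (dft s (z i)))
    @[n --> \oo] --> 0.
Proof.
move=> hgap uphi upsi.
have hlip i : exists c : R, 0 <= c /\ forall x y,
    `|smooth nu (psi i) x - smooth nu (psi i) y| <= c * `|x - y|.
  by have [_ [c c0 hc]] := ulip_smooth nu (upsi i); exists c.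
have [c hc] := choice hlip.
have c0 i : 0 <= c i by case: (hc i).
have hc1 i x y : `|smooth nu (psi i) x - smooth nu (psi i) y| <= c i * `|x - y|.
  by case: (hc i).
pose Y n (m : sample n) i w := (1 - gamma) *: @Z n (m i) s w +
  gamma *: local_mean (@Z n) (@A n) (m i) s w.
pose g n (m : sample n) w := phi (arrZ n m w) * ind (@A n) m s.+1 a w.
have ug n m : urv (g n m : g_sigma_algebraType
    (hgen (@Z n) (@A n) [set r | (r <= s)%N] [set r | (r <= s)%N]) -> R).
  apply: urvM; last by apply: urv_ind.
  by apply: (umf_urv (s := s) _ uphi) => i r rs; apply: hist_Z.
have ugO n m : urv (g n m : Om -> R).
  split; last by case: (ug n m).
  by have [] := brv_sub (@hgen_sub _ _ _ _ _ _ _ (@nm n) _ _) (urv_brv (ug n m)).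
have mY n m i : measurable_fun setT (Y n m i : Om -> borel T).
  apply: measurable_addV; apply: measurable_scaleV => //.
  exact: (measurable_local_mean (@nm n) (m i) s).
have usY n m i : urv (fun w => smooth nu (psi i) (Y n m i w)).
  have [ms s01] := ulip_urv (ulip_smooth nu (upsi i)).
  by split=> [|w]; [exact: measurableT_comp ms (mY n m i)|exact: s01].
have usd n (m : sample n) i : urv (fun w => smooth nu (psi i) (dft s (@Z n (m i) ^~ w))).
  have [ms s01] := ulip_urv (ulip_smooth nu (upsi i)).
  split=> [|w]; last exact: s01.
  by apply: (measurableT_comp ms); apply: measurable_drift.
have upZ n (m : sample n) i : urv (fun w => psi i (@Z n (m i) s.+1 w)).
  have [ms s01] := ulip_urv (upsi i).
  by split=> [|w]; [exact: measurableT_comp ms (mZ _ _)|exact: s01].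
pose x n m := Ex P (fun w => g n m w * \prod_i psi i (@Z n (m i) s.+1 w)).
pose x' n m := Ex P (fun w => g n m w * \prod_i smooth nu (psi i) (Y n m i w)).
pose y n m := Ex P (fun w => g n m w * \prod_i smooth nu (psi i) (dft s (@Z n (m i) ^~ w))).
have e1 (F : forall n, sample n -> Om -> R) n : savg (fun m : sample n =>
    Ex P (fun w => phi (arrZ n m w) * F n m w * ind (@A n) m s.+1 a w)) =
    savg (fun m => Ex P (fun w => g n m w * F n m w)).
  congr savg; apply/funext => m; congr (Ex P _); apply/funext => w.
  by rewrite /g mulrAC.
rewrite (_ : (fun n => _) = (fun n => (savg (x n) - savg (x' n)) +
    (savg (x' n) - savg (y n)))); last first.
  apply/funext => n; rewrite addrA subrK /En.
  by rewrite (e1 (fun n m w => \prod_i psi i (@Z n (m i) s.+1 w)))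
    (e1 (fun n m w => \prod_i smooth nu (psi i) (dft s (@Z n (m i) ^~ w)))).
rewrite -[X in _ --> X]addr0; apply: cvgD.
  apply: (savg_injective_cvg (M := 1)) => [n m|n m im].
    by apply: unit_dist_le1; apply: Ex_urv; apply: urvM => //; apply: urv_prod.
  rewrite /x; under eq_fun do under eq_bigr do rewrite (am_state (hmodel n)).
  have mYh i : measurable_fun setT (Y n m i : g_sigma_algebraType
      (hgen (@Z n) (@A n) [set r | (r <= s)%N] [set r | (r <= s)%N]) -> borel T).
    apply: measurable_addV; apply: measurable_scaleV; first by apply: hist_Z => /=.
    by apply: measurable_local_mean_at => [j|j l]; [apply: hist_Z|apply: hist_A] => /=.
  have ii : injective (fun i : 'I_K => (nat_of_ord (m i), s)) by move=> i j [/val_inj/im].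
  have indep : independent P (sigma_gen (fun i => xi i s : Om -> borel T))
      (filtration (@Z n) (@A n) s).
    move=> E F hE hF; apply: (a1_noise_indep h1 hE).
    by apply: sub_sigma_algebra; exists n.
  exact: (Ex_noise_step (@nm n) (xi := fun p : nat * nat => xi p.1 p.2)
    (sub := fun j => (j, s)) (pre := fun i => nat_of_ord (m i)) (a1_noise_iid h1) ii (fun=> erefl)
    indep mYh (ug n m) (fun i => ulip_urv (upsi i))).
apply: (@cvg0_le _ _ (fun n => (\sum_i (c i + 1)) * local_mean_gap s n)); last first.
  by rewrite -[X in _ --> X](mulr0 (\sum_i (c i + 1))); exact: cvgMr.
move=> n.
have -> : savg (x' n) - savg (y n) = savg (fun m => x' n m - y n m).
  by rewrite /savg sumrB mulrBr.
rewrite (le_trans (savg_norm _))//.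
have -> : (\sum_i (c i + 1)) * local_mean_gap s n = savg (fun m : sample n =>
    \sum_i (c i + 1) * Ex P (fun w => Num.min 1 (mean_gap s (m i) w))).
  rewrite savg_sum mulr_suml; apply: eq_bigr => i _; rewrite savgZ; congr (_ * _).
  by rewrite (savg_marginal i (fun j => Ex P (fun w => Num.min 1 (mean_gap s j w)))).
apply: savg_le => m; rewrite /x' /y -ExB; last 2 first.
- by apply: urv_brv; apply: urvM => //; apply: urv_prod.
- by apply: urv_brv; apply: urvM => //; apply: urv_prod.
have bD : brv (fun w => g n m w * \prod_i smooth nu (psi i) (Y n m i w) -
    g n m w * \prod_i smooth nu (psi i) (dft s (@Z n (m i) ^~ w))).
  by apply: brvB; apply: urv_brv; apply: urvM => //; apply: urv_prod.
apply: (le_trans (Ex_norm P bD)).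
rewrite (eq_bigr (fun i => Ex P (fun w => (c i + 1) * Num.min 1 (mean_gap s (m i) w)))).
  2: by move=> i _; rewrite ExZ//; exact: brv_mean_gap.
rewrite -Ex_sum => [|i]; last by apply: brvZ; exact: brv_mean_gap.
apply: Ex_le; [exact: brv_norm|by apply: brv_sum => i; apply: brvZ; exact: brv_mean_gap|].
move=> w; rewrite -mulrBr normrM.
have /andP[g0 g1] := (ugO n m).2 w; rewrite (ger0_norm g0).
apply: (le_trans (ler_piMl _ g1)) => //.
have h01 i := (usY n m i).2 w; have h01' i := (usd n m i).2 w.
apply: (le_trans (prod_unit_dist_big _ h01 h01')).
apply: ler_sum => i _; exact: smooth_gap.
Qed.

End finite_noise_step.

(** * Convergence of the local means *)

(** An iterated limit: [n] goes to infinity for a fixed cut-off [q], and then the cut-off is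
    removed. *)
Lemma cvg0_double {R : realType} (x : nat -> R) (y : nat -> nat -> R) (Y : nat -> R) :
  (forall n, 0 <= x n) -> (forall q, \forall n \near \oo, x n <= y q n) ->
  (forall q, y q n @[n --> \oo] --> Y q) -> Y q @[q --> \oo] --> 0 ->
  x n @[n --> \oo] --> 0.
Proof.
move=> x0 xy yY Y0; apply/cvgrPdist_le => e e0.
have e20 : 0 < e / 2 by rewrite divr_gt0.
move/cvgrPdist_le : Y0 => /(_ _ e20)[q _ /(_ q (leqnn q))/=]; rewrite sub0r normrN => Yq.
move/cvgrPdist_le : (yY q) => /(_ _ e20) hy.
apply: filterS2 (xy q) hy => n xn hn; rewrite sub0r normrN ger0_norm//.
have := ler_norm (Y q); have := ler_norm (y q n - Y q).
by rewrite distrC; move: hn xn Yq; rewrite distrC; set b := `|y q n - _|; lra.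
Qed.

(** Given the first entry of the sample, the other two are independent, which produces the square of
    a mean. [F i] pins the first entry to [i], so that the summand becomes a product over the
    sample. *)
Lemma savg_triple {R : realType} n (h : 'I_n.+1 -> 'I_n.+1 -> R) :
  savg (fun m : {ffun 'I_3 -> 'I_n.+1} =>
    h (m ord0) (m (inord 1)) * h (m ord0) (m (inord 2))) =
  n.+1%:R^-1 * \sum_i (n.+1%:R^-1 * \sum_j h i j) ^+ 2.
Proof.
pose F (i : 'I_n.+1) (l : 'I_3) (j : 'I_n.+1) : R :=
  if l == ord0 then (j == i)%:R else h i j.
have o1 : lift ord0 ord0 = inord 1 :> 'I_3 by apply: val_inj; rewrite /= inordK.
have o2 : lift ord0 (lift ord0 ord0) = inord 2 :> 'I_3 by apply: val_inj; rewrite /= inordK.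
have e (m : {ffun 'I_3 -> 'I_n.+1}) :
    h (m ord0) (m (inord 1)) * h (m ord0) (m (inord 2)) = \sum_i \prod_l F i l (m l).
  rewrite (bigD1 (m ord0))//= [X in _ + X]big1 ?addr0.
    by rewrite !big_ord_recl big_ord0 o1 o2 /F/= eqxx mul1r mulr1 -o1 -o2.
  by move=> i im; rewrite big_ord_recl /F/= eq_sym (negbTE im) mul0r.
under eq_fun do rewrite e.
rewrite savg_sum mulr_sumr; apply: eq_bigr => i _; rewrite (savg_prod (F i)).
have s1 : \sum_j ((j == i)%:R : R) = 1.
  by rewrite (bigD1 i)//= eqxx big1 ?addr0// => j /negbTE ->.
have h3 (g : 'I_3 -> R) : \prod_l g l = g ord0 * (g (inord 1) * g (inord 2)).
  by rewrite !big_ord_recl big_ord0 mulr1 o1 o2.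
by rewrite h3 /F/= s1 mulr1 -o1 -o2/= expr2.
Qed.

Lemma prod_pairs3 {R : realType} (F : 'I_3 -> 'I_3 -> R) :
  (forall i j, i != ord0 -> F i j = 1) ->
  \prod_(p : pairs 3) F (val p).1 (val p).2 = F ord0 (inord 1) * F ord0 (inord 2).
Proof.
move=> F1.
have h1 : ((ord0 : 'I_3) < (inord 1 : 'I_3))%N by rewrite /= inordK.
have h2 : ((ord0 : 'I_3) < (inord 2 : 'I_3))%N by rewrite /= inordK.
pose p1 : pairs 3 := exist _ (ord0, inord 1) h1.
pose p2 : pairs 3 := exist _ (ord0, inord 2) h2.
have p12 : p2 != p1.
  by rewrite -val_eqE/= xpair_eqE eqxx/= -val_eqE/= !inordK.
rewrite (bigD1 p1)//= (bigD1 p2)//= big1 ?mulr1// => -[[i j] ij] /andP[/= q1 q2].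
move: q1 q2; rewrite -!val_eqE/= => q1 q2; apply: F1; apply/eqP => i0; subst i.
move: q1 q2 ij; rewrite !xpair_eqE eqxx/= -!val_eqE/= !inordK//.
by case: j => -[|[|[|//]]].
Qed.

Section marginals_of_edge_convergence.
Context {R : realType} {d : nat} {gamma : R}.
Local Notation T := 'rV[R]_d.
Variables (B : bool -> T -> T -> R) (B0 : T -> T -> R).
Hypotheses (hgamma : 0 < gamma < 1) (hB : forall a, edge_kernel (B a)).
Variables (nu mu0 : probability (borel T) R).
Context {dO : measure_display} {Om : measurableType dO} (P : probability Om R).
Variables (xi : nat -> nat -> Om -> T) (Z : forall n, 'I_n.+1 -> nat -> Om -> T).
Variable A : forall n, 'I_n.+1 -> 'I_n.+1 -> nat -> Om -> bool.
Hypothesis hmodel : forall n, agent_model P gamma B xi (@Z n) (@A n).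
Hypothesis h1 : assumption1 P xi Z A nu.
Hypothesis h2 : assumption2 P B0 Z A mu0.
Hypothesis h3 : assumption3 P B B0 xi Z.
Context {K : nat} {dX} {OX : measurableType dX} (Q' : probability OX R).
Variable X : 'I_K -> nat -> OX -> T.
Hypothesis mX : forall i s, measurable_fun setT (X i s : OX -> borel T).
Local Notation arr := ('I_K -> nat -> T).
Local Notation arrZ n m w := (fun i r => @Z n (m i) r w).
Local Notation arrX w := (fun i r => X i r w).
Local Notation EN := (@En R d _ Om P Z A K).
Let hB0 : edge_kernel B0 := a2_kernel h2.
Let nm n := @model_network R d gamma B _ _ P xi Z A hmodel n.

(** Decomposing over patterns makes the edges deterministic, and each term converges. In the limit,
    [sum_pats_affine] replaces every edge at time [s] by its conditional probability [B_s] given the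
    trajectories. *)
Lemma edge_cvg_affine s (f : arr -> R) (c e : pairs K -> arr -> R) :
  edge_cvg B B0 Q' X (EN s.+1) s.+1 s ->
  bmf s f -> (forall p, bmf s (c p)) -> (forall p, bmf s (e p)) ->
  ae_cont Q' X s f -> (forall p, ae_cont Q' X s (c p)) ->
  (forall p, ae_cont Q' X s (e p)) ->
  savg (fun m : {ffun 'I_K -> 'I_n.+1} => Ex P (fun w => f (arrZ n m w) *
    \prod_p (c p (arrZ n m w) + e p (arrZ n m w) *
      (@A n (m (val p).1) (m (val p).2) s w)%:R))) @[n --> \oo] -->
  Ex Q' (fun w => f (arrX w) * \prod_p (c p (arrX w) + e p (arrX w) *
      Bpath B B0 s (X (val p).1 ^~ w) (X (val p).2 ^~ w))).
Proof.
move=> ecv bf bc be cf cc ce.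
pose F (a : nat -> pairs K -> bool) z := f z * \prod_p (c p z + e p z * (a s p)%:R).
have bF a : bmf s (F a).
  apply: bmfM => //; apply: bmf_prod => p; apply: bmfD => //.
  by apply: bmfM => //; exact: bmf_cst.
have cF a : ae_cont Q' X s (F a).
  have cc' : {ae Q', forall w, forall p, arr_cont s (c p) (arrX w)}.
    by apply: filter_forall => p; exact: cc.
  have ce' : {ae Q', forall w, forall p, arr_cont s (e p) (arrX w)}.
    by apply: filter_forall => p; exact: ce.
  apply: filterS3 cf cc' ce' => w hf hc he.
  apply: arr_contM => //; apply: arr_cont_prod => p; apply: arr_contD => //.
  by apply: arr_contM => //; exact: arr_cont_cst.
have bZ n (m : {ffun 'I_K -> 'I_n.+1}) q g : bmf q g -> brv (fun w => g (arrZ n m w)).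
  by apply: bmf_brv => i r _; case: (nm n).
have bX q g : bmf q g -> brv (fun w => g (arrX w)).
  by apply: bmf_brv => i r _; exact: mX.
have bind n (m : {ffun 'I_K -> 'I_n.+1}) a : brv (ind (@A n) m s.+1 a : Om -> R).
  have := @urv_ind _ _ R d n.+1 (@Z n) (@A n) K m setT setT s.+1 a (fun _ _ => Logic.I).
  by move=> /urv_brv; exact/brv_sub/(hgen_sub (@nm n)).
have := @cvgr_sum R nat _ \oo _ (pats s.+1) predT (fun a n => EN s.+1 n a (F a)) _
  (fun a _ => ecv a (F a) (bF a) (cF a)).
rewrite (_ : (fun n => _) = (fun n => savg (fun m : {ffun 'I_K -> 'I_n.+1} =>
    Ex P (fun w => f (arrZ n m w) * \prod_p (c p (arrZ n m w) + e p (arrZ n m w) *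
      (@A n (m (val p).1) (m (val p).2) s w)%:R))))); last first.
  apply/funext => n; rewrite /En -savg_sum; congr savg; apply/funext => m.
  rewrite -Ex_sum; last by move=> a; apply: brvM => //; exact: bZ (bF a).
  congr (Ex P _); apply/funext => w.
  rewrite (@sum_pats_ind _ _ s.+1 (fun q p => @A n (m (val p).1) (m (val p).2) q w)
    (fun a => F a (arrZ n m w))) // => a a' aa'.
  by rewrite /F; congr (_ * _); apply: eq_bigr => p _; rewrite aa'.
have E : \sum_(a <- pats s.+1) Ex Q' (fun w => F a (arrX w) * wt B B0 s.+1 a (arrX w)) =
    Ex Q' (fun w => f (arrX w) * \prod_p (c p (arrX w) + e p (arrX w) *
      Bpath B B0 s (X (val p).1 ^~ w) (X (val p).2 ^~ w))).
  rewrite -Ex_sum; last first.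
    move=> a; apply: brvM; first exact: bX (bF a).
    by apply: (bX s); apply: umf_bmf; exact: wt_umf.
  congr (Ex Q' _); apply/funext => w; rewrite /F.
  have := @sum_pats_affine K R d B B0 (arrX w) s (fun p => c p (arrX w)) (fun p => e p (arrX w)).
  move=> <-; rewrite mulr_sumr; apply: eq_bigr => a _.
  by rewrite mulrA.
by rewrite -E; apply.
Qed.

Lemma edge_cvg_marginal s (f : arr -> R) :
  edge_cvg B B0 Q' X (EN s.+1) s.+1 s -> bmf s f -> ae_cont Q' X s f ->
  savg (fun m : {ffun 'I_K -> 'I_n.+1} => Ex P (fun w => f (arrZ n m w))) @[n --> \oo] -->
  Ex Q' (fun w => f (arrX w)).
Proof.
move=> ecv bf cf.
have ae1 (c0 : R) : ae_cont Q' X s (fun=> c0) by apply: filterE => w; exact: arr_cont_cst.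
have := edge_cvg_affine (c := fun _ _ => 1) (e := fun _ _ => 0) ecv bf
  (fun _ => bmf_cst _ _) (fun _ => bmf_cst _ _) cf (fun _ => ae1 1) (fun _ => ae1 0).
rewrite (_ : (fun n => _) = (fun n => savg (fun m : {ffun 'I_K -> 'I_n.+1} =>
  Ex P (fun w => f (arrZ n m w))))); last first.
  apply/funext => n; congr savg; apply/funext => m; congr (Ex P _); apply/funext => w.
  by rewrite big1 ?mulr1// => p _; rewrite mul0r addr0.
suff -> : (fun w => f (arrX w) * \prod_(p : pairs K) (1 + 0 *
  Bpath B B0 s (X (val p).1 ^~ w) (X (val p).2 ^~ w))) = (fun w => f (arrX w)) by [].
by apply/funext => w; rewrite big1 ?mulr1// => p _; rewrite mul0r addr0.
Qed.

End marginals_of_edge_convergence.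

Lemma le_of_cvg {R : realType} (x : nat -> R) (l M : R) :
  x n @[n --> \oo] --> l -> (\forall n \near \oo, x n <= M) -> l <= M.
Proof. by move=> xl xM; apply: (closed_cvg _ (@closed_le R M) xM _ xl). Qed.

Lemma integral_min_le {R : realType} {dO} {O : measurableType dO} (P : probability O R)
    (f : O -> R) (M : R) : measurable_fun setT f -> (forall w, 0 <= f w) ->
  (forall q : nat, Ex P (fun w => Num.min q%:R (f w)) <= M) ->
  (\int[P]_w (f w)%:E <= M%:E)%E.
Proof.
move=> mf f0 h; pose g (q : nat) w := (Num.min q%:R (f w))%:E.
have mg q : measurable_fun setT (g q).
  by apply/measurable_EFinP; case: (brv_min q%:R mf f0).
have g0 q w : setT w -> (0 <= g q w)%E by move=> _; rewrite lee_fin le_min ler0n f0.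
have ndg w : setT w -> {homo g ^~ w : n m / (n <= m)%N >-> (n <= m)%E}.
  move=> _ n m nm; rewrite lee_fin le_min !ge_min lexx orbT andbT.
  by rewrite ler_nat nm.
have gE w : limn (g ^~ w) = (f w)%:E.
  apply: lim_near_cst => //; near=> q; rewrite /g min_r//.
  by near: q; exact: nbhs_infty_ger.
have := monotone_convergence P measurableT mg g0 ndg.
under eq_integral do rewrite gE.
move=> ->; apply: lime_le; first exact: (cvgP _ (cvg_monotone_convergence measurableT mg g0 ndg)).
near=> q; rewrite EFin_Ex; last exact: brv_min.
by rewrite lee_fin.
Unshelve. all: by end_near. Qed.

Lemma l1_continuous {R : realType} {d : nat} : continuous (@l1 R d).
Proof.
move=> x; apply: (@cvgr_sum R 'rV[R]_d 'I_d (nbhs x)) => c _.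
by apply: cvg_norm; exact: coord_continuous.
Qed.

Lemma arr_cont_coord {R : realType} {d : nat} {I : finType} s r i (u : 'rV[R]_d -> R)
    (z : I -> nat -> 'rV[R]_d) : continuous u -> (r <= s)%N ->
  arr_cont s (fun y => u (y i r)) z.
Proof.
by move=> cu rs; exact: (cvg_comp _ _ (@arr_near_coord _ _ _ s z i r rs) (cu (z i r))).
Qed.

Lemma arr_cont_comp {R : realType} {d : nat} {I : finType} s (phi : R -> R) f
    (z : I -> nat -> 'rV[R]_d) : continuous phi -> arr_cont s f z ->
  arr_cont s (fun y => phi (f y)) z.
Proof. by move=> cphi cf; exact: (cvg_comp _ _ cf (cphi (f z))). Qed.

(** * Three independent copies and the moments of the limit *)

Section triple.
Context {R : realType} {d : nat} {gamma : R}.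
Local Notation T := 'rV[R]_d.
Variables (B : bool -> T -> T -> R) (B0 : T -> T -> R).
Hypotheses (hgamma : 0 < gamma < 1) (hB : forall a, edge_kernel (B a)).
Variables (nu mu0 : probability (borel T) R).
Context {dO : measure_display} {Om : measurableType dO} (P : probability Om R).
Variables (xi : nat -> nat -> Om -> T) (Z : forall n, 'I_n.+1 -> nat -> Om -> T).
Variable A : forall n, 'I_n.+1 -> 'I_n.+1 -> nat -> Om -> bool.
Hypothesis hmodel : forall n, agent_model P gamma B xi (@Z n) (@A n).
Hypothesis h1 : assumption1 P xi Z A nu.
Hypothesis h2 : assumption2 P B0 Z A mu0.
Hypothesis h3 : assumption3 P B B0 xi Z.
Context {dQ : measure_display} {OQ : measurableType dQ} (Q : probability OQ R).
Variable Z0 : nat -> OQ -> T.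
Hypothesis mZ0 : forall s, measurable_fun setT (Z0 s : OQ -> borel T).
Local Notation dft := (drift (gamma := gamma) B B0 Q Z0).
Local Notation mfs := (mf B B0 Q Z0).
Hypothesis w1 : wls mu0 nu dft Q (fun _ : 'I_1 => Z0).
Let hB0 : edge_kernel B0 := a2_kernel h2.
Let nm n := @model_network R d gamma B _ _ P xi Z A hmodel n.
Local Notation Q3 := (pprod Q (pprod Q Q)).
Local Notation one := (fun _ : 'I_1 => Z0).

Let mdrift s d' (O' : measurableType d') X :
  (forall r, (r <= s)%N -> measurable_fun setT (X r : O' -> borel T)) ->
  measurable_fun setT ((fun w => dft s (X ^~ w)) : O' -> borel T).
Proof. exact: measurable_drift. Qed.

Definition tripleX : 'I_3 -> nat -> OQ * (OQ * OQ) -> T := joinX one (joinX one one).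

Lemma tripleX0 r w : tripleX ord0 r w = Z0 r w.1.
Proof.
rewrite /tripleX -(joinXl one (joinX one one) ord0).
by congr joinX; exact: val_inj.
Qed.

Lemma tripleX1 r w : tripleX (inord 1) r w = Z0 r w.2.1.
Proof.
rewrite -[RHS](joinXl one one ord0) -[RHS](joinXr one (joinX one one)) /tripleX.
by congr joinX; apply: val_inj; rewrite /= inordK.
Qed.

Lemma tripleX2 r w : tripleX (inord 2) r w = Z0 r w.2.2.
Proof.
rewrite -[RHS](joinXr one one ord0) -[RHS](joinXr one (joinX one one)) /tripleX.
by congr joinX; apply: val_inj; rewrite /= inordK.
Qed.

Lemma triple_wls : wls mu0 nu dft Q3 tripleX.
Proof. exact: (wls_prod mdrift w1 (wls_prod mdrift w1 w1)). Qed.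

Lemma triple_copies : copies Q Z0 Q3 tripleX.
Proof.
exact (copies_prod (@copies1 _ _ _ _ Q Z0)
  (copies_prod (@copies1 _ _ _ _ Q Z0) (@copies1 _ _ _ _ Q Z0))).
Qed.

Let mX3 i s : measurable_fun setT (tripleX i s : OQ * (OQ * OQ) -> borel T).
Proof. exact: wls_measurable triple_wls i s. Qed.

Lemma Ex_triple0 (phi : (nat -> T) -> R) : brv (fun w => phi (Z0 ^~ w)) ->
  Ex Q3 (fun w => phi (tripleX ord0 ^~ w)) = Ex Q (fun w => phi (Z0 ^~ w)).
Proof.
move=> bphi.
have e w : phi (tripleX ord0 ^~ w) = phi (Z0 ^~ w.1).
  by congr phi; apply/funext => r; exact: tripleX0.
under eq_fun do rewrite e.
rewrite Ex_pprod; last by apply: (brv_comp bphi); exact: measurable_fst.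
by congr (Ex Q _); apply/funext => x; exact: (Ex_cst (pprod Q Q) (phi (Z0 ^~ x))).
Qed.

Variable s : nat.
Hypothesis ecv : edge_cvg B B0 Q3 tripleX
  (@En R d _ Om P Z A 3 s.+1) s.+1 s.

Lemma cvg_average (phi : (nat -> T) -> R) :
  bmf s (fun z : 'I_3 -> nat -> T => phi (z ord0)) ->
  ae_cont Q3 tripleX s (fun z => phi (z ord0)) ->
  n.+1%:R^-1 * \sum_i Ex P (fun w => phi (@Z n i ^~ w)) @[n --> \oo] -->
  Ex Q (fun w => phi (Z0 ^~ w)).
Proof.
move=> bphi cphi; have := edge_cvg_marginal hB hmodel h2 mX3 ecv bphi cphi.
under eq_fun do rewrite (savg_marginal ord0 (fun j => Ex P (fun w => phi (@Z _ j ^~ w)))).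
rewrite Ex_triple0//.
apply: (@bmf_brv _ _ _ s (fun z : 'I_3 -> nat -> T => phi (z ord0)) _ _
  (fun _ r => Z0 r)) bphi => i r _; exact: mZ0.
Qed.

(** The bounds for the networks are uniform in the truncation. A truncated exponential is bounded
    and continuous, so its bound passes to the limit, and monotone convergence removes the
    truncation. *)
Lemma exp_moment_limit : exists M : R, (\int[Q]_w (expR (l1 (Z0 s w)))%:E <= M%:E)%E.
Proof.
have [M hM] := moments hgamma hB hmodel h1 h2 h3 s (@ler01 R).
have M0 : 0 <= M.
  have [n _ /(_ n (leqnn n)) h] := hM; apply: le_trans (h 1 ltr01); apply: Ex_ge0 => w.
  by rewrite le_min ler01 emom_ge0.
exists M; apply: integral_min_le => [|w|q]; last 1 first.
(* The moment bounds hold for positive truncation levels; level [0] is trivial. *)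
- case: q => [|q].
    rewrite (_ : (fun w => _) = fun=> 0) ?Ex_cst//.
    by apply/funext => w; rewrite min_l// expR_ge0.
  pose phi (x : nat -> T) : R := Num.min q.+1%:R (expR (l1 (x s))).
  have cphi (z : 'I_3 -> nat -> T) : arr_cont s (fun z => phi (z ord0)) z.
    apply: (arr_cont_coord (u := fun x => Num.min q.+1%:R (expR (l1 x)))) => // x.
    apply: (@continuous_min R T (fun=> q.+1%:R) (fun x => expR (l1 x))).
      exact: (@cst_continuous T R).
    exact: (cvg_comp _ _ (@l1_continuous R d x) (@continuous_expR R (l1 x))).
  have bphi : bmf s (fun z : 'I_3 -> nat -> T => phi (z ord0)).
    split; first exact: arr_cont_mfun.
    exists q.+1%:R => z; rewrite ger0_norm ?le_min ?ler0n ?expR_ge0//.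
    by rewrite ge_min lexx.
  apply: (le_of_cvg (cvg_average bphi _)); first by apply: filterE => w; exact: cphi.
  move: hM; apply: filterS => n hM; apply: le_trans (hM q.+1%:R _) => //.
  have be i : brv (fun w => Num.min q.+1%:R (expR (l1 (@Z n i s w)))).
    apply: brv_min => [|w]; last exact: expR_ge0.
    have := measurable_exp_l1 1 ((@nm n).1 i s); under eq_fun do rewrite mul1r; exact.
  rewrite -Ex_sum// -ExZ; last exact: brv_sum.
  apply: Ex_le; [by apply: brvZ; exact: brv_sum|exact: brv_min_emom|].
  move=> w; rewrite /emom; under [in leRHS]eq_bigr do rewrite mul1r.
  exact: avg_min.
- by have := measurable_exp_l1 1 (mZ0 s); under eq_fun do rewrite mul1r.
- exact: expR_ge0.
Qed.

Lemma integrable_exp : Q.-integrable setT (EFin \o (fun w => expR (l1 (Z0 s w)))).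
Proof.
apply/integrableP; split.
  apply/measurable_EFinP; have := measurable_exp_l1 1 (mZ0 s).
  by under eq_fun do rewrite mul1r.
have [M hM] := exp_moment_limit; apply: le_lt_trans (ltry M).
by under eq_integral do rewrite gee0_abs ?lee_fin ?expR_ge0//.
Qed.

Lemma triple_integrable_coords : integrable_coords Q Z0 s.
Proof.
move=> c; apply: (le_integrable measurableT _ _ integrable_exp).
  by apply/measurable_EFinP; exact: measurable_coord.
move=> w _; rewrite lee_fin [leRHS]ger0_norm ?expR_ge0//.
by rewrite (le_trans (coord_le_l1 _ _))// (le_trans _ (expR_ge1Dx _))// lerDr.
Qed.

End triple.

Section consistency.
Context {R : realType} {d : nat} {gamma : R}.
Local Notation T := 'rV[R]_d.
Variables (B : bool -> T -> T -> R) (B0 : T -> T -> R).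
Hypotheses (hgamma : 0 < gamma < 1) (hB : forall a, edge_kernel (B a)).
Variables (nu mu0 : probability (borel T) R).
Context {dO : measure_display} {Om : measurableType dO} (P : probability Om R).
Variables (xi : nat -> nat -> Om -> T) (Z : forall n, 'I_n.+1 -> nat -> Om -> T).
Variable A : forall n, 'I_n.+1 -> 'I_n.+1 -> nat -> Om -> bool.
Hypothesis hmodel : forall n, agent_model P gamma B xi (@Z n) (@A n).
Hypothesis h1 : assumption1 P xi Z A nu.
Hypothesis h2 : assumption2 P B0 Z A mu0.
Hypothesis h3 : assumption3 P B B0 xi Z.
Context {dQ : measure_display} {OQ : measurableType dQ} (Q : probability OQ R).
Variable Z0 : nat -> OQ -> T.
Hypothesis mZ0 : forall s, measurable_fun setT (Z0 s : OQ -> borel T).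
Local Notation dft := (drift (gamma := gamma) B B0 Q Z0).
Local Notation mfs := (mf B B0 Q Z0).
Hypothesis w1 : wls mu0 nu dft Q (fun _ : 'I_1 => Z0).
Hypothesis npos : near_pos B B0.
Let hB0 : edge_kernel B0 := a2_kernel h2.
Let nm n := @model_network R d gamma B _ _ P xi Z A hmodel n.
Local Notation Q3 := (pprod Q (pprod Q Q)).
Local Notation X3 := (tripleX Z0).
Let wX3 : wls mu0 nu dft Q3 X3 := triple_wls hB h2 mZ0 w1.
Let mX3 i s : measurable_fun setT (X3 i s : OQ * (OQ * OQ) -> borel T).
Proof. exact: wls_measurable wX3 i s. Qed.
Let mZ n i s : measurable_fun setT (@Z n i s : Om -> borel T).
Proof. by case: (nm n). Qed.

Variable s : nat.
Hypothesis ecv : edge_cvg B B0 Q3 X3 (@En R d _ Om P Z A 3 s.+1) s.+1 s.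

Local Notation G u := (mfU B B0 Q Z0 s u).

(** The counterpart of [mfU] in the network: numerator of the local mean when [u] is a coordinate,
    denominator when [u = 1], both divided by the number of agents. *)
Definition weighted_mean (u : T -> R) n (i : 'I_n.+1) w : R :=
  n.+1%:R^-1 * \sum_j (@A n i j s w)%:R * u (@Z n j s w).
Local Notation H := weighted_mean.

Lemma mfU_bound (u : T -> R) M x : 0 <= M -> measurable_fun setT (u : borel T -> R) ->
  (forall y, `|u y| <= M) -> `|G u x| <= M.
Proof.
move=> M0 mu uM; apply: Ex_bound; last first.
  move=> w; rewrite normrM; have /andP[b0 b1] := Bpath01 hB hB0 s x (Z0 ^~ w).
  by rewrite (ger0_norm b0) (le_trans (ler_piMr _ b1)).
apply: brvM; first by split; [exact: measurableT_comp mu (mZ0 s)|exists M].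
split; first by apply: (measurable_Bpath hB hB0).
exists 1 => w; have /andP[b0 b1] := Bpath01 hB hB0 s x (Z0 ^~ w).
by rewrite ger0_norm.
Qed.

Lemma bmf_mfU {K : nat} (u : T -> R) M i : measurable_fun setT (u : borel T -> R) ->
  (forall y, `|u y| <= M) -> bmf s (fun z : 'I_K -> nat -> T => G u (z i)).
Proof.
move=> mu uM; split=> [d' O' X mX|].
  by apply: (@measurable_mfU _ _ _ _ hB hB0 _ _ _ _ mZ0 s u _ _ (X i)) => // r; exact: mX.
exists M => z; apply: mfU_bound => //; exact: le_trans (uM 0).
Qed.

Let bmf_u {K : nat} (u : T -> R) M (i : 'I_K) : measurable_fun setT (u : borel T -> R) ->
  (forall y, `|u y| <= M) -> bmf s (fun z : 'I_K -> nat -> T => u (z i s)).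
Proof.
move=> mu uM; split; last by exists M.
by move=> d' O' X mX; exact: (measurableT_comp mu (mX i s (leqnn s))).
Qed.

Section bounded_test_function.
Variables (u : T -> R) (M : R).
Hypotheses (cu : continuous u) (uM : forall y, `|u y| <= M).

Let mu : measurable_fun setT (u : borel T -> R).
Proof. exact: (@continuous_borelP R T u cu). Qed.

Let M0 : 0 <= M. Proof. exact: le_trans (uM 0). Qed.

Lemma brv_weighted_mean n i : brv (@weighted_mean u n i).
Proof.
apply: brvZ; apply: brv_sum => j; apply: brvM.
  exact: (brv_bool (fun b => b%:R) ((@nm n).2 i j s)).
by split; [exact: measurableT_comp mu (mZ _ _)|exists M].
Qed.

Lemma brv_mfU n i : brv (fun w => G u (@Z n i ^~ w)).
Proof.
by apply: (@bmf_brv _ _ _ s (fun z => G u (z ord0)) _ _ (fun _ : 'I_1 => @Z n i));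
  [move=> _ r _; exact: mZ|exact: bmf_mfU uM].
Qed.

(* The mean square distance is an average over samples [(i, j, l)] of products of
   a function of [(i, j)] and a function of [(i, l)]: in the limit these factors
   are independent and centred given the trajectory of [i]. *)
Lemma second_moment_cvg : n.+1%:R^-1 * \sum_i Ex P (fun w =>
  (@H u n i w - G u (@Z n i ^~ w)) ^+ 2) @[n --> \oo] --> 0.
Proof.
(* With these coefficients the two pairs that contain agent [0] each carry the centred factor
   [u * A - G u], and the third pair carries [1]. *)
pose c (p : pairs 3) (z : 'I_3 -> nat -> T) : R :=
  if (val p).1 == ord0 then - G u (z ord0) else 1.
pose e (p : pairs 3) (z : 'I_3 -> nat -> T) : R :=
  if (val p).1 == ord0 then u (z (val p).2 s) else 0.
have iu : Q.-integrable setT (EFin \o (fun w => u (Z0 s w))).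
  by apply: brv_integrable; split; [exact: measurableT_comp mu (mZ0 s)|exists M].
have cG := ae_arr_cont_mfU hB hB0 (a2_mu0_ac h2) (a1_noise_ac h1) mZ0 w1 wX3 (s := s) mu iu.
have bc p : bmf s (c p).
  rewrite /c; case: ((val p).1 == ord0); last exact: bmf_cst.
  rewrite (_ : (fun z : 'I_3 -> nat -> T => _) = (fun z => -1 * G u (z ord0))).
    by apply: bmfZ; exact: bmf_mfU uM.
  by apply/funext => z; rewrite mulN1r.
have be p : bmf s (e p).
  rewrite /e; case: ((val p).1 == ord0); last exact: bmf_cst.
  exact: bmf_u uM.
have cc p : ae_cont Q3 X3 s (c p).
  apply: filterS cG => w hw; rewrite /c.
  case: ((val p).1 == ord0); last exact: arr_cont_cst.
  exact: (cvgN (hw ord0)).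
have ce p : ae_cont Q3 X3 s (e p).
  apply: filterE => w; rewrite /e.
  case: ((val p).1 == ord0); last exact: arr_cont_cst.
  exact: arr_cont_coord.
have bone : bmf s (fun _ : 'I_3 -> nat -> T => 1 : R) by exact: bmf_cst.
have cone : ae_cont Q3 X3 s (fun=> 1) by apply: filterE => w; exact: arr_cont_cst.
have := edge_cvg_affine hB hmodel h2 mX3 ecv bone bc be cone cc ce.
rewrite (_ : (fun n => _) = (fun n => n.+1%:R^-1 * \sum_i Ex P (fun w =>
    (@H u n i w - G u (@Z n i ^~ w)) ^+ 2))); last first.
  apply/funext => n.
  pose h w (i j : 'I_n.+1) : R := - G u (@Z n i ^~ w) + u (@Z n j s w) * (@A n i j s w)%:R.
  have bh i j : brv (fun w => h w i j).
    apply: brvD; first exact/brvN/brv_mfU.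
    apply: brvM; first by split; [exact: measurableT_comp mu (mZ _ _)|exists M].
    exact: (brv_bool (fun b => b%:R) ((@nm n).2 i j s)).
  transitivity (savg (fun m : {ffun 'I_3 -> 'I_n.+1} => Ex P (fun w =>
      h w (m ord0) (m (inord 1)) * h w (m ord0) (m (inord 2))))).
    congr savg; apply/funext => m; congr (Ex P _); apply/funext => w; rewrite mul1r.
    pose F (i j : 'I_3) : R := if i == ord0 then - G u (@Z n (m ord0) ^~ w) +
      u (@Z n (m j) s w) * (@A n (m i) (m j) s w)%:R else 1.
    rewrite -[RHS](prod_pairs3 (F := F)) => [|i j /negbTE i0]; last by rewrite /F i0.
    apply: eq_bigr => p _; rewrite /c /e /F; case: ifP => // _.
    by rewrite mul0r addr0.
  rewrite savg_Ex => [|m]; last exact: brvM.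
  under eq_fun do rewrite savg_triple.
  have hH i w : n.+1%:R^-1 * \sum_j h w i j = @H u n i w - G u (@Z n i ^~ w).
    rewrite /h /weighted_mean big_split/= mulrDr addrC; congr (_ + _).
      by congr (_ * _); apply: eq_bigr => j _; rewrite mulrC.
    by rewrite avg_cst.
  under eq_fun do under eq_bigr do rewrite hH.
  have bHG i : brv (fun w => (@H u n i w - G u (@Z n i ^~ w)) ^+ 2).
    have bD : brv (fun w => @H u n i w - G u (@Z n i ^~ w)).
      by apply: brvB; [exact: brv_weighted_mean|exact: brv_mfU].
    exact: (brvM bD bD).
  by rewrite ExZ; [rewrite Ex_sum|exact: brv_sum].
pose phi x y : R := - G u (Z0 ^~ x) + u (Z0 s y) * Bpath B B0 s (Z0 ^~ x) (Z0 ^~ y).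
have limE : (fun w => 1 * \prod_p (c p (fun i r => X3 i r w) + e p (fun i r => X3 i r w) *
    Bpath B B0 s (X3 (val p).1 ^~ w) (X3 (val p).2 ^~ w))) =
    (fun w => phi w.1 w.2.1 * phi w.1 w.2.2).
  apply/funext => w; rewrite mul1r.
  pose F (i j : 'I_3) : R := if i == ord0 then - G u (X3 ord0 ^~ w) +
    u (X3 j s w) * Bpath B B0 s (X3 i ^~ w) (X3 j ^~ w) else 1.
  transitivity (\prod_(p : pairs 3) F (val p).1 (val p).2).
    apply: eq_bigr => p _; rewrite /c /e /F; case: ifP => // _.
    by rewrite mul0r addr0.
  rewrite prod_pairs3 => [|i j /negbTE i0]; last by rewrite /F i0.
  have x0 : X3 ord0 ^~ w = Z0 ^~ w.1 by apply/funext => r; exact: tripleX0.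
  have x1 : X3 (inord 1) ^~ w = Z0 ^~ w.2.1 by apply/funext => r; exact: tripleX1.
  have x2 : X3 (inord 2) ^~ w = Z0 ^~ w.2.2 by apply/funext => r; exact: tripleX2.
  by rewrite /F eqxx x0 x1 x2 tripleX1 tripleX2.
have bphi3 : brv (fun w : OQ * (OQ * OQ) => phi w.1 w.2.1 * phi w.1 w.2.2).
  rewrite -limE; apply: brvM; first exact: brv_cst.
  apply: (@bmf_brv _ _ _ s (fun z => \prod_p (c p z + e p z *
    Bpath B B0 s (z (val p).1) (z (val p).2))) _ _ X3) => [i r _|]; first exact: mX3.
  apply: bmf_prod => p; apply: bmfD => //; apply: bmfM => //; apply: umf_bmf.
  exact: umf_Bpath.
suff -> : Ex Q3 (fun w => 1 * \prod_p (c p (fun i r => X3 i r w) +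
    e p (fun i r => X3 i r w) *
    Bpath B B0 s (X3 (val p).1 ^~ w) (X3 (val p).2 ^~ w))) = 0 by [].
(* Given the first trajectory [x], integrating the last copy suffices: the integral of [u * B_s] is
   [G u] by definition, so [phi x] is centred. *)
rewrite limE Ex_pprod// -[RHS](Ex_cst Q); congr (Ex Q _); apply/funext => x.
have bphi x' : brv (fun y => phi x' y).
  apply: brvD; first exact: brv_cst.
  apply: brvM; first by split; [exact: measurableT_comp mu (mZ0 s)|exists M].
  split; first by apply: (measurable_Bpath hB hB0).
  by exists 1 => y; have /andP[b0 b1] := Bpath01 hB hB0 s (Z0 ^~ x') (Z0 ^~ y);
    rewrite ger0_norm.
rewrite Ex_pprod/=; last first.
  apply: brvM; [apply: (brv_comp (bphi x)); exact: measurable_fst|].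
  by apply: (brv_comp (bphi x)); exact: measurable_snd.
rewrite -[RHS](Ex_cst Q); congr (Ex Q _); apply/funext => y.
rewrite ExZ//; rewrite /phi ExD; [|exact: brv_cst|]; last first.
  apply: brvM; first by split; [exact: measurableT_comp mu (mZ0 s)|exists M].
  split; first by apply: (measurable_Bpath hB hB0).
  by exists 1 => y'; have /andP[b0 b1] := Bpath01 hB hB0 s (Z0 ^~ x) (Z0 ^~ y');
    rewrite ger0_norm.
by rewrite Ex_cst addNr mulr0.
Qed.

Lemma first_moment_cvg : n.+1%:R^-1 * \sum_i Ex P (fun w =>
  `|@H u n i w - G u (@Z n i ^~ w)|) @[n --> \oo] --> 0.
Proof.
have bD n i : brv (fun w => @H u n i w - G u (@Z n i ^~ w)).
  by apply: brvB; [exact: brv_weighted_mean|exact: brv_mfU].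
(* With [Q = q + 1], the inequality [t <= 1/Q + Q t^2] follows by completing the square and passes
   from second to first moments. *)
apply: (@cvg0_double _ _ (fun q n => q.+1%:R^-1 + q.+1%:R * (n.+1%:R^-1 * \sum_i Ex P (fun w =>
  (@H u n i w - G u (@Z n i ^~ w)) ^+ 2))) (fun q => q.+1%:R^-1)).
- by move=> n; apply: avg_ge0 => i; apply: Ex_ge0.
- move=> q; apply: nearW => n.
  have -> : q.+1%:R^-1 = n.+1%:R^-1 * \sum_(i < n.+1) (q.+1%:R^-1 : R).
    by rewrite avg_cst.
  rewrite mulrCA -mulrDr ler_wpM2l ?invr_ge0// mulr_sumr -big_split/=.
  apply: ler_sum => i _.
  have bD2 : brv (fun w => (@H u n i w - G u (@Z n i ^~ w)) ^+ 2) by apply: brvM.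
  rewrite -ExZ// -(Ex_cst P q.+1%:R^-1) -ExD; [|exact: brv_cst|exact: brvZ].
  apply: Ex_le; [exact: brv_norm|by apply: brvD; [exact: brv_cst|exact: brvZ]|].
  move=> w; rewrite -real_normK ?num_real//; set t := `|_|.
  have q0 : 0 < q.+1%:R :> R by [].
  rewrite -subr_ge0.
  have -> : q.+1%:R^-1 + q.+1%:R * t ^+ 2 - t =
      q.+1%:R * ((t - q.+1%:R^-1 / 2) ^+ 2 + 3 / 4 * q.+1%:R^-1 ^+ 2).
    by field; rewrite gt_eqF.
  by rewrite mulr_ge0// ?(ltW q0)// addr_ge0 ?sqr_ge0// mulr_ge0 ?sqr_ge0.
- move=> q; rewrite -[X in _ --> X]addr0; apply: cvgD; first exact: cvg_cst.
  by rewrite -[X in _ --> X](mulr0 q.+1%:R); apply: cvgMr; exact: second_moment_cvg.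
- exact: cvg_harmonic.
Qed.

End bounded_test_function.
End consistency.

(** * Truncation and comparison of quotients *)

Section truncation.
Context {R : realType}.

Definition clamp (q : nat) (x : R) : R := Num.max (- q%:R) (Num.min q%:R x).

Lemma clamp_norm q x : `|clamp q x| <= q%:R.
Proof.
have q0 : 0 <= q%:R :> R by [].
rewrite ler_norml /clamp le_max lexx/= ge_max ge_min lexx andbT.
by rewrite (le_trans _ q0)// oppr_le0.
Qed.

Lemma clamp_continuous q : continuous (clamp q).
Proof.
have -> : clamp q = (fun=> - q%:R) \max ((fun=> q%:R) \min id) by [].
move=> x; apply: continuous_max; first exact: cst_continuous.
by apply: continuous_min; [exact: cst_continuous|exact: cvg_id].
Qed.

(** The excess [y = |x| - q] satisfies [y <= e^y], and [q + 1 <= e^q]; multiplying the two gives the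
    rate. *)
Lemma clamp_dist q x : `|x - clamp q x| <= harmonic q * expR `|x|.
Proof.
have q0 : 0 <= q%:R :> R by [].
have e0 := expR_ge0 `|x|.
have key : q%:R <= `|x| -> `|x| - q%:R <= harmonic q * expR `|x|.
  move=> qx; rewrite mulrC ler_pdivlMr; last by [].
  apply: (@le_trans _ _ (expR (`|x| - q%:R) * expR q%:R)); last by rewrite -expRD subrK.
  apply: ler_pM; rewrite ?subr_ge0//.
    by apply: le_trans (expR_ge1Dx _); rewrite lerDr.
  by rewrite -natr1 addrC; exact: expR_ge1Dx.
have h0 : 0 <= harmonic q * expR `|x| by rewrite mulr_ge0 ?invr_ge0.
rewrite /clamp; case: (ltP q%:R x) => qx.
  rewrite max_r; last by rewrite (le_trans _ q0)// oppr_le0.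
  have x0 : 0 <= x by rewrite (le_trans q0)// ltW.
  have := key; rewrite (ger0_norm x0) => k; rewrite ger0_norm ?subr_ge0 ?(ltW qx)//.
  exact/k/ltW.
case: (leP (- q%:R) x) => qx'; first by rewrite subrr normr0.
have x0 : x <= 0 by rewrite (le_trans (ltW qx'))// oppr_le0.
have := key; rewrite (ler0_norm x0) => k; rewrite ler0_norm ?opprB; last by rewrite subr_le0 ltW.
by rewrite addrC; apply: k; rewrite lerNr ltW.
Qed.

Lemma ratio_bound (Q a b a' D : R) : 1 <= Q -> 0 < b ->
  Num.min 1 `|a / b - a' / D| <=
  Num.max 0 (2 - Q * D) + Num.min 1 (`|a'| / Q) + (2 * Q + 2 * Q ^+ 3) * `|b - D| +
  (1 + 2 * Q) * Num.min 1 `|a - a'|.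
Proof.
move=> Q1 b0; have Q0 : 0 < Q by apply: lt_le_trans Q1.
set k1 := Num.max _ _; set k2 := Num.min 1 (`|a'| / Q).
set t1 := (2 * Q + _) * _; set m := Num.min 1 `|a - a'|; set t2 := (1 + 2 * Q) * m.
have k10 : 0 <= k1 by rewrite le_max lexx.
have k20 : 0 <= k2 by rewrite le_min ler01 divr_ge0// ltW.
have Q30 : 0 <= Q ^+ 3 by rewrite exprn_ge0 ?ltW.
have m0 : 0 <= m by rewrite le_min ler01 normr_ge0.
have t10 : 0 <= t1 by rewrite mulr_ge0// addr_ge0// mulr_ge0// ltW.
have t20 : 0 <= t2 by rewrite mulr_ge0// addr_ge0// mulr_ge0// ltW.
have one x : 1 <= x -> Num.min 1 `|a / b - a' / D| <= x.
  by move=> h; rewrite (le_trans _ h)// ge_min lexx.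
have [D1|D1] := leP (Q * D) 1.
  by apply: one; have : 1 <= k1; [rewrite le_max; apply/orP; right; lra|lra].
have D0 : 0 < D by rewrite -(pmulr_rgt0 _ Q0) (lt_trans ltr01).
have [a'1|a'1] := leP Q `|a'|.
  apply: one; have : 1 <= k2; last by lra.
  by rewrite le_min lexx/= ler_pdivlMr// mul1r.
have [bD|bD] := leP 1 (2 * Q * `|b - D|).
  apply: one; have : 2 * Q * `|b - D| <= t1; last by lra.
  by rewrite /t1 [leRHS]mulrDl lerDl mulr_ge0// mulr_ge0.
have [aa|aa] := leP 1 `|a - a'|.
  apply: one; have : m = 1 by rewrite /m min_l.
  by rewrite /t2 => ->; lra.
have mE : m = `|a - a'| by rewrite /m min_r// ltW.
rewrite ge_min; apply/orP; right.
have b1 : 1 < 2 * Q * b.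
  have : D - b <= `|b - D| by rewrite distrC ler_norm.
  have : Q * `|b - D| * 2 < 1 by rewrite mulrC mulrA.
  move=> h1 h2; have : Q * (D - b) <= Q * `|b - D| by rewrite ler_pM2l.
  rewrite mulrBr; lra.
have ib : b^-1 <= 2 * Q.
  by rewrite -[b^-1]mul1r ler_pdivrMr// ltW.
have iD : D^-1 <= Q by rewrite -[D^-1]mul1r ler_pdivrMr// ltW.
have ib0 : 0 <= b^-1 by rewrite invr_ge0 ltW.
have iD0 : 0 <= D^-1 by rewrite invr_ge0 ltW.
have -> : a / b - a' / D = (a - a') * b^-1 + a' * (D - b) * (b^-1 * D^-1).
  by field; rewrite !gt_eqF.
rewrite (le_trans (ler_normD _ _))// !normrM (ger0_norm ib0) (ger0_norm iD0) (distrC D).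
apply: (@le_trans _ _ (`|a - a'| * (2 * Q) + Q * `|b - D| * (2 * Q * Q))).
  by apply: lerD; apply: ler_pM => //; rewrite ?mulr_ge0//; apply: ler_pM => //; exact: ltW.
have p0 : 0 <= `|b - D| by [].
have e1 : Q * `|b - D| * (2 * Q * Q) = 2 * Q ^+ 3 * `|b - D| by ring.
have e2 : t1 = 2 * Q * `|b - D| + 2 * Q ^+ 3 * `|b - D| by rewrite /t1; ring.
have e3 : t2 = `|a - a'| * (2 * Q) + `|a - a'| by rewrite /t2 mE; ring.
have : 0 <= 2 * Q * `|b - D| by rewrite mulr_ge0// mulr_ge0// ltW.
by rewrite e1; have := normr_ge0 (a - a'); lra.
Qed.

End truncation.

Lemma min_sum {R : realType} (J : finType) (x : J -> R) : (forall j, 0 <= x j) ->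
  Num.min 1 (\sum_j x j) <= \sum_j Num.min 1 (x j).
Proof.
move=> x0; elim: (index_enum J) => [|j l ih].
  by rewrite !big_nil ge_min lexx orbT.
rewrite !big_cons (le_trans (min_add _ _ _))// ?lerD2l//.
by apply: sumr_ge0 => i _.
Qed.

Section convergence_of_local_means.
Context {R : realType} {d : nat} {gamma : R}.
Local Notation T := 'rV[R]_d.
Variables (B : bool -> T -> T -> R) (B0 : T -> T -> R).
Hypotheses (hgamma : 0 < gamma < 1) (hB : forall a, edge_kernel (B a)).
Variables (nu mu0 : probability (borel T) R).
Context {dO : measure_display} {Om : measurableType dO} (P : probability Om R).
Variables (xi : nat -> nat -> Om -> T) (Z : forall n, 'I_n.+1 -> nat -> Om -> T).
Variable A : forall n, 'I_n.+1 -> 'I_n.+1 -> nat -> Om -> bool.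
Hypothesis hmodel : forall n, agent_model P gamma B xi (@Z n) (@A n).
Hypothesis h1 : assumption1 P xi Z A nu.
Hypothesis h2 : assumption2 P B0 Z A mu0.
Hypothesis h3 : assumption3 P B B0 xi Z.
Context {dQ : measure_display} {OQ : measurableType dQ} (Q : probability OQ R).
Variable Z0 : nat -> OQ -> T.
Hypothesis mZ0 : forall s, measurable_fun setT (Z0 s : OQ -> borel T).
Local Notation dft := (drift (gamma := gamma) B B0 Q Z0).
Local Notation mfs := (mf B B0 Q Z0).
Hypothesis w1 : wls mu0 nu dft Q (fun _ : 'I_1 => Z0).
Hypothesis npos : near_pos B B0.
Let hB0 : edge_kernel B0 := a2_kernel h2.
Let nm n := @model_network R d gamma B _ _ P xi Z A hmodel n.
Local Notation Q3 := (pprod Q (pprod Q Q)).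
Local Notation X3 := (tripleX Z0).
Let mZ n i s : measurable_fun setT (@Z n i s : Om -> borel T).
Proof. by case: (nm n). Qed.

Variable s : nat.
Hypothesis ecv : edge_cvg B B0 Q3 X3 (@En R d _ Om P Z A 3 s.+1) s.+1 s.

Local Notation G u := (mfU B B0 Q Z0 s u).
Local Notation H := (weighted_mean Z A s).
Local Notation coord c := (fun y : T => y ord0 c).
Local Notation coordq c q := (fun y : T => clamp q (y ord0 c)).

Let mcoord c : measurable_fun setT (coord c : borel T -> R).
Proof. by apply: measurable_coord; exact: measurable_id. Qed.

Let ccoordq c q : continuous (coordq c q).
Proof.
move=> x; have h : {for x, continuous (coord c)} by exact: coord_continuous.
exact: (continuous_comp h (@clamp_continuous R q (x ord0 c))).
Qed.

Let mH u n i : measurable_fun setT (u : borel T -> R) ->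
  measurable_fun setT (@weighted_mean _ _ _ _ Z A s u n i).
Proof.
move=> mu; apply: measurable_funM; first exact: measurable_cst.
apply: measurable_sum => j; apply: measurable_funM.
  by case: (brv_bool (fun b => b%:R : R) ((@nm n).2 i j s)).
exact: (measurableT_comp mu (mZ _ _)).
Qed.

Let mG u n i : measurable_fun setT (u : borel T -> R) ->
  measurable_fun setT (fun w => G u (@Z n i ^~ w)).
Proof.
by move=> mu; apply: (@measurable_mfU _ _ _ _ hB hB0 _ _ _ _ mZ0 s u _ _ (@Z n i)).
Qed.

Let iexp := integrable_exp hgamma hB hmodel h1 h2 h3 mZ0 w1 ecv.
Let icoord := triple_integrable_coords hgamma hB hmodel h1 h2 h3 mZ0 w1 ecv.

Let MQ : R := \int[Q]_w expR (l1 (Z0 s w)).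

Let iGu u x : measurable_fun setT (u : borel T -> R) ->
  (forall y, `|u y| <= l1 y) ->
  Q.-integrable setT (EFin \o (fun w => u (Z0 s w) * Bpath B B0 s x (Z0 ^~ w))).
Proof.
move=> mu ul; apply: (le_integrable measurableT _ _ iexp).
  apply/measurable_EFinP; apply: measurable_funM; first exact: (measurableT_comp mu (mZ0 s)).
  exact: (measurable_Bpath hB hB0).
move=> w _; rewrite lee_fin [leRHS]ger0_norm ?expR_ge0// normrM.
have /andP[b0 b1] := Bpath01 hB hB0 s x (Z0 ^~ w).
rewrite (ger0_norm b0) (le_trans (ler_piMr _ b1))// (le_trans (ul _))//.
by rewrite (le_trans _ (expR_ge1Dx _))// lerDr.
Qed.

Let clamp_le q (x : R) : `|clamp q x| <= `|x|.
Proof.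
have q0 : 0 <= q%:R :> R by [].
rewrite /clamp; case: (ltP q%:R x) => qx.
  rewrite max_r; last by rewrite (le_trans _ q0)// oppr_le0.
  by rewrite ger0_norm// (le_trans (ltW qx))// ler_norm.
case: (leP (- q%:R) x) => qx' //.
by rewrite normrN ger0_norm// -normrN (le_trans _ (ler_norm _))// lerNr ltW.
Qed.

Let mcoordq c q : measurable_fun setT (coordq c q : borel T -> R).
Proof. exact: (@continuous_borelP R T (coordq c q) (@ccoordq c q)). Qed.

Let G_dist c q x : `|G (coord c) x - G (coordq c q) x| <= harmonic q * MQ.
Proof.
have i1 := iGu x (mcoord c) (fun y => coord_le_l1 y c).
have i2 := iGu x (mcoordq c q) (fun y => le_trans (clamp_le q _) (coord_le_l1 y c)).
rewrite /mfU -RintegralB//.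
have iB := integrableB measurableT i1 i2.
apply: (le_trans (le_normr_Rintegral measurableT iB)).
rewrite /MQ -RintegralZl//; apply: le_Rintegral => //.
- exact: integrable_norm.
- exact: (integrableZl measurableT (harmonic q) iexp).
move=> w _; rewrite -mulrBl normrM.
have /andP[b0 b1] := Bpath01 hB hB0 s x (Z0 ^~ w).
rewrite (ger0_norm b0) (le_trans (ler_piMr _ b1))// (le_trans (clamp_dist _ _))//.
by rewrite ler_wpM2l ?invr_ge0// ler_expR coord_le_l1.
Qed.

Let H_dist c q n i w : `|@weighted_mean _ _ _ _ Z A s (coord c) n i w - H (coordq c q) i w| <=
  harmonic q * emom (@Z n) s 1 w.
Proof.
rewrite /weighted_mean /emom -mulrBr -sumrB normrM ger0_norm ?invr_ge0//.
rewrite mulrCA ler_wpM2l ?invr_ge0// (le_trans (ler_norm_sum _ _ _))// mulr_sumr.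
apply: ler_sum => j _; rewrite -mulrBr normrM mul1r.
apply: (@le_trans _ _ `|@Z n j s w ord0 c - clamp q (@Z n j s w ord0 c)|).
  by case: (A _ _ _ _); rewrite ?normr1 ?mul1r ?normr0 ?mul0r.
rewrite (le_trans (clamp_dist _ _))//.
by rewrite ler_wpM2l ?invr_ge0// ler_expR coord_le_l1.
Qed.

Let gap c n i w : R :=
  Num.min 1 `|@weighted_mean _ _ _ _ Z A s (coord c) n i w - G (coord c) (@Z n i ^~ w)|.

Let bgap c n i : brv (@gap c n i).
Proof.
apply: brv_min => //; apply: (measurableT_comp (@normr_measurable R setT)).
by apply: measurable_funB; [exact: mH|exact: mG].
Qed.

(** A coordinate is clamped at [q]. Clamping costs [harmonic q] times an exponential moment, in the
    network and in the limit, and the clamped coordinate is a bounded continuous test function. *)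
Lemma coord_gap_cvg c : n.+1%:R^-1 * \sum_i Ex P (@gap c n i) @[n --> \oo] --> 0.
Proof.
have [M hM] := moments hgamma hB hmodel h1 h2 h3 s (@ler01 R).
pose fm q n := n.+1%:R^-1 * \sum_i Ex P (fun w =>
  `|@weighted_mean _ _ _ _ Z A s (coordq c q) n i w - G (coordq c q) (@Z n i ^~ w)|).
apply: (@cvg0_double _ _ (fun q n => harmonic q * (M + MQ) + fm q n)
  (fun q => harmonic q * (M + MQ))).
- move=> n; apply: avg_ge0 => i; apply: Ex_ge0 => w.
  by rewrite le_min ler01 normr_ge0.
- move=> q; move: hM; apply: filterS => n hM.
  have hq0 : 0 < harmonic q :> R by rewrite invr_gt0.
  have bS := brv_min_emom (@nm n) s 1 (harmonic q)^-1.
  have bfm i : brv (fun w => `|@weighted_mean _ _ _ _ Z A s (coordq c q) n i w -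
      G (coordq c q) (@Z n i ^~ w)|).
    apply: brv_norm; apply: brvB.
      exact: (brv_weighted_mean hmodel s (ccoordq (q := q)) (fun y => clamp_norm q (y ord0 c))).
    exact: (brv_mfU hB hmodel h2 Q mZ0 s (ccoordq (q := q)) (fun y => clamp_norm q (y ord0 c))).
  apply: (@le_trans _ _ (harmonic q *
      (Ex P (fun w => Num.min (harmonic q)^-1 (emom (@Z n) s 1 w)) + MQ) + fm q n)).
    2: by rewrite lerD2r ler_wpM2l ?(ltW hq0)// lerD2r hM// invr_gt0.
  have -> : harmonic q * (Ex P (fun w => Num.min (harmonic q)^-1 (emom (@Z n) s 1 w)) + MQ) =
     n.+1%:R^-1 * \sum_(i < n.+1) (harmonic q *
       (Ex P (fun w => Num.min (harmonic q)^-1 (emom (@Z n) s 1 w)) + MQ)).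
    by rewrite avg_cst.
  rewrite /fm -mulrDr ler_wpM2l ?invr_ge0// -big_split/=; apply: ler_sum => i _.
  rewrite mulrDr -ExZ// -[X in _ + X + _](Ex_cst P) -ExD; [|exact: brvZ|exact: brv_cst].
  rewrite -ExD//; last by apply: brvD; [exact: brvZ|exact: brv_cst].
  apply: Ex_le => //.
    by apply: brvD => //; apply: brvD; [exact: brvZ|exact: brv_cst].
  move=> w; rewrite /gap.
  (* A cap at [1] after scaling is a cap at [(harmonic q)^-1] before, to which the moment bound,
     uniform in the cap, applies. *)
  have e1 : harmonic q * Num.min (harmonic q)^-1 (emom (@Z n) s 1 w) =
      Num.min 1 (harmonic q * emom (@Z n) s 1 w).
    by rewrite minr_pMr ?(ltW hq0)// divff// gt_eqF.
  rewrite e1.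
  have := H_dist c q i w; have := G_dist c q (@Z n i ^~ w).
  set Hc := weighted_mean _ _ _ (coord c) _ _; set Hq := weighted_mean _ _ _ _ _ _.
  set Gc := G (coord c) _; set Gq := G _ _ => hG hH.
  have e0 := emom_ge0 (@Z n) s 1 w.
  have t0 : 0 <= harmonic q * MQ by apply: le_trans hG.
  have tri : `|Hc - Gc| <= harmonic q * emom (@Z n) s 1 w + harmonic q * MQ + `|Hq - Gq|.
    have -> : Hc - Gc = (Hc - Hq) + (Gq - Gc) + (Hq - Gq) by ring.
    rewrite (le_trans (ler_normD _ _))// lerD2r (le_trans (ler_normD _ _))//.
    by rewrite lerD// distrC.
  have n0 : 0 <= `|Hq - Gq| by [].
  case: (leP 1 (harmonic q * emom (@Z n) s 1 w)) => h.
    by rewrite ge_min; apply/orP; left; rewrite -addrA lerDl addr_ge0.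
  by rewrite ge_min tri orbT.
- move=> q; rewrite -[X in _ --> X]addr0; apply: cvgD; first exact: cvg_cst.
  exact: (first_moment_cvg hB hmodel h1 h2 mZ0 w1 ecv (ccoordq (q := q))
    (fun y => clamp_norm q (y ord0 c))).
- by rewrite -[X in _ --> X](mul0r (M + MQ)); apply: cvgMl; exact: cvg_harmonic.
Qed.

Let one_cont : continuous (fun _ : T => 1 : R). Proof. exact: cst_continuous. Qed.

Let one_bound (y : T) : `|1 : R| <= 1. Proof. by rewrite normr1. Qed.

Let G1_ge0 x : 0 <= G (fun=> 1) x.
Proof.
apply: Ex_ge0 => w; rewrite mul1r.
by case/andP: (Bpath01 hB hB0 s x (Z0 ^~ w)).
Qed.

(** The factors [(n+1)^-1] cancel in the local mean, so coordinates are compared as quotients with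
    cut-off [q.+1]; the loop at [i] makes the denominator positive. *)
Lemma mean_gap_le q n i w : Num.min 1 (mean_gap B B0 Z A Q Z0 s i w) <=
  \sum_c (Num.max 0 (2 - q.+1%:R * G (fun=> 1) (@Z n i ^~ w)) +
    Num.min 1 (`|G (coord c) (@Z n i ^~ w)| / q.+1%:R) +
    (2 * q.+1%:R + 2 * q.+1%:R ^+ 3) *
      `|H (fun=> 1) i w - G (fun=> 1) (@Z n i ^~ w)| +
    (1 + 2 * q.+1%:R) * gap c i w).
Proof.
have b0 : 0 < H (fun=> 1) i w.
  rewrite /weighted_mean mulr_gt0 ?invr_gt0//.
  under eq_bigr do rewrite mulr1.
  exact: (lt_le_trans ltr01 (deg_ge1 (a1_graph h1 n) s i w)).
have q1 : 1 <= q.+1%:R :> R by rewrite ler1n.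
apply: (@le_trans _ _ (\sum_c Num.min 1 `|H (coord c) i w / H (fun=> 1) i w -
    G (coord c) (@Z n i ^~ w) / G (fun=> 1) (@Z n i ^~ w)|)); last first.
  by apply: ler_sum => c _; exact: ratio_bound.
have -> : mean_gap B B0 Z A Q Z0 s i w = \sum_c `|H (coord c) i w / H (fun=> 1) i w -
    G (coord c) (@Z n i ^~ w) / G (fun=> 1) (@Z n i ^~ w)|.
  apply: eq_bigr => c _; rewrite /mf (mean_fieldE hB hB0 Q mZ0) !mxE.
  congr (`|_ - _|); last exact: mulrC.
  rewrite /weighted_mean summxE.
  rewrite [X in _ / (_ * X)](eq_bigr (fun j => (A i j s w)%:R)) => [|j _]; last exact: mulr1.
  rewrite invfM invrK mulrACA mulVf ?pnatr_eq0// mul1r [RHS]mulrC; congr (_ * _).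
  by apply: eq_bigr => j _; rewrite mxE.
by apply: min_sum.
Qed.

(** Bounded continuous penalties for a small denominator ([phi1]) and a large numerator ([phi2]), so
    that their averages over agents converge; the limits vanish as [q] grows since the limiting
    denominator is almost surely positive. *)
Let phi1 q (t : R) : R := Num.max 0 (2 - q.+1%:R * t).
Let phi2 q (t : R) : R := Num.min 1 (`|t| / q.+1%:R).

Let phi1_cont q : continuous (phi1 q).
Proof.
have -> : phi1 q = (fun=> 0) \max (fun t => 2 - q.+1%:R * t) by [].
move=> t; apply: continuous_max; first exact: cst_continuous.
by apply: cvgB; [exact: cvg_cst|apply: cvgMr; exact: cvg_id].
Qed.

Let phi2_cont q : continuous (phi2 q).
Proof.
have -> : phi2 q = (fun=> 1) \min (fun t => `|t| / q.+1%:R) by [].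
move=> t; apply: continuous_min; first exact: cst_continuous.
by apply: cvgMl; exact: norm_continuous.
Qed.

Let phi1_bound q (t : R) : 0 <= t -> `|phi1 q t| <= 2.
Proof.
move=> t0; have : 0 <= q.+1%:R * t by rewrite mulr_ge0.
by rewrite ger0_norm ?le_max ?lexx// /phi1 ge_max => h; apply/andP; split; lra.
Qed.

Let phi2_bound q (t : R) : `|phi2 q t| <= 1.
Proof. by rewrite ger0_norm ?ge_min ?lexx// le_min ler01 divr_ge0. Qed.

Let bmf1 {K} q (j : 'I_K) : bmf s (fun z : 'I_K -> nat -> T => phi1 q (G (fun=> 1) (z j))).
Proof.
split=> [d' O' X mX|]; last by exists 2 => z; exact: phi1_bound.
apply: (measurableT_comp (continuous_measurable_fun (@phi1_cont q))).
by apply: (@measurable_mfU _ _ _ _ hB hB0 _ _ _ _ mZ0 s (fun=> 1) _ _ (X j)) => // r; exact: mX.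
Qed.

Let bmf2 {K} q c (j : 'I_K) :
  bmf s (fun z : 'I_K -> nat -> T => phi2 q (G (coord c) (z j))).
Proof.
split=> [d' O' X mX|]; last by exists 1 => z; exact: phi2_bound.
apply: (measurableT_comp (continuous_measurable_fun (@phi2_cont q))).
by apply: (@measurable_mfU _ _ _ _ hB hB0 _ _ _ _ mZ0 s _ _ _ (X j)) => // r; exact: mX.
Qed.

Let wX3 : wls mu0 nu dft Q3 X3 := triple_wls hB h2 mZ0 w1.

Let ae1 q : ae_cont Q3 X3 s (fun z => phi1 q (G (fun=> 1) (z ord0))).
Proof.
have i1 : Q.-integrable setT (EFin \o (fun w => (fun=> 1 : R) (Z0 s w))).
  exact: (brv_integrable Q (brv_cst 1)).
have := ae_arr_cont_mfU hB hB0 (a2_mu0_ac h2) (a1_noise_ac h1) mZ0 w1 wX3 (s := s)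
  (u := fun=> 1) (measurable_cst _) i1.
by apply: filterS => w hw; apply: (arr_cont_comp (@phi1_cont q)); exact: hw.
Qed.

Let ae2 q c : ae_cont Q3 X3 s (fun z => phi2 q (G (coord c) (z ord0))).
Proof.
have := ae_arr_cont_mfU hB hB0 (a2_mu0_ac h2) (a1_noise_ac h1) mZ0 w1 wX3 (s := s)
  (@mcoord c) (icoord c).
by apply: filterS => w hw; apply: (arr_cont_comp (@phi2_cont q)); exact: hw.
Qed.

Let brvQ1 q : brv (fun w => phi1 q (G (fun=> 1) (Z0 ^~ w))).
Proof. by apply: (@bmf_brv _ _ _ s _ _ _ (fun _ : 'I_1 => Z0)) (bmf1 q ord0) => _ r _. Qed.

Let brvQ2 q c : brv (fun w => phi2 q (G (coord c) (Z0 ^~ w))).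
Proof. by apply: (@bmf_brv _ _ _ s _ _ _ (fun _ : 'I_1 => Z0)) (bmf2 q c ord0) => _ r _. Qed.

Let brvZ1 q n i : brv (fun w => phi1 q (G (fun=> 1) (@Z n i ^~ w))).
Proof. by apply: (@bmf_brv _ _ _ s _ _ _ (fun _ : 'I_1 => @Z n i)) (bmf1 q ord0) => _ r _. Qed.

Let brvZ2 q c n i : brv (fun w => phi2 q (G (coord c) (@Z n i ^~ w))).
Proof. by apply: (@bmf_brv _ _ _ s _ _ _ (fun _ : 'I_1 => @Z n i)) (bmf2 q c ord0) => _ r _. Qed.

Let lim1 : Ex Q (fun w => phi1 q (G (fun=> 1) (Z0 ^~ w))) @[q --> \oo] --> 0.
Proof.
rewrite -[X in _ --> X](Ex_cst Q); apply: (@Ex_dct _ _ _ Q _ _ 2) => [q|||].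
- by case: (brvQ1 q).
- exact: measurable_cst.
- by move=> q w; exact: phi1_bound.
apply: filterS (mfU1_gt0 hB hB0 Q mZ0 s npos) => w Gw.
apply: cvg_near_cst; near=> q; rewrite /phi1 max_l// subr_le0 -ler_pdivrMr//.
apply: (@le_trans _ _ q%:R); last by rewrite ler_nat.
near: q; exact: nbhs_infty_ger.
Unshelve. all: by end_near. Qed.

Let lim2 c : Ex Q (fun w => phi2 q (G (coord c) (Z0 ^~ w))) @[q --> \oo] --> 0.
Proof.
rewrite -[X in _ --> X](Ex_cst Q); apply: (@Ex_dct _ _ _ Q _ _ 1) => [q|||].
- by case: (brvQ2 q c).
- exact: measurable_cst.
- by move=> q w; exact: phi2_bound.
apply: filterE => w.
apply: (@cvg0_le _ _ (fun q => `|G (coord c) (Z0 ^~ w)| * harmonic q)) => [q|].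
  by rewrite ger0_norm ?le_min ?ler01 ?divr_ge0// ge_min lexx orbT.
by rewrite -[X in _ --> X](mulr0 `|G (coord c) (Z0 ^~ w)|); apply: cvgMr; exact: cvg_harmonic.
Qed.

(** For fixed [q], the errors [a3] and [a4] vanish as [n] grows although their constants depend on
    [q], while [a1] and [a2] converge to penalties of the limit, which vanish as [q] grows. *)
Lemma local_mean_gap_cvg : local_mean_gap B B0 P Z A Q Z0 s n @[n --> \oo] --> 0.
Proof.
pose a1 q n : R := n.+1%:R^-1 * \sum_(i < n.+1) Ex P (fun w => phi1 q (G (fun=> 1) (@Z n i ^~ w))).
pose a2 q c n : R := n.+1%:R^-1 *
  \sum_(i < n.+1) Ex P (fun w => phi2 q (G (coord c) (@Z n i ^~ w))).
pose a3 n : R := n.+1%:R^-1 * \sum_(i < n.+1) Ex P (fun w =>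
  `|H (fun=> 1) i w - G (fun=> 1) (@Z n i ^~ w)|).
pose a4 c n : R := n.+1%:R^-1 * \sum_(i < n.+1) Ex P (@gap c n i).
pose C1 q : R := 2 * q.+1%:R + 2 * q.+1%:R ^+ 3.
pose C2 q : R := 1 + 2 * q.+1%:R.
have b3 n i : brv (fun w => `|@weighted_mean _ _ _ _ Z A s (fun=> 1) n i w -
    G (fun=> 1) (@Z n i ^~ w)|).
  apply: brv_norm; apply: brvB.
    exact: (brv_weighted_mean hmodel s one_cont one_bound).
  exact: (brv_mfU hB hmodel h2 Q mZ0 s one_cont one_bound).
apply: (@cvg0_double _ _
  (fun q n => \sum_c (a1 q n + a2 q c n + C1 q * a3 n + C2 q * a4 c n))
  (fun q => \sum_c (Ex Q (fun w => phi1 q (G (fun=> 1) (Z0 ^~ w))) +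
                    Ex Q (fun w => phi2 q (G (coord c) (Z0 ^~ w)))))).
- by move=> n; apply: avg_ge0 => i; apply: Ex_ge0 => w; rewrite le_min ler01 l1_ge0.
- move=> q; apply: nearW => n.
  pose F c i w := phi1 q (G (fun=> 1) (@Z n i ^~ w)) + phi2 q (G (coord c) (@Z n i ^~ w)) +
    C1 q * `|H (fun=> 1) i w - G (fun=> 1) (@Z n i ^~ w)| + C2 q * gap c i w.
  have bF c i : brv (F c i).
    by apply: brvD; [apply: brvD; [exact: brvD|exact: brvZ]|exact: brvZ].
  apply: (@le_trans _ _ (n.+1%:R^-1 * \sum_(i < n.+1) \sum_c Ex P (F c i))).
    rewrite /local_mean_gap ler_wpM2l ?invr_ge0//; apply: ler_sum => i _.
    rewrite -Ex_sum//; apply: Ex_le; [|exact: brv_sum|by move=> w; exact: mean_gap_le].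
    exact: (brv_mean_gap hB hmodel h2 Q mZ0 s i).
  rewrite exchange_big/= mulr_sumr le_eqVlt; apply/orP; left; apply/eqP.
  apply: eq_bigr => c _; rewrite /a1 /a2 /a3 /a4.
  rewrite (mulrCA (C1 q)) (mulrCA (C2 q)) -!mulrDr; congr (_ * _).
  rewrite !mulr_sumr -!big_split/=; apply: eq_bigr => i _.
  rewrite /F ExD; [|by apply: brvD; [exact: brvD|exact: brvZ]|exact: brvZ].
  rewrite ExD; [|exact: brvD|exact: brvZ].
  by rewrite ExD// !ExZ.
- move=> q; apply: cvgr_sum => c _.
  rewrite -[X in _ --> X]addr0 -[X in _ --> X]addr0.
  apply: cvgD; [apply: cvgD; [apply: cvgD|]|].
  + exact: (cvg_average hB hmodel h2 mZ0 w1 ecv (phi := fun x => phi1 q (G (fun=> 1) x))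
      (bmf1 q ord0) (ae1 q)).
  + exact: (cvg_average hB hmodel h2 mZ0 w1 ecv (phi := fun x => phi2 q (G (coord c) x))
      (bmf2 q c ord0) (ae2 q c)).
  + rewrite -[X in _ --> X](mulr0 (C1 q)); apply: cvgMr.
    exact: (first_moment_cvg hB hmodel h1 h2 mZ0 w1 ecv one_cont one_bound).
  + by rewrite -[X in _ --> X](mulr0 (C2 q)); apply: cvgMr; exact: coord_gap_cvg.
- rewrite -[X in _ --> X](_ : \sum_(c < d) (0 + 0) = 0); last first.
    by rewrite big1// => c _; rewrite addr0.
  by apply: cvgr_sum => c _; apply: cvgD; [exact: lim1|exact: lim2].
Qed.

End convergence_of_local_means.

Section edge_convergence.
Context {R : realType} {d : nat} {gamma : R}.
Local Notation T := 'rV[R]_d.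
Variables (B : bool -> T -> T -> R) (B0 : T -> T -> R).
Hypotheses (hgamma : 0 < gamma < 1) (hB : forall a, edge_kernel (B a)).
Variables (nu mu0 : probability (borel T) R).
Context {dO : measure_display} {Om : measurableType dO} (P : probability Om R).
Variables (xi : nat -> nat -> Om -> T) (Z : forall n, 'I_n.+1 -> nat -> Om -> T).
Variable A : forall n, 'I_n.+1 -> 'I_n.+1 -> nat -> Om -> bool.
Hypothesis hmodel : forall n, agent_model P gamma B xi (@Z n) (@A n).
Hypothesis h1 : assumption1 P xi Z A nu.
Hypothesis h2 : assumption2 P B0 Z A mu0.
Hypothesis h3 : assumption3 P B B0 xi Z.
Context {dQ : measure_display} {OQ : measurableType dQ} (Q : probability OQ R).
Variable Z0 : nat -> OQ -> T.
Hypothesis mZ0 : forall s, measurable_fun setT (Z0 s : OQ -> borel T).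
Local Notation dft := (drift (gamma := gamma) B B0 Q Z0).
Local Notation mfs := (mf B B0 Q Z0).
Hypothesis w1 : wls mu0 nu dft Q (fun _ : 'I_1 => Z0).
Hypothesis npos : near_pos B B0.
Let hB0 : edge_kernel B0 := a2_kernel h2.

Let mdrift s d' (O' : measurableType d') X :
  (forall r, (r <= s)%N -> measurable_fun setT (X r : O' -> borel T)) ->
  measurable_fun setT ((fun w => dft s (X ^~ w)) : O' -> borel T).
Proof. exact: measurable_drift. Qed.

Lemma edge_cvg_of {K} {dX} {OX : measurableType dX} (Q' : probability OX R)
    (X : 'I_K -> nat -> OX -> T) :
  wls mu0 nu dft Q' X -> copies Q Z0 Q' X ->
  (forall s, edge_cvg B B0 Q' X (@En R d _ Om P Z A K s.+1) s.+1 s ->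
     integrable_coords Q Z0 s /\ local_mean_gap B B0 P Z A Q Z0 s n @[n --> \oo] --> 0) ->
  forall s, edge_cvg B B0 Q' X (@En R d _ Om P Z A K s.+1) s.+1 s.
Proof.
move=> wX cX h.
apply: (edge_cvg_all hB hB0 mdrift (a2_mu0_ac h2) (a1_noise_ac h1) wX).
- by move=> r n a s f g bf bg; exact: (EnD hmodel _ _ _ bf bg).
- by move=> r n a s c f bf; exact: (EnZ hmodel _ _ _ _ bf).
- by move=> r n a s f g bf bg fg; exact: (En_le hmodel _ _ _ bf bg fg).
- by move=> a psi upsi; exact: (En_init hmodel h2 _ upsi).
- by move=> s a f bf; exact: (En_edge hB hmodel h1 h2 _ bf).
- move=> s /h[ic _].
  exact: (ae_drift_cont hB hB0 npos (a2_mu0_ac h2) (a1_noise_ac h1) mZ0 w1 wX cX).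
- move=> s /h[_ gap] a phi psi uphi _ upsi.
  exact: (En_step hgamma hB hmodel h1 h2 mZ0 _ gap uphi upsi).
Qed.

(** The induction for three agents feeds itself: the convergence just reached at time [s] supplies
    the integrability and the law of large numbers for its own next step. *)
Lemma triple_edge_cvg s : edge_cvg B B0 (pprod Q (pprod Q Q)) (tripleX Z0)
  (@En R d _ Om P Z A 3 s.+1) s.+1 s.
Proof.
apply: edge_cvg_of; [exact: (triple_wls hB h2 mZ0 w1)|exact: triple_copies|].
move=> {}s ecv; split.
  exact: (triple_integrable_coords hgamma hB hmodel h1 h2 h3 mZ0 w1 ecv).
exact: (local_mean_gap_cvg hgamma hB hmodel h1 h2 h3 mZ0 w1 npos ecv).
Qed.

Lemma all_integrable_coords s : integrable_coords Q Z0 s.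
Proof.
exact: (triple_integrable_coords hgamma hB hmodel h1 h2 h3 mZ0 w1 (@triple_edge_cvg s)).
Qed.

Lemma sample_edge_cvg {K} {dX} {OX : measurableType dX} (Q' : probability OX R)
    (X : 'I_K -> nat -> OX -> T) s :
  wls mu0 nu dft Q' X -> copies Q Z0 Q' X ->
  edge_cvg B B0 Q' X (@En R d _ Om P Z A K s.+1) s.+1 s.
Proof.
move=> wX cX; apply: (edge_cvg_of wX cX) => {}s _; split.
  exact: all_integrable_coords.
exact: (local_mean_gap_cvg hgamma hB hmodel h1 h2 h3 mZ0 w1 npos (@triple_edge_cvg s)).
Qed.

End edge_convergence.

(** * Sampled trajectories *)

Lemma cvg_mx {T : topologicalType} {U : Type} {F : set_system U} {FF : Filter F} {p q}
    (f : U -> 'M[T]_(p, q)) (M : 'M[T]_(p, q)) :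
  (forall i j, f u i j @[u --> F] --> M i j) -> f u @[u --> F] --> M.
Proof.
move=> h A [V MV VA].
have : \forall u \near F, forall i j, V i j (f u i j).
  by apply: filter_forall => i; apply: filter_forall => j; exact: h (MV i j).
by apply: filterS => u hu; exact: VA.
Qed.

Lemma independent_Ex {R : realType} {dO} {O : measurableType dO} (P : probability O R)
    (gen : set (set O)) (E : set O) : <<s gen>> `<=` measurable -> measurable E ->
  (forall F, <<s gen>> F -> P (E `&` F) = (P E * P F)%E) ->
  forall g : g_sigma_algebraType gen -> R, brv g ->
  Ex P (fun w => \1_E w * (g : O -> R) w) = fine (P E) * Ex P (g : O -> R).
Proof.
move=> sub mE ind g bg.
rewrite (Ex_cond sub (brv_indic mE) (brv_cst (fine (P E))) _ bg).
  by rewrite ExZ//; exact: (brv_sub sub bg).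
move=> F sF; have mF := sub _ sF.
rewrite ExZ ?Ex_indic//; last exact: brv_indic.
rewrite -fineM ?fin_num_measure// -ind// -Ex_indic; last exact: measurableI.
by congr (Ex P _); apply/funext => w; rewrite indicI.
Qed.

(* When there is no injective sample the average over them is [0 / 0 = 0]. *)
Lemma injective_average {R : realType} {K n : nat} (x : {ffun 'I_K -> 'I_n.+1} -> R) (M : R) :
  (forall m, `|x m| <= M) ->
  `|(\sum_(m : {ffun 'I_K -> 'I_n.+1}) (injectiveb m)%:R * x m) /
      #|[pred m : {ffun 'I_K -> 'I_n.+1} | injectiveb m]|%:R - savg x| <= 2 * M * savg (fun m : {ffun 'I_K -> 'I_n.+1} => (~~ injectiveb m)%:R).
Proof.
move=> xM; set J : R := #|_|%:R; set N : R := n.+1%:R ^+ K.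
have N0 : 0 < N by rewrite exprn_gt0.
have J0 : 0 <= J by [].
have JE : J = \sum_(m : {ffun 'I_K -> 'I_n.+1}) (injectiveb m)%:R.
  rewrite /J -sum1_card natr_sum big_mkcond/=; apply: eq_bigr => m _.
  by rewrite inE; case: injectiveb.
have NE : N = \sum_(m : {ffun 'I_K -> 'I_n.+1}) 1.
  by rewrite sumr_const cardT -cardE card_ffun !card_ord natrX.
have M0 : 0 <= M by apply: le_trans (xM [ffun=> ord0]).
pose y := \sum_(m : {ffun 'I_K -> 'I_n.+1}) (injectiveb m)%:R * x m.
pose z := \sum_(m : {ffun 'I_K -> 'I_n.+1}) (~~ injectiveb m)%:R * x m.
have yJ : `|y| <= J * M.
  rewrite (le_trans (ler_norm_sum _ _ _))// JE mulr_suml; apply: ler_sum => m _.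
  by rewrite normrM ger0_norm// ler_wpM2l.
have zJ : `|z| <= (N - J) * M.
  rewrite (le_trans (ler_norm_sum _ _ _))// JE NE -sumrB mulr_suml; apply: ler_sum => m _.
  by rewrite normrM ger0_norm//; case: injectiveb => /=;
    rewrite ?mul0r ?subrr ?mul0r// subr0 !mul1r.
have sE : savg x = N^-1 * (y + z).
  rewrite /savg -/N; congr (_ * _); rewrite /y /z -big_split/=; apply: eq_bigr => m _.
  by case: injectiveb; rewrite /= mul1r mul0r ?addr0 ?add0r.
have nE : savg (fun m : {ffun 'I_K -> 'I_n.+1} => (~~ injectiveb m)%:R) = N^-1 * (N - J).
  rewrite /savg -/N JE NE -sumrB; congr (_ * _); apply: eq_bigr => m _.
  by case: injectiveb; rewrite ?subrr ?subr0.
rewrite sE nE -/y.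
have NJ : 0 <= N - J.
  rewrite JE NE -sumrB; apply: sumr_ge0 => m _.
  by case: injectiveb; rewrite ?subrr ?subr0.
have [J00|Jn0] := eqVneq J 0.
  have -> : y = 0 by apply/eqP; rewrite -normr_le0 (le_trans yJ)// J00 mul0r.
  rewrite J00 mul0r sub0r add0r normrN normrM subr0 mulVf ?gt_eqF// mulr1.
  rewrite ger0_norm ?invr_ge0 ?(ltW N0)// mulrC ler_pdivrMr//.
  apply: (le_trans zJ); rewrite J00 subr0 mulrC ler_wpM2r ?(ltW N0)//.
  by rewrite ler_peMl// ler1n.
have Jp : 0 < J by rewrite lt_def Jn0.
(* Both terms in the bracket are at most [(N - J) * M], which is the origin of the factor [2]. *)
have -> : y / J - N^-1 * (y + z) = N^-1 * ((N - J) / J * y - z).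
  by field; rewrite !gt_eqF.
rewrite normrM ger0_norm ?invr_ge0 ?(ltW N0)// mulrCA ler_wpM2l ?invr_ge0 ?(ltW N0)//.
rewrite (le_trans (ler_normB _ _))//.
have : `|(N - J) / J * y| <= (N - J) * M.
  rewrite normrM ger0_norm ?divr_ge0// -mulrA ler_wpM2l// [leLHS]mulrC ler_pdivrMr//.
  by rewrite [leRHS]mulrC.
by move: zJ; set u := `|z|; set v := `|_ * y|; lra.
Qed.

Section sampled_trajectories.
Context {R : realType} {d K t : nat}.
Local Notation T := 'rV[R]_d.

Definition trajectories (z : 'I_K -> nat -> T) : 'rV['rV[T]_t.+1]_K :=
  \row_i upto t (z i).

(* The adjacency of [i] and [j] is read off the pattern entry of the pair
   [{i, j}]; loops are always present. *)
Definition pattern_edge (a : nat -> pairs K -> bool) s (i j : 'I_K) : bool :=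
  if [pick p : pairs K | (val p == (i, j)) || (val p == (j, i))] is Some p
  then a s p else true.

Definition pattern_graph (a : nat -> pairs K -> bool) : 'M['rV[bool]_t.+1]_K :=
  \matrix_(i, j) upto t (fun s => pattern_edge a s i j).

Lemma pattern_edgeE {dO} {O : measurableType dO} {n} (A : 'I_n -> 'I_n -> nat -> O -> bool)
    (m : 'I_K -> 'I_n) w s i j : reflexive_symmetric A ->
  pattern_edge (fun s p => A (m (val p).1) (m (val p).2) s w) s i j = A (m i) (m j) s w.
Proof.
move=> symA; rewrite /pattern_edge; case: pickP => [p /orP[/eqP ->|/eqP ->]//|h].
  exact: (symA s w).1.
have [_ refl] := symA s w.
suff ij : i = j by rewrite ij refl.
apply/eqP; apply: contraT; rewrite -val_eqE/= neq_ltn => /orP[ij|ij].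
  by have := h (exist _ (i, j) ij); rewrite eqxx.
by have := h (exist _ (j, i) ij); rewrite eqxx orbT.
Qed.

Lemma pattern_graph_eq a a' : (forall s, (s < t.+1)%N -> a s =1 a' s) ->
  pattern_graph a = pattern_graph a'.
Proof.
move=> aa'; apply/matrixP => i j; rewrite !mxE; apply/rowP => r; rewrite !mxE.
by rewrite /pattern_edge; case: pickP => // p _; rewrite aa'.
Qed.

Variable f : 'rV['rV[T]_t.+1]_K * 'M['rV[bool]_t.+1]_K -> R.
Hypothesis bf : bounded_continuous f.

Lemma arr_cont_trajectories a z :
  arr_cont t (fun y => f (trajectories y, pattern_graph a)) z.
Proof.
have cz : trajectories y @[y --> arr_near t z] --> trajectories z.
  apply: cvg_mx => i j; rewrite /trajectories; under eq_cvg do rewrite mxE.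
  rewrite mxE; apply: cvg_mx => i' r; rewrite /upto; under eq_cvg do rewrite mxE.
  by rewrite mxE; apply: arr_near_coord; rewrite -ltnS.
apply: (cvg_comp _ _ (cvg_pair cz (cvg_cst (pattern_graph a)))).
exact: bf.1.
Qed.

Lemma bmf_trajectories a : bmf t (fun y => f (trajectories y, pattern_graph a)).
Proof.
split; first by apply: arr_cont_mfun => z; exact: arr_cont_trajectories.
by have [_ [M hM]] := bf; exists M.
Qed.

End sampled_trajectories.

Section sampled_agents_limit.
Context {R : realType} {d : nat} {gamma : R}.
Local Notation T := 'rV[R]_d.
Variables (B : bool -> T -> T -> R) (B0 : T -> T -> R).
Hypotheses (hgamma : 0 < gamma < 1) (hB : forall a, edge_kernel (B a)).
Variables (nu mu0 : probability (borel T) R).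
Context {dO : measure_display} {Om : measurableType dO} (P : probability Om R).
Variables (xi : nat -> nat -> Om -> T) (Z : forall n, 'I_n.+1 -> nat -> Om -> T).
Variable A : forall n, 'I_n.+1 -> 'I_n.+1 -> nat -> Om -> bool.
Hypothesis hmodel : forall n, agent_model P gamma B xi (@Z n) (@A n).
Hypothesis h1 : assumption1 P xi Z A nu.
Hypothesis h2 : assumption2 P B0 Z A mu0.
Hypothesis h3 : assumption3 P B B0 xi Z.
Context {dQ : measure_display} {OQ : measurableType dQ} (Q : probability OQ R) {k : nat}.
Variables (zeta Zlim : 'I_k.+1 -> nat -> OQ -> T).
Variable Alim : 'I_k.+1 -> 'I_k.+1 -> nat -> OQ -> bool.
Hypothesis hlim : limit_process Q gamma B B0 mu0 nu zeta Zlim Alim.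
Variable t : nat.
Variable f : 'rV['rV[T]_t.+1]_k.+1 * 'M['rV[bool]_t.+1]_k.+1 -> R.
Hypothesis bf : bounded_continuous f.
Let hB0 : edge_kernel B0 := a2_kernel h2.
Let nm n := @model_network R d gamma B _ _ P xi Z A hmodel n.
Let npos : near_pos B B0.
Proof.
apply: (near_pos_kernels hB hB0); case: (a3_kernels h3) => -[]; [by left|by right].
Qed.

Definition sampled_value n (m : 'I_k.+1 -> 'I_n.+1) w : R :=
  f (\row_i upto t (fun s => @Z n (m i) s w),
     \matrix_(i, j) upto t (fun s => @A n (m i) (m j) s w)).

Definition limit_value w : R :=
  f (\row_i upto t (fun s => Zlim i s w),
     \matrix_(i, j) upto t (fun s => Alim i j s w)).

Let pattern_sum {d' n'} {O' : measurableType d'} (Z' : 'I_n' -> nat -> O' -> T)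
    (A' : 'I_n' -> 'I_n' -> nat -> O' -> bool) (m : 'I_k.+1 -> 'I_n') w :
  reflexive_symmetric A' ->
  f (\row_i upto t (fun s => Z' (m i) s w),
     \matrix_(i, j) upto t (fun s => A' (m i) (m j) s w)) =
  \sum_(a <- pats t.+1) f (trajectories (fun i r => Z' (m i) r w),
    pattern_graph a) * ind A' m t.+1 a w.
Proof.
move=> symA'; rewrite (@sum_pats_ind _ _ t.+1
  (fun s p => A' (m (val p).1) (m (val p).2) s w)
  (fun a => f (trajectories (fun i r => Z' (m i) r w), pattern_graph a))).
  congr (f (_, _)); apply/matrixP => i j; rewrite !mxE; apply/rowP => r.
  by rewrite /pattern_graph !mxE (pattern_edgeE m w r i j symA').
by move=> a a' aa'; rewrite (pattern_graph_eq aa').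
Qed.

Let Fa a : ('I_k.+1 -> nat -> T) -> R := fun z => f (trajectories z, pattern_graph a).

Let bFa a : bmf t (Fa a). Proof. exact: bmf_trajectories. Qed.

Let bind_of {d' n'} {O' : measurableType d'} (Z' : 'I_n' -> nat -> O' -> T)
    (A' : 'I_n' -> 'I_n' -> nat -> O' -> bool) (m : 'I_k.+1 -> 'I_n') r a :
  network_measurable Z' A' -> brv (ind A' m r a : O' -> R).
Proof.
move=> nm'; have := @urv_ind _ _ R d n' Z' A' k.+1 m setT setT r a (fun _ _ => Logic.I).
by move=> /urv_brv; exact/brv_sub/(hgen_sub nm').
Qed.

Let brv_pattern {d' n'} {O' : measurableType d'} (Z' : 'I_n' -> nat -> O' -> T)
    (A' : 'I_n' -> 'I_n' -> nat -> O' -> bool) (m : 'I_k.+1 -> 'I_n') a :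
  network_measurable Z' A' ->
  brv (fun w => Fa a (fun i r => Z' (m i) r w) * ind A' m t.+1 a w : R).
Proof.
move=> nm'; apply: brvM; last exact: (bind_of m _ _ nm').
by apply: (bmf_brv _ (bFa a)) => i r _; case: nm'.
Qed.

Lemma brv_sampled_value n (m : 'I_k.+1 -> 'I_n.+1) :
  brv (sampled_value m : g_sigma_algebraType (hgen (@Z n) (@A n) setT setT) -> R).
Proof.
rewrite (_ : sampled_value m = fun w => \sum_(a <- pats t.+1)
    Fa a (fun i r => @Z n (m i) r w) * ind (@A n) m t.+1 a w).
  apply: brv_sum => a; apply: brvM; last first.
    by apply: urv_brv; apply: urv_ind.
  by apply: (bmf_brv _ (bFa a)) => i r _; apply: hist_Z.
by apply/funext => w; exact: (pattern_sum (@Z n) m w (a1_graph h1 n)).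
Qed.

Lemma brv_limit_value : brv limit_value.
Proof.
rewrite (_ : limit_value = fun w => \sum_(a <- pats t.+1)
    Fa a (fun i r => Zlim i r w) * ind Alim id t.+1 a w).
  by apply: brv_sum => a; apply: (brv_pattern id _ (lp_measurable hlim)).
by apply/funext => w; exact: (pattern_sum Zlim id w (lp_graph hlim)).
Qed.

(** Splitting according to the pattern of edges writes [f] as a finite sum of functions of
    positions. Each term converges by [sample_edge_cvg], and [limit_identification] recognises the
    limits as the terms of the given limiting process. *)
Lemma sampled_value_cvg :
  savg (fun m : {ffun 'I_k.+1 -> 'I_n.+1} => Ex P (sampled_value m)) @[n --> \oo] -->
  Ex Q limit_value.
Proof.
have mZ0 s : measurable_fun setT (Zlim ord0 s : OQ -> borel T).
  by case: (lp_measurable hlim).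
have w1 := limit_wls hB hB0 hlim.
have [d' [ O' [Q' [X [wX cX]]]]] := wls_power hB hB0 mZ0 w1 k.
have ecv := sample_edge_cvg hgamma hB hmodel h1 h2 h3 mZ0 w1 npos (s := t) wX cX.
have cFa a : ae_cont Q' X t (Fa a).
  by apply: filterE => w; exact: arr_cont_trajectories.
have ic := all_integrable_coords hgamma hB hmodel h1 h2 h3 mZ0 w1 npos.
have id_ a := limit_identification hB hB0 npos (a2_mu0_ac h2) (a1_noise_ac h1) hlim wX cX ic
  a (bFa a) (cFa a).
have := @cvgr_sum R nat _ \oo _ (pats t.+1) predT
  (fun a n => @En R d _ Om P Z A k.+1 t.+1 n a (Fa a)) _ (fun a _ => ecv a (Fa a) (bFa a) (cFa a)).
rewrite (_ : (fun n => _) = (fun n => savg (fun m : {ffun 'I_k.+1 -> 'I_n.+1} =>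
    Ex P (sampled_value m)))); last first.
  apply/funext => n; rewrite /En -savg_sum; congr savg; apply/funext => m.
  rewrite -Ex_sum; last by move=> a; exact: (brv_pattern m a (@nm n)).
  congr (Ex P _); apply/funext => w.
  by rewrite -(pattern_sum (@Z n) m w (a1_graph h1 n)).
suff -> : Ex Q limit_value = \sum_(a <- pats t.+1)
    Ex Q' (fun w => Fa a (fun i r => X i r w) * wt B B0 t.+1 a (fun i r => X i r w)).
  by apply.
under [RHS]eq_bigr do rewrite -id_.
rewrite -Ex_sum; last by move=> a; exact: (brv_pattern id a (lp_measurable hlim)).
congr (Ex Q _); apply/funext => w.
by rewrite -(pattern_sum Zlim id w (lp_graph hlim)).
Qed.

Variables (replacement : bool) (m : forall n, Om -> {ffun 'I_k.+1 -> 'I_n.+1}).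
Hypothesis hm : forall n, replacement || (k.+1 <= n.+1)%N ->
  uniform_sample P replacement (@m n) /\
  sample_independent P (@m n) (@Z n) (@A n).

Definition random_sample_value n w : R := @sampled_value n (m n w) w.

Let sampled_hist n (mu : {ffun 'I_k.+1 -> 'I_n.+1}) : brv (sampled_value mu : Om -> R).
Proof. exact: (brv_sub (@hgen_sub _ _ _ _ _ _ _ (@nm n) _ _) (@brv_sampled_value n mu)). Qed.

Let valueE n w : random_sample_value n w =
  \sum_(mu : {ffun 'I_k.+1 -> 'I_n.+1}) \1_(@m n @^-1` [set mu]) w * sampled_value mu w.
Proof.
rewrite (bigD1 (m n w))//= big1 ?addr0.
  by rewrite indicE mem_set// mul1r.
by move=> mu /eqP mn; rewrite indicE memNset ?mul0r// => /= h; apply: mn.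
Qed.

Let average n : replacement || (k.+1 <= n.+1)%N -> brv (@random_sample_value n) /\
  Ex P (@random_sample_value n) =
  (\sum_(mu : {ffun 'I_k.+1 -> 'I_n.+1}) (replacement || injectiveb mu)%:R *
     Ex P (sampled_value mu)) /
  #|[pred g : {ffun 'I_k.+1 -> 'I_n.+1} | replacement || injectiveb g]|%:R.
Proof.
move=> /hm[um im].
have bterm (mu : {ffun 'I_k.+1 -> 'I_n.+1}) :
    brv (fun w => \1_(@m n @^-1` [set mu]) w * sampled_value mu w).
  by apply: brvM; [apply: brv_indic; case: (um mu)|exact: sampled_hist].
have e : @random_sample_value n = fun w => \sum_(mu : {ffun 'I_k.+1 -> 'I_n.+1})
    \1_(@m n @^-1` [set mu]) w * sampled_value mu w.
  by apply/funext => w; exact: valueE.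
split; first by rewrite e; exact: brv_sum.
rewrite e Ex_sum// mulr_suml; apply: eq_bigr => mu _.
have [mE PE] := um mu.
rewrite (independent_Ex (@hgen_sub _ _ _ _ _ _ _ (@nm n) _ _) mE _ (@brv_sampled_value n mu)).
  by rewrite PE /= mulrAC.
by move=> F sF; apply: im => //; exists [set mu] => //; rewrite setTI.
Qed.

Lemma random_sample_value_cvg :
  (fun n => 'E_P[@random_sample_value n])%E @ \oo --> ('E_Q[limit_value])%E.
Proof.
have [_ [M fM]] := bf.
have EM n (mu : {ffun 'I_k.+1 -> 'I_n.+1}) : `|Ex P (sampled_value mu)| <= M.
  by apply: Ex_bound; [exact: sampled_hist|move=> w; exact: fM].
have M0 : 0 <= M := le_trans (normr_ge0 _) (EM 0%N [ffun=> ord0]).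
pose e n := Ex P (@random_sample_value n).
(* Without replacement nothing is assumed about [m n] for too small [n], so expectations are
   computed only eventually. *)
have ok : \forall n \near \oo, replacement || (k.+1 <= n.+1)%N.
  by near=> n; apply/orP; right; rewrite ltnS; near: n; exact: nbhs_infty_ge.
have near_savg : \forall n \near \oo,
    `|e n - savg (fun mu : {ffun 'I_k.+1 -> 'I_n.+1} => Ex P (sampled_value mu))| <=
    2 * M * savg (fun mu : {ffun 'I_k.+1 -> 'I_n.+1} => (~~ injectiveb mu)%:R).
  move: ok; apply: filterS => n okn; rewrite /e (average okn).2.
  case: replacement => /=; last exact: injective_average (@EM n).
  have -> : (\sum_(mu : {ffun 'I_k.+1 -> 'I_n.+1}) 1 * Ex P (sampled_value mu)) /
     #|[pred g : {ffun 'I_k.+1 -> 'I_n.+1} | true]|%:R =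
     savg (fun mu : {ffun 'I_k.+1 -> 'I_n.+1} => Ex P (sampled_value mu)).
    rewrite /savg mulrC; congr (_ * _); last by apply: eq_bigr => mu _; rewrite mul1r.
    by rewrite card_ffun !card_ord natrX.
  rewrite subrr normr0; apply: mulr_ge0; first exact: mulr_ge0.
  by rewrite /savg mulr_ge0 ?invr_ge0 ?exprn_ge0// sumr_ge0.
have ecv : e n @[n --> \oo] --> Ex Q limit_value.
  rewrite -[X in _ --> X]add0r.
  rewrite (_ : e = fun n => (e n - savg (fun mu : {ffun 'I_k.+1 -> 'I_n.+1} =>
      Ex P (sampled_value mu))) + savg (fun mu : {ffun 'I_k.+1 -> 'I_n.+1} =>
      Ex P (sampled_value mu))); last by apply/funext => n; rewrite subrK.
  apply: cvgD; last exact: sampled_value_cvg.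
  apply: norm_cvg0; apply: (@squeeze_cvgr _ _ _ _ (fun=> 0) (fun n => 2 * M *
    savg (fun mu : {ffun 'I_k.+1 -> 'I_n.+1} => (~~ injectiveb mu)%:R)) _ _ 0).
  - by move: near_savg; apply: filterS => n h; rewrite normr_ge0.
  - exact: cvg_cst.
  - by rewrite -[X in _ --> X](mulr0 (2 * M)); apply: cvgMr; exact: noninjective_cvg.
have -> : ('E_Q[limit_value])%E = (Ex Q limit_value)%:E.
  by rewrite unlock EFin_Ex//; exact: brv_limit_value.
have EP n : replacement || (k.+1 <= n.+1)%N ->
    ('E_P[@random_sample_value n])%E = (e n)%:E.
  by move=> okn; rewrite unlock EFin_Ex//; case: (average okn).
apply/fine_cvgP; split; first by move: ok; apply: filterS => n /EP ->.
apply: cvg_trans ecv; apply: near_eq_cvg; move: ok; apply: filterS => n okn.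
by rewrite /= EP.
Unshelve. all: by end_near. Qed.

End sampled_agents_limit.

Theorem theorem2p8 (R : realType) (d : nat) (hd : (0 < d)%N)
    (gamma : R) (hgamma : 0 < gamma < 1)
    (B : bool -> 'rV[R]_d -> 'rV[R]_d -> R) (hB : forall a, edge_kernel (B a))
    (B0 : 'rV[R]_d -> 'rV[R]_d -> R)
    (nu mu0 : probability (borel 'rV[R]_d) R)
    (* the n-agent models *)
    (disp : measure_display) (Om : measurableType disp) (P : probability Om R)
    (xi : nat -> nat -> Om -> 'rV[R]_d)
    (Z : forall n, 'I_n.+1 -> nat -> Om -> 'rV[R]_d)
    (A : forall n, 'I_n.+1 -> 'I_n.+1 -> nat -> Om -> bool)
    (hmodel : forall n, agent_model P gamma B xi (@Z n) (@A n))
    (h1 : assumption1 P xi Z A nu)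
    (h2 : assumption2 P B0 Z A mu0)
    (h3 : assumption3 P B B0 xi Z)
    (t k : nat)
    (* the limiting process *)
    (disp' : measure_display) (Om' : measurableType disp')
    (Q : probability Om' R)
    (zeta Zlim : 'I_k.+1 -> nat -> Om' -> 'rV[R]_d)
    (Alim : 'I_k.+1 -> 'I_k.+1 -> nat -> Om' -> bool)
    (hlim : limit_process Q gamma B B0 mu0 nu zeta Zlim Alim)
    (* the sample *)
    (replacement : bool) (m : forall n, Om -> {ffun 'I_k.+1 -> 'I_n.+1})
    (hm : forall n, replacement || (k.+1 <= n.+1)%N ->
       uniform_sample P replacement (@m n) /\
       sample_independent P (@m n) (@Z n) (@A n)) :
  cvg_in_distribution P Q
    (fun n w =>
      (\row_i upto t (fun s => Z n (m n w i) s w),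
       \matrix_(i, j) upto t (fun s => A n (m n w i) (m n w j) s w))
      : ('rV['rV['rV[R]_d]_t.+1]_k.+1 * 'M['rV[bool]_t.+1]_k.+1)%type)
    (fun w =>
      (\row_i upto t (fun s => Zlim i s w),
       \matrix_(i, j) upto t (fun s => Alim i j s w))).
Proof.
by move=> f bf; exact: (random_sample_value_cvg hgamma hB hmodel h1 h2 h3 hlim bf hm).
Qed.
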